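(* Let $\mu < \kappa$ be regular uncountable cardinals, with $\kappa$ supercompact, and let $\mathbb P := \mathrm{Coll}(\mu, {<}\kappa)$ be the Lévy collapse. Then, in $V^{\mathbb P}$, $\mathsf{SNSP}_\kappa$ holds and moreover is indestructible under $\kappa$-directed closed set forcing (i.e., $\mathsf{SNSP}_\kappa$ holds in every extension of $V^{\mathbb P}$ by a $\kappa$-directed closed set forcing).
   Context: A partial order $\Lambda$ (order $\leq_\Lambda$, strict part $<_\Lambda$) is $\kappa$-directed if every subset of size $<\kappa$ has an upper bound; directed means $\aleph_0$-directed; $d_\Lambda$ is the largest $\kappa$ such that $\Lambda$ is $\kappa$-directed. For a binary relation $R$, write $x <_R y$ for $(x,y)\in R$ and $x \leq_R y$ for ''$(x,y) \in R$ or $x = y$''. A $\Lambda$-system is a structure $\mathcal S = \langle \langle S_u \mid u \in \Lambda\rangle, \mathcal R\rangle$ such that: (1) the $S_u$ are pairwise disjoint nonempty sets; let $S = \bigcup_u S_u$ and for $x \in S$ let $\ell(x)$ be the unique $u$ with $x \in S_u$; (2) $\mathcal R$ is a nonempty set of transitive binary relations on $S$; (3) for all $x,y \in S$, $R \in \mathcal R$, if $x <_R y$ then $\ell(x) <_\Lambda \ell(y)$; (4) for all $x,y,z \in S$ and $R \in \mathcal R$, if $x, y <_R z$ and $\ell(x) \leq_\Lambda \ell(y)$ then $x \leq_R y$; (5) for all $u <_\Lambda v$ there are $x \in S_u$, $y \in S_v$, $R \in \mathcal R$ with $x <_R y$. The width of $\mathcal S$ is $\max\{\sup\{|S_u| \mid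 u \in \Lambda\}, |\mathcal R|\}$. For $R \in \mathcal R$, $x,y\in S$ are $R$-compatible if there is $z \in S$ with $x,y \leq_R z$. A branch through $R$ is a set $b \subseteq S$ whose elements are pairwise $R$-compatible; a branch in $\mathcal S$ is a branch through some $R \in \mathcal R$; it is cofinal if $\{u \in \Lambda \mid b \cap S_u \neq \emptyset\}$ is cofinal in $\Lambda$. For an infinite regular cardinal $\kappa$, $\mathsf{SNSP}_\kappa$ is the assertion that for every directed partial order $\Lambda$ with $d_\Lambda \geq \kappa$, every $\Lambda$-system $\mathcal S$ with $\mathrm{width}(\mathcal S)^+ < \kappa$ has a cofinal branch. A forcing poset is $\kappa$-directed closed if every directed set of conditions of size $<\kappa$ has a lower bound. *)

(* Defs.v *)
(* A theorem of ZFC is rendered as a statement about every model (V, E) of ZFC.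
   Formulas of set theory are kept as syntax because forcing acts on them: for a
   formula phi of the forcing language, "p forces phi" is again a formula,
   evaluated in the ground model. A statement about a generic extension is a
   formula forced by every condition, and a statement about an extension of an
   extension is obtained by nesting. *)

(* First-order formulas over {=, membership}, with parameters from X.
   Quantifiers use Rocq binders. *)
Inductive form (X : Type) : Type :=
| Mem : X -> X -> form X
| Eq : X -> X -> form X
| Bot : form X
| Imp : form X -> form X -> form X
| And : form X -> form X -> form X
| Or : form X -> form X -> form X
| All : (X -> form X) -> form X
| Ex : (X -> form X) -> form X.

Arguments Mem {X} _ _.
Arguments Eq {X} _ _.
Arguments Bot {X}.
Arguments Imp {X} _ _.
Arguments And {X} _ _.
Arguments Or {X} _ _.
Arguments All {X} _.
Arguments Ex {X} _.

Declare Scope form_scope.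
Delimit Scope form_scope with form.
Bind Scope form_scope with form.

Notation "x ∈ y" := (Mem x y) (at level 70, no associativity) : form_scope.
Notation "x ≐ y" := (Eq x y) (at level 70, no associativity) : form_scope.
Notation "¬ f" := (Imp f Bot) (at level 75, right associativity) : form_scope.
Notation "f ∧ g" := (And f g) (at level 80, right associativity) : form_scope.
Notation "f ∨ g" := (Or f g) (at level 85, right associativity) : form_scope.
Notation "f ⇒ g" := (Imp f g) (at level 90, right associativity) : form_scope.
Notation "f ⇔ g" := (And (Imp f g) (Imp g f)) (at level 95, no associativity)
  : form_scope.
Notation "∀ x .. y , f" := (All (fun x => .. (All (fun y => f)) ..))
  (at level 200, x binder, y binder, right associativity) : form_scope.
Notation "∃ x .. y , f" := (Ex (fun x => .. (Ex (fun y => f)) ..))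
  (at level 200, x binder, y binder, right associativity) : form_scope.
Notation "∀[ x ∈ a ] f" := (All (fun x => Imp (Mem x a) f))
  (at level 200, x name, a at level 69, f at level 200, right associativity)
  : form_scope.
Notation "∃[ x ∈ a ] f" := (Ex (fun x => And (Mem x a) f))
  (at level 200, x name, a at level 69, f at level 200, right associativity)
  : form_scope.

Open Scope form_scope.

Fixpoint sat {V : Type} (E : V -> V -> Prop) (f : form V) : Prop :=
  match f with
  | Mem x y => E x y
  | Eq x y => x = y
  | Bot => False
  | Imp g h => sat E g -> sat E h
  | And g h => sat E g /\ sat E h
  | Or g h => sat E g \/ sat E h
  | All g => forall x, sat E (g x)
  | Ex g => exists x, sat E (g x)
  end.

Section Basic.
Context {X : Type}.
Implicit Types a b c d f r s t x y z w : X.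

Definition empty a : form X := ∀ x, ¬ x ∈ a.
Definition sub a b : form X := ∀[x ∈ a] x ∈ b.

Definition is_upair z a b : form X := ∀ x, x ∈ z ⇔ (x ≐ a ∨ x ≐ b).
Definition is_opair z a b : form X :=
  ∃ s t, is_upair s a a ∧ is_upair t a b ∧ is_upair z s t.

(* <a, b> is an element of r *)
Definition pin a b r : form X := ∃ z, is_opair z a b ∧ z ∈ r.
(* <<a, b>, c> is an element of r *)
Definition tin a b c r : form X := ∃ z, is_opair z a b ∧ pin z c r.

Definition is_family f a : form X :=
  (∀[z ∈ f] ∃[x ∈ a] ∃ y, is_opair z x y) ∧
  (∀[x ∈ a] ∃ y, pin x y f ∧ ∀ y', pin x y' f ⇒ y' ≐ y).

Definition is_fun f a b : form X :=
  is_family f a ∧ ∀ x y, pin x y f ⇒ y ∈ b.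

Definition injective f : form X := ∀ x x' y, pin x y f ⇒ pin x' y f ⇒ x ≐ x'.

Definition equipotent a b : form X :=
  ∃ f, is_fun f a b ∧ injective f ∧ ∀[y ∈ b] ∃ x, pin x y f.
Definition card_le a b : form X := ∃ f, is_fun f a b ∧ injective f.
Definition card_lt a b : form X := card_le a b ∧ ¬ card_le b a.

Definition transitive a : form X := ∀[x ∈ a] sub x a.
(* Correct in the presence of Foundation. *)
Definition is_ord a : form X := transitive a ∧ ∀[x ∈ a] transitive x.
Definition limit a : form X := is_ord a ∧ (∃ x, x ∈ a) ∧ ∀[x ∈ a] ∃[y ∈ a] x ∈ y.
Definition is_omega w : form X := limit w ∧ ∀[n ∈ w] ¬ limit n.

(* initial ordinals, finite ones included *)
Definition is_card a : form X := is_ord a ∧ ∀[x ∈ a] ¬ card_le a x.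
Definition is_cardinality c a : form X := is_card c ∧ equipotent a c.
Definition is_succ_card c d : form X :=
  is_card d ∧ c ∈ d ∧ ∀ d', is_card d' ∧ c ∈ d' ⇒ sub d d'.

Definition infinite_regular a : form X :=
  is_card a ∧ (∃ w, is_omega w ∧ sub w a) ∧
  ∀[x ∈ a] ∀ f, is_fun f x a ⇒ ∃[b ∈ a] ∀ i y, pin i y f ⇒ y ∈ b.
Definition uncountable a : form X := ∃ w, is_omega w ∧ card_lt w a.
End Basic.

(* Closed syntax, used for the two axiom schemes only: [V -> form V] contains
   functions that are not definable, so it must not index a scheme. *)
Inductive fml : Type :=
| fMem : nat -> nat -> fml
| fEq : nat -> nat -> fml
| fBot : fml
| fImp : fml -> fml -> fml
| fAll : fml -> fml.

Definition scons {X : Type} (x : X) (e : nat -> X) (n : nat) : X :=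
  match n with O => x | S m => e m end.

Fixpoint inst {X : Type} (f : fml) (e : nat -> X) : form X :=
  match f with
  | fMem i j => e i ∈ e j
  | fEq i j => e i ≐ e j
  | fBot => Bot
  | fImp g h => inst g e ⇒ inst h e
  | fAll g => ∀ x, inst g (scons x e)
  end.

Inductive ZFC_axiom {X : Type} : form X -> Prop :=
| ax_extensionality : ZFC_axiom (∀ x y, (∀ z, z ∈ x ⇔ z ∈ y) ⇒ x ≐ y)
| ax_foundation :
    ZFC_axiom (∀ x, (∃ y, y ∈ x) ⇒ ∃[y ∈ x] ¬ ∃[z ∈ y] z ∈ x)
| ax_pairing : ZFC_axiom (∀ x y, ∃ z, x ∈ z ∧ y ∈ z)
| ax_union : ZFC_axiom (∀ x, ∃ u, ∀[y ∈ x] ∀[z ∈ y] z ∈ u)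
| ax_powerset : ZFC_axiom (∀ x, ∃ p, ∀ y, sub y x ⇒ y ∈ p)
| ax_infinity :
    ZFC_axiom (∃ w, (∃[e ∈ w] empty e) ∧
                    ∀[x ∈ w] ∃[y ∈ w] ∀ z, z ∈ y ⇔ (z ∈ x ∨ z ≐ x))
| ax_choice :
    ZFC_axiom (∀ F, (∀[x ∈ F] ∃ y, y ∈ x) ∧
                    (∀[x ∈ F] ∀[y ∈ F] ((∃[z ∈ x] z ∈ y) ⇒ x ≐ y)) ⇒
                    ∃ c, ∀[x ∈ F] ∃ y, (y ∈ x ∧ y ∈ c) ∧
                                       ∀ y', y' ∈ x ∧ y' ∈ c ⇒ y' ≐ y)
| ax_separation (f : fml) (e : nat -> X) :
    ZFC_axiom (∀ a, ∃ b, ∀ x, x ∈ b ⇔ (x ∈ a ∧ inst f (scons x e)))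
| ax_replacement (f : fml) (e : nat -> X) :
    ZFC_axiom (∀ a, (∀[x ∈ a] ∃ y, inst f (scons x (scons y e)) ∧
                       ∀ y', inst f (scons x (scons y' e)) ⇒ y' ≐ y) ⇒
                    ∃ b, ∀[x ∈ a] ∃[y ∈ b] inst f (scons x (scons y e))).

Definition models_ZFC {V : Type} (E : V -> V -> Prop) : Prop :=
  forall f : form V, ZFC_axiom f -> sat E f.

Section Supercompact.
Context {X : Type}.
Implicit Types A K U kappa : X.

(* { x in K | f x } is an element of U *)
Definition comp_in U K (f : X -> form X) : form X :=
  ∃[Y ∈ U] ∀ x, x ∈ Y ⇔ (x ∈ K ∧ f x).

Definition is_Pkappa K kappa A : form X :=
  ∀ x, x ∈ K ⇔ (sub x A ∧ card_lt x kappa).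

(* U is a kappa-complete fine normal ultrafilter on K = P_kappa(A) *)
Definition normal_measure U K kappa A : form X :=
  (∀[Y ∈ U] sub Y K) ∧
  K ∈ U ∧
  (∀[Y ∈ U] ¬ empty Y) ∧
  (∀[Y ∈ U] ∀ Z, sub Y Z ∧ sub Z K ⇒ Z ∈ U) ∧
  (∀ Y, sub Y K ⇒ Y ∈ U ∨ comp_in U K (fun x => ¬ x ∈ Y)) ∧
  (∀ F, sub F U ∧ ¬ empty F ∧ card_lt F kappa ⇒
        comp_in U K (fun x => ∀[Y ∈ F] x ∈ Y)) ∧
  (∀[a ∈ A] comp_in U K (fun x => a ∈ x)) ∧
  (∀ f, is_fun f K A ∧ comp_in U K (fun x => ∃[y ∈ x] pin x y f) ⇒
        ∃[a ∈ A] comp_in U K (fun x => pin x a f)).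

Definition supercompact kappa : form X :=
  is_card kappa ∧ uncountable kappa ∧
  ∀ A, card_le kappa A ⇒
       ∃ K U, is_Pkappa K kappa A ∧ normal_measure U K kappa A.
End Supercompact.

(* A forcing poset is a set P with L = {<q, p> | q <= p}; q <= p means that q is
   the stronger condition. *)

Section Forcing.
Context {X : Type}.
Implicit Types P L p q r T E kappa mu : X.

Definition forcing_poset P L : form X :=
  (∃ p, p ∈ P) ∧
  (∀[z ∈ L] ∃[q ∈ P] ∃[p ∈ P] is_opair z q p) ∧
  (∀[p ∈ P] pin p p L) ∧
  (∀ p q r, pin p q L ⇒ pin q r L ⇒ pin p r L).

Definition directed_closed kappa P L : form X :=
  ∀ D, sub D P ∧ card_lt D kappa ∧
       (∀[p ∈ D] ∀[q ∈ D] ∃[r ∈ D] pin r p L ∧ pin r q L) ⇒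
       ∃[p ∈ P] ∀[q ∈ D] pin p q L.

(* Every set is a name: its value under a generic G is
   val(t) = { val(s) | <s, r> in t and r in G }. *)

(* p forces that every element of s is an element of t, where [eqv q a b] says
   that q forces a = b *)
Definition forces_sub L (eqv : X -> X -> X -> form X) p s t : form X :=
  ∀ a r, pin a r s ⇒
  ∀ q, pin q p L ∧ pin q r L ⇒
  ∃ q', pin q' q L ∧ ∃ b r', pin b r' t ∧ pin q' r' L ∧ eqv q' a b.

(* E is the restriction to names in T of the relation { <<p, s>, t> | p forces
   s = t }, given by its recursive definition *)
Definition eq_forcing_relation L T E : form X :=
  ∀ p, pin p p L ⇒ ∀[s ∈ T] ∀[t ∈ T]
    (tin p s t E ⇔
     (forces_sub L (fun q a b => tin q a b E) p s t ∧
      forces_sub L (fun q b a => tin q a b E) p t s)).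

Definition forces_eq L p s t : form X :=
  ∃ T E, transitive T ∧ s ∈ T ∧ t ∈ T ∧ eq_forcing_relation L T E ∧ tin p s t E.

Definition forces_mem L p s t : form X :=
  ∀ q, pin q p L ⇒
  ∃ q', pin q' q L ∧ ∃ b r, pin b r t ∧ pin q' r L ∧ forces_eq L q' s b.

Fixpoint forces L p (f : form X) {struct f} : form X :=
  match f with
  | Mem s t => forces_mem L p s t
  | Eq s t => forces_eq L p s t
  | Bot => Bot
  | Imp g h => ∀ q, pin q p L ⇒ forces L q g ⇒ forces L q h
  | And g h => forces L p g ∧ forces L p h
  | Or g h =>
      ∀ q, pin q p L ⇒ ∃ q', pin q' q L ∧ (forces L q' g ∨ forces L q' h)
  | All g => ∀ s, forces L p (g s)
  | Ex g => ∀ q, pin q p L ⇒ ∃ q', pin q' q L ∧ ∃ s, forces L q' (g s)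
  end.

Definition forced P L (f : form X) : form X := ∀[p ∈ P] forces L p f.

(* c is the canonical name { <check y, p> | y in x, p in P } of x *)
Definition is_check P x c : form X :=
  ∃ T f, transitive T ∧ x ∈ T ∧ is_family f T ∧
    (∀ y d, pin y d f ⇒
       ∀ z, z ∈ d ⇔ ∃[w ∈ y] ∃ e, pin w e f ∧ ∃[p ∈ P] is_opair z e p) ∧
    pin x c f.

(* Conditions of Coll(mu, <kappa): functions p with |p| < mu, dom(p) included in
   kappa x mu and p(alpha, xi) < alpha. *)
Definition collapse_condition mu kappa p : form X :=
  (∀[z ∈ p] ∃[alpha ∈ kappa] ∃[xi ∈ mu] ∃[beta ∈ alpha]
     ∃ d, is_opair d alpha xi ∧ is_opair z d beta) ∧
  (∀ d b b', pin d b p ⇒ pin d b' p ⇒ b ≐ b') ∧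
  card_lt p mu.

Definition is_levy_collapse mu kappa P L : form X :=
  (∀ p, p ∈ P ⇔ collapse_condition mu kappa p) ∧
  (∀ z, z ∈ L ⇔ ∃[q ∈ P] ∃[p ∈ P] is_opair z q p ∧ sub p q).
End Forcing.

Section Systems.
Context {X : Type}.
(* A partial order is a set Lam with le = {<u, v> | u <= v}; a system is a
   function S with domain Lam together with a set RR of relations. *)
Implicit Types Lam le S RR kappa : X.

Definition partial_order Lam le : form X :=
  (∀[z ∈ le] ∃[u ∈ Lam] ∃[v ∈ Lam] is_opair z u v) ∧
  (∀[u ∈ Lam] pin u u le) ∧
  (∀ u v, pin u v le ⇒ pin v u le ⇒ u ≐ v) ∧
  (∀ u v w, pin u v le ⇒ pin v w le ⇒ pin u w le).

Definition lt le u v : form X := pin u v le ∧ ¬ u ≐ v.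

Definition card_directed kappa Lam le : form X :=
  ∀ D, sub D Lam ∧ card_lt D kappa ⇒ ∃[v ∈ Lam] ∀[u ∈ D] pin u v le.

Definition directed Lam le : form X := ∃ w, is_omega w ∧ card_directed w Lam le.

Definition is_d d Lam le : form X :=
  is_card d ∧ card_directed d Lam le ∧
  ∀ d', is_card d' ∧ card_directed d' Lam le ⇒ sub d' d.

(* d_Lambda >= kappa. If Lambda has a maximum, it is d-directed for every
   cardinal d, and d_Lambda is read as infinity. *)
Definition d_ge kappa Lam le : form X :=
  (∃ d, is_d d Lam le ∧ sub kappa d) ∨
  (∀ d, is_card d ⇒ card_directed d Lam le).

(* x is an element of S_u *)
Definition at_level S u x : form X := ∃ B, pin u B S ∧ x ∈ B.
Definition in_system S x : form X := ∃ u, at_level S u x.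

Definition le_rel R x y : form X := pin x y R ∨ x ≐ y.

Definition is_system Lam le S RR : form X :=
  is_family S Lam ∧
  (∀[u ∈ Lam] ∃ x, at_level S u x) ∧
  (∀ u v x, at_level S u x ⇒ at_level S v x ⇒ u ≐ v) ∧
  (∃ R, R ∈ RR) ∧
  (∀[R ∈ RR] ∀[z ∈ R] ∃ x y, in_system S x ∧ in_system S y ∧ is_opair z x y) ∧
  (∀[R ∈ RR] ∀ x y z, pin x y R ⇒ pin y z R ⇒ pin x z R) ∧
  (∀[R ∈ RR] ∀ x y u v, at_level S u x ⇒ at_level S v y ⇒
     pin x y R ⇒ lt le u v) ∧
  (∀[R ∈ RR] ∀ x y z u v, at_level S u x ⇒ at_level S v y ⇒
     pin x z R ⇒ pin y z R ⇒ pin u v le ⇒ le_rel R x y) ∧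
  (∀ u v, lt le u v ⇒
     ∃ x y, at_level S u x ∧ at_level S v y ∧ ∃[R ∈ RR] pin x y R).

(* s = sup { |S_u| : u in Lam }, the union of these cardinals *)
Definition is_sup_levels s S : form X :=
  ∀ i, i ∈ s ⇔ ∃ u B c, pin u B S ∧ is_cardinality c B ∧ i ∈ c.

Definition is_width w S RR : form X :=
  ∃ s c, is_sup_levels s S ∧ is_cardinality c RR ∧
         ((sub c s ∧ w ≐ s) ∨ (sub s c ∧ w ≐ c)).

Definition is_branch S R b : form X :=
  (∀[x ∈ b] in_system S x) ∧
  ∀[x ∈ b] ∀[y ∈ b] ∃ z, in_system S z ∧ le_rel R x z ∧ le_rel R y z.

Definition has_cofinal_branch Lam le S RR : form X :=
  ∃ b, (∃[R ∈ RR] is_branch S R b) ∧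
       ∀[u ∈ Lam] ∃[v ∈ Lam] pin u v le ∧ ∃[x ∈ b] at_level S v x.

Definition SNSP kappa : form X :=
  ∀ Lam le, partial_order Lam le ∧ directed Lam le ∧ d_ge kappa Lam le ⇒
  ∀ S RR, is_system Lam le S RR ∧
    (∃ w w', is_width w S RR ∧ is_succ_card w w' ∧ w' ∈ kappa) ⇒
  has_cofinal_branch Lam le S RR.

Definition SNSP_indestructible kappa : form X :=
  ∀ Q L, forcing_poset Q L ∧ directed_closed kappa Q L ⇒
  ∀ c, is_check Q kappa c ⇒ forced Q L (SNSP c).
End Systems.

(* Main.v *)
Require Import Defs.
From Stdlib Require Import Arith Cantor Lia Classical ClassicalEpsilon
  FunctionalExtensionality PropExtensionality.

(* By Loewenheim-Skolem we may work in a countable model, so generic filters exist and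
   statements about forcing become statements about generic extensions. Let G be generic for
   Coll(mu, <kappa), let Q be kappa-directed closed in V[G], and let H be Q-generic.

   Fix a system in V[G][H] whose width is w; then w < mu because mu^+ = kappa. A branch is read
   off from a <mu-closed poset T in V[G] of conditions of j(Coll(mu, <kappa)) / G, where j is
   the ultrapower by a normal measure U on P_kappa(A). To avoid class embeddings, conditions
   are represented by functions on U-large sets, and truth in the ultrapower is truth for U-almost all z.
   Such a condition t carries a partial enumeration of pairs (q, b), where q is in Q and b is a
   name for an element of Lambda, and for every index z the enumeration extends to one of
   length mu. Directed closure of Q yields q_z below the pairs that form a chain, and
   kappa-directedness of Lambda yields a name v_z of a strict upper bound of the elements
   listed at z. If all conditions q_z with z in t force the i-th element of level b below the
   l-th element of level v_z in the k-th relation, then t approximates the branch determined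
   by (k, l). Any two elements chosen by t are compatible, and each level can be met below t.

   A <mu-closed poset of such approximations gives a cofinal branch outright: otherwise one
   builds mu conditions that pairwise disagree on a level of size less than mu. *)

(** The customary argument lifts j to V[G][H]: H is absorbed by the tail of j(Coll(mu, <kappa)), and
    a master condition in j(Q) lies below the image of H. Both steps are hidden in the enumeration.
    One coordinate of the tail lists the pairs (q, b) in length mu, and the chain chosen greedily
    from this list plays the part of the absorbed filter; the conditions whose chain lies in the
    actual H form the quotient forcing, and q_z is the master condition. The quotient lives in
    V[G][H] but remains closed, as Q adds no sequences shorter than kappa. Each z has its own q_z
    and v_z and its own decision (i, k, l). There are fewer than mu such triples, so a condition can
    be strengthened until the triple no longer depends on z; for this the elements and relations of
    the system are replaced by indices below w. The bound v_z must be strict because a system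
    relates only elements of distinct levels; a partial order with a maximum is treated apart, where
    a single element is a branch. *)

(* Unlike [fml] it has every connective of [form], so that [forces] acts on it syntactically. *)
Inductive fm : Type :=
| gMem : nat -> nat -> fm
| gEq : nat -> nat -> fm
| gBot : fm
| gImp : fm -> fm -> fm
| gAnd : fm -> fm -> fm
| gOr : fm -> fm -> fm
| gAll : fm -> fm
| gEx : fm -> fm.

Fixpoint dinst {X : Type} (f : fm) (e : nat -> X) : form X :=
  match f with
  | gMem i j => Mem (e i) (e j)
  | gEq i j => Eq (e i) (e j)
  | gBot => Bot
  | gImp g h => Imp (dinst g e) (dinst h e)
  | gAnd g h => And (dinst g e) (dinst h e)
  | gOr g h => Or (dinst g e) (dinst h e)
  | gAll g => All (fun x => dinst g (scons x e))
  | gEx g => Ex (fun x => dinst g (scons x e))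
  end.

Definition up (r : nat -> nat) (n : nat) : nat :=
  match n with O => O | S m => S (r m) end.

Fixpoint ren (r : nat -> nat) (f : fm) : fm :=
  match f with
  | gMem i j => gMem (r i) (r j)
  | gEq i j => gEq (r i) (r j)
  | gBot => gBot
  | gImp g h => gImp (ren r g) (ren r h)
  | gAnd g h => gAnd (ren r g) (ren r h)
  | gOr g h => gOr (ren r g) (ren r h)
  | gAll g => gAll (ren (up r) g)
  | gEx g => gEx (ren (up r) g)
  end.

Lemma scons_up {X : Type} (x : X) (e : nat -> X) (r : nat -> nat) :
  (fun n => scons x e (up r n)) = scons x (fun n => e (r n)).
Proof. extensionality n. destruct n; reflexivity. Qed.

Lemma dinst_ren {X : Type} (f : fm) : forall (r : nat -> nat) (e : nat -> X),
  dinst (ren r f) e = dinst f (fun n => e (r n)).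
Proof.
  induction f; intros r e; cbn; f_equal; auto;
    extensionality x; rewrite IHf, scons_up; reflexivity.
Qed.

Fixpoint emb (f : fml) : fm :=
  match f with
  | fMem i j => gMem i j
  | fEq i j => gEq i j
  | fBot => gBot
  | fImp g h => gImp (emb g) (emb h)
  | fAll g => gAll (emb g)
  end.

Lemma inst_emb {X : Type} (f : fml) : forall e : nat -> X, inst f e = dinst (emb f) e.
Proof.
  induction f; intros e; cbn; f_equal; auto. extensionality x. auto.
Qed.

(** * Uniformly definable formulas *)

(** A [form V] may contain arbitrary Rocq functions under its quantifiers and then has no
    counterpart in another model. A family given by one [fm] for all carriers can be moved between
    V, the countable model and generic extensions. *)
Definition uniform (F : forall X : Type, (nat -> X) -> form X) : Prop :=
  exists f, forall X e, F X e = dinst f e.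

Lemma U_mem i j : uniform (fun X e => Mem (e i) (e j)).
Proof. exists (gMem i j). reflexivity. Qed.
Lemma U_eq i j : uniform (fun X e => Eq (e i) (e j)).
Proof. exists (gEq i j). reflexivity. Qed.
Lemma U_bot : uniform (fun X e => Bot).
Proof. exists gBot. reflexivity. Qed.
Lemma U_imp F G : uniform F -> uniform G -> uniform (fun X e => Imp (F X e) (G X e)).
Proof. intros [f Hf] [g Hg]. exists (gImp f g). intros. cbn. rewrite Hf, Hg. reflexivity. Qed.
Lemma U_and F G : uniform F -> uniform G -> uniform (fun X e => And (F X e) (G X e)).
Proof. intros [f Hf] [g Hg]. exists (gAnd f g). intros. cbn. rewrite Hf, Hg. reflexivity. Qed.
Lemma U_or F G : uniform F -> uniform G -> uniform (fun X e => Or (F X e) (G X e)).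
Proof. intros [f Hf] [g Hg]. exists (gOr f g). intros. cbn. rewrite Hf, Hg. reflexivity. Qed.
Lemma U_all (F : forall X, X -> (nat -> X) -> form X) :
  uniform (fun X e => F X (e 0) (fun n => e (S n))) ->
  uniform (fun X e => All (fun x => F X x e)).
Proof.
  intros [f Hf]. exists (gAll f). intros. cbn. f_equal. extensionality x.
  rewrite <- Hf. reflexivity.
Qed.
Lemma U_ex (F : forall X, X -> (nat -> X) -> form X) :
  uniform (fun X e => F X (e 0) (fun n => e (S n))) ->
  uniform (fun X e => Ex (fun x => F X x e)).
Proof.
  intros [f Hf]. exists (gEx f). intros. cbn. f_equal. extensionality x.
  rewrite <- Hf. reflexivity.
Qed.
Lemma U_ext (F G : forall X : Type, (nat -> X) -> form X) :
  (forall X e, F X e = G X e) -> uniform F -> uniform G.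
Proof. intros H [f Hf]. exists f. intros. rewrite <- H. auto. Qed.
Lemma U_ren (r : nat -> nat) F : uniform F -> uniform (fun X e => F X (fun n => e (r n))).
Proof.
  intros [f Hf]. exists (ren r f). intros. rewrite dinst_ren. auto.
Qed.

Create HintDb unif.
Ltac utac :=
  cbv beta;
  repeat (first
    [ solve [auto 1 with unif nocore]
    | simple apply U_mem | simple apply U_eq | simple apply U_bot | simple apply U_imp
    | simple apply U_and | simple apply U_or | simple apply U_all | simple apply U_ex ];
    cbv beta).

Lemma U_empty i : uniform (fun X e => empty (e i)).
Proof. unfold empty. utac. Qed.
Lemma U_sub i j : uniform (fun X e => sub (e i) (e j)).
Proof. unfold sub. utac. Qed.
Lemma U_upair i j k : uniform (fun X e => is_upair (e i) (e j) (e k)).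
Proof. unfold is_upair. utac. Qed.
#[export] Hint Resolve U_empty U_sub U_upair : unif.
Lemma U_opair i j k : uniform (fun X e => is_opair (e i) (e j) (e k)).
Proof. unfold is_opair. utac. Qed.
#[export] Hint Resolve U_opair : unif.
Lemma U_pin i j k : uniform (fun X e => pin (e i) (e j) (e k)).
Proof. unfold pin. utac. Qed.
#[export] Hint Resolve U_pin : unif.
Lemma U_tin i j k l : uniform (fun X e => tin (e i) (e j) (e k) (e l)).
Proof. unfold tin. utac. Qed.
Lemma U_family i j : uniform (fun X e => is_family (e i) (e j)).
Proof. unfold is_family. utac. Qed.
#[export] Hint Resolve U_tin U_family : unif.
Lemma U_fun i j k : uniform (fun X e => is_fun (e i) (e j) (e k)).
Proof. unfold is_fun. utac. Qed.
Lemma U_injective i : uniform (fun X e => injective (e i)).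
Proof. unfold injective. utac. Qed.
#[export] Hint Resolve U_fun U_injective : unif.
Lemma U_equipotent i j : uniform (fun X e => equipotent (e i) (e j)).
Proof. unfold equipotent. utac. Qed.
Lemma U_card_le i j : uniform (fun X e => card_le (e i) (e j)).
Proof. unfold card_le. utac. Qed.
#[export] Hint Resolve U_equipotent U_card_le : unif.
Lemma U_card_lt i j : uniform (fun X e => card_lt (e i) (e j)).
Proof. unfold card_lt. utac. Qed.
Lemma U_transitive i : uniform (fun X e => transitive (e i)).
Proof. unfold transitive. utac. Qed.
#[export] Hint Resolve U_card_lt U_transitive : unif.
Lemma U_ord i : uniform (fun X e => is_ord (e i)).
Proof. unfold is_ord. utac. Qed.
#[export] Hint Resolve U_ord : unif.
Lemma U_limit i : uniform (fun X e => limit (e i)).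
Proof. unfold limit. utac. Qed.
#[export] Hint Resolve U_limit : unif.
Lemma U_omega i : uniform (fun X e => is_omega (e i)).
Proof. unfold is_omega. utac. Qed.
Lemma U_card i : uniform (fun X e => is_card (e i)).
Proof. unfold is_card. utac. Qed.
#[export] Hint Resolve U_omega U_card : unif.
Lemma U_cardinality i j : uniform (fun X e => is_cardinality (e i) (e j)).
Proof. unfold is_cardinality. utac. Qed.
Lemma U_succ_card i j : uniform (fun X e => is_succ_card (e i) (e j)).
Proof. unfold is_succ_card. utac. Qed.
Lemma U_regular i : uniform (fun X e => infinite_regular (e i)).
Proof. unfold infinite_regular. utac. Qed.
Lemma U_uncountable i : uniform (fun X e => uncountable (e i)).
Proof. unfold uncountable. utac. Qed.
#[export] Hint Resolve U_cardinality U_succ_card U_regular U_uncountable : unif.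
Lemma U_supercompact i : uniform (fun X e => supercompact (e i)).
Proof. unfold supercompact, is_Pkappa, normal_measure, comp_in. utac. Qed.
Lemma U_forcing_poset i j : uniform (fun X e => forcing_poset (e i) (e j)).
Proof. unfold forcing_poset. utac. Qed.
Lemma U_directed_closed i j k : uniform (fun X e => directed_closed (e i) (e j) (e k)).
Proof. unfold directed_closed. utac. Qed.
Lemma U_forces_eq i j k l : uniform (fun X e => forces_eq (e i) (e j) (e k) (e l)).
Proof. unfold forces_eq, eq_forcing_relation, forces_sub. utac. Qed.
#[export] Hint Resolve U_supercompact U_forcing_poset U_directed_closed U_forces_eq : unif.
Lemma U_forces_mem i j k l : uniform (fun X e => forces_mem (e i) (e j) (e k) (e l)).
Proof. unfold forces_mem. utac. Qed.
Lemma U_check i j k : uniform (fun X e => is_check (e i) (e j) (e k)).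
Proof. unfold is_check. utac. Qed.
Lemma U_levy i j k l : uniform (fun X e => is_levy_collapse (e i) (e j) (e k) (e l)).
Proof. unfold is_levy_collapse, collapse_condition. utac. Qed.
#[export] Hint Resolve U_forces_mem U_check U_levy : unif.

(** Since [forces] computes on syntax, forcing a formula is again a formula of the ground model.
    This is what allows forcing to be nested, as in [SNSP_indestructible]. *)
Lemma U_forces_dinst f : forall i j r,
  uniform (fun X e => forces (e i) (e j) (dinst f (fun n => e (r n)))).
Proof.
  induction f; intros i j r; cbn [dinst forces]; utac; auto.
  - eapply U_ext; [|apply (IHf (S i) (S j) (up r))].
    intros. cbn. f_equal. f_equal. extensionality n. destruct n; reflexivity.
  - eapply U_ext; [|apply (IHf (S (S (S i))) 1 (up (fun n => S (S (r n)))))].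
    intros. cbn. f_equal. f_equal. extensionality n. destruct n; reflexivity.
Qed.
Lemma U_forces i j F : uniform F -> uniform (fun X e => forces (e i) (e j) (F X e)).
Proof.
  intros [f Hf]. eapply U_ext; [|apply (U_forces_dinst f i j (fun n => n))].
  intros. cbn. rewrite Hf. reflexivity.
Qed.

Lemma U_partial_order i j : uniform (fun X e => partial_order (e i) (e j)).
Proof. unfold partial_order. utac. Qed.
Lemma U_lt i j k : uniform (fun X e => lt (e i) (e j) (e k)).
Proof. unfold lt. utac. Qed.
Lemma U_card_directed i j k : uniform (fun X e => card_directed (e i) (e j) (e k)).
Proof. unfold card_directed. utac. Qed.
#[export] Hint Resolve U_partial_order U_lt U_card_directed : unif.
Lemma U_directed i j : uniform (fun X e => directed (e i) (e j)).
Proof. unfold directed. utac. Qed.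
Lemma U_d_ge i j k : uniform (fun X e => d_ge (e i) (e j) (e k)).
Proof. unfold d_ge, is_d. utac. Qed.
Lemma U_at_level i j k : uniform (fun X e => at_level (e i) (e j) (e k)).
Proof. unfold at_level. utac. Qed.
#[export] Hint Resolve U_directed U_d_ge U_at_level : unif.
Lemma U_in_system i j : uniform (fun X e => in_system (e i) (e j)).
Proof. unfold in_system. utac. Qed.
Lemma U_le_rel i j k : uniform (fun X e => le_rel (e i) (e j) (e k)).
Proof. unfold le_rel. utac. Qed.
#[export] Hint Resolve U_in_system U_le_rel : unif.
Lemma U_system i j k l : uniform (fun X e => is_system (e i) (e j) (e k) (e l)).
Proof. unfold is_system. utac. Qed.
Lemma U_width i j k : uniform (fun X e => is_width (e i) (e j) (e k)).
Proof. unfold is_width, is_sup_levels. utac. Qed.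
Lemma U_cofinal_branch i j k l :
  uniform (fun X e => has_cofinal_branch (e i) (e j) (e k) (e l)).
Proof. unfold has_cofinal_branch, is_branch. utac. Qed.
#[export] Hint Resolve U_system U_width U_cofinal_branch : unif.
Lemma U_SNSP i : uniform (fun X e => SNSP (e i)).
Proof. unfold SNSP. utac. Qed.
#[export] Hint Resolve U_SNSP : unif.
Lemma U_SNSP_ind i : uniform (fun X e => SNSP_indestructible (e i)).
Proof. unfold SNSP_indestructible, forced. utac. apply U_forces. utac. Qed.
#[export] Hint Resolve U_SNSP_ind : unif.

(** * Countable elementary submodels *)

(** The enumeration has two uses: every element becomes available as a parameter of a closed
    formula, and the dense classes to be met by a generic filter can be listed. *)
Record struct : Type := Struct {
  car :> Type;
  mem : car -> car -> Prop;
  enum : nat -> car;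
  enum_surj : forall x, exists n, enum n = x }.
Arguments mem {s}.
Arguments enum {s}.

Fixpoint enc_fm (f : fm) : nat :=
  match f with
  | gMem i j => to_nat (0, to_nat (i, j))
  | gEq i j => to_nat (1, to_nat (i, j))
  | gBot => to_nat (2, 0)
  | gImp g h => to_nat (3, to_nat (enc_fm g, enc_fm h))
  | gAnd g h => to_nat (4, to_nat (enc_fm g, enc_fm h))
  | gOr g h => to_nat (5, to_nat (enc_fm g, enc_fm h))
  | gAll g => to_nat (6, enc_fm g)
  | gEx g => to_nat (7, enc_fm g)
  end.

Lemma to_nat_pair_inj a b c d : to_nat (a, b) = to_nat (c, d) -> a = c /\ b = d.
Proof. intros H. apply to_nat_inj in H. injection H; auto. Qed.

Ltac cantor_inj :=
  repeat match goal with
  | H : to_nat (?a, ?b) = to_nat (?c, ?d) |- _ =>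
      apply to_nat_pair_inj in H; destruct H; try discriminate
  end.

Lemma enc_fm_inj f : forall g, enc_fm f = enc_fm g -> f = g.
Proof.
  induction f; destruct g; cbn -[to_nat]; intros H; cantor_inj; subst; f_equal; auto.
Qed.

Lemma surj_of_inj (X : Type) (x0 : X) (c : X -> nat) :
  (forall x y, c x = c y -> x = y) -> exists g : nat -> X, forall x, exists n, g n = x.
Proof.
  intros H. exists (fun n => epsilon (inhabits x0) (fun x => c x = n)).
  intros x. exists (c x). apply H.
  apply (epsilon_spec (inhabits x0) (fun y => c y = c x)). eauto.
Qed.

(** Skolem terms. [Cons] builds the lists on which Skolem functions act, so no arities are needed
    and the terms are visibly countable. *)
Inductive tm : Type := Base (n : nat) | Cons (a b : tm) | Sk (f : fm) (a : tm).

Fixpoint enc_tm (t : tm) : nat :=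
  match t with
  | Base n => to_nat (0, n)
  | Cons a b => to_nat (1, to_nat (enc_tm a, enc_tm b))
  | Sk f a => to_nat (2, to_nat (enc_fm f, enc_tm a))
  end.

Lemma enc_tm_inj s : forall t, enc_tm s = enc_tm t -> s = t.
Proof.
  induction s; destruct t; cbn -[to_nat]; intros H; cantor_inj; subst; f_equal; auto.
  apply enc_fm_inj; auto.
Qed.

Fixpoint bnd (f : fm) : nat :=
  match f with
  | gMem i j | gEq i j => S (i + j)
  | gBot => 0
  | gImp g h | gAnd g h | gOr g h => bnd g + bnd h
  | gAll g | gEx g => bnd g
  end.

Lemma dinst_bnd {X : Type} (f : fm) : forall (e e' : nat -> X),
  (forall n, n < bnd f -> e n = e' n) -> dinst f e = dinst f e'.
Proof.
  induction f; intros e e' H; cbn in *.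
  - rewrite !H by lia; reflexivity.
  - rewrite !H by lia; reflexivity.
  - reflexivity.
  - f_equal; [apply IHf1|apply IHf2]; intros; apply H; lia.
  - f_equal; [apply IHf1|apply IHf2]; intros; apply H; lia.
  - f_equal; [apply IHf1|apply IHf2]; intros; apply H; lia.
  - f_equal. extensionality x. apply IHf. intros [|n] Hn; cbn; auto. apply H. lia.
  - f_equal. extensionality x. apply IHf. intros [|n] Hn; cbn; auto. apply H. lia.
Qed.

Section Skolem.
Variables (V : Type) (E : V -> V -> Prop) (base : nat -> V).

Definition skolem (f : fm) (e : nat -> V) : V :=
  epsilon (inhabits (base 0)) (fun x => sat E (dinst f (scons x e))).

(* A term evaluates to an element and, read as a list, to an environment. *)
Fixpoint ev (t : tm) : V * (nat -> V) :=
  match t with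
  | Base n => (base n, base)
  | Cons a b => (base 0, scons (fst (ev a)) (snd (ev b)))
  | Sk f a => (skolem f (snd (ev a)), base)
  end.

Definition hull : Type := {x : V | exists t, x = fst (ev t)}.

Lemma hull_eq (x y : hull) : proj1_sig x = proj1_sig y -> x = y.
Proof.
  destruct x as [x Hx], y as [y Hy]; cbn. intros ->. f_equal. apply proof_irrelevance.
Qed.

(** A term can match an infinite environment only on an initial segment; this is enough, because a
    formula reads only variables below [bnd]. *)
Lemma hull_env (n : nat) : forall e : nat -> hull,
  exists t, forall k, k < n -> snd (ev t) k = proj1_sig (e k).
Proof.
  induction n; intros e.
  - exists (Base 0). intros; lia.
  - destruct (IHn (fun k => e (S k))) as [t Ht].
    destruct (proj2_sig (e 0)) as [s Hs].
    exists (Cons s t). intros [|k] Hk; cbn; [congruence|apply Ht; lia].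
Qed.

Lemma hull_witness f (e : nat -> hull) :
  (exists x, sat E (dinst f (scons x (fun n => proj1_sig (e n))))) ->
  exists x : hull, sat E (dinst f (scons (proj1_sig x) (fun n => proj1_sig (e n)))).
Proof.
  intros Hx. destruct (hull_env (bnd f) e) as [t Ht].
  assert (Heq : forall x, dinst f (scons x (fun n => proj1_sig (e n)))
                          = dinst f (scons x (snd (ev t)))).
  { intros x. apply dinst_bnd. intros [|k] Hk; cbn; auto. rewrite Ht; auto. lia. }
  exists (exist _ (skolem f (snd (ev t))) (ex_intro _ (Sk f t) eq_refl)); cbn.
  rewrite Heq. unfold skolem.
  apply (epsilon_spec (inhabits (base 0)) (fun x => sat E (dinst f (scons x (snd (ev t)))))).
  destruct Hx as [x Hx]. exists x. rewrite <- Heq. exact Hx.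
Qed.

Definition hull_mem (x y : hull) : Prop := E (proj1_sig x) (proj1_sig y).

Lemma scons_proj (x : hull) (e : nat -> hull) :
  (fun n => proj1_sig (scons x e n)) = scons (proj1_sig x) (fun n => proj1_sig (e n)).
Proof. extensionality n. destruct n; reflexivity. Qed.

Lemma hull_elementary f : forall e : nat -> hull,
  sat hull_mem (dinst f e) <-> sat E (dinst f (fun n => proj1_sig (e n))).
Proof.
  induction f; intros e; cbn.
  - reflexivity.
  - split; [congruence|apply hull_eq].
  - reflexivity.
  - rewrite IHf1, IHf2. reflexivity.
  - rewrite IHf1, IHf2. reflexivity.
  - rewrite IHf1, IHf2. reflexivity.
  - split; intros H.
    + apply NNPP. intros Hn. apply not_all_ex_not in Hn.
      destruct (hull_witness (gImp f gBot) e) as [x Hx]; [exact Hn|].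
      apply Hx. specialize (H x). rewrite IHf, scons_proj in H. exact H.
    + intros x. rewrite IHf, scons_proj. apply H.
  - split.
    + intros [x H]. rewrite IHf, scons_proj in H. eauto.
    + intros H. destruct (hull_witness f e H) as [x Hx]. exists x.
      rewrite IHf, scons_proj. exact Hx.
Qed.

End Skolem.

Lemma countable_elementary_submodel (V : Type) (E : V -> V -> Prop) (base : nat -> V) :
  exists (M : struct) (inc : M -> V) (b : nat -> M),
    (forall n, inc (b n) = base n) /\
    forall f e, sat (@mem M) (dinst f e) <-> sat E (dinst f (fun n => inc (e n))).
Proof.
  destruct (surj_of_inj tm (Base 0) enc_tm enc_tm_inj) as [g Hg].
  set (h := fun n => exist (fun x => exists t, x = fst (ev V E base t))
             (fst (ev V E base (g n))) (ex_intro _ (g n) eq_refl) : hull V E base).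
  assert (Hh : forall x, exists n, h n = x).
  { intros [x [t Ht]]. destruct (Hg t) as [n Hn]. exists n. apply hull_eq. cbn.
    rewrite Hn. auto. }
  exists (Struct _ (hull_mem V E base) h Hh), (@proj1_sig _ _),
    (fun n => exist _ (base n) (ex_intro _ (Base n) eq_refl)).
  split; [reflexivity|]. intros. apply hull_elementary.
Qed.

(** Every axiom is a uniform formula, the two schemes because they are indexed by closed syntax. *)
Lemma ZFC_uniform (V : Type) (E : V -> V -> Prop) (M : struct) (inc : M -> V) :
  (forall f e, sat (@mem M) (dinst f e) <-> sat E (dinst f (fun n => inc (e n)))) ->
  models_ZFC E -> models_ZFC (@mem M).
Proof.
  intros H HV.
  assert (T : forall F, uniform F -> forall e : nat -> M,
             sat E (F V (fun n => inc (e n))) -> sat (@mem M) (F M e)).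
  { intros F [f Hf] e. rewrite !Hf. apply H. }
  intros f Hf. destruct Hf.
  - refine (T (fun X e => ∀ x y, (∀ z, z ∈ x ⇔ z ∈ y) ⇒ x ≐ y) _ enum _);
      [utac|apply HV; constructor].
  - refine (T (fun X e => ∀ x, (∃ y, y ∈ x) ⇒ ∃[y ∈ x] ¬ ∃[z ∈ y] z ∈ x) _ enum _);
      [utac|apply HV; constructor].
  - refine (T (fun X e => ∀ x y, ∃ z, x ∈ z ∧ y ∈ z) _ enum _);
      [utac|apply HV; constructor].
  - refine (T (fun X e => ∀ x, ∃ u, ∀[y ∈ x] ∀[z ∈ y] z ∈ u) _ enum _);
      [utac|apply HV; constructor].
  - refine (T (fun X e => ∀ x, ∃ p, ∀ y, sub y x ⇒ y ∈ p) _ enum _);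
      [utac|apply HV; constructor].
  - refine (T (fun X e => ∃ w, (∃[e ∈ w] empty e) ∧
                    ∀[x ∈ w] ∃[y ∈ w] ∀ z, z ∈ y ⇔ (z ∈ x ∨ z ≐ x)) _ enum _);
      [utac|apply HV; constructor].
  - refine (T (fun X e => ∀ F, (∀[x ∈ F] ∃ y, y ∈ x) ∧
                    (∀[x ∈ F] ∀[y ∈ F] ((∃[z ∈ x] z ∈ y) ⇒ x ≐ y)) ⇒
                    ∃ c, ∀[x ∈ F] ∃ y, (y ∈ x ∧ y ∈ c) ∧
                                       ∀ y', y' ∈ x ∧ y' ∈ c ⇒ y' ≐ y) _ enum _);
      [utac|apply HV; constructor].
  - refine (T (fun X e => ∀ a, ∃ b, ∀ x, x ∈ b ⇔ (x ∈ a ∧ inst f (scons x e))) _ e _);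
      [|apply HV; constructor].
    assert (Hi : uniform (fun X e => inst f e)).
    { exists (emb f). intros. apply inst_emb. }
    utac; (eapply U_ext; [|apply (U_ren (up (fun n => S (S n))) _ Hi)]);
      intros; cbn; f_equal; extensionality n; destruct n; reflexivity.
  - refine (T (fun X e => ∀ a, (∀[x ∈ a] ∃ y, inst f (scons x (scons y e)) ∧
                       ∀ y', inst f (scons x (scons y' e)) ⇒ y' ≐ y) ⇒
                    ∃ b, ∀[x ∈ a] ∃[y ∈ b] inst f (scons x (scons y e))) _ e _);
      [|apply HV; constructor].
    assert (Hi : uniform (fun X e => inst f e)).
    { exists (emb f). intros. apply inst_emb. }
    utac.
    (* Here y is variable 0, x is 1 and a is 2, whereas [f] reads x first, then y, and never a; the
       renaming swaps the first two and skips the third. *)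
    + eapply U_ext; [|apply (U_ren (fun n => match n with 0 => 1 | 1 => 0 | S (S m) => S (S (S m)) end) _ Hi)].
      intros. cbn. f_equal. extensionality n. destruct n as [|[|n]]; reflexivity.
    + eapply U_ext; [|apply (U_ren (fun n => match n with 0 => 2 | 1 => 0 | S (S m) => S (S (S (S m))) end) _ Hi)].
      intros. cbn. f_equal. extensionality n. destruct n as [|[|n]]; reflexivity.
    + eapply U_ext; [|apply (U_ren (fun n => match n with 0 => 1 | 1 => 0 | S (S m) => S (S (S (S m))) end) _ Hi)].
      intros. cbn. f_equal. extensionality n. destruct n as [|[|n]]; reflexivity.
Qed.

Notation "x ∊ y" := (mem x y) (at level 70, no associativity).

(** * Definability with parameters *)

Fixpoint renf (r : nat -> nat) (f : fml) : fml :=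
  match f with
  | fMem i j => fMem (r i) (r j)
  | fEq i j => fEq (r i) (r j)
  | fBot => fBot
  | fImp g h => fImp (renf r g) (renf r h)
  | fAll g => fAll (renf (up r) g)
  end.

Lemma inst_ren {X : Type} (f : fml) : forall (r : nat -> nat) (e : nat -> X),
  inst (renf r f) e = inst f (fun n => e (r n)).
Proof.
  induction f; intros r e; cbn; f_equal; auto;
    extensionality x; rewrite IHf, scons_up; reflexivity.
Qed.

Section Definability.
Context {M : struct}.
Implicit Types (e : nat -> M) (k : nat) (P Q : (nat -> M) -> Prop).

(* The model is countable, so every parameter is the value of a variable beyond k. *)
Definition app k e (n : nat) : M := if n <? k then e n else enum (n - k).

(** Definability is a property of Rocq predicates, so that separation and replacement can be applied
    to ordinary Rocq propositions about the model. *)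
Definition D k P : Prop := exists f : fml, forall e, sat mem (inst f (app k e)) <-> P e.

Lemma app_lt k e n : n < k -> app k e n = e n.
Proof. intros H. unfold app. apply Nat.ltb_lt in H. rewrite H. reflexivity. Qed.
Lemma app_ge k e n : app k e (k + n) = enum n.
Proof.
  unfold app. replace (k + n <? k) with false by (symmetry; apply Nat.ltb_ge; lia).
  f_equal. lia.
Qed.
Lemma app_S k e x : app (S k) (scons x e) = scons x (app k e).
Proof. extensionality n. destruct n; reflexivity. Qed.

Lemma D_ext k P Q : (forall e, P e <-> Q e) -> D k P -> D k Q.
Proof. intros H [f Hf]. exists f. intros e. rewrite Hf. apply H. Qed.
Lemma D_bot k : D k (fun _ => False).
Proof. exists fBot. intros; reflexivity. Qed.
Lemma D_imp k P Q : D k P -> D k Q -> D k (fun e => P e -> Q e).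
Proof. intros [f Hf] [g Hg]. exists (fImp f g). intros e. cbn. rewrite Hf, Hg. reflexivity. Qed.
Lemma D_all k (P : M -> (nat -> M) -> Prop) :
  D (S k) (fun e => P (e 0) (fun n => e (S n))) -> D k (fun e => forall x, P x e).
Proof.
  intros [f Hf]. exists (fAll f). intros e. cbn.
  split; intros H x; specialize (H x).
  - rewrite <- app_S, Hf in H. exact H.
  - rewrite <- app_S, Hf. exact H.
Qed.
(** Classically A is equivalent to truth or to falsity. Hence subformulas that do not mention the
    variables count as definable, even when they speak of filters or of other structures. *)
Lemma D_const k (A : Prop) : D k (fun _ => A).
Proof.
  destruct (classic A).
  - exists (fImp fBot fBot). cbn. tauto.
  - exists fBot. cbn. tauto.
Qed.
Lemma D_not k P : D k P -> D k (fun e => ~ P e).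
Proof. intros H. apply (D_imp k P (fun _ => False)); auto. apply D_bot. Qed.
Lemma D_and k P Q : D k P -> D k Q -> D k (fun e => P e /\ Q e).
Proof.
  intros HP HQ. apply (D_ext k (fun e => ~ (P e -> ~ Q e))); [|apply D_not, D_imp; [|apply D_not]; auto].
  intros e; cbn. split; [intros; split; apply NNPP; tauto|tauto].
Qed.
Lemma D_or k P Q : D k P -> D k Q -> D k (fun e => P e \/ Q e).
Proof.
  intros HP HQ. eapply D_ext; [|apply (D_imp k (fun e => ~ P e) _ (D_not _ _ HP) HQ)].
  intros e; cbn. split; [intros; destruct (classic (P e)); tauto|tauto].
Qed.
Lemma D_iff k P Q : D k P -> D k Q -> D k (fun e => P e <-> Q e).
Proof. intros. apply D_and; apply D_imp; auto. Qed.
Lemma D_ex k (P : M -> (nat -> M) -> Prop) :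
  D (S k) (fun e => P (e 0) (fun n => e (S n))) -> D k (fun e => exists x, P x e).
Proof.
  intros H. eapply D_ext; [|apply D_not, (D_all k (fun x e => ~ P x e)), D_not, H].
  intros e. cbn. split; [intros; apply NNPP; intros Hn; apply H0; intros x Hx; apply Hn; eauto
    |intros [x Hx] Hn; eapply Hn; eauto].
Qed.

Lemma D_ren n k P (r : nat -> nat) :
  D n P -> (forall i, i < n -> r i < k) -> D k (fun e => P (fun i => e (r i))).
Proof.
  intros [f Hf] Hr.
  exists (renf (fun i => if i <? n then r i else k + (i - n)) f). intros e.
  rewrite inst_ren, <- Hf.
  replace (fun i => app k e (if i <? n then r i else k + (i - n)))
    with (app n (fun i => e (r i))); [reflexivity|].
  extensionality i. unfold app at 1. destruct (i <? n) eqn:Hi.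
  - apply Nat.ltb_lt in Hi. rewrite app_lt; auto.
  - rewrite app_ge. reflexivity.
Qed.

(** The fixed values are turned into parameters. This yields separation instances whose predicate
    depends on a surrounding environment. *)
Lemma D_closed n k P e0 :
  D (n + k) P -> D n (fun e => P (fun i => if i <? n then e i else e0 (i - n))).
Proof.
  intros [f Hf].
  set (idx := fun c : M => epsilon (inhabits 0) (fun m => enum m = c)).
  assert (Hidx : forall c, enum (idx c) = c).
  { intros c. apply (epsilon_spec (inhabits 0) (fun m => enum m = c)). apply enum_surj. }
  exists (renf (fun i => if i <? n then i else if i <? n + k then n + idx (e0 (i - n))
                       else n + (i - (n + k))) f).
  intros e. rewrite inst_ren, <- Hf.
  match goal with |- sat _ (inst f ?a) <-> sat _ (inst f ?b) =>
    replace a with b; [reflexivity|] end.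
  extensionality i. unfold app at 1.
  destruct (Nat.ltb_spec i n), (Nat.ltb_spec i (n + k)); try lia.
  - rewrite app_lt; auto.
  - rewrite app_ge. auto.
  - rewrite app_ge. reflexivity.
Qed.

Definition Tm k (t : (nat -> M) -> M) : Prop :=
  D (S k) (fun e => e 0 = t (fun n => e (S n))).

Lemma Tm_var k i : i < k -> Tm k (fun e => e i).
Proof.
  intros H. exists (fEq 0 (S i)). intros e. cbn. rewrite !app_lt by lia. reflexivity.
Qed.
Lemma Tm_const k c : Tm k (fun _ => c).
Proof.
  destruct (enum_surj M c) as [m Hm]. exists (fEq 0 (S k + m)). intros e. cbn [inst sat].
  rewrite app_ge, Hm, app_lt by lia. reflexivity.
Qed.
Lemma Tm_shift k t : Tm k t -> Tm (S k) (fun e => t (fun n => e (S n))).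
Proof.
  intros H. apply (D_ren (S k) (S (S k)) _ (up S) H). intros [|i] Hi; cbn; lia.
Qed.
Lemma D_let k t (P : M -> (nat -> M) -> Prop) :
  Tm k t -> D (S k) (fun e => P (e 0) (fun n => e (S n))) -> D k (fun e => P (t e) e).
Proof.
  intros Ht HP. eapply D_ext; [|apply (D_ex k (fun x e => x = t e /\ P x e)), D_and; eauto].
  intros e. cbn. split; [intros [x [-> H]]; auto|eauto].
Qed.

Definition Def1 (P : M -> Prop) := D 1 (fun e => P (e 0)).
Definition Def2 (P : M -> M -> Prop) := D 2 (fun e => P (e 0) (e 1)).
Definition Def3 (P : M -> M -> M -> Prop) := D 3 (fun e => P (e 0) (e 1) (e 2)).
Definition Def4 (P : M -> M -> M -> M -> Prop) := D 4 (fun e => P (e 0) (e 1) (e 2) (e 3)).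
Definition Def5 (P : M -> M -> M -> M -> M -> Prop) :=
  D 5 (fun e => P (e 0) (e 1) (e 2) (e 3) (e 4)).
Definition Fun1 (F : M -> M) := Def2 (fun y x => y = F x).
Definition Fun2 (F : M -> M -> M) := Def3 (fun y x1 x2 => y = F x1 x2).
Definition Fun3 (F : M -> M -> M -> M) := Def4 (fun y x1 x2 x3 => y = F x1 x2 x3).

Lemma D_app1 (P : M -> Prop) k a : Def1 P -> Tm k a -> D k (fun e => P (a e)).
Proof.
  intros HP Ha. apply (D_let k a (fun x e => P x)); auto.
  apply (D_ren 1 (S k) _ (fun _ => 0) HP). intros; lia.
Qed.
Lemma D_app2 (P : M -> M -> Prop) k a b :
  Def2 P -> Tm k a -> Tm k b -> D k (fun e => P (a e) (b e)).
Proof.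
  intros HP Ha Hb. apply (D_let k a (fun x e => P x (b e))); auto.
  apply (D_let (S k) (fun e => b (fun n => e (S n))) (fun y e => P (e 0) y)).
  - apply Tm_shift; auto.
  - apply (D_ren 2 (S (S k)) _ (fun i => match i with 0 => 1 | _ => 0 end) HP).
    intros [|i]; lia.
Qed.
Lemma D_app3 (P : M -> M -> M -> Prop) k a b c :
  Def3 P -> Tm k a -> Tm k b -> Tm k c -> D k (fun e => P (a e) (b e) (c e)).
Proof.
  intros HP Ha Hb Hc. apply (D_let k a (fun x e => P x (b e) (c e))); auto.
  apply (D_let (S k) (fun e => b (fun n => e (S n)))
           (fun y e => P (e 0) y (c (fun n => e (S n))))).
  - apply Tm_shift; auto.
  - apply (D_let (S (S k)) (fun e => c (fun n => e (S (S n)))) (fun z e => P (e 1) (e 0) z)).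
    + apply (Tm_shift (S k) (fun e => c (fun n => e (S n)))), Tm_shift; auto.
    + apply (D_ren 3 (S (S (S k))) _ (fun i => match i with 0 => 2 | 1 => 1 | _ => 0 end) HP).
      intros [|[|i]]; lia.
Qed.
Lemma D_app4 (P : M -> M -> M -> M -> Prop) k a b c d :
  Def4 P -> Tm k a -> Tm k b -> Tm k c -> Tm k d ->
  D k (fun e => P (a e) (b e) (c e) (d e)).
Proof.
  intros HP Ha Hb Hc Hd. apply (D_let k a (fun x e => P x (b e) (c e) (d e))); auto.
  apply (D_let (S k) (fun e => b (fun n => e (S n)))
           (fun y e => P (e 0) y (c (fun n => e (S n))) (d (fun n => e (S n))))).
  - apply Tm_shift; auto.
  - apply (D_let (S (S k)) (fun e => c (fun n => e (S (S n))))
             (fun z e => P (e 1) (e 0) z (d (fun n => e (S (S n)))))).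
    + apply (Tm_shift (S k) (fun e => c (fun n => e (S n)))), Tm_shift; auto.
    + apply (D_let (S (S (S k))) (fun e => d (fun n => e (S (S (S n)))))
               (fun z e => P (e 2) (e 1) (e 0) z)).
      * apply (Tm_shift (S (S k)) (fun e => d (fun n => e (S (S n))))).
        apply (Tm_shift (S k) (fun e => d (fun n => e (S n)))), Tm_shift; auto.
      * apply (D_ren 4 (S (S (S (S k)))) _
                 (fun i => match i with 0 => 3 | 1 => 2 | 2 => 1 | _ => 0 end) HP).
        intros [|[|[|i]]]; lia.
Qed.
Lemma D_app5 (P : M -> M -> M -> M -> M -> Prop) k a b c d f :
  Def5 P -> Tm k a -> Tm k b -> Tm k c -> Tm k d -> Tm k f ->
  D k (fun e => P (a e) (b e) (c e) (d e) (f e)).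
Proof.
  intros HP Ha Hb Hc Hd Hf.
  apply (D_let k a (fun x e => P x (b e) (c e) (d e) (f e))); auto.
  apply (D_let (S k) (fun e => b (fun n => e (S n)))
    (fun y e => P (e 0) y (c (fun n => e (S n))) (d (fun n => e (S n))) (f (fun n => e (S n))))).
  - apply Tm_shift; auto.
  - apply (D_let (S (S k)) (fun e => c (fun n => e (S (S n))))
       (fun z e => P (e 1) (e 0) z (d (fun n => e (S (S n)))) (f (fun n => e (S (S n)))))).
    + apply (Tm_shift (S k) (fun e => c (fun n => e (S n)))), Tm_shift; auto.
    + apply (D_let (S (S (S k))) (fun e => d (fun n => e (S (S (S n)))))
               (fun z e => P (e 2) (e 1) (e 0) z (f (fun n => e (S (S (S n))))))).
      * apply (Tm_shift (S (S k)) (fun e => d (fun n => e (S (S n))))).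
        apply (Tm_shift (S k) (fun e => d (fun n => e (S n)))), Tm_shift; auto.
      * apply (D_let (S (S (S (S k)))) (fun e => f (fun n => e (S (S (S (S n))))))
                 (fun z e => P (e 3) (e 2) (e 1) (e 0) z)).
        -- apply (Tm_shift (S (S (S k))) (fun e => f (fun n => e (S (S (S n)))))).
           apply (Tm_shift (S (S k)) (fun e => f (fun n => e (S (S n))))).
           apply (Tm_shift (S k) (fun e => f (fun n => e (S n)))), Tm_shift; auto.
        -- apply (D_ren 5 (S (S (S (S (S k))))) _
             (fun i => match i with 0 => 4 | 1 => 3 | 2 => 2 | 3 => 1 | _ => 0 end) HP).
           intros [|[|[|[|i]]]]; lia.
Qed.

Lemma Tm_app1 (F : M -> M) k a : Fun1 F -> Tm k a -> Tm k (fun e => F (a e)).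
Proof.
  intros HF Ha. apply (D_app2 (fun y x => y = F x) (S k) (fun e => e 0) (fun e => a (fun n => e (S n))) HF).
  - apply Tm_var; lia.
  - apply Tm_shift; auto.
Qed.
Lemma Tm_app2 (F : M -> M -> M) k a b :
  Fun2 F -> Tm k a -> Tm k b -> Tm k (fun e => F (a e) (b e)).
Proof.
  intros HF Ha Hb. apply (D_app3 (fun y x1 x2 => y = F x1 x2) (S k) (fun e => e 0) (fun e => a (fun n => e (S n)))
    (fun e => b (fun n => e (S n))) HF).
  - apply Tm_var; lia.
  - apply Tm_shift; auto.
  - apply Tm_shift; auto.
Qed.
Lemma Tm_app3 (F : M -> M -> M -> M) k a b c :
  Fun3 F -> Tm k a -> Tm k b -> Tm k c -> Tm k (fun e => F (a e) (b e) (c e)).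
Proof.
  intros HF Ha Hb Hc. apply (D_app4 (fun y x1 x2 x3 => y = F x1 x2 x3) (S k) (fun e => e 0) (fun e => a (fun n => e (S n)))
    (fun e => b (fun n => e (S n))) (fun e => c (fun n => e (S n))) HF).
  - apply Tm_var; lia.
  - apply Tm_shift; auto.
  - apply Tm_shift; auto.
  - apply Tm_shift; auto.
Qed.

Lemma Def_mem : Def2 (@mem M).
Proof. exists (fMem 0 1). intros. reflexivity. Qed.
Lemma Def_eq : Def2 (@eq M).
Proof. exists (fEq 0 1). intros. reflexivity. Qed.

Lemma D_closed1 k (P : (nat -> M) -> M -> Prop) e :
  D (S k) (fun e => P (fun n => e (S n)) (e 0)) -> Def1 (P e).
Proof.
  intros H. apply (D_closed 1 k _ e) in H. eapply D_ext; [|exact H].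
  intros e'. cbn. replace (fun n => e (n - 0)) with e; [reflexivity|].
  extensionality n. rewrite Nat.sub_0_r. reflexivity.
Qed.
Lemma D_closed2 k (P : (nat -> M) -> M -> M -> Prop) e :
  D (S (S k)) (fun e => P (fun n => e (S (S n))) (e 0) (e 1)) -> Def2 (P e).
Proof.
  intros H. apply (D_closed 2 k _ e) in H. eapply D_ext; [|exact H].
  intros e'. cbn. replace (fun n => e (n - 0)) with e; [reflexivity|].
  extensionality n. rewrite Nat.sub_0_r. reflexivity.
Qed.
End Definability.

Create HintDb dfn.
#[export] Hint Resolve Def_mem Def_eq : dfn.

Ltac dlt := first [apply Nat.ltb_lt; reflexivity | lia].
Ltac dhint := solve [auto 3 with dfn nocore].
Ltac dfn_extra := fail.
Ltac dfn_step :=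
  match goal with
  | |- D _ (fun _ => ?A) => apply D_const
  | |- Tm _ (fun _ => ?c) => apply Tm_const
  | |- Tm _ (fun e => e ?i) => apply Tm_var; dlt
  | |- D _ (fun e => ~ _) => simple apply D_not
  | |- D _ (fun e => _ /\ _) => simple apply D_and
  | |- D _ (fun e => _ \/ _) => simple apply D_or
  | |- D _ (fun e => _ <-> _) => simple apply D_iff
  | |- D _ (fun e => exists x, _) => simple apply D_ex
  | |- D _ (fun e => forall x : car _, _) => simple apply D_all
  | |- D _ (fun e => _ -> _) => simple apply D_imp
  | |- _ => dfn_extra
  | |- D _ (fun e => ?P (@?a e) (@?b e) (@?c e) (@?d e) (@?f e)) =>
      simple apply (D_app5 P _ a b c d f); [dhint|..]
  | |- D _ (fun e => ?P (@?a e) (@?b e) (@?c e) (@?d e)) =>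
      simple apply (D_app4 P _ a b c d); [dhint|..]
  | |- D _ (fun e => ?P (@?a e) (@?b e) (@?c e)) =>
      simple apply (D_app3 P _ a b c); [dhint|..]
  | |- D _ (fun e => ?P (@?a e) (@?b e)) => simple apply (D_app2 P _ a b); [dhint|..]
  | |- D _ (fun e => ?P (@?a e)) => simple apply (D_app1 P _ a); [dhint|..]
  | |- Tm _ (fun e => ?F (@?a e) (@?b e) (@?c e)) =>
      simple apply (Tm_app3 F _ a b c); [dhint|..]
  | |- Tm _ (fun e => ?F (@?a e) (@?b e)) => simple apply (Tm_app2 F _ a b); [dhint|..]
  | |- Tm _ (fun e => ?F (@?a e)) => simple apply (Tm_app1 F _ a); [dhint|..]
  end.
Ltac dfn := unfold Fun1, Fun2, Fun3, Def1, Def2, Def3, Def4, Def5; cbv beta;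
  repeat (dfn_step; cbv beta).

Class ZFC (M : struct) : Prop := zfc : models_ZFC (@mem M).

(** * Sets *)

Section Sets.
Context {M : struct}.
Definition the (P : M -> Prop) : M := epsilon (inhabits (enum 0)) P.
Lemma the_spec (P : M -> Prop) : (exists x, P x) -> P (the P).
Proof. apply epsilon_spec. Qed.

Definition isset (Q : M -> Prop) : Prop := exists b, forall x, x ∊ b <-> Q x.
(** The value is arbitrary if Q is a proper class, so the lemmas about it ask for [isset]. *)
Definition setof (Q : M -> Prop) : M := the (fun b => forall x, x ∊ b <-> Q x).
Lemma setofE Q x : isset Q -> (x ∊ setof Q <-> Q x).
Proof. intros H. revert x. exact (the_spec _ H). Qed.

Context {Z : ZFC M}.
Implicit Types x y z a b c f g r : M.

Lemma ext x y : (forall z, z ∊ x <-> z ∊ y) -> x = y.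
Proof. intros H. exact (zfc _ ax_extensionality x y H). Qed.

Lemma setof_eq Q y : isset Q -> (y = setof Q <-> forall x, x ∊ y <-> Q x).
Proof.
  intros H. split.
  - intros -> x. apply setofE; auto.
  - intros Hy. apply ext. intros z. rewrite Hy, setofE; auto. reflexivity.
Qed.

Lemma Tm_setof k (Q : (nat -> M) -> M -> Prop) :
  (forall e, isset (Q e)) -> D (S k) (fun e => Q (fun n => e (S n)) (e 0)) ->
  Tm k (fun e => setof (Q e)).
Proof.
  intros H HQ. unfold Tm.
  apply (D_ext _ (fun e => forall x, x ∊ e 0 <-> Q (fun n => e (S n)) x)).
  - intros e. symmetry. apply setof_eq; auto.
  - apply D_all, D_iff; [apply (D_app2 mem _ (fun e => e 0) (fun e => e 1)); [apply Def_mem|..];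
      apply Tm_var; lia|].
    apply (D_ren (S k) (S (S k)) _ (up S) HQ). intros [|i] Hi; cbn; lia.
Qed.

Lemma Fun1_setof (Q : M -> M -> Prop) :
  (forall a, isset (Q a)) -> Def2 (fun z a => Q a z) -> Fun1 (fun a => setof (Q a)).
Proof. intros H HQ. apply (Tm_setof 1 (fun e => Q (e 0))); auto. Qed.
Lemma Fun2_setof (Q : M -> M -> M -> Prop) :
  (forall a b, isset (Q a b)) -> Def3 (fun z a b => Q a b z) -> Fun2 (fun a b => setof (Q a b)).
Proof. intros H HQ. apply (Tm_setof 2 (fun e => Q (e 0) (e 1))); auto. Qed.

Lemma sep_isset a (P : M -> Prop) : Def1 P -> isset (fun x => x ∊ a /\ P x).
Proof.
  intros [f Hf]. destruct (zfc _ (ax_separation f enum) a) as [b Hb]. exists b. intros x.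
  pose proof (Hb x) as H; cbn in H.
  assert (E : scons x enum = app 1 (fun _ : nat => x)).
  { extensionality n. destruct n; cbn; auto. unfold app. cbn. f_equal. lia. }
  rewrite E, Hf in H. split; apply H.
Qed.
Definition sep a (P : M -> Prop) : M := setof (fun x => x ∊ a /\ P x).
Lemma sepE a P x : Def1 P -> (x ∊ sep a P <-> x ∊ a /\ P x).
Proof. intros. apply setofE, sep_isset; auto. Qed.
Lemma Tm_sep k (a : (nat -> M) -> M) (P : (nat -> M) -> M -> Prop) :
  Tm k a -> D (S k) (fun e => P (fun n => e (S n)) (e 0)) -> Tm k (fun e => sep (a e) (P e)).
Proof.
  intros Ha HP. apply Tm_setof.
  - intros e. apply sep_isset. eapply D_closed1; eauto.
  - apply D_and; auto. apply (D_app2 mem _ (fun e => e 0) (fun e => a (fun n => e (S n)))).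
    + apply Def_mem.
    + apply Tm_var; lia.
    + apply Tm_shift; auto.
Qed.

Lemma isset_sub a (Q : M -> Prop) : Def1 Q -> (forall x, Q x -> x ∊ a) -> isset Q.
Proof.
  intros HQ H. destruct (sep_isset a Q HQ) as [b Hb]. exists b. intros x. rewrite Hb.
  split; [tauto|auto].
Qed.

Lemma empty_isset : isset (fun _ => False).
Proof. apply (isset_sub (enum 0)); [dfn|tauto]. Qed.
Definition emp : M := setof (fun _ => False).
Lemma empE x : ~ x ∊ emp.
Proof. unfold emp. rewrite setofE; [tauto|apply empty_isset]. Qed.

Lemma upair_isset a b : isset (fun x => x = a \/ x = b).
Proof.
  destruct (zfc _ ax_pairing a b) as [z [Ha Hb]]. apply (isset_sub z); [dfn|].
  intros x [-> | ->]; auto.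
Qed.
Definition upair a b : M := setof (fun x => x = a \/ x = b).
Lemma upairE a b x : x ∊ upair a b <-> x = a \/ x = b.
Proof. apply setofE, upair_isset. Qed.
Lemma Fun_upair : Fun2 upair.
Proof. unfold upair. apply Fun2_setof; [exact upair_isset|dfn]. Qed.

Lemma union_isset a : isset (fun x => exists y, y ∊ a /\ x ∊ y).
Proof.
  destruct (zfc _ ax_union a) as [u Hu]. apply (isset_sub u); [dfn|].
  intros x [y [Hy Hx]]. exact (Hu y Hy x Hx).
Qed.
Definition union a : M := setof (fun x => exists y, y ∊ a /\ x ∊ y).
Lemma unionE a x : x ∊ union a <-> exists y, y ∊ a /\ x ∊ y.
Proof. apply setofE, union_isset. Qed.
Lemma Fun_union : Fun1 union.
Proof. unfold union. apply Fun1_setof; [exact union_isset|dfn]. Qed.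

Definition subs a b : Prop := forall x, x ∊ a -> x ∊ b.
Lemma Def_subs : Def2 subs.
Proof. unfold subs. dfn. Qed.
Lemma pow_isset a : isset (fun x => subs x a).
Proof.
  destruct (zfc _ ax_powerset a) as [p Hp]. apply (isset_sub p); [unfold subs; dfn|].
  intros x Hx. exact (Hp x Hx).
Qed.
Definition pow a : M := setof (fun x => subs x a).
Lemma powE a x : x ∊ pow a <-> subs x a.
Proof. unfold pow. rewrite setofE; [reflexivity|apply pow_isset]. Qed.
Lemma Fun_pow : Fun1 pow.
Proof. unfold pow. apply Fun1_setof; [exact pow_isset|unfold subs; dfn]. Qed.

Hint Resolve Fun_upair Fun_union Fun_pow Def_subs : dfn.

Definition sing a : M := upair a a.
Lemma singE a x : x ∊ sing a <-> x = a.
Proof. unfold sing. rewrite upairE. tauto. Qed.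
Lemma Fun_sing : Fun1 sing.
Proof. unfold sing. dfn. Qed.

Definition cup a b : M := union (upair a b).
Lemma cupE a b x : x ∊ cup a b <-> x ∊ a \/ x ∊ b.
Proof.
  unfold cup. rewrite unionE. split.
  - intros [y [Hy Hx]]. apply upairE in Hy. destruct Hy; subst; auto.
  - intros [H|H]; [exists a|exists b]; rewrite upairE; auto.
Qed.
Lemma Fun_cup : Fun2 cup.
Proof. unfold cup. dfn. Qed.

Definition op a b : M := upair (sing a) (upair a b).
Lemma Fun_op : Fun2 op.
Proof. unfold op, sing. dfn. Qed.
Hint Resolve Fun_sing Fun_cup Fun_op : dfn.

Lemma upair_inj a b c d : upair a b = upair c d -> (a = c /\ b = d) \/ (a = d /\ b = c).
Proof.
  intros H.
  assert (H1 : forall x, x = a \/ x = b <-> x = c \/ x = d).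
  { intros x. rewrite <- !upairE, H. reflexivity. }
  destruct (proj1 (H1 a)) as [?|?]; auto; subst.
  - destruct (proj1 (H1 b)) as [?|?]; auto; subst.
    destruct (proj2 (H1 d)) as [?|?]; auto; subst; auto.
  - destruct (proj1 (H1 b)) as [?|?]; auto; subst.
    destruct (proj2 (H1 c)) as [?|?]; auto; subst; auto.
Qed.
Lemma op_inj a b c d : op a b = op c d -> a = c /\ b = d.
Proof.
  unfold op, sing. intros H. apply upair_inj in H. destruct H as [[H1 H2]|[H1 H2]].
  - apply upair_inj in H1, H2. intuition congruence.
  - apply upair_inj in H1, H2. intuition congruence.
Qed.

Lemma im_isset (F : M -> M) a : Fun1 F -> isset (fun y => exists x, x ∊ a /\ y = F x).
Proof.
  intros HF.
  assert (H2 : Def2 (fun x y => y = F x)) by dfn.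
  destruct H2 as [f Hf].
  assert (E : forall x y, sat mem (inst f (scons x (scons y enum))) <-> y = F x).
  { intros x y. rewrite <- (Hf (scons x (scons y enum))).
    replace (app 2 (scons x (scons y enum))) with (scons x (scons y (@enum M))); [reflexivity|].
    extensionality n. destruct n as [|[|n]]; cbn; auto. unfold app; cbn. f_equal. lia. }
  destruct (zfc _ (ax_replacement f enum) a) as [b Hb].
  { intros x Hx. exists (F x). cbn. split; [apply E; auto|]. intros y. apply E. }
  apply (isset_sub b); [dfn|]. intros y [x [Hx ->]].
  destruct (Hb x Hx) as [y [Hy Hy']]. cbn in Hy, Hy'. apply E in Hy'. subst. auto.
Qed.
Definition im (F : M -> M) a : M := setof (fun y => exists x, x ∊ a /\ y = F x).
Lemma imE F a y : Fun1 F -> (y ∊ im F a <-> exists x, x ∊ a /\ y = F x).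
Proof. intros. apply setofE, im_isset; auto. Qed.
Lemma Tm_im k (a : (nat -> M) -> M) (F : (nat -> M) -> M -> M) :
  Tm (S k) (fun e => F (fun n => e (S n)) (e 0)) -> Tm k a -> Tm k (fun e => im (F e) (a e)).
Proof.
  intros HF Ha. apply Tm_setof.
  - intros e. apply im_isset. exact (D_closed2 k (fun e y x => y = F e x) e HF).
  - apply D_ex, D_and.
    + apply (D_app2 mem _ (fun e => e 0) (fun e => a (fun n => e (S (S n))))).
      * apply Def_mem.
      * apply Tm_var; lia.
      * apply (Tm_shift (S k) (fun e => a (fun n => e (S n)))), Tm_shift; auto.
    + apply (D_ren (S (S k)) (S (S k)) _
        (fun i => match i with 0 => 1 | 1 => 0 | _ => i end) HF).
      intros [|[|i]]; lia.
Qed.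

Lemma prod_isset a b : isset (fun z => exists x y, x ∊ a /\ y ∊ b /\ z = op x y).
Proof.
  apply (isset_sub (pow (pow (cup a b)))); [dfn|].
  intros z (x & y & Hx & Hy & ->). apply powE. intros u Hu. apply powE.
  unfold op in Hu. apply upairE in Hu. intros v Hv. apply cupE.
  destruct Hu; subst; [apply singE in Hv; subst; auto|].
  apply upairE in Hv. destruct Hv; subst; auto.
Qed.
Definition prod a b : M := setof (fun z => exists x y, x ∊ a /\ y ∊ b /\ z = op x y).
Lemma prodE a b z : z ∊ prod a b <-> exists x y, x ∊ a /\ y ∊ b /\ z = op x y.
Proof. apply setofE, prod_isset. Qed.
Lemma prod_op a b x y : op x y ∊ prod a b <-> x ∊ a /\ y ∊ b.
Proof.
  rewrite prodE. split.
  - intros (x' & y' & Hx & Hy & H). apply op_inj in H. destruct H; subst; auto.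
  - intros [Hx Hy]. eauto 6.
Qed.
Lemma Fun_prod : Fun2 prod.
Proof. unfold prod. apply Fun2_setof; [exact prod_isset|dfn]. Qed.

Lemma op_union x y r : op x y ∊ r -> x ∊ union (union r) /\ y ∊ union (union r).
Proof.
  intros H. split; apply unionE; exists (upair x y);
    rewrite unionE, upairE; (split; [exists (op x y); split; auto; apply upairE; auto|auto]).
Qed.
Lemma dom_isset r : isset (fun x => exists y, op x y ∊ r).
Proof.
  apply (isset_sub (union (union r))); [dfn|]. intros x [y H]. apply (op_union x y), H.
Qed.
Definition dom r : M := setof (fun x => exists y, op x y ∊ r).
Lemma domE r x : x ∊ dom r <-> exists y, op x y ∊ r.
Proof. apply setofE, dom_isset. Qed.
Lemma Fun_dom : Fun1 dom.
Proof. unfold dom. apply Fun1_setof; [exact dom_isset|dfn]. Qed.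
Lemma ran_isset r : isset (fun y => exists x, op x y ∊ r).
Proof.
  apply (isset_sub (union (union r))); [dfn|]. intros x [y H]. apply (op_union y x), H.
Qed.
Definition ran r : M := setof (fun y => exists x, op x y ∊ r).
Lemma ranE r y : y ∊ ran r <-> exists x, op x y ∊ r.
Proof. apply setofE, ran_isset. Qed.

Lemma ap_isset f x : isset (fun z => exists y, op x y ∊ f /\ z ∊ y).
Proof.
  apply (isset_sub (union (ran f))); [dfn|]. intros z (y & Hy & Hz). apply unionE.
  exists y. rewrite ranE. eauto.
Qed.
(** The union of all values at x: a total definable operation, equal to the value of f at x when
    that is unique. *)
Definition ap f x : M := setof (fun z => exists y, op x y ∊ f /\ z ∊ y).
Lemma Fun_ap : Fun2 ap.
Proof. unfold ap. apply Fun2_setof; [exact ap_isset|dfn]. Qed.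
Hint Resolve Fun_prod Fun_dom Fun_ap : dfn.

Definition isfn f a : Prop :=
  (forall z, z ∊ f -> exists x y, x ∊ a /\ z = op x y) /\
  (forall x, x ∊ a -> exists y, op x y ∊ f /\ forall y', op x y' ∊ f -> y' = y).
Lemma Def_isfn : Def2 isfn.
Proof. unfold isfn. dfn. Qed.
Lemma ap_unique f x y : op x y ∊ f -> (forall y', op x y' ∊ f -> y' = y) -> ap f x = y.
Proof.
  intros H Hu. apply ext. intros z. unfold ap. rewrite setofE by apply ap_isset. split.
  - intros (y' & H' & Hz). rewrite <- (Hu _ H'). auto.
  - eauto.
Qed.
Lemma fn_dom f a x y : isfn f a -> op x y ∊ f -> x ∊ a.
Proof.
  intros [H _] Hf. destruct (H _ Hf) as (x' & y' & Hx & E). apply op_inj in E.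
  destruct E; subst; auto.
Qed.
Lemma ap_eq f a x y : isfn f a -> op x y ∊ f -> ap f x = y.
Proof.
  intros H Hf. pose proof (fn_dom _ _ _ _ H Hf) as Hx. destruct H as [_ H].
  destruct (H x Hx) as (y' & Hy' & Hu). apply ap_unique; auto.
  intros y'' Hy''. rewrite (Hu _ Hy''), (Hu _ Hf). auto.
Qed.
Lemma fn_ap f a x : isfn f a -> x ∊ a -> op x (ap f x) ∊ f.
Proof.
  intros H Hx. pose proof H as [_ H']. destruct (H' x Hx) as (y & Hy & _).
  rewrite (ap_eq f a x y H Hy). auto.
Qed.
Lemma fn_ext f g a : isfn f a -> isfn g a -> (forall x, x ∊ a -> ap f x = ap g x) -> f = g.
Proof.
  assert (W : forall f g, isfn f a -> isfn g a -> (forall x, x ∊ a -> ap f x = ap g x) ->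
    forall z, z ∊ f -> z ∊ g).
  { intros f' g' Hf Hg H z Hz. destruct (proj1 Hf z Hz) as (x & y & Hx & ->).
    rewrite <- (ap_eq f' a x y Hf Hz), H by auto. apply (fn_ap g' a); auto. }
  intros Hf Hg H. apply ext. intros z. split; apply W; auto. intros; symmetry; auto.
Qed.

Definition lam a (F : M -> M) : M := im (fun x => op x (F x)) a.
Lemma lam_op a F x y : Fun1 F -> (op x y ∊ lam a F <-> x ∊ a /\ y = F x).
Proof.
  intros HF. unfold lam. rewrite imE by dfn. split.
  - intros (x' & Hx & E). apply op_inj in E. destruct E; subst; auto.
  - intros [Hx ->]. eauto.
Qed.
Lemma lam_fn a F : Fun1 F -> isfn (lam a F) a.
Proof.
  intros HF. split.
  - intros z Hz. unfold lam in Hz. apply imE in Hz; [|dfn].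
    destruct Hz as (x & Hx & ->). eauto.
  - intros x Hx. exists (F x). rewrite lam_op by auto. split; auto.
    intros y'. rewrite lam_op by auto. tauto.
Qed.
Lemma ap_lam a F x : Fun1 F -> x ∊ a -> ap (lam a F) x = F x.
Proof. intros HF Hx. apply (ap_eq _ a); [apply lam_fn; auto|apply lam_op; auto]. Qed.
Lemma Tm_lam k (a : (nat -> M) -> M) (F : (nat -> M) -> M -> M) :
  Tm (S k) (fun e => F (fun n => e (S n)) (e 0)) -> Tm k a -> Tm k (fun e => lam (a e) (F e)).
Proof.
  intros HF Ha. apply (Tm_im k a (fun e x => op x (F e x))); auto.
  apply (Tm_app2 op (S k) (fun e => e 0)); auto with dfn. apply Tm_var; lia.
Qed.

Lemma sat_upair z a b : sat mem (is_upair z a b) <-> z = upair a b.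
Proof.
  unfold upair. rewrite setof_eq by apply upair_isset. reflexivity.
Qed.
Lemma sat_opair z a b : sat mem (is_opair z a b) <-> z = op a b.
Proof.
  unfold is_opair. cbn [sat]. split.
  - intros (s & t & Hs & Ht & H). apply sat_upair in Hs, Ht, H. subst. reflexivity.
  - intros ->. exists (sing a), (upair a b). rewrite !sat_upair. auto.
Qed.
Lemma sat_pin a b r : sat mem (pin a b r) <-> op a b ∊ r.
Proof.
  unfold pin. cbn [sat]. split.
  - intros (z & Hz & H). apply sat_opair in Hz. subst; auto.
  - intros H. exists (op a b). rewrite sat_opair. auto.
Qed.
Lemma sat_tin a b c r : sat mem (tin a b c r) <-> op (op a b) c ∊ r.
Proof.
  unfold tin. cbn [sat]. split.
  - intros (z & Hz & H). apply sat_opair in Hz. apply sat_pin in H. subst; auto.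
  - intros H. exists (op a b). rewrite sat_opair, sat_pin. auto.
Qed.
Lemma sat_family f a : sat mem (is_family f a) <-> isfn f a.
Proof.
  unfold is_family, isfn. cbn [sat]. split; intros [H1 H2]; split.
  - intros z Hz. destruct (H1 z Hz) as (x & Hx & y & Hy). apply sat_opair in Hy. eauto.
  - intros x Hx. destruct (H2 x Hx) as (y & Hy & Hu). exists y. apply sat_pin in Hy.
    split; auto. intros y' Hy'. apply Hu, sat_pin; auto.
  - intros z Hz. destruct (H1 z Hz) as (x & y & Hx & Hy). apply sat_opair in Hy. eauto.
  - intros x Hx. destruct (H2 x Hx) as (y & Hy & Hu). exists y. apply sat_pin in Hy.
    split; auto. intros y' Hy'. apply Hu, sat_pin; auto.
Qed.
Lemma sat_fun f a b :
  sat mem (is_fun f a b) <-> isfn f a /\ forall x, x ∊ a -> ap f x ∊ b.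
Proof.
  unfold is_fun. cbn [sat]. rewrite sat_family. split; intros [H1 H2]; split; auto.
  - intros x Hx. apply (H2 x), sat_pin, (fn_ap _ a); auto.
  - intros x y Hy. apply sat_pin in Hy. rewrite <- (ap_eq _ _ _ _ H1 Hy).
    apply H2. eapply fn_dom; eauto.
Qed.

End Sets.
#[export] Hint Resolve Fun_upair Fun_union Fun_pow Def_subs Fun_sing Fun_cup Fun_op
  Fun_prod Fun_dom Fun_ap Def_isfn : dfn.
Ltac dfn_extra ::=
  match goal with
  | |- Tm _ (fun e => sep _ _) => simple apply Tm_sep
  | |- Tm _ (fun e => im _ _) => simple apply Tm_im
  | |- Tm _ (fun e => lam _ _) => simple apply Tm_lam
  end.

(** * Ordinals, recursion, collection and well-orderings *)

Section Ordinals.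
Context {M : struct} {Z : ZFC M}.
Implicit Types x y z a b c f g r : M.

Lemma foundation x : (exists y, y ∊ x) -> exists y, y ∊ x /\ forall z, z ∊ y -> ~ z ∊ x.
Proof.
  intros H. destruct (zfc _ ax_foundation x H) as (y & Hy & Hn). exists y; split; auto.
  intros z Hz Hx. apply Hn. exists z; split; auto.
Qed.
Lemma mem_irrefl x : ~ x ∊ x.
Proof.
  intros H. destruct (foundation (sing x)) as (y & Hy & Hn).
  { exists x. apply singE; auto. }
  apply singE in Hy. subst. apply (Hn x H), singE; auto.
Qed.

Definition trans x : Prop := forall y z, y ∊ x -> z ∊ y -> z ∊ x.
Definition Ord x : Prop := trans x /\ forall y, y ∊ x -> trans y.
Lemma Def_trans : Def1 trans.
Proof. unfold trans. dfn. Qed.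
Hint Resolve Def_trans : dfn.
Lemma Def_Ord : Def1 Ord.
Proof. unfold Ord. dfn. Qed.
Hint Resolve Def_Ord : dfn.
Lemma sat_trans a : sat mem (transitive a) <-> trans a.
Proof. unfold transitive, sub, trans. cbn. split; eauto. Qed.
Lemma sat_ord a : sat mem (is_ord a) <-> Ord a.
Proof. unfold is_ord, transitive, sub, Ord, trans. cbn. firstorder. Qed.

Lemma ord_mem a b : Ord a -> b ∊ a -> Ord b.
Proof. intros [H1 H2] Hb. split; [apply H2; auto|]. intros y Hy. apply H2. eapply H1; eauto. Qed.

Definition succ a : M := cup a (sing a).
Lemma succE a x : x ∊ succ a <-> x ∊ a \/ x = a.
Proof. unfold succ. rewrite cupE, singE. reflexivity. Qed.
Lemma Fun_succ : Fun1 succ.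
Proof. unfold succ. dfn. Qed.
Hint Resolve Fun_succ : dfn.
Lemma ord_succ a : Ord a -> Ord (succ a).
Proof.
  intros [H1 H2]. split.
  - intros y z Hy Hz. rewrite succE in *. destruct Hy; subst; eauto.
  - intros y Hy. apply succE in Hy. destruct Hy; subst; auto.
Qed.

(** The model may be ill-founded from outside, so induction is available only for definable
    predicates, by applying Foundation to a set of counterexamples. *)
Lemma ord_ind (P : M -> Prop) : Def1 P ->
  (forall a, Ord a -> (forall b, b ∊ a -> P b) -> P a) -> forall a, Ord a -> P a.
Proof.
  intros HP H a Ha. apply NNPP. intros Hn.
  assert (HD : Def1 (fun x => ~ P x)) by dfn.
  destruct (foundation (sep (succ a) (fun x => ~ P x))) as (y & Hy & Hmin).
  { exists a. rewrite sepE by auto. rewrite succE. auto. }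
  rewrite sepE in Hy by auto. destruct Hy as [Hy HPy]. apply HPy.
  pose proof (ord_succ a Ha) as Hs. apply H; [eapply ord_mem; eauto|].
  intros b Hb. apply NNPP. intros Hb'. apply (Hmin b Hb). rewrite sepE by auto.
  split; auto. destruct Hs as [Hs _]. eapply Hs; eauto.
Qed.

Lemma ord_tri a b : Ord a -> Ord b -> a ∊ b \/ a = b \/ b ∊ a.
Proof.
  intros Ha. revert b. revert a Ha.
  apply (ord_ind (fun u => forall v, Ord v -> u ∊ v \/ u = v \/ v ∊ u)); [dfn|].
  intros u Hu IHu. apply (ord_ind (fun v => u ∊ v \/ u = v \/ v ∊ u)); [dfn|].
  intros v Hv IHv.
  destruct (classic (u ∊ v)) as [|H1]; auto. destruct (classic (v ∊ u)) as [|H2]; auto.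
  right; left. apply ext. intros w; split; intros Hw.
  - destruct (IHu w Hw v Hv) as [H|[H|H]]; auto; subst; [contradiction|].
    exfalso. apply H2. apply (proj1 Hu w); auto.
  - destruct (IHv w Hw) as [H|[H|H]]; auto; subst; [|contradiction].
    exfalso. apply H1. apply (proj1 Hv w); auto.
Qed.
Lemma ord_sub a b : Ord a -> Ord b -> subs a b -> a = b \/ a ∊ b.
Proof.
  intros Ha Hb Hs. destruct (ord_tri a b Ha Hb) as [H|[H|H]]; auto.
  exfalso. apply (mem_irrefl b). auto.
Qed.
Lemma ord_nmem a b : Ord a -> Ord b -> ~ a ∊ b -> subs b a.
Proof.
  intros Ha Hb H x Hx. destruct (ord_tri a b Ha Hb) as [?|[?|Hba]]; subst; auto; [tauto|].
  apply (proj1 Ha b); auto.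
Qed.
Lemma ord_nsub a b : Ord a -> Ord b -> ~ subs a b -> b ∊ a.
Proof.
  intros Ha Hb H. apply NNPP. intros Hn. apply H. apply ord_nmem; auto.
Qed.
Lemma ord_union a : (forall x, x ∊ a -> Ord x) -> Ord (union a).
Proof.
  intros H. split.
  - intros y z Hy Hz. rewrite unionE in *. destruct Hy as (u & Hu & Hy). exists u; split; auto.
    apply (proj1 (H u Hu) y); auto.
  - intros y Hy. apply unionE in Hy. destruct Hy as (u & Hu & Hy). apply (proj2 (H u Hu)); auto.
Qed.
Lemma ord_emp : Ord emp.
Proof. split; intros y; intros; exfalso; eapply empE; eauto. Qed.
Lemma ord_max a b : Ord a -> Ord b -> exists c, (c = a \/ c = b) /\ subs a c /\ subs b c.
Proof.
  intros Ha Hb. destruct (classic (subs a b)) as [H|H].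
  - exists b. unfold subs in *. auto.
  - exists a. split; auto. split; [unfold subs; auto|].
    apply ord_nsub in H; auto. intros x Hx. apply (proj1 Ha b); auto.
Qed.

(* Junk value: the empty set if no ordinal satisfies P. *)
Definition lord (P : M -> Prop) : M :=
  setof (fun b => (exists a, Ord a /\ P a) /\ forall a, Ord a -> P a -> b ∊ a).
Lemma lord_isset P : Def1 P ->
  isset (fun b => (exists a, Ord a /\ P a) /\ forall a, Ord a -> P a -> b ∊ a).
Proof.
  intros HP. destruct (classic (exists a, Ord a /\ P a)) as [(a & Ha & HPa)|Hn].
  - apply (isset_sub a); [dfn|]. intros b [_ H]. auto.
  - apply (isset_sub emp); [dfn|]. tauto.
Qed.
Lemma lordP P : Def1 P -> (exists a, Ord a /\ P a) ->
  Ord (lord P) /\ P (lord P) /\ forall b, Ord b -> P b -> subs (lord P) b.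
Proof.
  intros HP HE.
  assert (HE' : exists a, Ord a /\ P a /\ forall b, b ∊ a -> ~ P b).
  { apply NNPP. intros Hn. destruct HE as (a & Ha & HPa). revert HPa.
    apply (ord_ind (fun a => ~ P a)); auto; [dfn|]. intros b Hb IH HPb. apply Hn; eauto. }
  destruct HE' as (a & Ha & HPa & Hmin).
  assert (Hs : forall b, Ord b -> P b -> subs a b).
  { intros b Hb HPb. apply ord_nmem; auto. intros H. eapply Hmin; eauto. }
  assert (E : lord P = a).
  { symmetry. apply setof_eq; [apply lord_isset; auto|]. intros x. split.
    - intros Hx. split; auto. intros b Hb HPb. apply (Hs b); auto.
    - intros [_ H]. auto. }
  rewrite E. auto.
Qed.
Lemma lord_min P b : Def1 P -> Ord b -> P b -> ~ b ∊ lord P.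
Proof.
  intros HP Hb HPb H. destruct (lordP P HP) as (_ & _ & Hm); eauto.
  apply (mem_irrefl b). apply (Hm b); auto.
Qed.
Lemma Tm_lord k (P : (nat -> M) -> M -> Prop) :
  D (S k) (fun e => P (fun n => e (S n)) (e 0)) -> Tm k (fun e => lord (P e)).
Proof.
  intros HP. apply Tm_setof.
  - intros e. apply lord_isset. eapply D_closed1; eauto.
  - assert (H2 : D (S (S k)) (fun e => Ord (e 0) /\ P (fun n => e (S (S n))) (e 0))).
    { apply D_and; [apply (D_app1 Ord); [apply Def_Ord|apply Tm_var; lia]|].
      apply (D_ren (S k) (S (S k)) _ (up S) HP). intros [|i] Hi; cbn; lia. }
    apply D_and; [apply D_ex; exact H2|].
    apply D_all. eapply D_ext; [|apply (D_imp _ _ (fun e => e 1 ∊ e 0) H2)].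
    + intros e; cbn. tauto.
    + apply (D_app2 mem _ (fun e => e 1) (fun e => e 0)); [apply Def_mem|apply Tm_var; lia..].
Qed.

Ltac dfn_extra ::=
  match goal with
  | |- Tm _ (fun e => sep _ _) => simple apply Tm_sep
  | |- Tm _ (fun e => im _ _) => simple apply Tm_im
  | |- Tm _ (fun e => lam _ _) => simple apply Tm_lam
  | |- Tm _ (fun e => lord _) => simple apply Tm_lord
  end.

Lemma lam_ext a (F G : M -> M) : Fun1 F -> Fun1 G ->
  (forall x, x ∊ a -> F x = G x) -> lam a F = lam a G.
Proof.
  intros HF HG H. apply (fn_ext _ _ a); [apply lam_fn; auto..|].
  intros x Hx. rewrite !ap_lam; auto.
Qed.

Definition approx (pd : M -> M) (G : M -> M -> M) x f : Prop :=
  isfn f (pd x) /\ forall y, y ∊ pd x -> ap f y = G y (lam (pd y) (ap f)).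
(* The value is empty where the approximation is not unique. *)
Definition recF (pd : M -> M) (G : M -> M -> M) x : M :=
  setof (fun z => exists f, approx pd G x f /\ (forall f', approx pd G x f' -> f' = f) /\
                            z ∊ G x f).
Section Recursion.
Context (C : M -> Prop) (pd : M -> M) (G : M -> M -> M)
  (DC : Def1 C) (Dpd : Fun1 pd) (DG : Fun2 G)
  (pdC : forall x y, C x -> y ∊ pd x -> C y)
  (pdT : forall x y z, C x -> y ∊ pd x -> z ∊ pd y -> z ∊ pd x)
  (ind : forall P, Def1 P -> (forall x, C x -> (forall y, y ∊ pd x -> P y) -> P x) ->
         forall x, C x -> P x).

Lemma Def_approx : Def2 (approx pd G).
Proof. unfold approx. dfn. Qed.
Hint Resolve Def_approx : dfn.
Lemma recF_isset x : isset (fun z => exists f, approx pd G x f /\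
  (forall f', approx pd G x f' -> f' = f) /\ z ∊ G x f).
Proof.
  destruct (classic (exists f, approx pd G x f /\ (forall f', approx pd G x f' -> f' = f)))
    as [(f & Hf & Hu)|Hn].
  - apply (isset_sub (G x f)); [dfn|]. intros z (f' & Hf' & _ & Hz).
    rewrite <- (Hu f' Hf'). auto.
  - apply (isset_sub emp); [dfn|]. intros z (f & H1 & H2 & _). exfalso; eauto.
Qed.
Lemma Fun_recF : Fun1 (recF pd G).
Proof. unfold recF. apply Fun1_setof; [exact recF_isset|dfn]. Qed.
Hint Resolve Fun_recF : dfn.

Lemma approx_unique x f f' : C x -> approx pd G x f -> approx pd G x f' -> f = f'.
Proof.
  intros Hx [Hf1 Hf2] [Hf1' Hf2']. apply (fn_ext _ _ (pd x)); auto.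
  assert (H : forall y, C y -> y ∊ pd x -> ap f y = ap f' y); [|intros; apply H; eauto].
  apply (ind (fun y => y ∊ pd x -> ap f y = ap f' y)); [dfn|].
  intros y Hy IH Hyx. rewrite Hf2, Hf2' by auto. f_equal. apply lam_ext; [dfn|dfn|]. eauto.
Qed.
Lemma recF_approx x f : C x -> approx pd G x f -> recF pd G x = G x f.
Proof.
  intros Hx Hf. symmetry. apply setof_eq; [apply recF_isset|]. intros z. split.
  - intros Hz. exists f. split; [|split]; auto. intros f' Hf'. eapply approx_unique; eauto.
  - intros (f' & Hf' & _ & Hz). rewrite (approx_unique x f f'); auto.
Qed.
(** Approximations on [pd x] are unique by induction, and the restriction of [recF] itself is one.
    Taking [pd] to be the identity gives recursion on ordinals, and [tc] gives recursion on all
    sets. *)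
Theorem recF_eq x : C x -> recF pd G x = G x (lam (pd x) (recF pd G)).
Proof.
  intros Hx. apply recF_approx; auto. revert x Hx.
  apply (ind (fun x => approx pd G x (lam (pd x) (recF pd G)))); [dfn|].
  intros x Hx IH. split; [apply lam_fn; dfn|].
  intros y Hy. rewrite ap_lam by (auto; dfn).
  rewrite (recF_approx y (lam (pd y) (recF pd G))) by eauto. f_equal.
  apply lam_ext; [dfn|dfn|]. intros z Hz. rewrite ap_lam; eauto. dfn.
Qed.
End Recursion.

Definition ordrec (G : M -> M -> M) : M -> M := recF (fun x => x) G.
Lemma Fun_ordrec G : Fun2 G -> Fun1 (ordrec G).
Proof. intros HG. apply Fun_recF; auto. dfn. Qed.
Lemma ordrec_eq G a : Fun2 G -> Ord a -> ordrec G a = G a (lam a (ordrec G)).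
Proof.
  intros HG Ha. apply (recF_eq Ord (fun x => x)); auto with dfn; try solve [dfn].
  - intros; eapply ord_mem; eauto.
  - intros x y z Hx Hy Hz. apply (proj1 Hx y); auto.
  - intros P HP H. apply ord_ind; auto.
Qed.

Lemma inductive_set : exists w, emp ∊ w /\ forall x, x ∊ w -> succ x ∊ w.
Proof.
  destruct (zfc _ ax_infinity) as (w & (e & He & Hemp) & Hs). exists w. split.
  - replace emp with e; auto. apply ext. intros z. split; intros H; exfalso.
    + apply (Hemp z H).
    + eapply empE; eauto.
  - intros x Hx. destruct (Hs x Hx) as (y & Hy & Hyz). replace (succ x) with y; auto.
    apply ext. intros z. rewrite succE. apply (Hyz z).
Qed.

(** Iterated unions along the ordinals of an inductive set. Only recursion on ordinals is used,
    since recursion on sets presupposes transitive closures. *)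
Lemma trans_superset x : exists t, trans t /\ subs x t.
Proof.
  set (G := fun a h : M => cup x (union (im (fun b => union (ap h b)) a))).
  assert (HG : Fun2 G) by (unfold G; dfn).
  pose proof (Fun_ordrec G HG) as HF. set (F := ordrec G) in *.
  assert (HF1 : forall a z, Ord a -> (z ∊ F a <-> z ∊ x \/ exists b, b ∊ a /\ z ∊ union (F b))).
  { intros a z Ha. unfold F at 1. rewrite ordrec_eq by auto. unfold G at 1.
    rewrite cupE, unionE. apply or_iff_compat_l. split.
    - intros (y & Hy & Hz). apply imE in Hy; [|dfn]. destruct Hy as (b & Hb & ->).
      rewrite ap_lam in Hz by auto. eauto.
    - intros (b & Hb & Hz). exists (union (F b)). split; auto. apply imE; [dfn|].
      exists b. rewrite ap_lam by auto. auto. }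
  destruct inductive_set as (w & Hw0 & Hws).
  exists (union (im F (sep w Ord))). split.
  - intros y z Hy Hz. rewrite unionE in *. destruct Hy as (u & Hu & Hy).
    apply imE in Hu; auto. destruct Hu as (a & Ha & ->). apply sepE in Ha; [|dfn].
    destruct Ha as [Ha Hao]. exists (F (succ a)). split.
    + apply imE; auto. exists (succ a). rewrite sepE by dfn. split; auto. split; auto.
      apply ord_succ; auto.
    + apply HF1; [apply ord_succ; auto|]. right. exists a. rewrite succE, unionE. eauto.
  - intros y Hy. apply unionE. exists (F emp). split.
    + apply imE; auto. exists emp. rewrite sepE by dfn. split; auto. split; auto. apply ord_emp.
    + apply HF1; [apply ord_emp|]. auto.
Qed.

Lemma eps_ind (P : M -> Prop) : Def1 P ->
  (forall x, (forall y, y ∊ x -> P y) -> P x) -> forall x, P x.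
Proof.
  intros HP H x. apply NNPP. intros Hn.
  assert (HD : Def1 (fun x => ~ P x)) by dfn.
  destruct (trans_superset (sing x)) as (t & Ht & Hx).
  destruct (foundation (sep t (fun x => ~ P x))) as (y & Hy & Hmin).
  { exists x. rewrite sepE by auto. split; auto. apply Hx, singE; auto. }
  rewrite sepE in Hy by auto. destruct Hy as [Hy HPy]. apply HPy, H. intros z Hz.
  apply NNPP. intros HPz. apply (Hmin z Hz). rewrite sepE by auto. split; auto. eapply Ht; eauto.
Qed.

Lemma tc_isset x : isset (fun y => forall t, trans t -> subs x t -> y ∊ t).
Proof.
  destruct (trans_superset x) as (t & Ht & Hx). apply (isset_sub t); [dfn|]. auto.
Qed.
Definition tc x : M := setof (fun y => forall t, trans t -> subs x t -> y ∊ t).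
Lemma tcE x y : y ∊ tc x <-> forall t, trans t -> subs x t -> y ∊ t.
Proof. apply setofE, tc_isset. Qed.
Lemma Fun_tc : Fun1 tc.
Proof. unfold tc. apply Fun1_setof; [exact tc_isset|dfn]. Qed.
Hint Resolve Fun_tc : dfn.
Lemma tc_trans x : trans (tc x).
Proof. intros y z Hy Hz. rewrite tcE in *. intros t Ht Hx. apply (Ht y); auto. Qed.
Lemma tc_sub x : subs x (tc x).
Proof. intros y Hy. apply tcE. auto. Qed.
Lemma tc_min x t : trans t -> subs x t -> subs (tc x) t.
Proof. intros Ht Hx y Hy. rewrite tcE in Hy. auto. Qed.
Lemma tc_mono x y : x ∊ tc y -> subs (tc x) (tc y).
Proof. intros H. apply tc_min; [apply tc_trans|]. intros z Hz. eapply tc_trans; eauto. Qed.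
Lemma tc_ind (P : M -> Prop) : Def1 P ->
  (forall x, (forall y, y ∊ tc x -> P y) -> P x) -> forall x, P x.
Proof.
  intros HP H x. apply H. revert x.
  apply (eps_ind (fun x => forall y, y ∊ tc x -> P y)); [dfn|].
  intros x IH y Hy. rewrite tcE in Hy.
  assert (HD : Def1 (fun y => P y /\ forall z, z ∊ tc y -> P z)) by dfn.
  assert (Hy' : y ∊ sep (tc x) (fun y => P y /\ forall z, z ∊ tc y -> P z)).
  { apply Hy.
    - intros u v Hu Hv. rewrite sepE in * by auto. destruct Hu as (Hu & HPu & Hall).
      split; [eapply tc_trans; eauto|]. split; [apply Hall, tc_sub; auto|].
      intros z Hz. apply Hall. apply (tc_mono v u); auto. apply tc_sub; auto.
    - intros u Hu. rewrite sepE by auto. split; [apply tc_sub; auto|]. split; eauto. }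
  rewrite sepE in Hy' by auto. tauto.
Qed.

Definition epsrec (G : M -> M -> M) : M -> M := recF tc G.
Lemma Fun_epsrec G : Fun2 G -> Fun1 (epsrec G).
Proof. intros HG. apply Fun_recF; auto with dfn. Qed.
Lemma epsrec_eq G a : Fun2 G -> epsrec G a = G a (lam (tc a) (epsrec G)).
Proof.
  intros HG. apply (recF_eq (fun _ => True) tc); auto with dfn.
  - intros x y z _ Hy Hz. eapply tc_mono; eauto.
  - intros P HP H x _. apply tc_ind; auto.
Qed.

Lemma Fun_lord1 (P : M -> M -> Prop) : Def2 P -> Fun1 (fun x => lord (P x)).
Proof.
  intros HP. apply (Tm_lord 1 (fun e => P (e 0))). dfn.
Qed.

(** The cumulative hierarchy. It serves to derive [collection], by replacing arbitrary witnesses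
    with the ranks at which they occur. *)
Definition Vr : M -> M := ordrec (fun a h => union (im (fun b => pow (ap h b)) a)).
Lemma Fun_Vr : Fun1 Vr.
Proof. apply Fun_ordrec. dfn. Qed.
Hint Resolve Fun_Vr : dfn.
Lemma VrE a x : Ord a -> (x ∊ Vr a <-> exists b, b ∊ a /\ subs x (Vr b)).
Proof.
  intros Ha. unfold Vr at 1. rewrite ordrec_eq by (auto; dfn). fold Vr. rewrite unionE. split.
  - intros (y & Hy & Hx). apply imE in Hy; [|dfn]. destruct Hy as (b & Hb & ->).
    rewrite ap_lam in Hx by (auto; dfn). rewrite powE in Hx. eauto.
  - intros (b & Hb & Hx). exists (pow (Vr b)). rewrite powE. split; auto.
    apply imE; [dfn|]. exists b. rewrite ap_lam by (auto; dfn). auto.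
Qed.
Lemma Vr_mono a b : Ord b -> subs a b -> Ord a -> subs (Vr a) (Vr b).
Proof.
  intros Hb Hab Ha x. rewrite !VrE by auto. intros (c & Hc & Hx). eauto.
Qed.

(* Least ordinals are collected by replacement, and their supremum is taken. *)
Lemma ord_collect (R : M -> M -> Prop) a : Def2 R ->
  (forall x, x ∊ a -> exists b, Ord b /\ R x b) ->
  exists c, Ord c /\ forall x, x ∊ a -> exists b, b ∊ c /\ R x b.
Proof.
  intros HR H. pose proof (Fun_lord1 R HR) as HF.
  assert (Hl : forall x, x ∊ a -> Ord (lord (R x)) /\ R x (lord (R x))).
  { intros x Hx. destruct (lordP (R x)) as (H1 & H2 & _); auto. dfn. }
  exists (union (im (fun x => succ (lord (R x))) a)). split.
  - apply ord_union. intros y Hy. apply imE in Hy; [|dfn]. destruct Hy as (x & Hx & ->).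
    apply ord_succ, Hl; auto.
  - intros x Hx. exists (lord (R x)). split; [|apply Hl; auto].
    apply unionE. exists (succ (lord (R x))). rewrite succE. split; auto.
    apply imE; [dfn|]. eauto.
Qed.

Lemma Vr_all x : exists a, Ord a /\ x ∊ Vr a.
Proof.
  revert x. apply (eps_ind (fun x => exists a, Ord a /\ x ∊ Vr a)); [dfn|].
  intros x IH. destruct (ord_collect (fun y a => y ∊ Vr a) x) as (c & Hc & H); [dfn|auto|].
  exists (succ c). split; [apply ord_succ; auto|]. apply VrE; [apply ord_succ; auto|].
  exists c. rewrite succE. split; auto. intros y Hy. destruct (H y Hy) as (b & Hb & Hyb).
  apply (Vr_mono b c); auto; [|eapply ord_mem; eauto]. intros z Hz. apply (proj1 Hc b); auto.
Qed.

Lemma collection (R : M -> M -> Prop) a : Def2 R ->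
  (forall x, x ∊ a -> exists y, R x y) ->
  exists b, forall x, x ∊ a -> exists y, y ∊ b /\ R x y.
Proof.
  intros HR H.
  destruct (ord_collect (fun x c => exists y, y ∊ Vr c /\ R x y) a) as (c & Hc & Hb); [dfn|..].
  { intros x Hx. destruct (H x Hx) as (y & Hy). destruct (Vr_all y) as (b & Hb & Hyb). eauto. }
  exists (Vr c). intros x Hx. destruct (Hb x Hx) as (b & Hbc & y & Hy & HRy).
  exists y. split; auto. apply (Vr_mono b c); auto; [|eapply ord_mem; eauto].
  intros z Hz. apply (proj1 Hc b); auto.
Qed.

(** The axiom speaks of disjoint families, so each x is first replaced by {x} × x. *)
Lemma choice_fn a : (forall x, x ∊ a -> exists y, y ∊ x) ->
  exists c, isfn c a /\ forall x, x ∊ a -> ap c x ∊ x.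
Proof.
  intros H.
  assert (HD : Fun1 (fun x : M => prod (sing x) x)) by dfn.
  destruct (zfc _ ax_choice (im (fun x => prod (sing x) x) a)) as [c Hc].
  { split.
    - intros y Hy. apply imE in Hy; [|auto]. destruct Hy as (x & Hx & ->).
      destruct (H x Hx) as (y & Hy). exists (op x y). apply prod_op. rewrite singE. auto.
    - intros y Hy y' Hy' (z & Hz & Hz'). apply imE in Hy, Hy'; auto.
      destruct Hy as (x & Hx & ->), Hy' as (x' & Hx' & ->). cbn in *.
      apply prodE in Hz. destruct Hz as (u & v & Hu & Hv & ->).
      apply prod_op in Hz'. rewrite singE in *. destruct Hz'. congruence. }
  assert (HF : Def2 (fun x y : M => y ∊ x /\ op x y ∊ c)) by dfn.
  assert (Hu : forall x, x ∊ a -> exists y, (y ∊ x /\ op x y ∊ c) /\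
             forall y', y' ∊ x /\ op x y' ∊ c -> y' = y).
  { intros x Hx. destruct (Hc (prod (sing x) x)) as (z & (Hz & Hzc) & Hzu).
    { cbn. apply imE; eauto. }
    cbn in *. apply prodE in Hz. destruct Hz as (x' & y & Hx' & Hy & ->).
    apply singE in Hx'. subst x'. exists y. split; auto. intros y' [Hy' Hyc'].
    assert (E : op x y' = op x y). { apply Hzu. split; auto. apply prod_op. rewrite singE. auto. }
    apply op_inj in E. tauto. }
  exists (sep (prod a (union a)) (fun z => exists x y, z = op x y /\ y ∊ x /\ op x y ∊ c)).
  assert (HS : forall x y, op x y ∊ sep (prod a (union a))
     (fun z => exists x y, z = op x y /\ y ∊ x /\ op x y ∊ c) <-> x ∊ a /\ y ∊ x /\ op x y ∊ c).
  { intros x y. rewrite sepE by dfn. rewrite prod_op, unionE. split.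
    - intros [[Hx _] (x' & y' & E & Hy & Hyc)]. apply op_inj in E. destruct E; subst; auto.
    - intros (Hx & Hy & Hyc). split; eauto 8. }
  match goal with |- isfn ?g _ /\ _ => assert (Hfn : isfn g a) end.
  { split.
    - intros z Hz. apply sepE in Hz; [|dfn]. destruct Hz as [Hz _]. apply prodE in Hz.
      destruct Hz as (x & y & Hx & _ & ->). eauto.
    - intros x Hx. destruct (Hu x Hx) as (y & Hy & Hyu). exists y. rewrite HS. split; [tauto|].
      intros y'. rewrite HS. intros Hy'. apply Hyu. tauto. }
  split; auto. intros x Hx. pose proof (fn_ap _ _ _ Hfn Hx) as Hap. apply HS in Hap. tauto.
Qed.

Lemma AC_rel (R : M -> M -> Prop) a : Def2 R -> (forall x, x ∊ a -> exists y, R x y) ->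
  exists f, isfn f a /\ forall x, x ∊ a -> R x (ap f x).
Proof.
  intros HR H. destruct (collection R a HR H) as (b & Hb).
  assert (HF : Fun1 (fun x => sep b (R x))) by dfn.
  destruct (choice_fn (im (fun x => sep b (R x)) a)) as (c & Hc & Hc').
  { intros y Hy. apply imE in Hy; auto. destruct Hy as (x & Hx & ->).
    destruct (Hb x Hx) as (y & Hy & HRy). exists y. apply sepE; [dfn|auto]. }
  assert (HG : Fun1 (fun x => ap c (sep b (R x)))) by dfn.
  exists (lam a (fun x => ap c (sep b (R x)))). split; [apply lam_fn; auto|].
  intros x Hx. rewrite ap_lam by auto.
  assert (Hi : sep b (R x) ∊ im (fun x => sep b (R x)) a) by (apply imE; eauto).
  apply Hc' in Hi. apply sepE in Hi; [tauto|dfn].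
Qed.

Lemma burali_forti a : exists b, Ord b /\ ~ b ∊ a.
Proof.
  apply NNPP. intros Hn.
  assert (H : forall b, Ord b -> b ∊ sep a Ord).
  { intros b Hb. apply sepE; [dfn|]. split; auto. apply NNPP. eauto. }
  assert (Ho : Ord (sep a Ord)).
  { split.
    - intros y z Hy Hz. apply H. apply sepE in Hy; [|dfn]. eapply ord_mem; [apply Hy|auto].
    - intros y Hy. apply sepE in Hy; [|dfn]. apply (proj1 (proj2 Hy)). }
  apply (mem_irrefl _ (H _ Ho)).
Qed.

Definition inj_on f a : Prop :=
  forall x x', x ∊ a -> x' ∊ a -> ap f x = ap f x' -> x = x'.

(** F a is chosen among the elements of A that are not yet listed. If A were never exhausted,
    sending x to the least b with F b = x would map the set A onto all ordinals, against
    [burali_forti]. *)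
Theorem zermelo A : exists a f, Ord a /\ isfn f a /\ inj_on f a /\
  (forall x, x ∊ a -> ap f x ∊ A) /\ forall y, y ∊ A -> exists x, x ∊ a /\ ap f x = y.
Proof.
  destruct (choice_fn (sep (pow A) (fun x => exists y, y ∊ x))) as (c & Hc & Hcv).
  { intros x Hx. apply sepE in Hx; [tauto|dfn]. }
  set (G := fun a h : M => ap c (sep A (fun x => forall b, b ∊ a -> ~ x = ap h b))).
  assert (HG : Fun2 G) by (unfold G; dfn).
  pose proof (Fun_ordrec G HG) as HF. set (F := ordrec G) in *.
  set (rest := fun a => sep A (fun x => forall b, b ∊ a -> ~ x = F b)).
  assert (HR : forall a x, x ∊ rest a <-> x ∊ A /\ forall b, b ∊ a -> ~ x = F b).
  { intros a x. unfold rest. apply sepE. dfn. }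
  assert (HFv : forall a, Ord a -> (exists x, x ∊ rest a) -> F a ∊ rest a).
  { intros a Ha Hx. assert (E : F a = ap c (rest a)).
    { unfold F at 1. rewrite ordrec_eq by auto. unfold G at 1. f_equal. apply ext. intros x.
      rewrite HR, sepE by dfn. split; intros [H1 H2]; split; auto; intros b Hb E;
        apply (H2 b Hb); rewrite E, ap_lam; auto. }
    rewrite E. apply Hcv. apply sepE; [dfn|]. split; auto. apply powE. intros x Hx'.
    apply HR in Hx'. tauto. }
  assert (Hex : exists a, Ord a /\ ~ exists x, x ∊ rest a).
  { apply NNPP. intros Hn.
    assert (Hall : forall a, Ord a -> F a ∊ rest a).
    { intros a Ha. apply HFv; auto. apply NNPP. eauto. }
    pose proof (Fun_lord1 (fun x b => F b = x)) as HL.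
    destruct (burali_forti (im (fun x => lord (fun b => F b = x)) A)) as (b & Hb & Hbn).
    apply Hbn. apply imE; [apply HL; dfn|]. exists (F b).
    pose proof (Hall b Hb) as H. apply HR in H. split; [tauto|].
    destruct (lordP (fun c => F c = F b)) as (H1 & H2 & _); [dfn|eauto|].
    destruct (ord_tri b (lord (fun c => F c = F b)) Hb H1) as [H3|[H3|H3]]; auto; exfalso.
    - pose proof (Hall _ H1) as H4. apply HR in H4. apply (proj2 H4 b); auto.
    - apply (proj2 H _ H3). symmetry; auto. }
  assert (HDr : Def1 (fun a => ~ exists x, x ∊ rest a)) by (unfold rest; dfn).
  destruct (lordP (fun a => ~ exists x, x ∊ rest a)) as (Ha & Hr & Hmin); auto.
  set (a := lord (fun a => ~ exists x, x ∊ rest a)) in *.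
  assert (Hv : forall b, b ∊ a -> F b ∊ rest b).
  { intros b Hb. assert (Hbo : Ord b) by (eapply ord_mem; eauto). apply HFv; auto. apply NNPP.
    intros Hn. apply (mem_irrefl b). apply (Hmin b); auto. }
  exists a, (lam a F). split; [|split; [|split; [|split]]]; auto.
  - apply lam_fn; auto.
  - intros x x' Hx Hx' E. rewrite !ap_lam in E by auto.
    destruct (ord_tri x x') as [H|[H|H]]; auto; try (eapply ord_mem; eauto; fail); exfalso.
    + pose proof (Hv x' Hx') as H1. apply HR in H1. apply (proj2 H1 x); auto.
    + pose proof (Hv x Hx) as H1. apply HR in H1. apply (proj2 H1 x'); auto.
  - intros x Hx. rewrite ap_lam by auto. apply Hv in Hx. apply HR in Hx. tauto.
  - intros y Hy. apply NNPP. intros Hn. apply Hr. exists y. apply HR. split; auto.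
    intros b Hb E. apply Hn. exists b. rewrite ap_lam; auto.
Qed.
End Ordinals.
#[export] Hint Resolve Def_trans Def_Ord Fun_succ Fun_tc Fun_Vr : dfn.
Ltac dfn_extra ::=
  match goal with
  | |- Tm _ (fun e => sep _ _) => simple apply Tm_sep
  | |- Tm _ (fun e => im _ _) => simple apply Tm_im
  | |- Tm _ (fun e => lam _ _) => simple apply Tm_lam
  | |- Tm _ (fun e => lord _) => simple apply Tm_lord
  end.

(** * Cardinality, regularity and closed posets *)

Section Cardinals.
Context {M : struct} {Z : ZFC M}.
Implicit Types x y z a b c f g r m X Y : M.

Definition cle a b : Prop :=
  exists f, isfn f a /\ (forall x, x ∊ a -> ap f x ∊ b) /\ inj_on f a.
Lemma sat_card_le a b : sat mem (card_le a b) <-> cle a b.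
Proof.
  unfold card_le, cle, injective. cbn [sat]. split.
  - intros (f & Hf & Hi). apply sat_fun in Hf. destruct Hf as [Hf Hv]. exists f.
    split; [|split]; auto. intros x x' Hx Hx' E. apply (Hi x x' (ap f x)); apply sat_pin.
    + apply (fn_ap _ a); auto.
    + rewrite E. apply (fn_ap _ a); auto.
  - intros (f & Hf & Hv & Hi). exists f. rewrite sat_fun. split; auto.
    intros x x' y Hx Hx'. apply sat_pin in Hx, Hx'.
    apply Hi; [eapply fn_dom; eauto..|].
    rewrite (ap_eq _ _ _ _ Hf Hx), (ap_eq _ _ _ _ Hf Hx'). auto.
Qed.
Lemma sat_card_lt a b : sat mem (card_lt a b) <-> cle a b /\ ~ cle b a.
Proof. unfold card_lt. cbn [sat]. rewrite !sat_card_le. reflexivity. Qed.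
Lemma sat_card a : sat mem (is_card a) <-> Ord a /\ forall x, x ∊ a -> ~ cle a x.
Proof.
  unfold is_card. cbn [sat]. rewrite sat_ord. split; intros [H1 H2]; split; auto;
    intros x Hx H; apply (H2 x Hx), sat_card_le; auto.
Qed.

Lemma cle_fun (F : M -> M) a b : Fun1 F -> (forall x, x ∊ a -> F x ∊ b) ->
  (forall x x', x ∊ a -> x' ∊ a -> F x = F x' -> x = x') -> cle a b.
Proof.
  intros HF Hv Hi. exists (lam a F). split; [apply lam_fn; auto|]. split.
  - intros x Hx. rewrite ap_lam; auto.
  - intros x x' Hx Hx' E. rewrite !ap_lam in E; auto.
Qed.
Lemma cle_sub a b : subs a b -> cle a b.
Proof. intros H. apply (cle_fun (fun x => x)); auto. dfn. Qed.
Lemma cle_trans a b c : cle a b -> cle b c -> cle a c.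
Proof.
  intros (f & Hf & Hfv & Hfi) (g & Hg & Hgv & Hgi).
  apply (cle_fun (fun x => ap g (ap f x))); auto. dfn.
Qed.

(* The function may be partial and may take values outside X, so X may be empty. *)
Definition onto X d : Prop :=
  exists f, (forall i x y, op i x ∊ f -> op i y ∊ f -> x = y) /\
            forall x, x ∊ X -> exists i, i ∊ d /\ op i x ∊ f.
Lemma onto_rel (R : M -> M -> Prop) X d : Def2 R ->
  (forall i x y, i ∊ d -> R i x -> R i y -> x = y) ->
  (forall x, x ∊ X -> exists i, i ∊ d /\ R i x) -> onto X d.
Proof.
  intros HR Hf Hs.
  assert (HS : forall i x, op i x ∊ sep (prod d X) (fun z => exists i x, z = op i x /\ R i x)
     <-> i ∊ d /\ x ∊ X /\ R i x).
  { intros i x. rewrite sepE by dfn. rewrite prod_op. split.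
    - intros [[Hi Hx] (i' & x' & E & H)]. apply op_inj in E. destruct E; subst; auto.
    - intros (Hi & Hx & H). eauto 8. }
  exists (sep (prod d X) (fun z => exists i x, z = op i x /\ R i x)). split.
  - intros i x y. rewrite !HS. intros (H1 & _ & H2) (_ & _ & H3). eauto.
  - intros x Hx. destruct (Hs x Hx) as (i & Hi & H). exists i. rewrite HS. auto.
Qed.
Lemma onto_fun (F : M -> M) X d : Fun1 F ->
  (forall x, x ∊ X -> exists i, i ∊ d /\ F i = x) -> onto X d.
Proof.
  intros HF H. apply (onto_rel (fun i x => F i = x)); auto.
  - dfn.
  - intros; congruence.
Qed.
Lemma onto_cle X d : cle X d -> onto X d.
Proof.
  intros (f & Hf & Hv & Hi). apply (onto_rel (fun i x => x ∊ X /\ ap f x = i)).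
  - dfn.
  - intros i x y _ [Hx Ex] [Hy Ey]. apply Hi; auto. congruence.
  - intros x Hx. exists (ap f x). auto.
Qed.
Lemma cle_onto X d : Ord d -> onto X d -> cle X d.
Proof.
  intros Hd (f & Hf & Hs).
  assert (HP : forall x, x ∊ X -> let l := lord (fun i => i ∊ d /\ op i x ∊ f) in
     l ∊ d /\ op l x ∊ f).
  { intros x Hx l. destruct (lordP (fun i => i ∊ d /\ op i x ∊ f)) as (_ & H & _); auto; [dfn|].
    destruct (Hs x Hx) as (i & Hi & H). exists i. split; auto. eapply ord_mem; eauto. }
  apply (cle_fun (fun x => lord (fun i => i ∊ d /\ op i x ∊ f))).
  - dfn.
  - intros x Hx. apply HP; auto.
  - intros x x' Hx Hx' E. pose proof (proj2 (HP x Hx)) as H1.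
    pose proof (proj2 (HP x' Hx')) as H2. cbn in *. rewrite <- E in H2. eauto.
Qed.
Lemma onto_trans X Y d : onto X Y -> onto Y d -> onto X d.
Proof.
  intros (f & Hf & Hfs) (g & Hg & Hgs).
  apply (onto_rel (fun i x => exists y, op i y ∊ g /\ op y x ∊ f)); [dfn|..].
  - intros i x x' _ (y & H1 & H2) (y' & H3 & H4). rewrite (Hg _ _ _ H1 H3) in H2. eauto.
  - intros x Hx. destruct (Hfs x Hx) as (y & Hy & H1). destruct (Hgs y Hy) as (i & Hi & H2).
    eauto.
Qed.
Lemma onto_sub X Y d e : subs X Y -> subs d e -> onto Y d -> onto X e.
Proof.
  intros HX Hd (f & Hf & Hs). exists f. split; auto. intros x Hx.
  destruct (Hs x (HX x Hx)) as (i & Hi & H). eauto.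
Qed.

(** For a cardinal m this is |X| < m. Surjections, rather than injections, let smallness pass to
    images without further choices, and they persist in extensions. *)
Definition small m X : Prop := exists d, d ∊ m /\ onto X d.
Lemma Def_onto : Def2 onto.
Proof. unfold onto. dfn. Qed.
Hint Resolve Def_onto : dfn.

Lemma small_of_no_cle m X : Ord m -> ~ cle m X -> small m X.
Proof.
  intros Hm Hn. destruct (zermelo X) as (a & f & Ha & Hf & Hi & Hv & Hs).
  exists a. split.
  - apply ord_nsub; auto. intros H. apply Hn.
    apply (cle_fun (ap f)); [dfn|auto|]. intros x x' Hx Hx'. apply Hi; auto.
  - apply (onto_fun (ap f)); auto. dfn.
Qed.
Lemma cle_small m X : Ord m -> small m X -> cle X m.
Proof.
  intros Hm (d & Hd & H). apply (cle_trans _ d); [apply cle_onto; auto; eapply ord_mem; eauto|].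
  apply cle_sub. intros x Hx. apply (proj1 Hm d); auto.
Qed.
Lemma card_lt_small m X : sat mem (is_card m) -> (sat mem (card_lt X m) <-> small m X).
Proof.
  rewrite sat_card, sat_card_lt. intros [Hm Hc]. split.
  - intros [_ H]. apply small_of_no_cle; auto.
  - intros H. split; [apply cle_small; auto|]. destruct H as (d & Hd & H). intros H'.
    apply (Hc d Hd). apply (cle_trans _ X); auto. apply cle_onto; auto. eapply ord_mem; eauto.
Qed.
Lemma small_sub m X Y : subs X Y -> small m Y -> small m X.
Proof. intros H (d & Hd & Ho). exists d. split; auto. eapply onto_sub; eauto. unfold subs; auto. Qed.
Lemma small_onto m X Y : onto X Y -> small m Y -> small m X.
Proof. intros H (d & Hd & Ho). exists d. split; auto. eapply onto_trans; eauto. Qed.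
Lemma small_im m (F : M -> M) X : Fun1 F -> small m X -> small m (im F X).
Proof.
  intros HF. apply small_onto. apply (onto_fun F); auto. intros x Hx. apply imE in Hx; auto.
  destruct Hx as (i & Hi & ->). eauto.
Qed.

(** Regularity without mention of cardinals, and with infinity reduced to the existence of a
    nonempty element, from which closure under [succ] follows. In this form it passes directly to
    extensions without new short sequences. *)
Definition reg m : Prop :=
  Ord m /\ (exists x y, x ∊ y /\ y ∊ m) /\
  forall x f, x ∊ m -> isfn f x -> (forall i, i ∊ x -> ap f i ∊ m) ->
    exists b, b ∊ m /\ forall i, i ∊ x -> ap f i ∊ b.
Lemma reg_regular m : sat mem (infinite_regular m) -> reg m.
Proof.
  unfold infinite_regular. cbn [sat]. intros (H1 & (w & Hw & Hs) & H2).
  apply sat_card in H1. split; [tauto|]. split.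
  - destruct Hw as [(Hwo & (x & Hx) & Hl) _]. destruct (Hl x Hx) as (y & Hy & Hxy).
    exists x, y. split; auto. apply Hs; auto.
  - intros x f Hx Hf Hv. destruct (H2 x Hx f) as (b & Hb & H); [apply sat_fun; auto|].
    exists b. split; auto. intros i Hi. apply (H i), sat_pin, (fn_ap _ x); auto.
Qed.
Definition one : M := sing emp.
Lemma reg_one m : reg m -> one ∊ m.
Proof.
  intros (Hm & (x & y & Hxy & Hy) & _).
  assert (Ho : Ord one).
  { replace one with (@succ M emp); [apply ord_succ, ord_emp|]. apply ext. intros z.
    unfold one. rewrite succE, singE. split; auto. intros [H|H]; auto.
    exfalso; eapply empE; eauto. }
  destruct (ord_tri one m Ho Hm) as [H|[H|H]]; auto; exfalso.
  - rewrite <- H in Hy. apply singE in Hy. subst. eapply empE; eauto.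
  - apply singE in H. subst. eapply empE; eauto.
Qed.
Lemma reg_emp m : reg m -> emp ∊ m.
Proof.
  intros H. pose proof (reg_one m H) as H1. apply (proj1 (proj1 H) one); auto. apply singE; auto.
Qed.
Lemma reg_bound m (F : M -> M) d : reg m -> Fun1 F -> d ∊ m -> (forall i, i ∊ d -> F i ∊ m) ->
  exists b, b ∊ m /\ forall i, i ∊ d -> F i ∊ b.
Proof.
  intros (_ & _ & H) HF Hd Hv. destruct (H d (lam d F)) as (b & Hb & Hbi); auto.
  - apply lam_fn; auto.
  - intros i Hi. rewrite ap_lam; auto.
  - exists b. split; auto. intros i Hi. specialize (Hbi i Hi). rewrite ap_lam in Hbi; auto.
Qed.
Lemma reg_bound_rel m (R : M -> M -> Prop) d : reg m -> Def2 R -> d ∊ m ->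
  (forall i, i ∊ d -> exists b, b ∊ m /\ R i b) ->
  exists b, b ∊ m /\ forall i, i ∊ d -> exists c, c ∊ b /\ R i c.
Proof.
  intros Hr HR Hd H.
  assert (HP : forall i, i ∊ d -> let l := lord (fun b => b ∊ m /\ R i b) in l ∊ m /\ R i l).
  { intros i Hi l. destruct (lordP (fun b => b ∊ m /\ R i b)) as (_ & HH & _); auto; [dfn|].
    destruct (H i Hi) as (b & Hb & HRb). exists b. split; auto. eapply ord_mem; [apply Hr|auto]. }
  destruct (reg_bound m (fun i => lord (fun b => b ∊ m /\ R i b)) d) as (b & Hb & Hbi); auto.
  - dfn.
  - intros i Hi. apply HP; auto.
  - exists b. split; auto. intros i Hi. exists (lord (fun b => b ∊ m /\ R i b)).
    split; auto. apply HP; auto.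
Qed.
(** Regularity, applied to the one-point map with value a, yields an element of m above a. *)
Lemma reg_succ m a : reg m -> a ∊ m -> succ a ∊ m.
Proof.
  intros Hr Ha. destruct (reg_bound m (fun _ => a) one) as (b & Hb & H); auto; [dfn|..].
  { apply reg_one; auto. }
  assert (Hab : a ∊ b) by (apply (H emp), singE; auto).
  pose proof (proj1 Hr) as Hm. assert (Hbo : Ord b) by (eapply ord_mem; eauto).
  destruct (ord_sub (succ a) b) as [E|E]; auto.
  - apply ord_succ. eapply ord_mem; eauto.
  - intros x Hx. apply succE in Hx. destruct Hx; subst; auto. apply (proj1 Hbo a); auto.
  - rewrite E; auto.
  - apply (proj1 Hm b); auto.
Qed.

Definition unb m (Y : M -> Prop) : Prop := forall b, b ∊ m -> exists i, i ∊ m /\ Y i /\ b ∊ i.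
(** If the indices of each colour j were bounded, regularity would bound these fewer than m bounds,
    and hence all of Y. *)
Lemma pigeonhole m d (Y : M -> Prop) (R : M -> M -> Prop) :
  reg m -> d ∊ m -> Def1 Y -> Def2 R -> unb m Y ->
  (forall i, i ∊ m -> Y i -> exists j, j ∊ d /\ R i j) ->
  exists j, j ∊ d /\ unb m (fun i => Y i /\ R i j).
Proof.
  intros Hr Hd HY HR Hu H. apply NNPP. intros Hn.
  destruct (reg_bound_rel m (fun j b => forall i, i ∊ m -> Y i /\ R i j -> ~ b ∊ i) d)
    as (b & Hb & Hbj); auto; [dfn|..].
  - intros j Hj. apply NNPP. intros Hn'. apply Hn. exists j. split; auto. intros b Hb.
    apply NNPP. intros Hn''. apply Hn'. exists b. split; auto. intros i Hi HYR Hbi.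
    apply Hn''. eauto.
  - destruct (Hu b Hb) as (i & Hi & HYi & Hbi). destruct (H i Hi HYi) as (j & Hj & HRj).
    destruct (Hbj j Hj) as (c & Hc & Hcj). apply (Hcj i); auto.
    apply (proj1 (ord_mem _ _ (proj1 Hr) Hi) b); auto.
Qed.
Lemma pigeonhole_small m X (Y : M -> Prop) (R : M -> M -> Prop) :
  reg m -> small m X -> Def1 Y -> Def2 R -> unb m Y ->
  (forall i, i ∊ m -> Y i -> exists x, x ∊ X /\ R i x) ->
  exists x, x ∊ X /\ unb m (fun i => Y i /\ R i x).
Proof.
  intros Hr (d & Hd & f & Hf & Hs) HY HR Hu H.
  destruct (pigeonhole m d Y (fun i j => exists x, x ∊ X /\ op j x ∊ f /\ R i x))
    as (j & Hj & Huj); auto; [dfn|..].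
  - intros i Hi HYi. destruct (H i Hi HYi) as (x & Hx & HRx). destruct (Hs x Hx) as (j & Hj & E).
    eauto 6.
  - destruct (Huj emp) as (i0 & _ & [_ (x & Hx & Hjx & _)] & _); [apply reg_emp; auto|].
    exists x. split; auto. intros b Hb. destruct (Huj b Hb) as (i & Hi & (HYi & x' & _ & E & HR')
      & Hbi). rewrite (Hf _ _ _ E Hjx) in HR'. eauto 6.
Qed.
Lemma unb_all m : reg m -> unb m (fun _ => True).
Proof. intros Hr b Hb. exists (succ b). rewrite succE. split; auto. apply reg_succ; auto. Qed.

Lemma unb_two m (Y : M -> Prop) : reg m -> unb m Y -> exists i j, i ∊ m /\ j ∊ m /\ Y i /\ Y j /\ i ∊ j.
Proof.
  intros Hr Hu. destruct (Hu emp) as (i & Hi & HYi & _); [apply reg_emp; auto|].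
  destruct (Hu i Hi) as (j & Hj & HYj & Hij). eauto 8.
Qed.

(** An injection of m into the union would send unboundedly many indices into one X j, and then
    unboundedly many of those to one point. *)
Lemma small_union m d (X : M -> M) : reg m -> Fun1 X -> d ∊ m ->
  (forall i, i ∊ d -> small m (X i)) -> small m (union (im X d)).
Proof.
  intros Hr HX Hd H. apply small_of_no_cle; [apply Hr|]. intros (h & Hh & Hv & Hi).
  destruct (pigeonhole m d (fun _ => True) (fun i j => ap h i ∊ X j)) as (j & Hj & Hu); auto;
    [dfn|dfn|apply unb_all; auto|..].
  { intros i Hi' _. specialize (Hv i Hi'). apply unionE in Hv. destruct Hv as (y & Hy & Hv).
    apply imE in Hy; auto. destruct Hy as (j & Hj & ->). eauto. }
  destruct (pigeonhole_small m (X j) (fun i => True /\ ap h i ∊ X j) (fun i x => ap h i = x))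
    as (x & Hx & Hu'); auto; [dfn|dfn|..].
  { intros i _ [_ Hi']. eauto. }
  destruct (unb_two _ _ Hr Hu') as (i & i' & Hi1 & Hi2 & [_ E1] & [_ E2] & Hlt).
  assert (E : i = i') by (apply Hi; auto; congruence). subst. apply (mem_irrefl _ Hlt).
Qed.
Lemma small_sing m x : reg m -> small m (sing x).
Proof.
  intros Hr. exists one. split; [apply reg_one; auto|].
  apply (onto_fun (fun _ => x)); [dfn|]. intros y Hy. apply singE in Hy. subst.
  exists emp. split; auto. apply singE; auto.
Qed.
Lemma small_mem m d : reg m -> d ∊ m -> small m d.
Proof. intros Hr Hd. exists d. split; auto. apply onto_cle, cle_sub. unfold subs; auto. Qed.
Lemma small_cup m X Y : reg m -> small m X -> small m Y -> small m (cup X Y).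
Proof.
  intros Hr HX HY.
  assert (H2 : succ one ∊ m) by (apply reg_succ, reg_one; auto).
  assert (HF : Fun1 (fun i : M => sep (cup X Y) (fun z => (i = emp /\ z ∊ X) \/ (i = one /\ z ∊ Y))))
    by dfn.
  apply (small_sub m _ (union (im (fun i : M => sep (cup X Y)
     (fun z => (i = emp /\ z ∊ X) \/ (i = one /\ z ∊ Y))) (succ one)))).
  - intros z Hz. apply unionE. pose proof Hz as Hz'. apply cupE in Hz.
    destruct Hz as [Hz|Hz]; [exists (sep (cup X Y) (fun z => ((emp : M) = emp /\ z ∊ X) \/ ((emp : M) = one /\ z ∊ Y)))
     |exists (sep (cup X Y) (fun z => ((one : M) = emp /\ z ∊ X) \/ ((one : M) = one /\ z ∊ Y)))];
      (split; [apply imE; auto|apply sepE; [dfn|auto]]).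
    + exists emp. split; auto. apply succE. left. apply singE; auto.
    + exists one. split; auto. apply succE; auto.
  - apply small_union; auto. intros i _.
    destruct (classic (i = emp)) as [E|E].
    + apply (small_sub m _ X); auto. intros z Hz. apply sepE in Hz; [|dfn].
      destruct Hz as (_ & [[_ H]|[H _]]); auto. exfalso. subst.
      apply (empE emp). rewrite H at 2. apply singE; auto.
    + apply (small_sub m _ Y); auto. intros z Hz. apply sepE in Hz; [|dfn]. tauto.
Qed.

(** * Closed posets *)

Definition dseq (P : M) (le : M -> M -> Prop) d f : Prop :=
  isfn f d /\ (forall i, i ∊ d -> ap f i ∊ P) /\
  forall i j, i ∊ j -> j ∊ d -> le (ap f j) (ap f i).
Definition closed (P : M) (le : M -> M -> Prop) (eta : M) : Prop :=
  forall d f, d ∊ eta -> dseq P le d f -> exists r, r ∊ P /\ forall i, i ∊ d -> le r (ap f i).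

(** The choice function [c] picks each term among the extensions of a lower bound r of all earlier
    terms. The bound r is exposed in the conclusion because the splitting argument also places side
    conditions below it. *)
Lemma descending_sequence (P : M) (le : M -> M -> Prop) (eta p : M) (step : M -> M -> M -> Prop) :
  Def2 le -> Def3 step -> Ord eta -> (forall x y z, le x y -> le y z -> le x z) ->
  p ∊ P -> le p p -> closed P le eta ->
  (forall a r, a ∊ eta -> r ∊ P -> le r p -> exists r', r' ∊ P /\ le r' r /\ step a r r') ->
  exists g, dseq P le eta g /\ forall a, a ∊ eta -> le (ap g a) p /\
    exists r, r ∊ P /\ le r p /\ (forall b, b ∊ a -> le r (ap g b)) /\
      le (ap g a) r /\ step a r (ap g a).
Proof.
  intros Hle Hst Heta Htr Hp Hpp Hcl Hstep.
  destruct (choice_fn (sep (pow P) (fun x => exists y, y ∊ x))) as (c & Hc & Hcv).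
  { intros x Hx. apply sepE in Hx; [tauto|dfn]. }
  set (good := fun a h r' : M => exists r, r ∊ P /\ le r p /\ (forall b, b ∊ a -> le r (ap h b)) /\
                 le r' r /\ step a r r').
  assert (Hgood : Def3 good) by (unfold good; dfn).
  set (G := fun a h : M => ap c (sep P (good a h))).
  assert (HG : Fun2 G) by (unfold G; dfn).
  pose proof (Fun_ordrec G HG) as HF. set (F := ordrec G) in *.
  assert (Hmain : forall a, Ord a -> a ∊ eta -> F a ∊ P /\ good a (lam a F) (F a)).
  { apply (ord_ind (fun a => a ∊ eta -> F a ∊ P /\ good a (lam a F) (F a))); [dfn|].
    intros a Ha IH Hae.
    assert (Hsub : forall b, b ∊ a -> b ∊ eta) by (intros b Hb; apply (proj1 Heta a); auto).
    assert (Hlp : forall b, b ∊ a -> le (F b) p).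
    { intros b Hb. destruct (IH b Hb (Hsub b Hb)) as (_ & r & Hr & Hrp & _ & Hbr & _). eauto. }
    destruct (Hcl a (lam a F) Hae) as (r & Hr & Hrl).
    { split; [apply lam_fn; auto|]. split.
      - intros i Hi. rewrite ap_lam by auto. apply IH; auto.
      - intros i j Hij Hj. assert (Hi : i ∊ a) by (apply (proj1 Ha j); auto).
        rewrite !ap_lam by auto.
        destruct (IH j Hj (Hsub j Hj)) as (_ & r & Hr & _ & Hrb & Hjr & _).
        specialize (Hrb i Hij). rewrite ap_lam in Hrb by auto. eauto. }
    (* A lower bound of the empty sequence need not lie below p, so p itself is used at the first
       stage. *)
    assert (Hr' : exists r, r ∊ P /\ le r p /\ forall b, b ∊ a -> le r (ap (lam a F) b)).
    { destruct (classic (exists b, b ∊ a)) as [(b & Hb)|Hn].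
      - exists r. split; auto. split; auto. specialize (Hrl b Hb). rewrite ap_lam in Hrl by auto. eauto.
      - exists p. split; auto. split; auto. intros b Hb. exfalso; eauto. }
    clear r Hr Hrl. destruct Hr' as (r & Hr & Hrp & Hrl).
    destruct (Hstep a r Hae Hr Hrp) as (r' & Hr'P & Hr'r & Hs).
    assert (Hin : sep P (good a (lam a F)) ∊ sep (pow P) (fun x => exists y, y ∊ x)).
    { apply sepE; [dfn|]. split.
      - apply powE. intros x Hx. apply sepE in Hx; [tauto|dfn].
      - exists r'. apply sepE; [dfn|]. split; auto. exists r. auto. }
    apply Hcv in Hin. apply sepE in Hin; [|dfn]. unfold F at 1 3. rewrite ordrec_eq by auto.
    exact Hin. }
  assert (Hm : forall a, a ∊ eta -> F a ∊ P /\ good a (lam a F) (F a)).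
  { intros a Ha. apply Hmain; auto. eapply ord_mem; eauto. }
  assert (Hg : forall a, a ∊ eta -> exists r, r ∊ P /\ le r p /\ (forall b, b ∊ a -> le r (F b)) /\
      le (F a) r /\ step a r (F a)).
  { intros a Ha. destruct (Hm a Ha) as (_ & r & Hr & Hrp & Hrb & Hrest). exists r.
    split; auto. split; auto. split; auto. intros b Hb. specialize (Hrb b Hb).
    rewrite ap_lam in Hrb; auto. }
  exists (lam eta F). split; [split; [apply lam_fn; auto|split]|].
  - intros i Hi. rewrite ap_lam by auto. apply Hm; auto.
  - intros i j Hij Hj. assert (Hi : i ∊ eta) by (apply (proj1 Heta j); auto).
    rewrite !ap_lam by auto. destruct (Hg j Hj) as (r & _ & _ & Hb & Hjr & _). eauto.
  - intros a Ha. rewrite ap_lam by auto. destruct (Hg a Ha) as (r & Hr & Hrp & Hb & Hra & Hs).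
    split; eauto. exists r. split; auto. split; auto. split; auto. intros b Hb'.
    rewrite ap_lam; auto. apply (proj1 Heta a); auto.
Qed.

Lemma closed_sub P le eta d : Ord eta -> d ∊ eta -> closed P le eta -> closed P le d.
Proof. intros He Hd H d' f Hd'. apply H. apply (proj1 He d); auto. Qed.

(** The dense open sets are entered one after the other along a descending sequence of length d, and
    a lower bound of that sequence lies in all of them. *)
Lemma dense_intersection (P : M) (le : M -> M -> Prop) (eta d p : M) (U : M -> M -> Prop) :
  Def2 le -> Def2 U -> Ord eta -> d ∊ eta -> (forall x y z, le x y -> le y z -> le x z) ->
  (forall x, x ∊ P -> le x x) -> p ∊ P -> closed P le eta ->
  (forall i r r', i ∊ d -> r' ∊ P -> le r' r -> U i r -> U i r') ->
  (forall i r, i ∊ d -> r ∊ P -> le r p -> exists r', r' ∊ P /\ le r' r /\ U i r') ->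
  exists r, r ∊ P /\ le r p /\ forall i, i ∊ d -> U i r.
Proof.
  intros Hle HU Heta Hd Htr Hrefl Hp Hcl Hopen Hdense.
  destruct (classic (exists i, i ∊ d)) as [(i0 & Hi0)|Hn].
  2: { exists p. split; auto. split; auto. intros i Hi. exfalso; eauto. }
  destruct (descending_sequence P le d p (fun i r r' => U i r')) as (g & Hg & Hgs); auto.
  - dfn.
  - eapply ord_mem; eauto.
  - eapply closed_sub; eauto.
  - destruct (Hcl d g Hd Hg) as (r & Hr & Hrg). exists r. split; auto. split.
    + destruct (Hgs i0 Hi0). eauto.
    + intros i Hi. destruct (Hgs i Hi) as (_ & r' & _ & _ & _ & _ & HUi). eapply Hopen; eauto.
Qed.

Definition pi1 z : M := setof (fun u => exists x y, z = op x y /\ u ∊ x).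
Definition pi2 z : M := setof (fun u => exists x y, z = op x y /\ u ∊ y).
Lemma pi1_isset z : isset (fun u => exists x y, z = op x y /\ u ∊ x).
Proof.
  apply (isset_sub (union (union z))); [dfn|]. intros u (x & y & -> & Hu).
  apply unionE. exists x. split; auto. apply unionE. exists (sing x). rewrite singE. split; auto.
  apply upairE; auto.
Qed.
Lemma pi2_isset z : isset (fun u => exists x y, z = op x y /\ u ∊ y).
Proof.
  apply (isset_sub (union (union z))); [dfn|]. intros u (x & y & -> & Hu).
  apply unionE. exists y. split; auto. apply unionE. exists (upair x y). rewrite upairE. split; auto.
  apply upairE; auto.
Qed.
Lemma pi1_op x y : pi1 (op x y) = x.
Proof.
  symmetry. apply setof_eq; [apply pi1_isset|]. intros u. split; [eauto|].
  intros (x' & y' & E & H). apply op_inj in E. destruct E; subst; auto.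
Qed.
Lemma pi2_op x y : pi2 (op x y) = y.
Proof.
  symmetry. apply setof_eq; [apply pi2_isset|]. intros u. split; [eauto|].
  intros (x' & y' & E & H). apply op_inj in E. destruct E; subst; auto.
Qed.
Lemma Fun_pi1 : Fun1 pi1.
Proof. unfold pi1. apply Fun1_setof; [exact pi1_isset|dfn]. Qed.
Lemma Fun_pi2 : Fun1 pi2.
Proof. unfold pi2. apply Fun1_setof; [exact pi2_isset|dfn]. Qed.
Hint Resolve Fun_pi1 Fun_pi2 : dfn.

Definition le2 (le : M -> M -> Prop) (x y : M) : Prop := le (pi1 x) (pi1 y) /\ le (pi2 x) (pi2 y).
Lemma closed_prod P le eta : Ord eta -> Def2 le -> closed P le eta -> closed (prod P P) (le2 le) eta.
Proof.
  intros He Hle H d f Hd (Hf & Hv & Hdec).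
  assert (Hv' : forall i, i ∊ d -> pi1 (ap f i) ∊ P /\ pi2 (ap f i) ∊ P).
  { intros i Hi. specialize (Hv i Hi). apply prodE in Hv. destruct Hv as (x & y & Hx & Hy & ->).
    rewrite pi1_op, pi2_op. auto. }
  assert (H1 : Fun1 (fun i => pi1 (ap f i))) by dfn.
  assert (H2 : Fun1 (fun i => pi2 (ap f i))) by dfn.
  destruct (H d (lam d (fun i => pi1 (ap f i))) Hd) as (r & Hr & Hrl).
    { split; [apply lam_fn; auto|]. split.
      - intros i Hi. rewrite ap_lam by auto. apply Hv'; auto.
      - intros i j Hij Hj. rewrite !ap_lam by (auto; apply (proj1 (ord_mem _ _ He Hd) j); auto). apply (Hdec i j); auto. }
    destruct (H d (lam d (fun i => pi2 (ap f i))) Hd) as (s & Hs & Hsl).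
    { split; [apply lam_fn; auto|]. split.
      - intros i Hi. rewrite ap_lam by auto. apply Hv'; auto.
      - intros i j Hij Hj. rewrite !ap_lam by (auto; apply (proj1 (ord_mem _ _ He Hd) j); auto). apply (Hdec i j); auto. }
    exists (op r s). split; [apply prod_op; auto|]. intros i Hi. unfold le2.
    rewrite pi1_op, pi2_op. specialize (Hrl i Hi). specialize (Hsl i Hi).
    rewrite ap_lam in Hrl, Hsl; auto.
Qed.
End Cardinals.
#[export] Hint Resolve Def_onto Fun_pi1 Fun_pi2 : dfn.

(** * Definability of satisfaction and the interface to generic extensions *)

Section Uniform_definability.
Context {M : struct}.
Definition TmE (k : nat) (te : (nat -> M) -> nat -> M) : Prop :=
  forall n, Tm k (fun e => te e n).
Lemma TmE_scons k a te : Tm k a -> TmE k te -> TmE k (fun e => scons (a e) (te e)).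
Proof. intros Ha Ht [|n]; [exact Ha|apply Ht]. Qed.
Lemma TmE_const k (c : nat -> M) : TmE k (fun _ => c).
Proof. intros n. apply Tm_const. Qed.
Lemma TmE_shift k te : TmE k te -> TmE (S k) (fun e => te (fun n => e (S n))).
Proof. intros H n. apply (Tm_shift k (fun e => te e n)), H. Qed.

Lemma D_dinst f : forall k te, TmE k te -> D k (fun e => sat (@mem M) (dinst f (te e))).
Proof.
  assert (W : forall k te, TmE k te -> TmE (S k) (fun e => scons (e 0) (te (fun n => e (S n))))).
  { intros k te H. apply TmE_scons; [apply Tm_var; lia|apply TmE_shift; auto]. }
  induction f; intros k te H; cbn [dinst sat].
  - apply (D_app2 mem _ (fun e => te e n) (fun e => te e n0)); auto with dfn.
  - apply (D_app2 eq _ (fun e => te e n) (fun e => te e n0)); auto with dfn.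
  - apply D_bot.
  - apply D_imp; auto.
  - apply D_and; auto.
  - apply D_or; auto.
  - apply D_all. apply (IHf (S k) (fun e => scons (e 0) (te (fun n => e (S n))))). auto.
  - apply D_ex. apply (IHf (S k) (fun e => scons (e 0) (te (fun n => e (S n))))). auto.
Qed.
Lemma D_uniform F k te : uniform F -> TmE k te -> D k (fun e => sat (@mem M) (F M (te e))).
Proof.
  intros [f Hf] H. eapply D_ext; [|apply (D_dinst f k te H)]. intros e. rewrite Hf. reflexivity.
Qed.
End Uniform_definability.

(* Properties shared by genuine forcing and by the trivial extension N = M. *)
Record gext {M N : struct} (P L : M) (Fo : fm -> M -> (nat -> M) -> Prop) (chk : M -> M)
  (G : M -> Prop) (val : M -> N) : Prop := Gext {
  g_zfc : ZFC N;
  g_in : forall p, G p -> p ∊ P;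
  g_up : forall p q, G p -> op p q ∊ L -> G q;
  g_dir : forall p q, G p -> G q -> exists r, G r /\ op r p ∊ L /\ op r q ∊ L;
  g_meet : forall U, Def1 U -> (forall p, p ∊ P -> exists q, op q p ∊ L /\ U q) ->
           exists p, G p /\ U p;
  v_surj : forall y, exists s, y = val s;
  v_name : forall t, exists B, forall y, y ∊ val t -> exists b, b ∊ B /\ y = val b;
  v_truth : forall f e, sat mem (dinst f (fun n => val (e n))) <-> exists p, G p /\ Fo f p e;
  v_chk : forall x y, y ∊ val (chk x) <-> exists x', x' ∊ x /\ y = val (chk x');
  v_inj : forall x y, val (chk x) = val (chk y) -> x = y;
  v_gen : exists g, forall y, y ∊ g <-> exists p, G p /\ y = val (chk p);
  v_fun : forall B, exists f, forall z, z ∊ f <-> exists b, b ∊ B /\ z = op (val (chk b)) (val b) }.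

(** By [n_gen] and [v_truth], facts about forcing can be read off in generic extensions, so later
    arguments never unfold [forces]. In this generality the trivial forcing is an instance too. *)
Record fnotion {M : struct} (P L : M) (Fo : fm -> M -> (nat -> M) -> Prop) (chk : M -> M) : Prop :=
  Fnotion {
  n_trans : forall p q r, op p q ∊ L -> op q r ∊ L -> op p r ∊ L;
  n_refl : forall p, p ∊ P -> op p p ∊ L;
  n_dom : forall p q, op p q ∊ L -> p ∊ P /\ q ∊ P;
  n_def : forall f k p te, Tm k p -> TmE k te -> D k (fun e => Fo f (p e) (te e));
  n_chk : Fun1 chk;
  n_mono : forall f p q e, op q p ∊ L -> Fo f p e -> Fo f q e;
  n_gen : forall p, p ∊ P -> exists (N : struct) (G : M -> Prop) (val : M -> N),
          gext P L Fo chk G val /\ G p }.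

Definition poset {M : struct} (P L : M) : Prop :=
  (exists p, p ∊ P) /\
  (forall p q, op p q ∊ L -> p ∊ P /\ q ∊ P) /\
  (forall p, p ∊ P -> op p p ∊ L) /\
  (forall p q r, op p q ∊ L -> op q r ∊ L -> op p r ∊ L).
Lemma sat_poset {M : struct} {Z : ZFC M} (P L : M) :
  sat mem (forcing_poset P L) -> poset P L.
Proof.
  intros (H1 & H2 & H3 & H4). split; [|split; [|split]]; auto.
  - intros p q H. destruct (H2 _ H) as (q' & Hq & p' & Hp & E). apply sat_opair in E.
    apply op_inj in E. destruct E; subst; auto.
  - intros p Hp. apply sat_pin, H3; auto.
  - intros p q r Hp Hq. apply sat_pin. apply (H4 p q r); apply sat_pin; auto.
Qed.

(** * The forcing relation and generic filters *)

Section Forcing_relation.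
Context {M : struct} {Z : ZFC M} (P L : M) (HP : poset P L).
Implicit Types p q r s t a b x y z T : M.
Local Notation "q ⪯ p" := (op q p ∊ L) (at level 70).

Lemma lq_trans p q r : p ⪯ q -> q ⪯ r -> p ⪯ r.
Proof. apply HP. Qed.
Lemma lq_refl p : p ∊ P -> p ⪯ p.
Proof. apply HP. Qed.
Lemma lq_l p q : p ⪯ q -> p ∊ P.
Proof. apply HP. Qed.
Lemma lq_r p q : p ⪯ q -> q ∊ P.
Proof. apply HP. Qed.
Hint Resolve lq_trans lq_refl lq_l lq_r : core.

Lemma op_tc a r s : op a r ∊ s -> a ∊ tc s.
Proof.
  intros H. apply (tc_trans s (sing a)); [|apply singE; auto].
  apply (tc_trans s (op a r)); [apply tc_sub; auto|]. apply upairE; auto.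
Qed.
Lemma op_trans T a r s : trans T -> s ∊ T -> op a r ∊ s -> a ∊ T.
Proof.
  intros HT Hs H. apply (HT (sing a)); [|apply singE; auto].
  apply (HT (op a r)); [apply (HT s); auto|]. apply upairE; auto.
Qed.

Definition fsub (eqv : M -> M -> M -> Prop) p s t : Prop :=
  forall a r, op a r ∊ s -> forall q, q ⪯ p -> q ⪯ r ->
  exists q', q' ⪯ q /\ exists b r', op b r' ∊ t /\ q' ⪯ r' /\ eqv q' a b.

Lemma fsub_ext (e1 e2 : M -> M -> M -> Prop) p s t :
  (forall q a b r r', q ∊ P -> op a r ∊ s -> op b r' ∊ t -> e1 q a b -> e2 q a b) ->
  fsub e1 p s t -> fsub e2 p s t.
Proof.
  intros H H1 a r Ha q Hq Hqr. destruct (H1 a r Ha q Hq Hqr) as (q' & Hq' & b & r' & Hb & Hr & He).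
  eauto 10.
Qed.

Definition eqrel T E : Prop := forall p s t, p ∊ P -> s ∊ T -> t ∊ T ->
  (op (op p s) t ∊ E <-> fsub (fun q a b => op (op q a) b ∊ E) p s t /\
                         fsub (fun q b a => op (op q a) b ∊ E) p t s).
Lemma sat_fsub (F : M -> M -> M -> form M) (e1 : M -> M -> M -> Prop) p s t :
  (forall q a b, sat mem (F q a b) <-> e1 q a b) ->
  (sat mem (forces_sub L F p s t) <-> fsub e1 p s t).
Proof.
  intros HF. unfold forces_sub, fsub. cbn [sat]. split; intros H a r Ha q.
  - intros Hq Hr. destruct (H a r (proj2 (sat_pin _ _ _) Ha) q) as (q' & Hq' & b & r' & Hb & Hr' & He).
    { rewrite !sat_pin. auto. }
    rewrite !sat_pin in *. rewrite HF in He. eauto 10.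
  - intros [Hq Hr]. rewrite !sat_pin in *.
    destruct (H a r Ha q Hq Hr) as (q' & Hq' & b & r' & Hb & Hr' & He).
    exists q'. rewrite !sat_pin. split; auto. exists b, r'. rewrite !sat_pin, HF. auto.
Qed.
Lemma sat_eqrel T E : sat mem (eq_forcing_relation L T E) <-> eqrel T E.
Proof.
  assert (W : forall p s t, sat mem (tin p s t E ⇔
     (forces_sub L (fun q a b => tin q a b E) p s t ∧ forces_sub L (fun q b a => tin q a b E) p t s))
     <-> (op (op p s) t ∊ E <-> fsub (fun q a b => op (op q a) b ∊ E) p s t /\
                         fsub (fun q b a => op (op q a) b ∊ E) p t s)).
  { intros p s t. cbn [sat].
    rewrite sat_tin, (sat_fsub _ (fun q a b => op (op q a) b ∊ E)) by (intros; apply sat_tin).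
    rewrite (sat_fsub _ (fun q b a => op (op q a) b ∊ E)) by (intros; apply sat_tin).
    reflexivity. }
  unfold eq_forcing_relation, eqrel. split.
  - intros H p s t Hp Hs Ht. apply W. apply (H p); auto. apply sat_pin; auto.
  - intros H p Hp s Hs t Ht. apply W. apply sat_pin in Hp. apply H; eauto.
Qed.

(** Recursion on s alone: F s collects the pairs (p, t) with t in T. The clause for s then calls F
    only at names in [tc s]. *)
Lemma eqrel_exists T : trans T -> exists E, eqrel T E.
Proof.
  intros HT.
  set (fs := fun h p s t => fsub (fun q a b => op q b ∊ ap h a) p s t /\
                            fsub (fun q b a => op q b ∊ ap h a) p t s).
  assert (Hfs : Def4 fs) by (unfold fs, fsub; dfn).
  set (G := fun s h => sep (prod P T) (fun z => exists p t, z = op p t /\ fs h p s t)).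
  assert (HG : Fun2 G) by (unfold G; dfn).
  pose proof (Fun_epsrec G HG) as HF. set (F := epsrec G) in *.
  assert (HFE : forall p s t, op p t ∊ F s <-> p ∊ P /\ t ∊ T /\ fs (lam (tc s) F) p s t).
  { intros p s t. unfold F at 1. rewrite epsrec_eq by auto. unfold G at 1.
    rewrite sepE by dfn. rewrite prod_op. split.
    - intros [[Hp Ht] (p' & t' & E & H)]. apply op_inj in E. destruct E; subst. auto.
    - intros (Hp & Ht & H). split; eauto. }
  exists (sep (prod (prod P T) T) (fun z => exists p s t, z = op (op p s) t /\ op p t ∊ F s)).
  match goal with |- eqrel _ ?e => set (E := e) end.
  assert (HE : forall p s t, op (op p s) t ∊ E <-> p ∊ P /\ s ∊ T /\ t ∊ T /\ op p t ∊ F s).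
  { intros p s t. unfold E. rewrite sepE by dfn. rewrite !prod_op. split.
    - intros [[[Hp Hs] Ht] (p' & s' & t' & Eq & H)]. apply op_inj in Eq. destruct Eq as [Eq ->].
      apply op_inj in Eq. destruct Eq; subst. auto.
    - intros (Hp & Hs & Ht & H). split; eauto 8. }
  intros p s t Hp Hs Ht. rewrite HE, HFE. unfold fs. split.
  - intros (_ & _ & _ & _ & _ & H1 & H2). split.
    + revert H1. apply fsub_ext. intros q a b r r' Hq Ha Hb H.
      rewrite (ap_lam _ _ _ HF (op_tc a r s Ha)) in H. apply HE.
      pose proof (op_trans T a r s HT Hs Ha). pose proof (op_trans T b r' t HT Ht Hb). auto.
    + revert H2. apply fsub_ext. intros q b a r r' Hq Hb Ha H.
      rewrite (ap_lam _ _ _ HF (op_tc a r' s Ha)) in H. apply HE.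
      pose proof (op_trans T a r' s HT Hs Ha). pose proof (op_trans T b r t HT Ht Hb). auto.
  - intros [H1 H2]. do 5 (split; auto). split.
    + revert H1. apply fsub_ext. intros q a b r r' Hq Ha Hb H.
      rewrite (ap_lam _ _ _ HF (op_tc a r s Ha)). apply HE in H. tauto.
    + revert H2. apply fsub_ext. intros q b a r r' Hq Hb Ha H.
      rewrite (ap_lam _ _ _ HF (op_tc a r' s Ha)). apply HE in H. tauto.
Qed.

(** This makes [forces_eq] independent of the T and E that witness it. *)
Lemma eqrel_unique T E T' E' : trans T -> trans T' -> eqrel T E -> eqrel T' E' ->
  forall s t p, s ∊ T -> t ∊ T -> s ∊ T' -> t ∊ T' -> p ∊ P ->
  (op (op p s) t ∊ E -> op (op p s) t ∊ E').
Proof.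
  intros HT HT' HE HE'.
  apply (tc_ind (fun s => forall t p, s ∊ T -> t ∊ T -> s ∊ T' -> t ∊ T' -> p ∊ P ->
  (op (op p s) t ∊ E -> op (op p s) t ∊ E'))); [dfn|].
  intros s IH t p Hs Ht Hs' Ht' Hp. rewrite (HE p s t), (HE' p s t) by auto.
  intros [H1 H2]. split.
  - revert H1. apply fsub_ext. intros q a b r r' Hq Ha Hb H.
    apply IH; eauto using op_trans. eapply op_tc; eauto.
  - revert H2. apply fsub_ext. intros q b a r r' Hq Hb Ha H.
    apply IH; eauto using op_trans. eapply op_tc; eauto.
Qed.

Definition feq p s t : Prop := sat mem (forces_eq L p s t).
Lemma Def_feq : Def3 feq.
Proof.
  unfold feq. apply (D_uniform (fun X e => forces_eq (e 0) (e 1) (e 2) (e 3)) 3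
    (fun e => scons L (scons (e 0) (scons (e 1) (scons (e 2) (fun _ => L)))))); [utac|].
  repeat apply TmE_scons; try apply TmE_const; dfn.
Qed.
Hint Resolve Def_feq : dfn.
Lemma feq_rel T E p s t : trans T -> eqrel T E -> p ∊ P -> s ∊ T -> t ∊ T ->
  (feq p s t <-> op (op p s) t ∊ E).
Proof.
  intros HT HE Hp Hs Ht. unfold feq, forces_eq. cbn [sat]. split.
  - intros (T' & E' & HT' & Hs' & Ht' & HE' & H). rewrite sat_trans in HT'.
    rewrite sat_eqrel in HE'. rewrite sat_tin in H. revert H. eapply (eqrel_unique T' E' T E); eauto.
  - intros H. exists T, E. rewrite sat_trans, sat_eqrel, sat_tin. auto.
Qed.
Lemma feq_eq p s t : p ∊ P -> (feq p s t <-> fsub feq p s t /\ fsub (fun q b a => feq q a b) p t s).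
Proof.
  intros Hp. set (T := tc (upair s t)).
  assert (HT : trans T) by apply tc_trans.
  assert (Hs : s ∊ T) by (apply tc_sub, upairE; auto).
  assert (Ht : t ∊ T) by (apply tc_sub, upairE; auto).
  destruct (eqrel_exists T HT) as [E HE]. rewrite (feq_rel T E) by auto. rewrite (HE p s t) by auto.
  assert (W : forall q a b r r', q ∊ P -> op a r ∊ s -> op b r' ∊ t ->
            (feq q a b <-> op (op q a) b ∊ E)).
  { intros q a b r r' Hq Ha Hb. apply (feq_rel T E); eauto using op_trans. }
  split; intros [H1 H2]; split; [revert H1|revert H2|revert H1|revert H2]; apply fsub_ext;
    intros q a b r r' Hq Ha Hb; [apply (W q a b r r')|apply (W q b a r' r)|apply (W q a b r r')
    |apply (W q b a r' r)]; auto.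
Qed.

Definition fmem p s t : Prop := sat mem (forces_mem L p s t).
Lemma Def_fmem : Def3 fmem.
Proof.
  unfold fmem. apply (D_uniform (fun X e => forces_mem (e 0) (e 1) (e 2) (e 3)) 3
    (fun e => scons L (scons (e 0) (scons (e 1) (scons (e 2) (fun _ => L)))))); [utac|].
  repeat apply TmE_scons; try apply TmE_const; dfn.
Qed.
Lemma fmemE p s t : fmem p s t <-> forall q, q ⪯ p ->
  exists q', q' ⪯ q /\ exists b r, op b r ∊ t /\ q' ⪯ r /\ feq q' s b.
Proof.
  unfold fmem, forces_mem. cbn [sat]. split; intros H q Hq.
  - destruct (H q) as (q' & Hq' & b & r & Hb & Hr & He); [apply sat_pin; auto|].
    rewrite sat_pin in *. eauto 8.
  - apply sat_pin in Hq. destruct (H q Hq) as (q' & Hq' & b & r & Hb & Hr & He).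
    exists q'. rewrite sat_pin. split; auto. exists b, r. rewrite !sat_pin. auto.
Qed.

Lemma feq_mono p q s t : q ⪯ p -> feq p s t -> feq q s t.
Proof.
  intros Hq. rewrite !feq_eq by eauto. intros [H1 H2].
  split; intros a r Ha q' Hq' Hr; [apply (H1 a r)|apply (H2 a r)]; eauto.
Qed.
Lemma feq_dens p s t : p ∊ P -> (forall q, q ⪯ p -> exists q', q' ⪯ q /\ feq q' s t) -> feq p s t.
Proof.
  intros Hp H. apply feq_eq; auto.
  split; intros a r Ha q Hq Hr; destruct (H q Hq) as (q1 & Hq1 & H1);
    apply feq_eq in H1; eauto; destruct H1 as [H1 H2].
  - destruct (H1 a r Ha q1) as (q' & Hq' & Hrest); eauto.
  - destruct (H2 a r Ha q1) as (q' & Hq' & Hrest); eauto.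
Qed.
Lemma feq_refl s : forall p, p ∊ P -> feq p s s.
Proof.
  revert s. apply (tc_ind (fun s => forall p, p ∊ P -> feq p s s)); [dfn|].
  intros s IH p Hp. apply feq_eq; auto.
  split; intros a r Ha q Hq Hr; exists q; (split; [eauto|]); exists a, r;
    (split; [auto|split; [auto|]]); apply IH; eauto using op_tc.
Qed.
Lemma feq_sym s : forall t p, p ∊ P -> feq p s t -> feq p t s.
Proof.
  revert s. apply (tc_ind (fun s => forall t p, p ∊ P -> feq p s t -> feq p t s)); [dfn|].
  intros s IH t p Hp. rewrite !feq_eq by auto. intros [H1 H2]. split.
  - intros b r Hb q Hq Hr. destruct (H2 b r Hb q Hq Hr) as (q' & Hq' & a & r' & Ha & Hr' & He).
    exists q'. split; auto. exists a, r'. split; auto. split; auto. apply IH; eauto using op_tc.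
  - intros a r Ha q Hq Hr. destruct (H1 a r Ha q Hq Hr) as (q' & Hq' & b & r' & Hb & Hr' & He).
    exists q'. split; auto. exists b, r'. split; auto. split; auto. apply IH; eauto using op_tc.
Qed.
Lemma feq_trans s : forall t u p, p ∊ P -> feq p s t -> feq p t u -> feq p s u.
Proof.
  revert s. apply (tc_ind (fun s => forall t u p, p ∊ P -> feq p s t -> feq p t u -> feq p s u)); [dfn|].
  intros s IH t u p Hp. rewrite !feq_eq by auto. intros [H1 H2] [H3 H4]. split.
  - intros a r Ha q Hq Hr. destruct (H1 a r Ha q Hq Hr) as (q1 & Hq1 & b & r1 & Hb & Hr1 & He).
    destruct (H3 b r1 Hb q1) as (q2 & Hq2 & c & r2 & Hc & Hr2 & He2); eauto.
    exists q2. split; eauto. exists c, r2. split; auto. split; auto.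
    apply (IH a) with b; eauto using op_tc, feq_mono.
  - intros c r Hc q Hq Hr. destruct (H4 c r Hc q Hq Hr) as (q1 & Hq1 & b & r1 & Hb & Hr1 & He).
    destruct (H2 b r1 Hb q1) as (q2 & Hq2 & a & r2 & Ha & Hr2 & He2); eauto.
    exists q2. split; eauto. exists a, r2. split; auto. split; auto.
    apply (IH a) with b; eauto using op_tc, feq_mono.
Qed.
Lemma fmem_mono p q s t : q ⪯ p -> fmem p s t -> fmem q s t.
Proof. intros Hq. rewrite !fmemE. eauto. Qed.
Lemma fmem_dens p s t : (forall q, q ⪯ p -> exists q', q' ⪯ q /\ fmem q' s t) -> fmem p s t.
Proof.
  intros H. apply fmemE. intros q Hq. destruct (H q Hq) as (q1 & Hq1 & H1). rewrite fmemE in H1.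
  destruct (H1 q1) as (q' & Hq' & Hrest); eauto.
Qed.
Lemma fmem_intro a r t p : op a r ∊ t -> p ⪯ r -> fmem p a t.
Proof.
  intros Ha Hp. apply fmemE. intros q Hq. exists q. split; eauto. exists a, r.
  split; auto. split; eauto. apply feq_refl; eauto.
Qed.
Lemma fmem_eq_l p s s' t : fmem p s t -> feq p s s' -> fmem p s' t.
Proof.
  intros H He. apply fmemE. intros q Hq. rewrite fmemE in H.
  destruct (H q Hq) as (q' & Hq' & b & r & Hb & Hr & He'). exists q'. split; auto.
  exists b, r. split; auto. split; auto. apply (feq_trans s' s b); eauto.
  apply feq_sym; eauto. apply (feq_mono p); eauto.
Qed.
Lemma fmem_eq_r p s t t' : fmem p s t -> feq p t t' -> fmem p s t'.
Proof.
  intros H He. apply fmemE. intros q Hq. rewrite fmemE in H.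
  destruct (H q Hq) as (q1 & Hq1 & b & r & Hb & Hr & He1).
  rewrite feq_eq in He by eauto. destruct He as [He _].
  destruct (He b r Hb q1) as (q2 & Hq2 & b' & r' & Hb' & Hr' & He2); eauto.
  exists q2. split; eauto. exists b', r'. split; auto. split; auto.
  apply (feq_trans s b b'); eauto. apply (feq_mono q1); eauto.
Qed.

Definition frc p (f : form M) : Prop := sat mem (forces L p f).
Lemma frc_mono f : forall p q, q ⪯ p -> frc p f -> frc q f.
Proof.
  unfold frc. induction f; intros p q Hq; cbn [forces sat].
  - apply fmem_mono; auto.
  - apply feq_mono; auto.
  - tauto.
  - intros H r Hr. apply H. apply sat_pin. apply sat_pin in Hr. eauto.
  - intros [H1 H2]. eauto.
  - intros H' r Hr. apply H'. apply sat_pin. apply sat_pin in Hr. eauto.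
  - intros H' s. eauto.
  - intros H' r Hr. apply H'. apply sat_pin. apply sat_pin in Hr. eauto.
Qed.
Lemma frc_dens f : forall p, p ∊ P -> (forall q, q ⪯ p -> exists q', q' ⪯ q /\ frc q' f) -> frc p f.
Proof.
  unfold frc. induction f as [s t|s t| |g IHg h IHh|g IHg h IHh|g IHg h IHh|g IHg|g IHg];
    intros p Hp; cbn [forces sat].
  - intros. apply fmem_dens; auto.
  - intros. apply feq_dens; auto.
  - intros H. destruct (H p) as (q & _ & []). auto.
  - intros H q Hq Hg. apply sat_pin in Hq. apply IHh; eauto. intros r Hr.
    destruct (H r) as (r' & Hr' & Hrest); eauto. exists r'. split; auto.
    apply Hrest; [apply sat_pin; eauto|]. apply (frc_mono g q); eauto.
  - intros H. split; [apply IHg|apply IHh]; auto; intros q Hq; destruct (H q Hq) as (q' & Hq' & H1 & H2);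
      eauto.
  - intros H q Hq. apply sat_pin in Hq. destruct (H q Hq) as (q' & Hq' & H1).
    destruct (H1 q') as (q'' & Hq'' & H2); [apply sat_pin; eauto|]. exists q''. split; auto.
    apply sat_pin in Hq''. apply sat_pin. eauto.
  - intros H s. apply IHg; auto. intros q Hq. destruct (H q Hq) as (q' & Hq' & H1). eauto.
  - intros H q Hq. apply sat_pin in Hq. destruct (H q Hq) as (q' & Hq' & H1).
    destruct (H1 q') as (q'' & Hq'' & H2); [apply sat_pin; eauto|]. exists q''. split; auto.
    apply sat_pin in Hq''. apply sat_pin. eauto.
Qed.
Lemma D_frc f k (p : (nat -> M) -> M) te : Tm k p -> TmE k te -> D k (fun e => frc (p e) (dinst f (te e))).
Proof.
  intros Hp Ht. unfold frc.
  apply (D_uniform (fun X e => forces (e 0) (e 1) (dinst f (fun n => e (S (S n))))) k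
    (fun e => scons L (scons (p e) (te e)))).
  - apply (U_forces_dinst f 0 1 (fun n => S (S n))).
  - apply TmE_scons; [dfn|]. apply TmE_scons; auto.
Qed.

(** G is a collection of elements seen from outside the model, and it meets every dense class that
    is definable with parameters, not only the dense sets. *)
Definition filter (G : M -> Prop) : Prop :=
  (forall p, G p -> p ∊ P) /\ (forall p q, G p -> p ⪯ q -> G q) /\
  (forall p q, G p -> G q -> exists r, G r /\ r ⪯ p /\ r ⪯ q) /\
  (forall U, Def1 U -> (forall p, p ∊ P -> exists q, q ⪯ p /\ U q) -> exists p, G p /\ U p).

Lemma emb_inj f : forall g, emb f = emb g -> f = g.
Proof. induction f; destruct g; cbn; intros H; inversion H; subst; f_equal; auto. Qed.

(** There are countably many formulas and all parameters are among their variables, so the definable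
    dense classes can be met one after the other. *)
Lemma generic_exists p : p ∊ P -> exists G, filter G /\ G p.
Proof.
  intros Hp.
  destruct (surj_of_inj fml fBot (fun f => enc_fm (emb f))) as [g Hg].
  { intros x y H. apply emb_inj, enc_fm_inj; auto. }
  set (U := fun n x => sat (@mem M) (inst (g n) (app 1 (fun _ => x)))).
  set (nxt := fun n q => the (fun q' => q' ⪯ q /\ ((exists r, r ⪯ q /\ U n r) -> U n q'))).
  assert (Hnxt : forall n q, q ∊ P -> nxt n q ⪯ q /\ ((exists r, r ⪯ q /\ U n r) -> U n (nxt n q))).
  { intros n q Hq. apply (the_spec (fun q' => q' ⪯ q /\ ((exists r, r ⪯ q /\ U n r) -> U n q'))).
    destruct (classic (exists r, r ⪯ q /\ U n r)) as [(r & Hr & Hu)|Hn]; eauto.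
    exists q. split; auto. tauto. }
  set (sq := fix sq n := match n with 0 => p | S n => nxt n (sq n) end).
  assert (Hsq : forall n, sq n ∊ P).
  { induction n; cbn; auto. apply (lq_l _ (sq n)). apply Hnxt; auto. }
  assert (Hdec : forall n m, n <= m -> sq m ⪯ sq n).
  { intros n m H. induction H; auto. apply (lq_trans _ (sq m)); auto. apply Hnxt; auto. }
  exists (fun x => exists n, sq n ⪯ x). split; [|exists 0; auto].
  split; [|split; [|split]].
  - intros q (n & H). eauto.
  - intros q r (n & H) Hr. eauto.
  - intros q r (n & Hn) (m & Hm). exists (sq (max n m)). split; [exists (max n m); auto|].
    split; [apply (lq_trans _ (sq n))|apply (lq_trans _ (sq m))]; auto; apply Hdec; lia.
  - intros W [f Hf] Hd. destruct (Hg f) as [n Hn].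
    assert (HU : forall x, U n x <-> W x).
    { intros x. unfold U. rewrite Hn, Hf. reflexivity. }
    exists (sq (S n)). split; [exists (S n); auto|]. apply HU. cbn. apply Hnxt; auto.
    destruct (Hd (sq n) (Hsq n)) as (q & Hq & HWq). exists q. rewrite HU. auto.
Qed.

Lemma filter_below G p (U : M -> Prop) : filter G -> Def1 U -> G p ->
  (forall q, q ⪯ p -> exists q', q' ⪯ q /\ U q') -> exists q, G q /\ U q /\ q ⪯ p.
Proof.
  intros (H1 & H2 & H3 & H4) HU Hp Hd.
  destruct (H4 (fun q => (q ⪯ p /\ U q) \/ ~ exists r, r ⪯ q /\ r ⪯ p)) as (q & Hq & H); [dfn|..].
  - intros q Hq. destruct (classic (exists r, r ⪯ q /\ r ⪯ p)) as [(r & Hr & Hrp)|Hn].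
    + destruct (Hd r Hrp) as (q' & Hq' & HUq). exists q'. split; eauto.
    + exists q. auto.
  - destruct H as [[Hqp HUq]|Hn]; eauto. exfalso. destruct (H3 p q Hp Hq) as (r & _ & Hr & Hr').
    eauto.
Qed.

(** * The generic extension *)

Section Extension.
Context (G : M -> Prop) (HG : filter G).
Let Gin : forall p, G p -> p ∊ P := proj1 HG.
Let Gup : forall p q, G p -> p ⪯ q -> G q := proj1 (proj2 HG).
Let Gdir : forall p q, G p -> G q -> exists r, G r /\ r ⪯ p /\ r ⪯ q := proj1 (proj2 (proj2 HG)).
Let Gmeet := proj2 (proj2 (proj2 HG)).

Definition seq s t : Prop := exists p, G p /\ feq p s t.
Lemma seq_refl s : seq s s.
Proof.
  destruct (Gmeet (fun _ => True)) as (p & Hp & _); [dfn|eauto|].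
  exists p. split; auto. apply feq_refl; auto.
Qed.
Lemma seq_sym s t : seq s t -> seq t s.
Proof. intros (p & Hp & H). exists p. split; auto. apply feq_sym; auto. Qed.
Lemma seq_trans s t u : seq s t -> seq t u -> seq s u.
Proof.
  intros (p & Hp & H) (q & Hq & H'). destruct (Gdir p q Hp Hq) as (r & Hr & Hrp & Hrq).
  exists r. split; auto. apply (feq_trans s t u); eauto using feq_mono.
Qed.

(** The model may be ill-founded from outside, so names cannot be evaluated by recursion. Elements
    of the extension are classes of names that G makes equal. *)
Definition ecar : Type := {C : M -> Prop | exists s, C = seq s}.
Definition ev_val (s : M) : ecar := exist _ (seq s) (ex_intro _ s eq_refl).
Lemma ecar_eq s t : ev_val s = ev_val t <-> seq s t.
Proof.
  split.
  - intros H. apply (f_equal (@proj1_sig _ _)) in H. cbn in H. rewrite H. apply seq_refl.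
  - intros H. assert (E : seq s = seq t).
    { extensionality u. apply propositional_extensionality. split; intros Hu.
      - eapply seq_trans; [apply seq_sym|]; eauto.
      - eapply seq_trans; eauto. }
    unfold ev_val. revert E. generalize (seq s) (ex_intro (fun s' => seq s = seq s') s eq_refl).
    intros C HC ->. f_equal. apply proof_irrelevance.
Qed.
Lemma ecar_surj (y : ecar) : exists s, y = ev_val s.
Proof.
  destruct y as [C [s Hs]]. exists s. subst. unfold ev_val. f_equal.
Qed.
Definition emem (x y : ecar) : Prop :=
  exists s t p, x = ev_val s /\ y = ev_val t /\ G p /\ fmem p s t.
Lemma emem_val s t : emem (ev_val s) (ev_val t) <-> exists p, G p /\ fmem p s t.
Proof.
  split; [|intros (p & Hp & H); exists s, t, p; auto].
  intros (s' & t' & p & Hs & Ht & Hp & H). apply ecar_eq in Hs, Ht.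
  apply seq_sym in Hs. destruct Hs as (p1 & Hp1 & Hs).
  apply seq_sym in Ht. destruct Ht as (p2 & Hp2 & Ht).
  destruct (Gdir p p1 Hp Hp1) as (r & Hr & Hrp & Hr1).
  destruct (Gdir r p2 Hr Hp2) as (r' & Hr' & Hrr & Hr2).
  exists r'. split; auto. apply (fmem_eq_r _ _ t'); eauto using feq_mono.
  apply (fmem_eq_l _ s'); eauto using feq_mono, fmem_mono.
Qed.
Lemma eenum_surj : forall x : ecar, exists n, ev_val (enum n) = x.
Proof.
  intros x. destruct (ecar_surj x) as [s ->]. destruct (enum_surj M s) as [n Hn].
  exists n. congruence.
Qed.
Definition estr : struct := Struct ecar emem (fun n => ev_val (enum n)) eenum_surj.
Definition ival : M -> estr := ev_val.

Lemma ival_eq s t : ival s = ival t <-> seq s t.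
Proof. apply ecar_eq. Qed.
Lemma ival_mem (y : estr) t : y ∊ ival t <-> exists b r, op b r ∊ t /\ G r /\ y = ival b.
Proof.
  destruct (ecar_surj y) as [s ->]. split.
  - intros H. apply (emem_val s t) in H. destruct H as (p & Hp & H). rewrite fmemE in H.
    destruct (filter_below G p (fun q => exists b r, op b r ∊ t /\ q ⪯ r /\ feq q s b) HG)
      as (q & Hq & (b & r & Hb & Hr & He) & _); auto; [dfn|].
    exists b, r. split; auto. split; eauto. apply ecar_eq. exists q; auto.
  - intros (b & r & Hb & Hr & E). rewrite E. apply (emem_val b t). exists r. split; auto.
    eapply fmem_intro; eauto.
Qed.

Lemma ival_scons (s : M) e : (fun n => ival (scons s e n)) = scons (ival s) (fun n => ival (e n)).
Proof. extensionality n. destruct n; reflexivity. Qed.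

Lemma decide_frc f e : exists p, G p /\ (frc p (dinst f e) \/ forall q, q ⪯ p -> ~ frc q (dinst f e)).
Proof.
  apply Gmeet.
  - apply D_or; [|apply D_all, D_imp; [dfn|apply D_not]];
      [apply (D_frc f 1 (fun e => e 0) (fun _ => e))|apply (D_frc f 2 (fun e => e 0) (fun _ => e))];
      try apply TmE_const; dfn.
  - intros p Hp. destruct (classic (exists q, q ⪯ p /\ frc q (dinst f e))) as [(q & Hq & H)|Hn]; eauto.
    exists p. split; auto. right. intros q Hq H. apply Hn; eauto.
Qed.

Theorem truth f : forall e,
  sat (@mem estr) (dinst f (fun n => ival (e n))) <-> exists p, G p /\ frc p (dinst f e).
Proof.
  induction f; intros e.
  - apply emem_val.
  - apply ecar_eq.
  - cbn. split; [tauto|]. intros (p & _ & []).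
  - cbn [dinst sat]. rewrite IHf1, IHf2. split.
    + intros H. destruct (decide_frc f2 e) as (p & Hp & [H2|H2]).
      * exists p. split; auto. intros q Hq _. apply sat_pin in Hq. eapply frc_mono; eauto.
      * destruct (decide_frc f1 e) as (p' & Hp' & [H1|H1]).
        -- exfalso. destruct H as (q & Hq & Hf2); eauto.
           destruct (Gdir p q Hp Hq) as (r & Hr & Hrp & Hrq). apply (H2 r); auto.
           eapply frc_mono; eauto.
        -- exists p'. split; auto. intros q Hq Hf. apply sat_pin in Hq. exfalso. eapply H1; eauto.
    + intros (p & Hp & H) (q & Hq & Hf). destruct (Gdir p q Hp Hq) as (r & Hr & Hrp & Hrq).
      exists r. split; auto. apply H; [apply sat_pin; auto|]. eapply frc_mono; eauto.
  - cbn [dinst sat]. rewrite IHf1, IHf2. split.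
    + intros [(p & Hp & H1) (q & Hq & H2)]. destruct (Gdir p q Hp Hq) as (r & Hr & Hrp & Hrq).
      exists r. split; auto. split; [apply (frc_mono _ p)|apply (frc_mono _ q)]; auto.
    + intros (p & Hp & H1 & H2). split; exists p; auto.
  - cbn [dinst sat]. rewrite IHf1, IHf2. split.
    + intros [(p & Hp & H)|(p & Hp & H)]; exists p; (split; auto); intros q Hq; apply sat_pin in Hq;
        exists q; (split; [apply sat_pin; eauto|]); [left|right]; eapply frc_mono; eauto.
    + intros (p & Hp & H). destruct (decide_frc f1 e) as (q & Hq & [H1|H1]); eauto.
      destruct (decide_frc f2 e) as (q' & Hq' & [H2|H2]); eauto. exfalso.
      destruct (Gdir p q Hp Hq) as (r & Hr & Hrp & Hrq).
      destruct (Gdir r q' Hr Hq') as (r' & Hr' & Hrr & Hrq').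
      destruct (H r') as (s & Hs & Hor); [apply sat_pin; eauto|]. apply sat_pin in Hs.
      destruct Hor; [apply (H1 s)|apply (H2 s)]; eauto.
  - cbn [dinst sat]. split.
    + intros H.
      destruct (Gmeet (fun p => frc p (dinst (gAll f) e) \/
         exists s, forall q, q ⪯ p -> ~ frc q (dinst f (scons s e)))) as (p & Hp & [Ha|(s & Hs)]).
      * apply D_or; [apply (D_frc (gAll f) 1 (fun e => e 0) (fun _ => e)); [dfn|apply TmE_const]|].
        apply D_ex, D_all, D_imp; [dfn|apply D_not].
        apply (D_frc f 3 (fun e => e 0) (fun e' => scons (e' 1) e)); [dfn|].
        apply TmE_scons; [dfn|apply TmE_const].
      * intros p Hp. destruct (classic (exists q s, q ⪯ p /\
           forall r, r ⪯ q -> ~ frc r (dinst f (scons s e)))) as [(q & s & Hq & Hs)|Hn].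
        -- exists q. split; eauto.
        -- exists p. split; auto. left. intros s. apply frc_dens; auto. intros q Hq.
           apply NNPP. intros Hn'. apply Hn. exists q, s. split; auto. intros r Hr Hf.
           apply Hn'. eauto.
      * eauto.
      * exfalso. specialize (H (ival s)). rewrite <- ival_scons, IHf in H.
        destruct H as (q & Hq & Hf). destruct (Gdir p q Hp Hq) as (r & Hr & Hrp & Hrq).
        apply (Hs r); auto. eapply frc_mono; eauto.
    + intros (p & Hp & H) x. destruct (ecar_surj x) as [s ->]. fold (ival s).
      rewrite <- ival_scons, IHf. exists p. split; auto. apply H.
  - cbn [dinst sat]. split.
    + intros [x Hx]. destruct (ecar_surj x) as [s ->]. fold (ival s) in Hx.
      rewrite <- ival_scons, IHf in Hx. destruct Hx as (p & Hp & H). exists p. split; auto.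
      intros q Hq. apply sat_pin in Hq. exists q. split; [apply sat_pin; eauto|]. exists s.
      eapply frc_mono; eauto.
    + intros (p & Hp & H).
      destruct (filter_below G p (fun q => exists s, frc q (dinst f (scons s e))) HG)
        as (q & Hq & (s & Hs) & _); auto.
      * apply D_ex. apply (D_frc f 2 (fun e => e 1) (fun e' => scons (e' 0) e)); [dfn|].
        apply TmE_scons; [dfn|apply TmE_const].
      * intros q Hq. destruct (H q) as (q' & Hq' & s & Hs); [apply sat_pin; auto|].
        apply sat_pin in Hq'. exists q'. eauto.
      * exists (ival s). rewrite <- ival_scons, IHf. eauto.
Qed.
Ltac dfn_extra ::=
  match goal with
  | |- Tm _ (fun e => sep _ _) => simple apply Tm_sep
  | |- Tm _ (fun e => im _ _) => simple apply Tm_im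
  | |- Tm _ (fun e => lam _ _) => simple apply Tm_lam
  | |- Tm _ (fun e => lord _) => simple apply Tm_lord
  | |- TmE _ (fun _ => ?c) => apply TmE_const
  | |- TmE _ (fun e => scons _ _) => simple apply TmE_scons
  | |- D _ (fun e => frc _ (dinst _ _)) => simple apply D_frc
  end.
Lemma Gex : exists p, G p.
Proof. destruct (Gmeet (fun _ => True)) as (p & Hp & _); [dfn|eauto|eauto]. Qed.
Lemma isurj (y : estr) : exists s, y = ival s.
Proof. apply ecar_surj. Qed.
Lemma ienv (e : nat -> estr) : exists e' : nat -> M, e = fun n => ival (e' n).
Proof.
  exists (fun n => the (fun s => e n = ival s)). extensionality n.
  apply (the_spec (fun s => e n = ival s)). apply isurj.
Qed.
Lemma imem s t : ival s ∊ ival t <-> exists p, G p /\ fmem p s t.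
Proof. apply emem_val. Qed.

Lemma e_ext (x y : estr) : (forall z : estr, z ∊ x <-> z ∊ y) -> x = y.
Proof.
  destruct (isurj x) as [s ->], (isurj y) as [t ->]. intros H. apply ival_eq.
  destruct (Gmeet (fun p => feq p s t \/
     (exists a r, op a r ∊ s /\ p ⪯ r /\ forall q, q ⪯ p -> ~ fmem q a t) \/
     (exists a r, op a r ∊ t /\ p ⪯ r /\ forall q, q ⪯ p -> ~ fmem q a s)))
    as (p & Hp & [He|[(a & r & Ha & Hr & Hn)|(a & r & Ha & Hr & Hn)]]).
  - pose proof Def_fmem. dfn.
  - intros p Hp. destruct (classic (feq p s t)) as [He|He]; [exists p; auto|].
    rewrite feq_eq in He by auto. apply not_and_or in He.
    destruct He as [He|He]; unfold fsub in He; apply not_all_ex_not in He; destruct He as [a He];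
      apply not_all_ex_not in He; destruct He as [r He]; apply imply_to_and in He;
      destruct He as [Ha He]; apply not_all_ex_not in He; destruct He as [q He];
      apply imply_to_and in He; destruct He as [Hq He]; apply imply_to_and in He;
      destruct He as [Hr He]; exists q; (split; [auto|]); right; [left|right];
      exists a, r; (split; [auto|split; [auto|]]); intros q' Hq' Hm; rewrite fmemE in Hm;
      (destruct (Hm q') as (q2 & Hq2 & b & r' & Hb & Hr' & Heq); [eauto|]); apply He;
      exists q2; (split; [eauto|]); exists b, r'; (split; [auto|split; [auto|]]); auto.
    apply feq_sym; eauto.
  - exists p; auto.
  - exfalso. assert (Hm : ival a ∊ ival t).
    { apply H. apply ival_mem. exists a, r. split; auto. split; eauto. }
    apply imem in Hm. destruct Hm as (q & Hq & Hm).
    destruct (Gdir p q Hp Hq) as (r' & _ & H1 & H2). apply (Hn r' H1). eapply fmem_mono; eauto.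
  - exfalso. assert (Hm : ival a ∊ ival s).
    { apply H. apply ival_mem. exists a, r. split; auto. split; eauto. }
    apply imem in Hm. destruct Hm as (q & Hq & Hm).
    destruct (Gdir p q Hp Hq) as (r' & _ & H1 & H2). apply (Hn r' H1). eapply fmem_mono; eauto.
Qed.

(** Every member of a is attached to every condition, so the value consists of the values of all
    members of a. *)
Definition mk (a : M) : M := prod a P.
Lemma mk_mem (y : estr) a : y ∊ ival (mk a) <-> exists b, b ∊ a /\ y = ival b.
Proof.
  rewrite ival_mem. unfold mk. split.
  - intros (b & r & Hb & _ & ->). apply prod_op in Hb. exists b. tauto.
  - intros (b & Hb & ->). destruct Gex as [p Hp]. exists b, p. rewrite prod_op. auto.
Qed.
Lemma Fun_mk : Fun1 mk.
Proof. unfold mk. dfn. Qed.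

Definition chk : M -> M := epsrec (fun x h => prod (im (ap h) x) P).
Lemma Fun_chk : Fun1 chk.
Proof. apply Fun_epsrec. dfn. Qed.
Hint Resolve Fun_mk Fun_chk Def_feq Def_fmem : dfn.
Lemma chk_eq x : chk x = mk (im chk x).
Proof.
  unfold chk at 1. rewrite epsrec_eq by dfn. unfold mk. f_equal. apply ext. intros z.
  rewrite !imE by dfn. split; intros (y & Hy & ->); exists y; split; auto.
  - rewrite ap_lam; auto; [dfn|]. apply tc_sub; auto.
  - rewrite ap_lam; auto; [dfn|]. apply tc_sub; auto.
Qed.
Lemma chk_mem x (y : estr) : y ∊ ival (chk x) <-> exists x', x' ∊ x /\ y = ival (chk x').
Proof.
  rewrite chk_eq, mk_mem. split.
  - intros (b & Hb & ->). apply imE in Hb; [|dfn]. destruct Hb as (x' & Hx & ->). eauto.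
  - intros (x' & Hx & ->). exists (chk x'). split; auto. apply imE; [dfn|eauto].
Qed.
Lemma chk_op a r x : op a r ∊ chk x <-> r ∊ P /\ exists y, y ∊ x /\ a = chk y.
Proof.
  rewrite chk_eq. unfold mk. rewrite prod_op, imE by dfn. tauto.
Qed.
Lemma chk_feq x : forall y p, p ∊ P -> feq p (chk x) (chk y) -> x = y.
Proof.
  revert x. apply (eps_ind (fun x => forall y p, p ∊ P -> feq p (chk x) (chk y) -> x = y)); [dfn|].
  intros x IH y p Hp H. rewrite feq_eq in H by auto. destruct H as [H1 H2].
  apply ext. intros z. split; intros Hz.
  - destruct (H1 (chk z) p) with (q := p) as (q' & Hq & b & r' & Hb & Hr & He); auto.
    { apply chk_op. eauto. }
    apply chk_op in Hb. destruct Hb as (_ & z' & Hz' & ->).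
    rewrite (IH z Hz z' q'); eauto.
  - destruct (H2 (chk z) p) with (q := p) as (q' & Hq & b & r' & Hb & Hr & He); auto.
    { apply chk_op. eauto. }
    apply chk_op in Hb. destruct Hb as (_ & z' & Hz' & ->).
    rewrite <- (IH z' Hz' z q'); eauto.
Qed.
Lemma chk_inj x y : ival (chk x) = ival (chk y) -> x = y.
Proof. intros H. apply ival_eq in H. destruct H as (p & Hp & H). eapply chk_feq; eauto. Qed.

Lemma sep_name f (t : M) (e : nat -> M) : exists u, forall y : estr, y ∊ ival u <->
  y ∊ ival t /\ sat mem (dinst f (scons y (fun n => ival (e n)))).
Proof.
  set (g := gAnd (gMem 0 1) (ren (up S) f)).
  assert (Hg : forall b, sat (@mem estr) (dinst g (fun n => ival (scons b (scons t e) n))) <->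
     ival b ∊ ival t /\ sat mem (dinst f (scons (ival b) (fun n => ival (e n))))).
  { intros b. cbn. rewrite dinst_ren.
    replace (fun n => ival (scons b (scons t e) (up S n)))
      with (scons (ival b) (fun n => ival (e n))); [reflexivity|].
    extensionality n. destruct n; reflexivity. }
  assert (HD : Def2 (fun b p => frc p (dinst g (scons b (scons t e))))).
  { apply (D_frc g 2 (fun e => e 1) (fun e' => scons (e' 0) (scons t e))); [dfn|].
    apply TmE_scons; [dfn|apply TmE_const]. }
  exists (sep (prod (dom t) P) (fun z => exists b p, z = op b p /\
     frc p (dinst g (scons b (scons t e))))).
  intros y. rewrite ival_mem. split.
  - intros (b & r & Hb & Hr & ->). apply Hg, truth. apply sepE in Hb; [|dfn].
    destruct Hb as [_ (b' & p & E & H)]. apply op_inj in E. destruct E; subst. eauto.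
  - intros [Hy H]. apply ival_mem in Hy. destruct Hy as (b & r & Hb & Hr & ->).
    assert (Hs : sat (@mem estr) (dinst g (fun n => ival (scons b (scons t e) n)))).
    { apply Hg. split; auto. apply ival_mem. eauto. }
    apply truth in Hs. destruct Hs as (p & Hp & Hf). exists b, p. split; auto.
    apply sepE; [dfn|]. split; [|eauto]. apply prod_op. rewrite domE. eauto.
Qed.

(** Induction on names: if some name occurring in s can still be forced into t, pass to that name;
    otherwise s is already forced to be minimal. *)
Lemma e_foundation (x : estr) : (exists y : estr, y ∊ x) ->
  exists y : estr, y ∊ x /\ forall z : estr, z ∊ y -> ~ z ∊ x.
Proof.
  destruct (isurj x) as [t ->]. intros [y Hy]. destruct (isurj y) as [s ->].
  apply imem in Hy. destruct Hy as (p & Hp & H).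
  assert (W : forall s p, p ∊ P -> fmem p s t -> exists q, q ⪯ p /\ exists s', fmem q s' t /\
     forall s'' r, op s'' r ∊ s' -> forall q', q' ⪯ q -> ~ fmem q' s'' t).
  { clear - Z HP t. apply (tc_ind (fun s => forall p, p ∊ P -> fmem p s t -> exists q, q ⪯ p /\ exists s',
      fmem q s' t /\ forall s'' r, op s'' r ∊ s' -> forall q', q' ⪯ q -> ~ fmem q' s'' t)); [dfn|].
    intros s IH p Hp H.
    destruct (classic (exists s'' r q', op s'' r ∊ s /\ q' ⪯ p /\ fmem q' s'' t))
      as [(s'' & r & q' & Hs & Hq & Hm)|Hn].
    - destruct (IH s'') with (p := q') as (q & Hq' & Hrest); eauto using op_tc.
    - exists p. split; auto. exists s. split; auto. intros s'' r Hs q' Hq Hm. apply Hn. eauto 8. }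
  destruct (filter_below G p (fun q => exists s', fmem q s' t /\
     forall s'' r, op s'' r ∊ s' -> forall q', q' ⪯ q -> ~ fmem q' s'' t) HG)
    as (q & Hq & (s' & Hs' & Hn) & _); auto.
  - dfn.
  - intros q Hq. apply (W s); eauto using fmem_mono.
  - exists (ival s'). split; [apply imem; eauto|]. intros z Hz Hzt.
    apply ival_mem in Hz. destruct Hz as (s'' & r & Hs'' & _ & ->).
    apply imem in Hzt. destruct Hzt as (q' & Hq' & Hm).
    destruct (Gdir q q' Hq Hq') as (r' & _ & H1 & H2). apply (Hn s'' r Hs'' r' H1).
    eapply fmem_mono; eauto.
Qed.

(** Collection in the ground model, applied to pairs of a name from [dom t] and a condition,
    provides a set of names that contains enough witnesses. *)
Lemma e_replacement (f : fml) (e : nat -> estr) (a : estr) :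
  (forall x : estr, x ∊ a -> exists y : estr, sat mem (inst f (scons x (scons y e)))) ->
  exists b : estr, forall x : estr, x ∊ a -> exists y : estr, y ∊ b /\ sat mem (inst f (scons x (scons y e))).
Proof.
  destruct (isurj a) as [t ->], (ienv e) as [e' ->]. intros H.
  set (g := emb f).
  assert (Hg : forall b w, sat (@mem estr) (inst f (scons (ival b) (scons (ival w) (fun n => ival (e' n)))))
     <-> exists p, G p /\ frc p (dinst g (scons b (scons w e')))).
  { intros b w. rewrite <- truth, inst_emb. fold g. rewrite !ival_scons. reflexivity. }
  assert (HD : Def3 (fun b w p => frc p (dinst g (scons b (scons w e'))))).
  { apply (D_frc g 3 (fun e => e 2) (fun e => scons (e 0) (scons (e 1) e'))); [dfn|].
    repeat apply TmE_scons; try apply TmE_const; dfn. }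
  set (R := fun z w => exists b p, z = op b p /\ frc p (dinst g (scons b (scons w e')))).
  assert (HR : Def2 R) by (unfold R; dfn).
  destruct (collection R (sep (prod (dom t) P) (fun z => exists w, R z w)) HR) as (B & HB).
  { intros z Hz. apply sepE in Hz; [tauto|dfn]. }
  exists (ival (mk B)). intros x Hx. pose proof (H x Hx) as [y Hy].
  apply ival_mem in Hx. destruct Hx as (b & r & Hb & Hr & ->). destruct (isurj y) as [w ->].
  apply Hg in Hy. destruct Hy as (p & Hp & Hf).
  destruct (HB (op b p)) as (w' & Hw' & b' & p' & E & Hf').
  { apply sepE; [dfn|]. split; [apply prod_op; rewrite domE; eauto|]. exists w, b, p. auto. }
  apply op_inj in E. destruct E; subst. exists (ival w'). split; [apply mk_mem; eauto|].
  apply Hg. eauto.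
Qed.

(** Each subset has a name that is a subset of [prod (dom t) P], consisting of the pairs (b, p) such
    that p forces b into the subset. *)
Lemma e_powerset (x : estr) : exists p : estr, forall y : estr,
  (forall z : estr, z ∊ y -> z ∊ x) -> y ∊ p.
Proof.
  destruct (isurj x) as [t ->]. exists (ival (mk (pow (prod (dom t) P)))). intros y Hy.
  destruct (isurj y) as [u ->]. apply mk_mem.
  exists (sep (prod (dom t) P) (fun z => exists b p, z = op b p /\ fmem p b u)). split.
  - apply powE. intros z Hz. apply sepE in Hz; [tauto|dfn].
  - apply e_ext. intros z. split.
    + intros Hz. pose proof (Hy z Hz) as Hzt. apply ival_mem in Hzt.
      destruct Hzt as (b & r & Hb & Hr & ->). apply imem in Hz. destruct Hz as (p & Hp & H).
      apply ival_mem. exists b, p. split; auto. apply sepE; [dfn|]. split; [|eauto].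
      apply prod_op. rewrite domE. eauto.
    + intros Hz. apply ival_mem in Hz. destruct Hz as (b & p & Hb & Hp & ->).
      apply sepE in Hb; [|dfn]. destruct Hb as [_ (b' & p' & E & H)]. apply op_inj in E.
      destruct E; subst. apply imem. eauto.
Qed.

(* Elements of the members of F are named in tc t; a choice set consists of the
   elements whose name comes first in a well-ordering of tc t. *)
Lemma e_choice (F : estr) : (forall x : estr, x ∊ F -> exists y : estr, y ∊ x) ->
  (forall x y : estr, x ∊ F -> y ∊ F -> (exists z : estr, z ∊ x /\ z ∊ y) -> x = y) ->
  exists c : estr, forall x : estr, x ∊ F -> exists y : estr, (y ∊ x /\ y ∊ c) /\
    forall y' : estr, y' ∊ x /\ y' ∊ c -> y' = y.
Proof.
  destruct (isurj F) as [t ->]. intros Hne Hdis.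
  destruct (zermelo (tc t)) as (a & f & Ha & Hf & Hi & Hv & Hs).
  set (g := gEx (gAnd (gMem 0 3) (gAnd (gMem 1 0) (gAll (gImp (gMem 0 3) (gImp (gMem 0 1) gBot)))))).
  set (env := fun n => scons (ap f n) (scons (mk (im (ap f) n)) (scons t (fun _ => t)))).
  set (W := fun n p => frc p (dinst g (env n))).
  assert (HD : Def2 W).
  { apply (D_frc g 2 (fun e => e 1) (fun e => env (e 0))); [dfn|]. unfold env.
    repeat apply TmE_scons; try apply TmE_const; dfn. }
  assert (Hg : forall n, (exists p, G p /\ W n p) <->
     exists x : estr, x ∊ ival t /\ ival (ap f n) ∊ x /\ forall m, m ∊ n -> ~ ival (ap f m) ∊ x).
  { intros n. unfold W. rewrite <- truth. unfold g, env. cbn. split; intros (x & Hx & Hfx & H); exists x;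
      (split; [auto|split; [auto|]]).
    - intros m Hm Hmx. refine (H (ival (ap f m)) _ Hmx). apply (mk_mem (ival (ap f m))).
      exists (ap f m). split; auto. apply imE; [dfn|eauto].
    - intros z Hz Hzx. apply (mk_mem z) in Hz. destruct Hz as (b & Hb & ->). apply imE in Hb; [|dfn].
      destruct Hb as (m & Hm & ->). apply (H m Hm); auto. }
  set (C := ival (sep (prod (tc t) P) (fun z => exists n p, n ∊ a /\ z = op (ap f n) p /\ W n p))). exists C.
  assert (HC : forall y : estr, y ∊ C <-> exists n, n ∊ a /\ y = ival (ap f n) /\
     exists x : estr, x ∊ ival t /\ ival (ap f n) ∊ x /\ forall m, m ∊ n -> ~ ival (ap f m) ∊ x).
  { intros y. unfold C. rewrite ival_mem. split.
    - intros (b & r & Hb & Hr & ->). apply sepE in Hb; [|dfn].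
      destruct Hb as [_ (n & p & Hn & E & H)]. apply op_inj in E. destruct E; subst.
      exists n. split; auto. split; auto. apply Hg. eauto.
    - intros (n & Hn & -> & H). apply Hg in H. destruct H as (p & Hp & H). exists (ap f n), p.
      split; auto. apply sepE; [dfn|]. split; [apply prod_op; auto|]. eauto 6. }
  assert (Hleast : forall x : estr, x ∊ ival t -> exists n, n ∊ a /\ ival (ap f n) ∊ x /\
     forall m, m ∊ n -> ~ ival (ap f m) ∊ x).
  { intros x Hx. destruct (Hne x Hx) as [y Hy]. apply ival_mem in Hx.
    destruct Hx as (s & r & Hs' & Hr & ->). pose proof Hy as Hy'. apply ival_mem in Hy.
    destruct Hy as (b & r' & Hb & _ & ->).
    destruct (Hs b) as (n0 & Hn0 & E).
    { eapply tc_mono; [eapply op_tc; eauto|]. eapply op_tc; eauto. }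
    subst b. apply imem in Hy'. destruct Hy' as (p & Hp & Hm).
    destruct (filter_below G p (fun q => exists n, n ∊ a /\ fmem q (ap f n) s /\
       forall m, m ∊ n -> forall q', q' ⪯ q -> ~ fmem q' (ap f m) s) HG)
      as (q & Hq & (n & Hn & Hfn & Hmin) & _); auto.
    - dfn.
    - intros q Hq.
      destruct (lordP (fun n => n ∊ a /\ exists q', q' ⪯ q /\ fmem q' (ap f n) s))
        as (_ & (Hna & q' & Hq' & Hfq) & _); [dfn|..].
      { exists n0. split; [eapply ord_mem; eauto|]. split; auto. exists q. split; eauto.
        eapply fmem_mono; eauto. }
      exists q'. split; auto. eexists. split; [exact Hna|]. split; auto. intros m Hm' q2 Hq2 Hf2.
      assert (Hma : m ∊ a) by (eapply (proj1 Ha); eauto).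
      revert Hm'. apply lord_min; [dfn|eapply ord_mem; eauto|]. split; auto. exists q2. eauto.
    - exists n. split; auto. split; [apply imem; eauto|]. intros m Hm' Hms.
      apply imem in Hms. destruct Hms as (q' & Hq' & Hf').
      destruct (Gdir q q' Hq Hq') as (r2 & _ & H1 & H2). apply (Hmin m Hm' r2 H1).
      eapply fmem_mono; eauto. }
  intros x Hx. destruct (Hleast x Hx) as (n & Hn & Hnx & Hmin). exists (ival (ap f n)). split.
  - split; auto. apply HC. exists n. split; auto. split; eauto.
  - intros y' [Hy'x Hy'C]. apply HC in Hy'C. destruct Hy'C as (n' & Hn' & -> & x' & Hx' & Hnx' & Hmin').
    assert (E : x' = x) by (apply Hdis; eauto). subst x'.
    destruct (ord_tri n n') as [H|[H|H]]; try (eapply ord_mem; eauto; fail); subst; auto; exfalso.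
    + apply (Hmin' n H); auto.
    + apply (Hmin n' H); auto.
Qed.

Theorem estr_zfc : ZFC estr.
Proof.
  intros phi Hphi. destruct Hphi.
  - intros x y H. apply e_ext. exact H.
  - intros x H. destruct (e_foundation x H) as (y & Hy & Hn). exists y. split; auto.
    intros (z & Hz & Hzx). apply (Hn z Hz Hzx).
  - intros x y. destruct (isurj x) as [s ->], (isurj y) as [t ->].
    exists (ival (mk (upair s t))). split; apply mk_mem; [exists s|exists t]; rewrite upairE; auto.
  - intros x. destruct (isurj x) as [t ->]. exists (ival (mk (tc t))). intros y Hy z Hz.
    apply ival_mem in Hy. destruct Hy as (b & r & Hb & _ & ->). apply ival_mem in Hz.
    destruct Hz as (b' & r' & Hb' & _ & ->). apply mk_mem. exists b'. split; auto.
    eapply tc_mono; [eapply op_tc; eauto|]. eapply op_tc; eauto.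
  - intros x. apply e_powerset.
  - destruct inductive_set as (w & Hw & Hs). exists (ival (chk w)). split.
    + exists (ival (chk emp)). split; [apply chk_mem; eauto|]. intros z Hz. apply chk_mem in Hz.
      destruct Hz as (x & Hx & _). apply (empE x Hx).
    + intros x Hx. apply chk_mem in Hx. destruct Hx as (n & Hn & ->). exists (ival (chk (succ n))).
      split; [apply chk_mem; eauto|]. intros z. cbn.
      assert (E : z ∊ ival (chk (succ n)) <-> (z ∊ ival (chk n) \/ z = ival (chk n))).
      { rewrite !chk_mem. split.
        - intros (m & Hm & ->). apply succE in Hm. destruct Hm; subst; eauto.
        - intros [(m & Hm & ->)| ->]; [exists m|exists n]; rewrite succE; auto. }
      split; apply E.
  - intros F [H1 H2]. apply e_choice; [exact H1|]. intros x y Hx Hy Hz. apply (H2 x Hx y Hy Hz).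
  - intros a. destruct (isurj a) as [t ->], (ienv e) as [e' ->].
    destruct (sep_name (emb f) t e') as [u Hu]. exists (ival u). intros x.
    specialize (Hu x). rewrite <- inst_emb in Hu. split; [exact (proj1 Hu)|exact (proj2 Hu)].
  - intros a H. apply e_replacement. intros x Hx. destruct (H x Hx) as (y & Hy & _). eauto.
Qed.

Instance estr_ZFC : ZFC estr := estr_zfc.

Definition opn s t : M := mk (upair (mk (sing s)) (mk (upair s t))).
Lemma Fun_opn : Fun2 opn.
Proof. unfold opn. dfn. Qed.
Lemma mk_upair s t : ival (mk (upair s t)) = upair (ival s) (ival t).
Proof.
  apply ext. intros z. rewrite mk_mem, upairE. split.
  - intros (b & Hb & ->). apply upairE in Hb. destruct Hb; subst; auto.
  - intros [-> | ->]; [exists s|exists t]; rewrite upairE; auto.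
Qed.
Lemma opn_val s t : ival (opn s t) = op (ival s) (ival t).
Proof. unfold opn, op, sing. rewrite !mk_upair. reflexivity. Qed.

Theorem estr_gext : gext P L (fun f p e => frc p (dinst f e)) chk G ival.
Proof.
  constructor; auto.
  - exact estr_zfc.
  - apply isurj.
  - intros t. exists (dom t). intros y Hy. apply ival_mem in Hy.
    destruct Hy as (b & r & Hb & _ & ->). exists b. rewrite domE. eauto.
  - apply truth.
  - apply chk_mem.
  - apply chk_inj.
  - exists (ival (im (fun p => op (chk p) p) P)). intros y. rewrite ival_mem. split.
    + intros (b & r & Hb & Hr & ->). apply imE in Hb; [|dfn]. destruct Hb as (p & Hp & E).
      apply op_inj in E. destruct E; subst. eauto.
    + intros (p & Hp & ->). exists (chk p), p. split; auto. apply imE; [dfn|]. exists p. auto.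
  - intros B. pose proof Fun_opn as Ho. exists (ival (mk (im (fun b => opn (chk b) b) B))).
    intros z. rewrite mk_mem. split.
    + intros (b & Hb & ->). apply imE in Hb; [|dfn]. destruct Hb as (x & Hx & ->).
      rewrite opn_val. eauto.
    + intros (b & Hb & ->). exists (opn (chk b) b). rewrite opn_val. split; auto.
      apply imE; [dfn|eauto].
Qed.
End Extension.

Theorem forcing_fnotion : fnotion P L (fun f p e => frc p (dinst f e)) chk.
Proof.
  constructor; try apply HP.
  - intros f k p te. apply D_frc.
  - apply Fun_chk.
  - intros f p q e. apply frc_mono.
  - intros p Hp. destruct (generic_exists p Hp) as (G & HG & Hp').
    exists (estr G), G, (ival G). split; auto. apply estr_gext; auto.
Qed.

Lemma check_unique x c : sat mem (is_check P x c) -> c = chk x.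
Proof.
  intros (T & f & HT & Hx & Hf & Hrec & Hc). apply sat_trans in HT. apply sat_family in Hf.
  apply sat_pin in Hc.
  assert (H : forall y, y ∊ T -> ap f y = chk y).
  { apply (eps_ind (fun y => y ∊ T -> ap f y = chk y)); [pose proof Fun_chk; dfn|].
    intros y IH Hy. rewrite chk_eq. apply ext. intros z.
    specialize (Hrec y (ap f y) (proj2 (sat_pin _ _ _) (fn_ap _ _ _ Hf Hy)) z). cbn [sat] in Hrec.
    unfold mk. rewrite prodE. split.
    - intros Hz. apply Hrec in Hz. destruct Hz as (w & Hw & e & He & p & Hp & E).
      apply sat_pin in He. apply sat_opair in E. exists e, p. split; auto. apply imE; [apply Fun_chk|].
      exists w. split; auto. rewrite <- IH; eauto. symmetry. eapply ap_eq; eauto.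
    - intros (e & p & He & Hp & ->). apply imE in He; [|apply Fun_chk].
      destruct He as (w & Hw & ->). apply Hrec. exists w. split; auto. exists (chk w).
      rewrite sat_pin. split.
      + rewrite <- IH; eauto. apply (fn_ap _ T); eauto.
      + exists p. rewrite sat_opair. auto. }
  rewrite <- H by auto. symmetry. eapply ap_eq; eauto.
Qed.
End Forcing_relation.

(** * Absoluteness and distributivity in generic extensions *)

Definition lqr {M : struct} (L q p : M) : Prop := op q p ∊ L.

Section Extension_facts.
Context {M N : struct} {Z : ZFC M} {ZN : ZFC N} {P L : M} {Fo : fm -> M -> (nat -> M) -> Prop}
  {chk : M -> M} (F : fnotion P L Fo chk) {G : M -> Prop} {val : M -> N}
  (X : gext P L Fo chk G val).
Implicit Types a b c d f g p q r s t x y : M.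
Local Notation "q ⪯ p" := (op q p ∊ L) (at level 70).
Definition ii (x : M) : N := val (chk x).

Lemma ii_elim x (y : N) : y ∊ ii x -> exists x', x' ∊ x /\ y = ii x'.
Proof. apply (v_chk _ _ _ _ _ _ X). Qed.
Lemma ii_inj x y : ii x = ii y -> x = y.
Proof. apply (v_inj _ _ _ _ _ _ X). Qed.
Lemma ii_mem x y : ii x ∊ ii y <-> x ∊ y.
Proof.
  split.
  - intros H. apply ii_elim in H. destruct H as (x' & Hx & E). apply ii_inj in E. subst; auto.
  - intros H. apply (v_chk _ _ _ _ _ _ X). exists x. auto.
Qed.
Lemma ii_upair a b : ii (upair a b) = upair (ii a) (ii b).
Proof.
  apply ext. intros z. rewrite upairE. split.
  - intros H. apply ii_elim in H. destruct H as (x & Hx & ->). apply upairE in Hx. destruct Hx; subst; auto.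
  - intros [-> | ->]; apply ii_mem, upairE; auto.
Qed.
Lemma ii_op a b : ii (op a b) = op (ii a) (ii b).
Proof. unfold op, sing. rewrite !ii_upair. auto. Qed.
Lemma ii_opE a b r : op (ii a) (ii b) ∊ ii r <-> op a b ∊ r.
Proof. rewrite <- ii_op. apply ii_mem. Qed.
Lemma ii_opI (x y : N) r : op x y ∊ ii r -> exists a b, x = ii a /\ y = ii b /\ op a b ∊ r.
Proof.
  intros H. apply ii_elim in H. destruct H as (z & Hz & E).
  assert (H1 : upair x y ∊ ii z) by (rewrite <- E; apply upairE; auto).
  apply ii_elim in H1. destruct H1 as (u & Hu & E1).
  assert (Hx : x ∊ ii u) by (rewrite <- E1; apply upairE; auto).
  assert (Hy : y ∊ ii u) by (rewrite <- E1; apply upairE; auto).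
  apply ii_elim in Hx, Hy. destruct Hx as (a & _ & ->), Hy as (b & _ & ->).
  exists a, b. split; auto. split; auto. rewrite <- ii_op in E. apply ii_inj in E. subst; auto.
Qed.
Lemma ii_ord x : Ord x -> Ord (ii x).
Proof.
  intros [H1 H2]. split.
  - intros y z Hy Hz. apply ii_elim in Hy. destruct Hy as (a & Ha & ->). apply ii_elim in Hz.
    destruct Hz as (b & Hb & ->). apply ii_mem. eapply H1; eauto.
  - intros y Hy u z Hu Hz. apply ii_elim in Hy. destruct Hy as (a & Ha & ->). apply ii_elim in Hu.
    destruct Hu as (b & Hb & ->). apply ii_elim in Hz. destruct Hz as (c & Hc & ->).
    apply ii_mem. eapply H2; eauto.
Qed.
Lemma ii_fn f a : isfn f a -> isfn (ii f) (ii a).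
Proof.
  intros Hf. split.
  - intros z Hz. apply ii_elim in Hz. destruct Hz as (z' & Hz & ->).
    destruct (proj1 Hf z' Hz) as (x & y & Hx & ->). exists (ii x), (ii y). rewrite ii_mem, ii_op. auto.
  - intros x Hx. apply ii_elim in Hx. destruct Hx as (a' & Ha & ->). exists (ii (ap f a')).
    rewrite ii_opE. split; [apply (fn_ap _ a); auto|]. intros y Hy. apply ii_opI in Hy.
    destruct Hy as (a2 & b & E & -> & Hab). apply ii_inj in E. subst. f_equal. symmetry.
    eapply ap_eq; eauto.
Qed.
Lemma ii_ap f a x : isfn f a -> x ∊ a -> ap (ii f) (ii x) = ii (ap f x).
Proof.
  intros Hf Hx. apply (ap_eq _ (ii a)); [apply ii_fn; auto|]. apply ii_opE, (fn_ap _ a); auto.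
Qed.
Lemma ii_dom f : dom (ii f) = ii (dom f).
Proof.
  apply ext. intros z. rewrite domE. split.
  - intros [y H]. apply ii_opI in H. destruct H as (a & b & -> & -> & H). apply ii_mem, domE. eauto.
  - intros H. apply ii_elim in H. destruct H as (x & Hx & ->). apply domE in Hx. destruct Hx as [y Hy].
    exists (ii y). apply ii_opE; auto.
Qed.
Lemma ii_pi1 a b : pi1 (ii (op a b)) = ii a.
Proof. rewrite ii_op, pi1_op. auto. Qed.
Lemma ii_pi2 a b : pi2 (ii (op a b)) = ii b.
Proof. rewrite ii_op, pi2_op. auto. Qed.
Lemma ii_onto x d : onto x d -> onto (ii x) (ii d).
Proof.
  intros (f & Hf & Hs). exists (ii f). split.
  - intros i u v Hu Hv. apply ii_opI in Hu, Hv. destruct Hu as (i1 & u1 & -> & -> & Hu).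
    destruct Hv as (i2 & v1 & E & -> & Hv). apply ii_inj in E. subst. f_equal. eauto.
  - intros u Hu. apply ii_elim in Hu. destruct Hu as (u' & Hu & ->). destruct (Hs u' Hu) as (i & Hi & H).
    exists (ii i). rewrite ii_mem, ii_opE. auto.
Qed.

Lemma Def_lqr : Def2 (lqr L).
Proof. unfold lqr. dfn. Qed.

Lemma gen_below p (U : M -> Prop) : Def1 U -> G p ->
  (forall q, q ⪯ p -> exists q', q' ⪯ q /\ U q') -> exists q, G q /\ U q /\ q ⪯ p.
Proof.
  intros HU Hp Hd.
  destruct (g_meet _ _ _ _ _ _ X (fun q => (q ⪯ p /\ U q) \/ ~ exists r, r ⪯ q /\ r ⪯ p)) as (q & Hq & H);
    [dfn|..].
  - intros q Hq. destruct (classic (exists r, r ⪯ q /\ r ⪯ p)) as [(r & Hr & Hrp)|Hn].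
    + destruct (Hd r Hrp) as (q' & Hq' & HUq). exists q'. split.
      * eapply (n_trans _ _ _ _ F); eauto.
      * left. split; auto. eapply (n_trans _ _ _ _ F); eauto.
    + exists q. split; auto. apply (n_refl _ _ _ _ F); auto.
  - destruct H as [[Hqp HUq]|Hn]; eauto. exfalso.
    destruct (g_dir _ _ _ _ _ _ X p q Hp Hq) as (r & _ & Hr & Hr'). eauto.
Qed.

Lemma truth_u (H : forall X : Type, (nat -> X) -> form X) (f : fm) (e : nat -> M) :
  (forall X e, H X e = dinst f e) ->
  (sat mem (H N (fun n => val (e n))) <-> exists p, G p /\ Fo f p e).
Proof. intros Hf. rewrite Hf. apply (v_truth _ _ _ _ _ _ X). Qed.

(** By closure, the conditions that for each i lie below the i-th entry or are incompatible with it
    form a dense class. A member of G is never incompatible with entries that are in G. *)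
Lemma closed_lower eta d g : Ord eta -> closed P (lqr L) eta -> d ∊ eta -> isfn g d ->
  (forall i, i ∊ d -> G (ap g i)) -> exists h, G h /\ forall i, i ∊ d -> h ⪯ ap g i.
Proof.
  intros He Hcl Hd Hg HG.
  destruct (g_meet _ _ _ _ _ _ X (fun h => forall i, i ∊ d -> h ⪯ ap g i \/
      ~ exists r, r ⪯ h /\ r ⪯ ap g i)) as (h & Hh & H); [dfn|..].
  - intros p Hp.
    destruct (dense_intersection P (lqr L) eta d p
      (fun i h => h ⪯ ap g i \/ ~ exists r, r ⪯ h /\ r ⪯ ap g i)) as (r & Hr & Hrp & H); auto.
    + apply Def_lqr.
    + dfn.
    + intros x y z. apply (n_trans _ _ _ _ F).
    + intros x. apply (n_refl _ _ _ _ F).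
    + intros i r r' Hi Hr' Hrr [H|H].
      * left. eapply (n_trans _ _ _ _ F); eauto.
      * right. intros (u & Hu & Hug). apply H. exists u. split; auto.
        apply (n_trans _ _ _ _ F _ r'); auto.
    + intros i r Hi Hr Hrp. destruct (classic (exists u, u ⪯ r /\ u ⪯ ap g i)) as [(u & Hu & Hug)|Hn].
      * exists u. split; [apply (n_dom _ _ _ _ F) in Hu; tauto|]. auto.
      * exists r. split; auto. split; auto. apply (n_refl _ _ _ _ F); auto.
    + exists r. split; auto.
  - exists h. split; auto. intros i Hi. destruct (H i Hi) as [H'|H']; auto. exfalso. apply H'.
    destruct (g_dir _ _ _ _ _ _ X h (ap g i) Hh (HG i Hi)) as (r & _ & H1 & H2). eauto.
Qed.

End Extension_facts.

Ltac dfn_extra ::=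
  match goal with
  | |- Tm _ (fun e => sep _ _) => simple apply Tm_sep
  | |- Tm _ (fun e => im _ _) => simple apply Tm_im
  | |- Tm _ (fun e => lam _ _) => simple apply Tm_lam
  | |- Tm _ (fun e => lord _) => simple apply Tm_lord
  | |- TmE _ (fun _ => ?c) => apply TmE_const
  | |- TmE _ (fun e => scons _ _) => simple apply TmE_scons
  | H : fnotion _ _ ?Fo _ |- D _ (fun e => ?Fo ?f (@?p e) (@?te e)) =>
      apply (n_def _ _ _ _ H f _ p te)
  | H : fnotion _ _ _ ?c |- Tm _ (fun e => ?c (@?a e)) => apply (Tm_app1 c _ a (n_chk _ _ _ _ H))
  end.

Lemma force_below {M : struct} {P L : M} {Fo : fm -> M -> (nat -> M) -> Prop} {chk : M -> M}
  (F : fnotion P L Fo chk) (p q : M) (f : fm) (e : nat -> M) {N : struct} (G : M -> Prop) (val : M -> N)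
  (X : gext P L Fo chk G val) : G p -> G q -> Fo f q e ->
  exists r, G r /\ op r p ∊ L /\ Fo f r e.
Proof.
  intros Hp Hq H. destruct (g_dir _ _ _ _ _ _ X p q Hp Hq) as (r & Hr & Hrp & Hrq).
  exists r. split; auto. split; auto. eapply (n_mono _ _ _ _ F); eauto.
Qed.

Section Distributivity.
Context {M : struct} {Z : ZFC M} {P L : M} {Fo : fm -> M -> (nat -> M) -> Prop}
  {chk : M -> M} (F : fnotion P L Fo chk).
Implicit Types a b c d f g p q r s t x y : M.
Local Notation "q ⪯ p" := (op q p ∊ L) (at level 70).

(** Below a condition forcing the name to denote such a function, closure allows all its values to
    be decided successively; a condition of G that decides them all shows g to be the ground-model
    function of these values. *)
Theorem distributivity {N : struct} {ZN : ZFC N} {G : M -> Prop} {val : M -> N}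
  (X : gext P L Fo chk G val) eta d B (g : N) :
  Ord eta -> closed P (lqr L) eta -> d ∊ eta ->
  isfn g (val (chk d)) -> (forall i, i ∊ val (chk d) -> ap g i ∊ val (chk B)) ->
  exists h, isfn h d /\ (forall i, i ∊ d -> ap h i ∊ B) /\ g = val (chk h).
Proof.
  intros He Hcl Hd Hg Hgv.
  destruct (v_surj _ _ _ _ _ _ X g) as [gn Egn].
  destruct (U_fun 0 1 2) as [ffun Hffun]. destruct (U_pin 0 1 2) as [fpin Hfpin].
  set (e0 := scons gn (scons (chk d) (fun _ => chk B))).
  assert (H0 : exists p, G p /\ Fo ffun p e0).
  { apply (truth_u X _ _ _ Hffun). apply sat_fun. unfold e0; cbn [scons]. rewrite <- Egn. auto. }
  destruct H0 as (p0 & Hp0 & Hf0).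
  set (ep := fun i y => scons (chk i) (scons (chk y) (fun _ => gn))).
  assert (Dep : Def3 (fun i y r => Fo fpin r (ep i y))) by (unfold ep; dfn).
  destruct (gen_below F X p0 (fun q => exists h, isfn h d /\ forall i, i ∊ d -> ap h i ∊ B /\
     Fo fpin q (ep i (ap h i)))) as (q & Hq & (h & Hh & HhB) & _); auto; [unfold ep; dfn|..].
  - intros q Hqp.
    destruct (dense_intersection P (lqr L) eta d q (fun i r => exists y, y ∊ B /\ Fo fpin r (ep i y)))
      as (r & Hr & Hrq & HU); auto.
    + apply Def_lqr.
    + unfold ep; dfn.
    + intros x y z. apply (n_trans _ _ _ _ F).
    + intros x. apply (n_refl _ _ _ _ F).
    + apply (n_dom _ _ _ _ F) in Hqp. tauto.
    + intros i r r' Hi Hr' Hrr (y & Hy & H). exists y. split; auto. eapply (n_mono _ _ _ _ F); eauto.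
    (* A condition that decides the i-th value is found by reading off the value in a generic
       extension whose filter contains r. *)
    + intros i r Hi Hr Hrq. destruct (n_gen _ _ _ _ F r Hr) as (N' & G' & val' & X' & Hr').
      pose proof (g_zfc _ _ _ _ _ _ X') as ZN'. change (ZFC N') in ZN'.
      assert (Hp0' : G' p0).
      { apply (g_up _ _ _ _ _ _ X' r); auto. eapply (n_trans _ _ _ _ F); eauto. }
      assert (Hs : sat mem (is_fun (val' gn) (val' (chk d)) (val' (chk B)))).
      { apply (truth_u X' _ _ e0 Hffun). eauto. }
      apply sat_fun in Hs. destruct Hs as [Hs1 Hs2].
      assert (Hi' : ii (chk := chk) (val := val') i ∊ val' (chk d)) by (apply (ii_mem X'); auto).
      pose proof (Hs2 _ Hi') as Hy. apply (ii_elim X') in Hy. destruct Hy as (y & Hy & Ey).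
      assert (Hpin : sat mem (pin (val' (chk i)) (val' (chk y)) (val' gn))).
      { apply sat_pin. unfold ii in *. rewrite <- Ey. apply (fn_ap _ (val' (chk d))); auto. }
      apply (truth_u X' _ _ (ep i y) Hfpin) in Hpin. destruct Hpin as (u & Hu & Hfu).
      destruct (force_below F r u _ _ _ _ X' Hr' Hu Hfu) as (r' & Hr1 & Hr2 & Hr3).
      exists r'. split; [apply (n_dom _ _ _ _ F) in Hr2; tauto|]. split; eauto.
    + destruct (AC_rel (fun i y => y ∊ B /\ Fo fpin r (ep i y)) d) as (h & Hh & HhR); auto.
      { unfold ep; dfn. }
      exists r. split; auto. exists h. split; auto.
  - exists h. split; auto. split; [intros; apply HhB; auto|].
    apply (fn_ext _ _ (val (chk d))); auto; [apply (ii_fn X); auto|].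
    intros x Hx. apply (ii_elim X) in Hx. destruct Hx as (i & Hi & ->).
    change (val (chk h)) with (ii (chk := chk) (val := val) h). rewrite (ii_ap X h d) by auto.
    apply (ap_eq _ (val (chk d))); auto. apply sat_pin. rewrite Egn.
    apply (truth_u X _ _ (ep i (ap h i)) Hfpin). exists q. split; auto. apply HhB; auto.
Qed.

Lemma reg_extension {N : struct} {ZN : ZFC N} {G : M -> Prop} {val : M -> N}
  (X : gext P L Fo chk G val) m : reg m -> closed P (lqr L) m -> reg (val (chk m)).
Proof.
  intros (Hm & (x & y & Hxy & Hy) & Hr) Hcl. split; [apply (ii_ord X); auto|]. split.
  - exists (val (chk x)), (val (chk y)). split; apply (ii_mem X); auto.
  - intros x' f Hx' Hf Hv. apply (ii_elim X) in Hx'. destruct Hx' as (d & Hd & ->).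
    destruct (distributivity X m d m f) as (h & Hh & Hhv & E); auto. subst.
    destruct (Hr d h) as (b & Hb & Hbi); auto. exists (val (chk b)). split; [apply (ii_mem X); auto|].
    intros i Hi. apply (ii_elim X) in Hi. destruct Hi as (i' & Hi & ->).
    change (val (chk h)) with (ii (chk := chk) (val := val) h). rewrite (ii_ap X h d) by auto.
    apply (ii_mem X); auto.
Qed.
End Distributivity.

(** * The trivial forcing *)

Section Trivial_forcing.
Context {M : struct} {Z : ZFC M}.
Definition triv_Fo (f : fm) (p : M) (e : nat -> M) : Prop := sat mem (dinst f e).
Lemma trivial_le (p q : M) : op p q ∊ sing (op emp emp) <-> p = emp /\ q = emp.
Proof.
  rewrite singE. split.
  - intros E. apply op_inj in E. auto.
  - intros [-> ->]. auto.
Qed.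
(** With M as an extension of itself, the principle in V[G] and in V[G][H] becomes two instances of
    one theorem. *)
Lemma trivial_gext : gext (sing emp) (sing (op emp emp)) triv_Fo (fun x => x) (fun p => p = emp) (fun x : M => x).
Proof.
  constructor; auto.
  - intros p ->. apply singE; auto.
  - intros p q -> H. apply trivial_le in H. tauto.
  - intros p q -> ->. exists emp. rewrite trivial_le. auto.
  - intros U HU H. destruct (H emp) as (q & Hq & HUq); [apply singE; auto|].
    apply trivial_le in Hq. destruct Hq; subst; eauto.
  - intros y. eauto.
  - intros t. exists t. eauto.
  - intros f e. unfold triv_Fo. split; [intros; exists emp; auto|]. intros (p & _ & H). exact H.
  - intros x y. split; [eauto|]. intros (x' & Hx & ->). auto.
  - exists (sing emp). intros y. rewrite singE. split; [intros ->; eauto|]. intros (p & -> & ->). auto.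
  - intros B. exists (lam B (fun b => b)). intros z. unfold lam. rewrite imE by dfn. reflexivity.
Qed.
Lemma trivial_fnotion : fnotion (sing emp) (sing (op emp emp)) triv_Fo (fun x : M => x).
Proof.
  constructor.
  - intros p q r H1 H2. apply trivial_le in H1, H2. apply trivial_le. tauto.
  - intros p Hp. apply singE in Hp. apply trivial_le. auto.
  - intros p q H. apply trivial_le in H. rewrite !singE. tauto.
  - intros f k p te Hp Ht. apply D_dinst; auto.
  - dfn.
  - intros f p q e _ H. exact H.
  - intros p Hp. apply singE in Hp. subst. exists M, (fun p => p = emp), (fun x : M => x).
    split; auto. apply trivial_gext.
Qed.
End Trivial_forcing.

(** * Branches from a closed poset of approximations *)

(* If F decides more and more of a branch along the poset T but no F-branch is cofinal,
   then pairs of conditions can be split: they disagree on all high levels. A descending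
   sequence of length mu of split pairs leads to mu side conditions that pairwise disagree
   on one level, which has fewer than mu elements. *)
Section Preservation.
Context {M : struct} {Z : ZFC M} (mu Lam w T : M) (leL leT : M -> M -> Prop) (SL : M -> M)
  (ltk : M -> M -> M -> Prop) (F : M -> M -> M -> M -> Prop).
Context (DleL : Def2 leL) (DleT : Def2 leT) (DSL : Fun1 SL) (DF : Def4 F)
  (Hmu : reg mu) (Hw : w ∊ mu).
Definition insys x : Prop := exists u, u ∊ Lam /\ x ∊ SL u.
Definition lek k x y : Prop := ltk k x y \/ x = y.
Definition cmp k x y : Prop := exists z, insys z /\ lek k x z /\ lek k y z.
Context
  (Lne : exists u, u ∊ Lam)
  (Lanti : forall u v, leL u v -> leL v u -> u = v)
  (Ltrans : forall u v x, leL u v -> leL v x -> leL u x)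
  (Ldir : forall f, isfn f mu -> (forall i, i ∊ mu -> ap f i ∊ Lam) ->
          exists v, v ∊ Lam /\ forall i, i ∊ mu -> leL (ap f i) v)
  (Rtrans : forall k x y z, ltk k x y -> ltk k y z -> ltk k x z)
  (Rlev : forall k x y u v, ltk k x y -> u ∊ Lam -> v ∊ Lam -> x ∊ SL u -> y ∊ SL v ->
          leL u v /\ u <> v)
  (Rtree : forall k x y z u v, ltk k x z -> ltk k y z -> u ∊ Lam -> v ∊ Lam ->
           x ∊ SL u -> y ∊ SL v -> leL u v -> lek k x y)
  (Ssmall : forall u, u ∊ Lam -> small mu (SL u))
  (Tne : exists t, t ∊ T)
  (Trefl : forall t, t ∊ T -> leT t t)
  (Ttrans : forall t s r, leT t s -> leT s r -> leT t r)
  (Tclosed : closed T leT mu)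
  (Fmono : forall t t' k l x, t' ∊ T -> leT t' t -> F t k l x -> F t' k l x)
  (Fcmp : forall t k l x y, t ∊ T -> k ∊ w -> l ∊ w -> F t k l x -> F t k l y -> cmp k x y)
  (Ffull : forall t u, t ∊ T -> u ∊ Lam -> exists t' k l x, t' ∊ T /\ leT t' t /\
           k ∊ w /\ l ∊ w /\ x ∊ SL u /\ F t' k l x).

Lemma lek_trans k x y z : lek k x y -> lek k y z -> lek k x z.
Proof. unfold lek. intros [H|H] [H'|H']; subst; eauto. Qed.

Lemma cmp_le k x z u v : cmp k x z -> u ∊ Lam -> v ∊ Lam -> x ∊ SL u -> z ∊ SL v -> leL u v ->
  lek k x z.
Proof.
  intros (y & Hy & [H1|H1] & [H2|H2]) Hu Hv Hx Hz Huv; subst; unfold lek in *; eauto.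
  destruct (Rlev _ _ _ _ _ H2 Hv Hu Hz Hx) as [H3 H4]. exfalso. apply H4. auto.
Qed.

Lemma dir_rel (R : M -> M -> Prop) d : Def2 R -> (forall i, i ∊ d -> i ∊ mu) ->
  (forall i, i ∊ d -> exists u, u ∊ Lam /\ R i u) ->
  exists v, v ∊ Lam /\ forall i, i ∊ d -> exists u, u ∊ Lam /\ R i u /\ leL u v.
Proof.
  intros HR Hd H.
  destruct (AC_rel (fun i u => u ∊ Lam /\ (i ∊ d -> R i u)) mu) as (f & Hf & HfR); [dfn|..].
  { intros i Hi. destruct (classic (i ∊ d)) as [Hid|Hid].
    - destruct (H i Hid) as (u & Hu & HRu). eauto.
    - destruct Lne as [u Hu]. exists u. tauto. }
  destruct (Ldir f) as (v & Hv & Hvf); auto.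
  { intros i Hi. apply HfR; auto. }
  exists v. split; auto. intros i Hi. exists (ap f i). destruct (HfR i); auto.
Qed.
Lemma dir_two u v : u ∊ Lam -> v ∊ Lam -> exists x, x ∊ Lam /\ leL u x /\ leL v x.
Proof.
  intros Hu Hv.
  destruct (dir_rel (fun i x => (i = emp /\ x = u) \/ (i = one /\ x = v)) (succ one))
    as (x & Hx & H); [dfn|..].
  - intros i Hi. apply (proj1 (proj1 Hmu) (succ one)); auto. apply reg_succ, reg_one; auto.
  - intros i Hi. apply succE in Hi. destruct Hi as [Hi|Hi]; [apply singE in Hi|]; subst; eauto.
  - exists x. split; auto. split.
    + destruct (H emp) as (y & _ & [[_ E]|[E _]] & Hl); subst; auto.
      * apply succE. left. apply singE; auto.
      * exfalso. apply (empE emp). rewrite E at 2. apply singE; auto.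
    + destruct (H one) as (y & _ & [[E _]|[_ E]] & Hl); subst; auto.
      * apply succE. auto.
      * exfalso. apply (empE emp). rewrite <- E at 2. apply singE; auto.
Qed.

Definition split k l a b u : Prop := forall v x, v ∊ Lam -> leL u v -> x ∊ SL v ->
  ~ exists a' b', a' ∊ T /\ b' ∊ T /\ leT a' a /\ leT b' b /\ F a' k l x /\ F b' k l x.
Lemma Def_split : Def5 split.
Proof. unfold split. dfn. Qed.
Hint Resolve Def_split : dfn.
Lemma split_mono k l a b u a' b' u' : split k l a b u -> leT a' a -> leT b' b ->
  leL u u' -> split k l a' b' u'.
Proof.
  intros H Ha Hb Hu v x Hv Huv Hx (c & d & Hc & Hd & Hca & Hdb & Hrest).
  apply (H v x Hv); eauto 10.
Qed.

(** The last clause records that some condition has used the code k; from this [no_max_branch]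
    recovers a relation of the system with that code. *)
Definition cofinal_branch k l b : Prop :=
  (forall x, x ∊ b -> insys x) /\ (forall x y, x ∊ b -> y ∊ b -> cmp k x y) /\
  (forall u, u ∊ Lam -> exists v x, v ∊ Lam /\ leL u v /\ x ∊ b /\ x ∊ SL v) /\
  exists t x, t ∊ T /\ F t k l x.

Section Split.
Hypothesis nobranch : ~ exists k l b, k ∊ w /\ l ∊ w /\ cofinal_branch k l b.

(** If no pair below (t0, t1) splits, then the elements chosen by conditions below t0 form a cofinal
    branch. Two conditions below t0 may be incompatible; conditions below t1 provide the link
    between their choices. *)
Lemma split_one k l t0 t1 : k ∊ w -> l ∊ w -> t0 ∊ T -> t1 ∊ T ->
  exists t0' t1' u, t0' ∊ T /\ t1' ∊ T /\ leT t0' t0 /\ leT t1' t1 /\ u ∊ Lam /\ split k l t0' t1' u.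
Proof.
  intros Hk Hl Ht0 Ht1. apply NNPP. intros Hn.
  assert (H : forall a b u, a ∊ T -> b ∊ T -> leT a t0 -> leT b t1 -> u ∊ Lam ->
     exists v x a' b', v ∊ Lam /\ leL u v /\ x ∊ SL v /\ a' ∊ T /\ b' ∊ T /\ leT a' a /\ leT b' b /\
       F a' k l x /\ F b' k l x).
  { intros a b u Ha Hb Hat Hbt Hu. apply NNPP. intros Hn'. apply Hn. exists a, b, u.
    do 5 (split; auto). intros v x Hv Huv Hx (a' & b' & Hrest). apply Hn'. exists v, x, a', b'. tauto. }
  clear Hn.
  set (b := sep (union (im SL Lam)) (fun x => exists t, t ∊ T /\ leT t t0 /\ F t k l x)).
  assert (Hb : forall x, x ∊ b <-> insys x /\ exists t, t ∊ T /\ leT t t0 /\ F t k l x).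
  { intros x. unfold b. rewrite sepE by dfn. apply and_iff_compat_r. rewrite unionE. split.
    - intros (y & Hy & Hx). apply imE in Hy; auto. destruct Hy as (u & Hu & ->). exists u; auto.
    - intros (u & Hu & Hx). exists (SL u). split; auto. apply imE; eauto. }
  apply nobranch. exists k, l, b. split; auto. split; auto. split; [|split; [|split]].
  - intros x Hx. apply Hb in Hx. tauto.
  - intros x y Hx Hy. apply Hb in Hx, Hy. destruct Hx as ((u & Hu & Hxu) & t & Ht & Htt & Hfx).
    destruct Hy as ((v & Hv & Hyv) & t' & Ht' & Htt' & Hfy).
    (* First t and t1 are extended to agree on some z. Then t' and the extension c of t1 are
       extended to agree on some z' at a level above those of y and z. Compatibility within one
       condition gives x below z, z below z' and y below z'. *)
    destruct (H t t1 u) as (v1 & z & a & c & Hv1 & Huv1 & Hz & Ha & Hc & Hat & Hct & Hfa & Hfc); auto.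
    destruct (dir_two v v1) as (v2 & Hv2 & Hvv2 & Hv12); auto.
    destruct (H t' c v2) as (v3 & z' & a' & c' & Hv3 & Hv23 & Hz' & Ha' & Hc' & Hat' & Hct' & Hfa' & Hfc');
      eauto.
    exists z'. split; [exists v3; auto|]. split.
    + apply (lek_trans k x z).
      * apply (cmp_le k x z u v1); auto. apply (Fcmp a k l); eauto.
      * apply (cmp_le k z z' v1 v3); eauto; apply (Fcmp c' k l); eauto.
    + apply (cmp_le k y z' v v3); eauto; apply (Fcmp a' k l); eauto.
  - intros u Hu. destruct (H t0 t1 u) as (v & x & a & c & Hv & Huv & Hx & Ha & Hc & Hat & Hct & Hfa & Hfc);
      auto.
    exists v, x. split; auto. split; auto. split; auto. apply Hb. split; [exists v; auto|eauto].
  - destruct Lne as [u Hu].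
    destruct (H t0 t1 u) as (v & x & a & c & Hv & Huv & Hx & Ha & Hc & Hat & Hct & Hfa & Hfc); eauto.
Qed.

Definition split2 a b u : Prop := forall k l, k ∊ w -> l ∊ w -> split k l a b u.
(** T × T is mu-closed and w is below mu, so the dense sets for all pairs (k, l) are met
    simultaneously; directedness then supplies one level that serves all pairs. *)
Lemma split_all t : t ∊ T -> exists t0 t1 u, t0 ∊ T /\ t1 ∊ T /\ leT t0 t /\ leT t1 t /\
  u ∊ Lam /\ split2 t0 t1 u.
Proof.
  intros Ht.
  assert (Hwmu : forall i, i ∊ w -> i ∊ mu) by (intros i Hi; apply (proj1 (proj1 Hmu) w); auto).
  assert (D2 : Def2 (le2 leT)) by (unfold le2; dfn).
  assert (HT2 : forall x, x ∊ prod T T -> le2 leT x x).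
  { intros x Hx. apply prodE in Hx. destruct Hx as (a & b & Ha & Hb & ->). unfold le2.
    rewrite pi1_op, pi2_op. auto. }
  assert (Htr : forall x y z, le2 leT x y -> le2 leT y z -> le2 leT x z).
  { unfold le2. intros x y z [H1 H2] [H3 H4]. eauto. }
  assert (Hcl : closed (prod T T) (le2 leT) mu) by (apply closed_prod; auto; apply Hmu).
  set (U := fun k l p => exists u, u ∊ Lam /\ split k l (pi1 p) (pi2 p) u).
  assert (DU : Def3 U) by (unfold U; dfn).
  assert (Hopen : forall k l r r', le2 leT r' r -> U k l r -> U k l r').
  { intros k l r r' [H1 H2] (u & Hu & Hs). exists u. split; auto. intros v x Hv Huv Hx
      (c & d & Hc & Hd & Hca & Hdb & Hrest). apply (Hs v x Hv); eauto 10. }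
  assert (Hone : forall k p, k ∊ w -> p ∊ prod T T ->
     exists r, r ∊ prod T T /\ le2 leT r p /\ forall l, l ∊ w -> U k l r).
  { intros k p Hk Hp. apply (dense_intersection (prod T T) (le2 leT) mu w p (U k)); auto.
    - dfn.
    - apply Hmu.
    - eauto.
    - intros l r Hl Hr _. apply prodE in Hr. destruct Hr as (a & b & Ha & Hb & ->).
      destruct (split_one k l a b) as (a' & b' & u & Ha' & Hb' & Haa & Hbb & Hu & Hs); auto.
      exists (op a' b'). unfold le2, U. rewrite prod_op, !pi1_op, !pi2_op. eauto 8. }
  destruct (dense_intersection (prod T T) (le2 leT) mu w (op t t) (fun k r => forall l, l ∊ w -> U k l r))
    as (r & Hr & Hrt & HU); auto.
  - dfn.
  - apply Hmu.
  - apply prod_op; auto.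
  - eauto.
  - apply prodE in Hr. destruct Hr as (a & b & Ha & Hb & ->).
    unfold le2, U in *. rewrite !pi1_op, !pi2_op in *.
    destruct (dir_rel (fun k u => forall l, l ∊ w -> split k l a b u) w) as (v & Hv & Hvk); auto.
    { dfn. }
    { intros k Hk. destruct (dir_rel (fun l u => split k l a b u) w) as (v & Hv & Hvl); auto; [dfn|..].
      exists v. split; auto. intros l Hl. destruct (Hvl l Hl) as (u & Hu & Hs & Huv).
      eapply split_mono; eauto. }
    exists a, b, v. do 5 (split; try tauto). intros k l Hk Hl.
    destruct (Hvk k Hk) as (u & Hu & Hs & Huv). eapply split_mono; eauto.
Qed.

Lemma split_false : False.
Proof.
  destruct Tne as [ts Hts].
  (* At each stage the pair split below r consists of the next term of the sequence and a side
     condition s that is left behind. *)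
  set (step := fun a r r' : M => exists s u, s ∊ T /\ leT s r /\ u ∊ Lam /\ split2 r' s u).
  assert (Ds2 : Def3 split2) by (unfold split2; dfn).
  destruct (descending_sequence T leT mu ts step) as (g & Hg & Hgs); auto.
  { unfold step. dfn. }
  { apply Hmu. }
  { intros a r _ Hr _. destruct (split_all r Hr) as (t0 & t1 & u & H0 & H1 & H2 & H3 & H4 & H5).
    exists t0. split; auto. split; auto. exists t1, u. auto. }
  destruct Hg as (Hgf & HgT & Hgd).
  destruct (AC_rel (fun a z => pi1 z ∊ T /\ pi2 z ∊ Lam /\ (forall b, b ∊ a -> leT (pi1 z) (ap g b)) /\
     split2 (ap g a) (pi1 z) (pi2 z)) mu) as (h & Hh & HhR); [dfn|..].
  { intros a Ha. destruct (Hgs a Ha) as (_ & r & Hr & _ & Hrb & Hra & s & u & Hs & Hsr & Hu & Hsp).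
    exists (op s u). rewrite pi1_op, pi2_op. do 3 (split; auto). eauto. }
  (* One level u above all mu splitting levels; every side condition can be extended so as to choose
     an element there. *)
  destruct (Ldir (lam mu (fun a => pi2 (ap h a)))) as (u & Hu & Hul).
  { apply lam_fn. dfn. }
  { intros i Hi. rewrite ap_lam by (auto; dfn). apply HhR; auto. }
  assert (Hul' : forall i, i ∊ mu -> leL (pi2 (ap h i)) u).
  { intros i Hi. specialize (Hul i Hi). rewrite ap_lam in Hul by (auto; dfn). auto. }
  set (hit := fun a k l x => exists t, t ∊ T /\ leT t (pi1 (ap h a)) /\ F t k l x).
  assert (Dhit : Def4 hit) by (unfold hit; dfn).
  destruct (pigeonhole mu w (fun _ => True) (fun a k => exists l x, l ∊ w /\ x ∊ SL u /\ hit a k l x))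
    as (k & Hk & Hku); auto; [dfn|dfn|apply unb_all; auto|..].
  { intros a Ha _. destruct (Ffull (pi1 (ap h a)) u) as (t & k & l & x & Ht & Hth & Hk & Hl & Hx & Hf);
      auto; [apply HhR; auto|].
    exists k. split; auto. exists l, x. split; auto. split; auto. exists t; auto. }
  destruct (pigeonhole mu w (fun a => True /\ exists l x, l ∊ w /\ x ∊ SL u /\ hit a k l x)
     (fun a l => exists x, x ∊ SL u /\ hit a k l x)) as (l & Hl & Hlu); auto; [dfn|dfn|..].
  { intros a Ha [_ (l & x & Hl & Hx & H)]. eauto. }
  destruct (pigeonhole_small mu (SL u) (fun a => (True /\ exists l x, l ∊ w /\ x ∊ SL u /\ hit a k l x)
     /\ exists x, x ∊ SL u /\ hit a k l x) (fun a x => hit a k l x)) as (x & Hx & Hxu); auto; [dfn|dfn|..].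
  { intros a Ha [_ H]. auto. }
  destruct (unb_two mu _ Hmu Hxu) as (a & a' & Ha & Ha' & [_ (t & Ht & Hth & Hf)] &
    [_ (t' & Ht' & Hth' & Hf')] & Hlt).
  destruct (HhR a Ha) as (_ & _ & _ & Hsp). destruct (HhR a' Ha') as (_ & _ & Hb & _).
  (* For a below a', the side condition of stage a' extends g a. Hence t' and t choose the same x
     although g a and the side condition of stage a are split. *)
  apply (Hsp k l Hk Hl u x Hu (Hul' a Ha) Hx). exists t', t. do 2 (split; auto).
  split; [|auto]. apply (Ttrans _ (pi1 (ap h a'))); auto.
Qed.
End Split.

Theorem branch_exists : exists k l b, k ∊ w /\ l ∊ w /\ cofinal_branch k l b.
Proof. apply NNPP. exact split_false. Qed.
End Preservation.

(** * Normal measures and the Levy collapse *)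

(* In the ultrapower by a normal measure on P_kappa(A), a condition t is a condition of
   j(P) above kappa, and the indices z are those where it lies in the generic filter.
   Conditions t carry a partial enumeration kk t of A of length below mu, and stand for
   sets of indices z, each with a total enumeration KK z that extends kk t. *)
Record star {W : struct} (mu A T Zs : W) (leT : W -> W -> Prop) (kk : W -> W -> W -> Prop)
  (ix : W -> W -> Prop) (KK : W -> W -> W -> Prop) : Prop := Star {
  st_dle : Def2 leT;
  st_dkk : Def3 kk;
  st_dix : Def2 ix;
  st_dKK : Def3 KK;
  st_refl : forall t, t ∊ T -> leT t t;
  st_trans : forall t s r, leT t s -> leT s r -> leT t r;
  st_len : forall t, t ∊ T -> exists c, c ∊ mu /\ forall x, (exists a, kk t x a) <-> x ∊ c;
  st_kfun : forall t x a b, t ∊ T -> kk t x a -> kk t x b -> a = b;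
  st_kA : forall t x a, t ∊ T -> kk t x a -> a ∊ A;
  st_kmono : forall t t' x a, leT t' t -> kk t x a -> kk t' x a;
  st_imono : forall t t' z, leT t' t -> ix t' z -> ix t z;
  st_iZ : forall t z, t ∊ T -> ix t z -> z ∊ Zs;
  st_iK : forall t z x a, t ∊ T -> ix t z -> kk t x a -> KK z x a;
  st_Kfun : forall z x a b, KK z x a -> KK z x b -> a = b;
  st_Kmu : forall z x a, KK z x a -> x ∊ mu /\ a ∊ A;
  st_ext : forall t a c, t ∊ T -> a ∊ A -> (forall x, (exists a, kk t x a) <-> x ∊ c) ->
    exists t', t' ∊ T /\ leT t' t /\ forall x b, kk t' x b <-> kk t x b \/ (x = c /\ b = a);
  st_closed : forall d f, d ∊ mu -> dseq T leT d f -> exists t, t ∊ T /\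
    (forall i, i ∊ d -> leT t (ap f i)) /\ forall x a, kk t x a <-> exists i, i ∊ d /\ kk (ap f i) x a;
  st_ne : forall t, t ∊ T -> exists z, ix t z;
  st_dec : forall t w f, t ∊ T -> w ∊ mu -> isfn f Zs -> (forall z, z ∊ Zs -> ap f z ∊ w) ->
    exists t' i, t' ∊ T /\ leT t' t /\ i ∊ w /\ forall z, ix t' z -> ap f z = i }.

Section Bounded.
Context {M : struct} {Z : ZFC M}.
Implicit Types X d m : M.
Lemma onto_total X d : onto X d -> (exists x, x ∊ X) ->
  exists g, isfn g d /\ (forall i, i ∊ d -> ap g i ∊ X) /\ forall x, x ∊ X -> exists i, i ∊ d /\ ap g i = x.
Proof.
  intros (f & Hf & Hs) [x0 Hx0].
  destruct (AC_rel (fun i x => x ∊ X /\ ((exists y, y ∊ X /\ op i y ∊ f) -> op i x ∊ f)) d)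
    as (g & Hg & HgR); [dfn|..].
  { intros i _. destruct (classic (exists y, y ∊ X /\ op i y ∊ f)) as [(y & Hy & Hiy)|Hn]; eauto.
    exists x0. tauto. }
  exists g. split; auto. split; [intros i Hi; apply HgR; auto|].
  intros x Hx. destruct (Hs x Hx) as (i & Hi & Hix). exists i. split; auto.
  apply (Hf i); auto. apply HgR; eauto.
Qed.
Lemma small_bounded m X : reg m -> small m X -> subs X m -> exists b, b ∊ m /\ subs X b.
Proof.
  intros Hm (d & Hd & f & Hf & Hs) HX.
  destruct (reg_bound_rel m (fun i c => forall x, op i x ∊ f -> x ∊ X -> x = c) d) as (b & Hb & H); auto.
  - dfn.
  - intros i Hi. destruct (classic (exists x, op i x ∊ f /\ x ∊ X)) as [(x & Hx & HxX)|Hn].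
    + exists x. split; auto. intros y Hy _. eauto.
    + exists emp. split; [apply reg_emp; auto|]. intros x Hx HxX. exfalso; eauto.
  - exists b. split; auto. intros x Hx. destruct (Hs x Hx) as (i & Hi & Hix).
    destruct (H i Hi) as (c & Hc & Hcx). rewrite (Hcx x); auto.
Qed.
End Bounded.

Section Measure.
Context {M : struct} {Z : ZFC M} (kappa A0 K U : M).
Context (Hk : reg kappa) (HA : subs kappa A0)
  (HK : forall z, z ∊ K <-> subs z A0 /\ small kappa z)
  (U_sub : forall Y, Y ∊ U -> subs Y K)
  (U_K : K ∊ U)
  (U_ne : forall Y, Y ∊ U -> exists x, x ∊ Y)
  (U_up : forall Y Y', Y ∊ U -> subs Y Y' -> subs Y' K -> Y' ∊ U)
  (U_ult : forall Y, subs Y K -> Y ∊ U \/ sep K (fun x => ~ x ∊ Y) ∊ U)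
  (U_comp : forall F, subs F U -> (exists Y, Y ∊ F) -> small kappa F ->
            sep K (fun x => forall Y, Y ∊ F -> x ∊ Y) ∊ U)
  (U_fine : forall a, a ∊ A0 -> sep K (fun x => a ∊ x) ∊ U)
  (U_norm : forall f, isfn f K -> (forall x, x ∊ K -> ap f x ∊ A0) ->
            sep K (fun x => ap f x ∊ x) ∊ U -> exists a, a ∊ A0 /\ sep K (fun x => ap f x = a) ∊ U).

Implicit Types X Y d m s t k c : M.
Definition ae (Q : M -> Prop) : Prop := exists Y, Y ∊ U /\ forall x, x ∊ Y -> Q x.
Lemma D_ae (k : nat) (Q : (nat -> M) -> M -> Prop) :
  D (S k) (fun e => Q (fun n => e (S n)) (e 0)) -> D k (fun e => ae (Q e)).
Proof.
  intros H. unfold ae. apply D_ex, D_and; [dfn|]. apply D_all, D_imp; [dfn|].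
  apply (D_ren (S k) (S (S k)) _ (up S) H). intros [|i] Hi; cbn; lia.
Qed.
Ltac dfn_extra ::=
  match goal with
  | |- Tm _ (fun e => sep _ _) => simple apply Tm_sep
  | |- Tm _ (fun e => im _ _) => simple apply Tm_im
  | |- Tm _ (fun e => lam _ _) => simple apply Tm_lam
  | |- Tm _ (fun e => lord _) => simple apply Tm_lord
  | |- D _ (fun e => ae _) => simple apply D_ae
  | |- TmE _ (fun _ => ?c) => apply TmE_const
  | |- TmE _ (fun e => scons _ _) => simple apply TmE_scons
  | H : fnotion _ _ ?Fo _ |- D _ (fun e => ?Fo ?f (@?p e) (@?te e)) =>
      apply (n_def _ _ _ _ H f _ p te)
  | H : fnotion _ _ _ ?c |- Tm _ (fun e => ?c (@?a e)) => apply (Tm_app1 c _ a (n_chk _ _ _ _ H))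
  end.
Lemma ae_mono (Q Q' : M -> Prop) : (forall x, x ∊ K -> Q x -> Q' x) -> ae Q -> ae Q'.
Proof. intros H (Y & HY & HQ). exists Y. split; auto. intros x Hx. apply H; auto. apply (U_sub Y); auto. Qed.
Lemma ae_K (Q : M -> Prop) : (forall x, x ∊ K -> Q x) -> ae Q.
Proof. intros H. exists K. auto. Qed.
Lemma ae_ex Q : ae Q -> exists x, x ∊ K /\ Q x.
Proof. intros (Y & HY & HQ). destruct (U_ne Y HY) as [x Hx]. exists x. split; auto. apply (U_sub Y); auto. Qed.
Lemma ae_set Q : Def1 Q -> ae Q -> sep K Q ∊ U.
Proof.
  intros HQ (Y & HY & H). apply (U_up Y); auto.
  - intros x Hx. apply sepE; auto. split; auto. apply (U_sub Y); auto.
  - intros x Hx. apply sepE in Hx; tauto.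
Qed.
Lemma ae_small (Q : M -> M -> Prop) X : Def2 Q -> small kappa X ->
  (forall i, i ∊ X -> ae (Q i)) -> ae (fun x => forall i, i ∊ X -> Q i x).
Proof.
  intros HQ HX H. destruct (classic (exists i, i ∊ X)) as [(i0 & Hi0)|Hn].
  2: { apply ae_K. intros x _ i Hi. exfalso; eauto. }
  assert (HF : Fun1 (fun i => sep K (Q i))) by dfn.
  exists (sep K (fun x => forall Y, Y ∊ im (fun i => sep K (Q i)) X -> x ∊ Y)). split.
  - apply U_comp.
    + intros Y HY. apply imE in HY; auto. destruct HY as (i & Hi & ->). apply ae_set; auto. dfn.
    + exists (sep K (Q i0)). apply imE; eauto.
    + apply small_im; auto.
  - intros x Hx i Hi. apply sepE in Hx; [|dfn]. destruct Hx as [_ Hx].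
    assert (Hxi : x ∊ sep K (Q i)) by (apply Hx, imE; eauto). apply sepE in Hxi; [tauto|dfn].
Qed.
Lemma ae_and (Q Q' : M -> Prop) : ae Q -> ae Q' -> ae (fun x => Q x /\ Q' x).
Proof.
  intros (Y & HY & H) (Y' & HY' & H').
  destruct (ae_small (fun i x => x ∊ i) (upair Y Y')) as (W & HW & HH); [dfn|..].
  - apply (small_onto _ _ (succ one)); [|apply small_mem, reg_succ, reg_one; auto].
    apply (onto_rel (fun i x => (i = emp /\ x = Y) \/ (i = one /\ x = Y'))); [dfn|..].
    + intros i x y _ [[H1 H2]|[H1 H2]] [[H3 H4]|[H3 H4]]; subst; auto; exfalso;
        apply (empE emp); [rewrite H3 at 2|rewrite <- H3 at 2]; apply singE; auto.
    + intros x Hx. apply upairE in Hx. destruct Hx; subst.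
      * exists emp. split; auto. apply succE. left. apply singE; auto.
      * exists one. split; auto. apply succE; auto.
  - intros i Hi. apply upairE in Hi. destruct Hi; subst; [exists Y|exists Y']; auto.
  - exists W. split; auto. intros x Hx. split; [apply H|apply H']; apply (HH x Hx); apply upairE; auto.
Qed.
Lemma ae_dec Q : Def1 Q -> ae Q \/ ae (fun x => ~ Q x).
Proof.
  intros HQ. destruct (U_ult (sep K Q)) as [H|H].
  - intros x Hx. apply sepE in Hx; tauto.
  - left. exists (sep K Q). split; auto. intros x Hx. apply sepE in Hx; tauto.
  - right. eexists. split; [exact H|]. intros x Hx HQx. apply sepE in Hx; [|dfn].
    destruct Hx as [H1 H2]. apply H2. apply sepE; auto.
Qed.
(** If each of the fewer than kappa values failed almost everywhere, completeness would give an
    index at which all of them fail. *)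
Lemma ae_const (R : M -> M -> Prop) X : Def2 R -> small kappa X ->
  ae (fun x => exists i, i ∊ X /\ R x i) -> exists i, i ∊ X /\ ae (fun x => R x i).
Proof.
  intros HR HX H. apply NNPP. intros Hn.
  assert (H2 : ae (fun x => forall i, i ∊ X -> ~ R x i)).
  { apply (ae_small (fun i x => ~ R x i)); auto; [dfn|]. intros i Hi.
    destruct (ae_dec (fun x => R x i)) as [H1|H1]; [dfn| |auto]. exfalso; eauto. }
  destruct (ae_ex _ (ae_and _ _ H H2)) as (x & _ & (i & Hi & HRi) & Hno). apply (Hno i Hi HRi).
Qed.
Lemma ae_fine a : a ∊ A0 -> ae (fun x => a ∊ x).
Proof.
  intros Ha. eexists. split; [apply (U_fine a Ha)|]. intros x Hx. apply sepE in Hx; [tauto|dfn].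
Qed.
Lemma ae_fine_small X : subs X A0 -> small kappa X -> ae (fun x => subs X x).
Proof.
  intros H Hs. unfold subs. apply (ae_small (fun i x => i ∊ x)); auto; [dfn|].
  intros i Hi. apply ae_fine; auto.
Qed.
Lemma ae_norm (R : M -> M -> Prop) : Def2 R ->
  ae (fun x => exists y, y ∊ x /\ R x y) -> exists a, a ∊ A0 /\ ae (fun x => a ∊ x /\ R x a).
Proof.
  intros HR H.
  destruct (AC_rel (fun x y => y ∊ A0 /\ ((exists y, y ∊ x /\ R x y) -> y ∊ x /\ R x y)) K)
    as (f & Hf & HfR); [dfn|..].
  { intros x Hx. destruct (classic (exists y, y ∊ x /\ R x y)) as [(y & Hy & HRy)|Hn].
    - exists y. split; auto. apply HK in Hx. apply (proj1 Hx); auto.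
    (* The default value emp belongs to A0 because A0 contains kappa. *)
    - exists emp. split; [apply HA, reg_emp; auto|]. tauto. }
  destruct (U_norm f Hf) as (a & Ha & HUa).
  - intros x Hx. apply HfR; auto.
  - apply ae_set; [dfn|]. revert H. apply ae_mono. intros x Hx H. apply HfR; auto.
  - exists a. split; auto.
    assert (H2 : ae (fun x => ap f x = a)).
    { eexists. split; [exact HUa|]. intros x Hx. apply sepE in Hx; [tauto|dfn]. }
    generalize (ae_and _ _ H H2). apply ae_mono. intros x Hx [H3 <-]. apply HfR; auto.
Qed.

Section Levy.
Context (mu P L : M) (Hmu : reg mu) (Hmuc : forall d, d ∊ mu -> ~ onto mu d)
  (Hkc : forall d, d ∊ kappa -> ~ onto kappa d) (Hmk : mu ∊ kappa).
Definition cond p : Prop :=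
  (forall z, z ∊ p -> exists a x b, a ∊ kappa /\ x ∊ mu /\ b ∊ a /\ z = op (op a x) b) /\
  (forall d b b', op d b ∊ p -> op d b' ∊ p -> b = b') /\ small mu p.
Context (HP : forall p, p ∊ P <-> cond p)
  (HL : forall q p, op q p ∊ L <-> q ∊ P /\ p ∊ P /\ subs p q).

Lemma mu_kappa x : x ∊ mu -> x ∊ kappa.
Proof. intros. apply (proj1 (proj1 Hk) mu); auto. Qed.
Lemma small_mk X : small mu X -> small kappa X.
Proof. intros (d & Hd & H). exists d. split; auto. apply mu_kappa; auto. Qed.
Lemma cond_sub p q : q ∊ P -> subs p q -> p ∊ P.
Proof.
  rewrite !HP. intros (H1 & H2 & H3) Hs. split; [|split]; eauto. eapply small_sub; eauto.
Qed.
Lemma cond_emp : emp ∊ P.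
Proof.
  apply HP. split; [|split]; try (intros; exfalso; eapply empE; eauto; fail).
  exists emp. split; [apply reg_emp; auto|]. exists emp.
  split; intros; exfalso; eapply empE; eauto.
Qed.
Lemma levy_poset : (exists p, p ∊ P) /\ (forall p q, op p q ∊ L -> p ∊ P /\ q ∊ P) /\
  (forall p, p ∊ P -> op p p ∊ L) /\ (forall p q r, op p q ∊ L -> op q r ∊ L -> op p r ∊ L).
Proof.
  split; [exists emp; apply cond_emp|]. split; [|split].
  - intros p q H. apply HL in H. tauto.
  - intros p Hp. apply HL. unfold subs. auto.
  - intros p q r H1 H2. apply HL in H1, H2. apply HL. unfold subs in *. intuition auto.
Qed.
Lemma cond_cup p q : p ∊ P -> q ∊ P ->
  (forall d b b', op d b ∊ p -> op d b' ∊ q -> b = b') -> cup p q ∊ P.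
Proof.
  rewrite !HP. intros (H1 & H2 & H3) (H4 & H5 & H6) H. split; [|split].
  - intros z Hz. apply cupE in Hz. destruct Hz; auto.
  - intros d b b' Hb Hb'. rewrite cupE in Hb, Hb'. destruct Hb, Hb'; eauto. symmetry; eauto.
  - apply small_cup; auto.
Qed.
Lemma le_cup p q : cup p q ∊ P -> op (cup p q) p ∊ L /\ op (cup p q) q ∊ L.
Proof.
  intros H. rewrite !HL. assert (Hp : subs p (cup p q)) by (intros x Hx; apply cupE; auto).
  assert (Hq : subs q (cup p q)) by (intros x Hx; apply cupE; auto).
  split; (split; [auto|split; [eapply cond_sub; eauto|auto]]).
Qed.
Lemma chain_union d (f : M -> M) : Fun1 f -> d ∊ mu -> (forall i, i ∊ d -> f i ∊ P) ->
  (forall i j, i ∊ d -> j ∊ d -> i ∊ j -> subs (f i) (f j)) -> union (im f d) ∊ P.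
Proof.
  intros Hf Hd Hv Hm. assert (Hdo : Ord d) by (eapply ord_mem; [apply Hmu|auto]).
  assert (HE : forall x, x ∊ union (im f d) <-> exists i, i ∊ d /\ x ∊ f i).
  { intros x. rewrite unionE. split.
    - intros (y & Hy & Hx). apply imE in Hy; auto. destruct Hy as (i & Hi & ->). eauto.
    - intros (i & Hi & Hx). exists (f i). split; auto. apply imE; eauto. }
  apply HP. split; [|split].
  - intros z Hz. apply HE in Hz. destruct Hz as (i & Hi & Hz).
    specialize (Hv i Hi). apply HP in Hv. apply Hv; auto.
  - intros x b b' Hb Hb'. apply HE in Hb, Hb'. destruct Hb as (i & Hi & Hb), Hb' as (j & Hj & Hb').
    destruct (ord_tri i j) as [H|[H|H]]; try (eapply ord_mem; eauto; fail).
    + specialize (Hv j Hj). apply HP in Hv. apply (proj1 (proj2 Hv) x); auto. apply (Hm i j); auto.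
    + subst. specialize (Hv j Hj). apply HP in Hv. apply (proj1 (proj2 Hv) x); auto.
    + specialize (Hv i Hi). apply HP in Hv. apply (proj1 (proj2 Hv) x); auto. apply (Hm j i); auto.
  - apply small_union; auto. intros i Hi. specialize (Hv i Hi). apply HP in Hv. apply Hv.
Qed.
Lemma levy_closed : closed P (fun q p => op q p ∊ L) mu.
Proof.
  intros d f Hd (Hf & Hv & Hdec).
  assert (HU : union (im (ap f) d) ∊ P).
  { apply chain_union; auto; [dfn|]. intros i j Hi Hj Hij. specialize (Hdec i j Hij Hj).
    apply HL in Hdec. tauto. }
  exists (union (im (ap f) d)). split; auto. intros i Hi. apply HL. split; auto. split; auto.
  intros x Hx. apply unionE. exists (ap f i). split; auto. apply imE; [dfn|eauto].
Qed.

(** The collapse coordinate a of an entry ((a, xi), b). *)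
Definition dm x : M := pi1 (pi1 x).
Lemma Fun_dm : Fun1 dm.
Proof. unfold dm. dfn. Qed.
Hint Resolve Fun_dm : dfn.
Lemma dm_op a x b : dm (op (op a x) b) = a.
Proof. unfold dm. rewrite !pi1_op. auto. Qed.
Lemma cond_dm p x : p ∊ P -> x ∊ p -> dm x ∊ kappa.
Proof.
  intros Hp Hx. apply HP in Hp. destruct (proj1 Hp x Hx) as (a & y & b & Ha & _ & _ & ->).
  rewrite dm_op. auto.
Qed.
(** A condition has fewer than kappa entries, so fineness and completeness put all its coordinates
    into z. *)
Lemma ae_dm p : p ∊ P -> ae (fun z => forall x, x ∊ p -> dm x ∊ z).
Proof.
  intros Hp. apply (ae_mono (fun z => subs (im dm p) z)).
  - intros z _ H x Hx. apply H, imE; [dfn|eauto].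
  - apply ae_fine_small.
    + intros x Hx. apply imE in Hx; [|dfn]. destruct Hx as (y & Hy & ->). apply HA.
      eapply cond_dm; eauto.
    + apply small_im; [dfn|]. apply HP in Hp. apply small_mk, Hp.
Qed.

(* In terms of the ultrapower: the part of [q] below kappa is a condition of P itself. *)
Lemma decomposition (q : M -> M) : Fun1 q -> ae (fun z => q z ∊ P) ->
  exists p, ae (fun z => forall x, x ∊ p <-> x ∊ q z /\ dm x ∊ z).
Proof.
  intros Hq HqP.
  (* The sizes of the conditions are below mu, so almost all q z can be enumerated on the same
     ordinal d; the proof then treats the i-th entries for one i at a time. *)
  destruct (ae_const (fun z d => onto (q z) d) mu) as (d & Hd & Had); [dfn|apply small_mem; auto|..].
  { revert HqP. apply ae_mono. intros z _ Hz. apply HP in Hz. destruct Hz as (_ & _ & H). exact H. }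
  destruct (AC_rel (fun z f => onto (q z) d ->
     (forall i x y, op i x ∊ f -> op i y ∊ f -> x = y) /\
     forall x, x ∊ q z -> exists i, i ∊ d /\ op i x ∊ f) K) as (f & Hf & HfR); [dfn|..].
  { intros z _. destruct (classic (onto (q z) d)) as [(g & Hg)|Hn]; [eauto|exists emp; tauto]. }
  assert (Hgood : ae (fun z => q z ∊ P /\ onto (q z) d)) by (apply ae_and; auto).
  set (V := fun i x z => op i x ∊ ap f z /\ x ∊ q z /\ dm x ∊ z).
  assert (DV : Def3 V) by (unfold V; dfn).
  (* If the coordinate of the i-th entry lies in z almost everywhere, normality makes this
     coordinate a constant. Then completeness fixes the position, which is below mu, and the value,
     which is below a. *)
  assert (Hcase : forall i, i ∊ d -> ae (fun z => ~ exists x, V i x z) \/ exists x, ae (V i x)).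
  { intros i Hi. destruct (ae_dec (fun z => exists x, V i x z)) as [H|H]; [dfn| |auto]. right.
    destruct (ae_norm (fun z a => q z ∊ P /\ exists x, V i x z /\ dm x = a)) as (a & Ha & H1); [dfn|..].
    { generalize (ae_and _ _ H HqP). apply ae_mono. intros z _ [(x & Hx) HqPz]. exists (dm x).
      split; [apply Hx|eauto]. }
    assert (Hak : a ∊ kappa).
    { destruct (ae_ex _ H1) as (z & _ & _ & Hz & x & Hx & <-). apply (cond_dm (q z)); auto. apply Hx. }
    destruct (ae_const (fun z y => exists b, b ∊ a /\ V i (op (op a y) b) z) mu) as (y & Hy & H2);
      [dfn|apply small_mem; auto|..].
    { revert H1. apply ae_mono. intros z _ (Haz & Hz & x & Hx & Ex). apply HP in Hz.
      destruct (proj1 Hz x) as (a' & y & b & Ha' & Hy & Hb & E); [apply Hx|]. subst x.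
      rewrite dm_op in Ex. subst. eauto. }
    destruct (ae_const (fun z b => V i (op (op a y) b) z) a) as (b & Hb & H3);
      [dfn|apply small_mem; auto|auto|]. eauto. }
  set (p := sep (union P) (fun x => ae (fun z => x ∊ q z /\ dm x ∊ z))).
  assert (Hp : forall x, x ∊ p <-> ae (fun z => x ∊ q z /\ dm x ∊ z)).
  { intros x. unfold p. rewrite sepE by dfn. split; [tauto|]. intros H. split; auto.
    destruct (ae_ex _ (ae_and _ _ H HqP)) as (z & _ & [Hx _] & Hz). apply unionE. eauto. }
  exists p.
  assert (H1 : ae (fun z => forall i, i ∊ d -> forall x, V i x z -> x ∊ p)).
  { apply (ae_small (fun i z => forall x, V i x z -> x ∊ p)); [dfn|apply small_mk, small_mem; auto|].
    intros i Hi. destruct (Hcase i Hi) as [H|(x & Hx)].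
    - revert H. apply ae_mono. intros z _ H x Hx. exfalso; eauto.
    - assert (Hxp : x ∊ p) by (apply Hp; revert Hx; apply ae_mono; intros z _ H; apply H).
      generalize (ae_and _ _ Hx Hgood). apply ae_mono.
      intros z Hz [(H2 & H3 & _) [_ H4]] y (H5 & _ & _).
      destruct (HfR z Hz H4) as [Hfun _]. rewrite (Hfun _ _ _ H5 H2). auto. }
  assert (Hsm : small kappa p).
  { apply (small_onto _ _ d); [|apply small_mk, small_mem; auto].
    apply (onto_rel (fun i x => ae (V i x))); [dfn|..].
    - intros i x y _ Hx Hy.
      destruct (ae_ex _ (ae_and _ _ Hgood (ae_and _ _ Hx Hy))) as (z & Hz & [_ H] & H2 & H3).
      destruct (HfR z Hz H) as [Hfun _]. apply (Hfun i); [apply H2|apply H3].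
    - intros x Hx. apply Hp in Hx.
      apply (ae_const (fun z i => V i x z) d); [dfn|apply small_mk, small_mem; auto|].
      generalize (ae_and _ _ Hgood Hx). apply ae_mono. intros z Hz [[_ H] [H2 H3]].
      destruct (HfR z Hz H) as [_ Hs]. destruct (Hs x H2) as (i & Hi & Hix).
      exists i. split; auto. split; auto. }
  assert (H2 : ae (fun z => forall x, x ∊ p -> x ∊ q z /\ dm x ∊ z)).
  { apply (ae_small (fun x z => x ∊ q z /\ dm x ∊ z)); auto; [dfn|]. intros x Hx. apply Hp; auto. }
  generalize (ae_and _ _ Hgood (ae_and _ _ H1 H2)). apply ae_mono.
  intros z Hz [[_ Ho] [H3 H4]] x. split; auto. intros [Hx Hxz].
  destruct (HfR z Hz Ho) as [_ Hs]. destruct (Hs x Hx) as (i & Hi & Hix).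
  apply (H3 i Hi). split; auto.
Qed.

(** This takes the place of the kappa-chain condition. If values escaped almost every z, choose q z
    that decides a value b z outside z. By [decomposition] the parts of the q z at coordinates in z
    agree, so q z1 is compatible with q z for some z that contains the coordinates of q z1 and also
    b z1. Then b z = b z1 lies in z. *)
Lemma bounded_values (p0 : M) (dec : M -> M -> M -> Prop) : Def3 dec -> p0 ∊ P ->
  (forall r r' x b, op r' r ∊ L -> dec r x b -> dec r' x b) ->
  (forall r x b b', op r p0 ∊ L -> dec r x b -> dec r x b' -> b = b') ->
  exists z, z ∊ K /\ forall x r b, x ∊ mu -> op r p0 ∊ L -> b ∊ kappa -> dec r x b -> b ∊ z.
Proof.
  intros Hdec Hp0 Hmono Hfun. apply ae_ex.
  apply (ae_mono (fun z => forall x, x ∊ mu -> forall r b, op r p0 ∊ L -> b ∊ kappa -> dec r x b -> b ∊ z)).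
  { intros z _ H x r b Hx Hr Hb. eauto. }
  apply (ae_small (fun x z => forall r b, op r p0 ∊ L -> b ∊ kappa -> dec r x b -> b ∊ z)); [dfn|..].
  { apply small_mem; auto. }
  intros x Hx. destruct (ae_dec (fun z => forall r b, op r p0 ∊ L -> b ∊ kappa -> dec r x b -> b ∊ z))
    as [H|H]; [dfn|auto|exfalso].
  destruct (AC_rel (fun z y => pi1 y ∊ P /\ ((~ forall r b, op r p0 ∊ L -> b ∊ kappa -> dec r x b -> b ∊ z)
     -> op (pi1 y) p0 ∊ L /\ pi2 y ∊ kappa /\ dec (pi1 y) x (pi2 y) /\ ~ pi2 y ∊ z)) K)
    as (f & Hf & HfR); [dfn|..].
  { intros z _. destruct (classic (forall r b, op r p0 ∊ L -> b ∊ kappa -> dec r x b -> b ∊ z)) as [Hz|Hz].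
    - exists (op p0 emp). rewrite pi1_op. tauto.
    - apply NNPP. intros Hn. apply Hz. intros r b Hr Hb Hd. apply NNPP. intros Hbz. apply Hn.
      exists (op r b). rewrite pi1_op, pi2_op. split; [apply HL in Hr; tauto|auto]. }
  set (q := fun z => pi1 (ap f z)). set (b := fun z => pi2 (ap f z)).
  assert (Hq : Fun1 q) by (unfold q; dfn).
  assert (Hb : Fun1 b) by (unfold b; dfn).
  assert (HqP : forall z, z ∊ K -> q z ∊ P) by (intros z Hz; apply (HfR z Hz)).
  destruct (decomposition q Hq) as (p & Hp); [apply ae_K; auto|].
  destruct (ae_ex _ (ae_and _ _ H Hp)) as (z1 & Hz1 & Hbad1 & Hp1).
  destruct (HfR z1 Hz1) as [_ H1]. destruct (H1 Hbad1) as (Hq1 & Hb1 & Hd1 & _). clear H1.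
  fold (q z1) in Hq1, Hd1. fold (b z1) in Hb1, Hd1.
  destruct (ae_ex _ (ae_and _ _ (ae_and _ _ H Hp) (ae_and _ _ (ae_dm (q z1) (HqP z1 Hz1))
     (ae_fine (b z1) (HA _ Hb1))))) as (z & Hz & [Hbad Hpz] & Hdm & Hbz).
  destruct (HfR z Hz) as [_ H1]. destruct (H1 Hbad) as (Hqz & _ & Hdz & Hnz). clear H1.
  fold (q z) in Hqz, Hdz. fold (b z) in Hdz, Hnz.
  assert (Hc : cup (q z1) (q z) ∊ P).
  { apply cond_cup; auto. intros d c c' Hc Hc'.
    assert (Hin : op d c' ∊ q z1).
    { apply Hp1. apply Hpz. split; auto. pose proof (Hdm _ Hc) as Hd. unfold dm in *.
      rewrite pi1_op in *. auto. }
    pose proof (HqP z1 Hz1) as H2. apply HP in H2. apply (proj1 (proj2 H2) d); auto. }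
  destruct (le_cup _ _ Hc) as [Hl1 Hl2].
  apply Hnz. rewrite (Hfun (cup (q z1) (q z)) x (b z) (b z1)); auto.
  - apply (proj2 (proj2 (proj2 levy_poset)) _ (q z1)); auto.
  - apply (Hmono (q z)); auto.
  - apply (Hmono (q z1)); auto.
Qed.
(** In the ultrapower this is an ordinal below j(kappa) that is not in the image of A0, so not below
    kappa, together with a map of it onto the image of A0. The collapse at this coordinate
    enumerates A0 in length mu. *)
Lemma collapse_index : exists az, isfn az K /\ forall z, z ∊ K -> (exists y, y ∊ z) ->
  let a := pi1 (ap az z) in let e := pi2 (ap az z) in
  a ∊ kappa /\ ~ a ∊ z /\ isfn e a /\ (forall b, b ∊ a -> ap e b ∊ z) /\
  forall y, y ∊ z -> exists b, b ∊ a /\ ap e b = y.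
Proof.
  apply (AC_rel (fun z y => (exists y, y ∊ z) -> pi1 y ∊ kappa /\ ~ pi1 y ∊ z /\ isfn (pi2 y) (pi1 y) /\
    (forall b, b ∊ pi1 y -> ap (pi2 y) b ∊ z) /\
    forall x, x ∊ z -> exists b, b ∊ pi1 y /\ ap (pi2 y) b = x)); [dfn|].
  intros z Hz. destruct (classic (exists y, y ∊ z)) as [Hne|Hn]; [|exists emp; tauto].
  apply HK in Hz. destruct Hz as [HzA Hzs].
  destruct (small_bounded kappa (sep z (fun x => x ∊ kappa))) as (b & Hb & Hbs); auto.
  { eapply small_sub; [|exact Hzs]. intros x Hx. apply sepE in Hx; [tauto|dfn]. }
  { intros x Hx. apply sepE in Hx; [tauto|dfn]. }
  destruct Hzs as (d & Hd & Ho).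
  destruct (ord_max b d) as (a & Ha & Hba & Hda); try (eapply ord_mem; [apply Hk|auto]; fail).
  assert (Hak : a ∊ kappa) by (destruct Ha; subst; auto).
  destruct (onto_total z a) as (e & He & Hev & Hes); auto.
  { eapply onto_sub; [| |exact Ho]; auto. unfold subs; auto. }
  exists (op a e). intros _. rewrite pi1_op, pi2_op. split; auto. split; [|auto].
  intros Haz. apply (mem_irrefl a). apply Hba, Hbs. apply sepE; [dfn|auto].
Qed.

Section Levy_extension.
Context {N : struct} {ZN : ZFC N} {Fo : fm -> M -> (nat -> M) -> Prop} {chk : M -> M}
  (F : fnotion P L Fo chk) {G : M -> Prop} {val : M -> N} (X : gext P L Fo chk G val).
Local Notation ι := (@ii M N chk val).

Lemma decide_value (gn d B : M) (ffun fpin : fm) :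
  (forall (X : Type) (e : nat -> X), is_fun (e 0) (e 1) (e 2) = dinst ffun e) ->
  (forall (X : Type) (e : nat -> X), pin (e 0) (e 1) (e 2) = dinst fpin e) ->
  forall p0, Fo ffun p0 (scons gn (scons (chk d) (fun _ => chk B))) ->
  (forall r i, i ∊ d -> op r p0 ∊ L ->
     exists r' y, op r' r ∊ L /\ y ∊ B /\ Fo fpin r' (scons (chk i) (scons (chk y) (fun _ => gn)))) /\
  forall r i y y', op r p0 ∊ L -> Fo fpin r (scons (chk i) (scons (chk y) (fun _ => gn))) ->
     Fo fpin r (scons (chk i) (scons (chk y') (fun _ => gn))) -> y = y'.
Proof.
  intros Hffun Hfpin p0 Hf0.
  assert (W : forall r, op r p0 ∊ L -> exists (N' : struct) (G' : M -> Prop) (val' : M -> N'),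
    gext P L Fo chk G' val' /\ G' r /\ ZFC N' /\
    sat mem (is_fun (val' gn) (val' (chk d)) (val' (chk B)))).
  { intros r Hr. destruct (n_gen _ _ _ _ F r) as (N' & G' & val' & X' & Hr').
    { apply (n_dom _ _ _ _ F) in Hr. tauto. }
    exists N', G', val'. split; auto. split; auto. split; [exact (g_zfc _ _ _ _ _ _ X')|].
    apply (truth_u X' _ _ (scons gn (scons (chk d) (fun _ => chk B))) Hffun). exists p0.
    split; auto. apply (g_up _ _ _ _ _ _ X' r); auto. }
  split.
  - intros r i Hi Hr. destruct (W r Hr) as (N' & G' & val' & X' & Hr' & ZN' & Hs).
    apply sat_fun in Hs. destruct Hs as [Hs1 Hs2].
    assert (Hi' : ii (chk := chk) (val := val') i ∊ val' (chk d)) by (apply (ii_mem X'); auto).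
    pose proof (Hs2 _ Hi') as Hy. apply (ii_elim X') in Hy. destruct Hy as (y & Hy & Ey).
    assert (Hpin : sat mem (pin (val' (chk i)) (val' (chk y)) (val' gn))).
    { apply sat_pin. unfold ii in *. rewrite <- Ey. apply (fn_ap _ (val' (chk d))); auto. }
    apply (truth_u X' _ _ (scons (chk i) (scons (chk y) (fun _ => gn))) Hfpin) in Hpin.
    destruct Hpin as (u & Hu & Hfu).
    destruct (force_below F r u _ _ _ _ X' Hr' Hu Hfu) as (r' & Hr1 & Hr2 & Hr3). eauto.
  - intros r i y y' Hr H1 H2. destruct (W r Hr) as (N' & G' & val' & X' & Hr' & ZN' & Hs).
    apply sat_fun in Hs. destruct Hs as [Hs1 _]. apply (v_inj _ _ _ _ _ _ X').
    assert (Hp1 : sat mem (pin (val' (chk i)) (val' (chk y)) (val' gn))).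
    { apply (truth_u X' _ _ (scons (chk i) (scons (chk y) (fun _ => gn))) Hfpin). eauto. }
    assert (Hp2 : sat mem (pin (val' (chk i)) (val' (chk y')) (val' gn))).
    { apply (truth_u X' _ _ (scons (chk i) (scons (chk y') (fun _ => gn))) Hfpin). eauto. }
    apply sat_pin in Hp1, Hp2. rewrite <- (ap_eq _ _ _ _ Hs1 Hp1). apply (ap_eq _ _ _ _ Hs1 Hp2).
Qed.

(** By [bounded_values] all values that the surjection could take lie in one z of size less than
    kappa. *)
Lemma levy_no_onto : ~ onto (ι kappa) (ι mu).
Proof.
  intros Ho. destruct (onto_total (ι kappa) (ι mu) Ho) as (g & Hg & Hgv & Hgs).
  { exists (ι mu). apply (ii_mem X); auto. }
  destruct (v_surj _ _ _ _ _ _ X g) as [gn Egn].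
  destruct (U_fun 0 1 2) as [ffun Hffun]. destruct (U_pin 0 1 2) as [fpin Hfpin].
  assert (H0 : exists p, G p /\ Fo ffun p (scons gn (scons (chk mu) (fun _ => chk kappa)))).
  { apply (truth_u X _ _ _ Hffun). apply sat_fun. cbn [scons]. rewrite <- Egn. auto. }
  destruct H0 as (p0 & Hp0 & Hf0).
  destruct (decide_value gn mu kappa ffun fpin Hffun Hfpin p0 Hf0) as [_ Hfun].
  destruct (bounded_values p0 (fun r x b => Fo fpin r (scons (chk x) (scons (chk b) (fun _ => gn)))))
    as (z & Hz & Hzb); auto.
  - dfn.
  - apply (g_in _ _ _ _ _ _ X); auto.
  - intros r r' x b Hr H. eapply (n_mono _ _ _ _ F); eauto.
  - apply HK in Hz. destruct Hz as [_ (d & Hd & Hod)]. apply (Hkc d Hd).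
    eapply onto_sub; [| |exact Hod]; [|unfold subs; auto]. intros b Hb.
    destruct (Hgs (ι b)) as (i & Hi & Ei); [apply (ii_mem X); auto|].
    apply (ii_elim X) in Hi. destruct Hi as (x & Hx & ->).
    assert (Hpin : sat mem (pin (val (chk x)) (val (chk b)) (val gn))).
    { apply sat_pin. rewrite <- Egn. change (val (chk b)) with (ι b). rewrite <- Ei.
      apply (fn_ap _ (ι mu)); auto. apply (ii_mem X); auto. }
    apply (truth_u X _ _ (scons (chk x) (scons (chk b) (fun _ => gn))) Hfpin) in Hpin.
    destruct Hpin as (u & Hu & Hfu).
    destruct (force_below F p0 u _ _ _ _ X Hp0 Hu Hfu) as (r & Hr & Hrp & Hfr). eauto.
Qed.

Lemma generic_fun p p' d b b' : G p -> G p' -> op d b ∊ p -> op d b' ∊ p' -> b = b'.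
Proof.
  intros Hp Hp' Hb Hb'. destruct (g_dir _ _ _ _ _ _ X p p' Hp Hp') as (r & Hr & Hrp & Hrp').
  apply HL in Hrp, Hrp'. destruct Hrp as (HrP & _ & Hs), Hrp' as (_ & _ & Hs').
  apply HP in HrP. apply (proj1 (proj2 HrP) d); auto.
Qed.

Lemma levy_collapses (x : N) : x ∊ ι kappa -> onto x (ι mu).
Proof.
  intros Hx. apply (ii_elim X) in Hx. destruct Hx as (a & Ha & ->).
  destruct (v_gen _ _ _ _ _ _ X) as (g & Hg).
  apply (onto_rel (fun i b => exists p, p ∊ g /\ op (op (ι a) i) b ∊ p)); [dfn|..].
  - intros i b b' _ (p & Hp & Hb) (p' & Hp' & Hb'). apply Hg in Hp, Hp'.
    destruct Hp as (q & Hq & ->), Hp' as (q' & Hq' & ->).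
    apply (ii_opI X) in Hb, Hb'. destruct Hb as (d & c & Ed & -> & Hc), Hb' as (d' & c' & Ed' & -> & Hc').
    rewrite Ed in Ed'. apply (ii_inj X) in Ed'. subst d'. f_equal. apply (generic_fun q q' d c c'); auto.
  - intros y Hy. apply (ii_elim X) in Hy. destruct Hy as (b & Hb & ->).
    destruct (g_meet _ _ _ _ _ _ X (fun p => exists i, i ∊ mu /\ op (op a i) b ∊ p)) as (p & Hp & i & Hi & H).
    + dfn.
    (* A condition has fewer than mu entries and mu is a cardinal, so some position i of coordinate
       a is still free. *)
    + intros p Hp. assert (Hi : exists i, i ∊ mu /\ ~ exists c, op (op a i) c ∊ p).
      { apply NNPP. intros Hn. pose proof Hp as Hp'. apply HP in Hp'.
        destruct Hp' as (_ & _ & d & Hd & Hod). apply (Hmuc d Hd). apply (onto_trans _ p); auto.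
        apply (onto_rel (fun z i => exists c, z = op (op a i) c)); [dfn|..].
        - intros z i j _ (c & ->) (c' & E). apply op_inj in E. destruct E as [E _]. apply op_inj in E. tauto.
        - intros i Hi. apply NNPP. intros Hn'. apply Hn. exists i. split; auto. intros (c & Hc).
          apply Hn'. eauto. }
      destruct Hi as (i & Hi & Hni).
      assert (Hc : cup p (sing (op (op a i) b)) ∊ P).
      { apply cond_cup; auto.
        - apply HP. split; [|split].
          + intros z Hz. apply singE in Hz. subst. exists a, i, b. auto.
          + intros d c c' H H'. apply singE in H, H'. rewrite <- H in H'. apply op_inj in H'.
            destruct H'; auto.
          + apply small_sing; auto.
        - intros d c c' H H'. apply singE in H'. apply op_inj in H'. destruct H'; subst.
          exfalso; eauto. }
      exists (cup p (sing (op (op a i) b))). split; [apply le_cup; auto|]. exists i. split; auto.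
      apply cupE. right. apply singE; auto.
    + exists (ι i). rewrite (ii_mem X). split; auto. exists (ι p). split; [apply Hg; eauto|].
      rewrite <- (ii_op X). apply (ii_opE X); auto.
Qed.
End Levy_extension.

(** * Conditions of the ultrapower collapse above kappa *)

Section Conditions.
Context (az : M) (Haz : forall z, z ∊ K -> (exists y, y ∊ z) ->
  let a := pi1 (ap az z) in let e := pi2 (ap az z) in
  a ∊ kappa /\ ~ a ∊ z /\ isfn e a /\ (forall b, b ∊ a -> ap e b ∊ z) /\
  forall y, y ∊ z -> exists b, b ∊ a /\ ap e b = y).
Definition al z : M := pi1 (ap az z).
Definition ez z : M := pi2 (ap az z).
Lemma Fun_al : Fun1 al.
Proof. unfold al. dfn. Qed.
Lemma Fun_ez : Fun1 ez.
Proof. unfold ez. dfn. Qed.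
Hint Resolve Fun_al Fun_ez : dfn.
Lemma azP z : z ∊ K -> emp ∊ z -> al z ∊ kappa /\ ~ al z ∊ z /\ isfn (ez z) (al z) /\
  (forall b, b ∊ al z -> ap (ez z) b ∊ z) /\ forall y, y ∊ z -> exists b, b ∊ al z /\ ap (ez z) b = y.
Proof. intros Hz He. apply (Haz z Hz). eauto. Qed.

Definition entry z x b : M := op (op (al z) x) b.
Lemma Fun_entry : Fun3 entry.
Proof. unfold entry. dfn. Qed.
Hint Resolve Fun_entry : dfn.
Lemma entry_dm z x b : dm (entry z x b) = al z.
Proof. apply dm_op. Qed.

(* The pair (s, k) stands for a condition of j(P) above kappa whose coordinate [al]
   enumerates k, and c is the length of k. *)
Definition cohere s k c : Prop :=
  isfn s (dom s) /\ dom s ∊ U /\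
  (forall z, z ∊ dom s -> emp ∊ z /\ ap s z ∊ P /\ (forall x, x ∊ ap s z -> ~ dm x ∊ z) /\
     (forall x, x ∊ c -> exists b, entry z x b ∊ ap s z /\ ap (ez z) b = ap k x) /\
     (forall x b, entry z x b ∊ ap s z -> x ∊ c)) /\
  isfn k c /\ c ∊ mu /\ (forall x, x ∊ c -> ap k x ∊ A0).
Lemma Def_cohere : Def3 cohere.
Proof. unfold cohere. dfn. Qed.
Hint Resolve Def_cohere : dfn.
Definition TT : M := sep (prod (pow (prod K P)) (pow (prod mu A0)))
  (fun t => exists c, cohere (pi1 t) (pi2 t) c).
Definition leT t' t : Prop := subs (dom (pi1 t')) (dom (pi1 t)) /\
  (forall z, z ∊ dom (pi1 t') -> subs (ap (pi1 t) z) (ap (pi1 t') z)) /\ subs (pi2 t) (pi2 t').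
Lemma Def_leT : Def2 leT.
Proof. unfold leT. dfn. Qed.
Lemma TT_in t : t ∊ TT -> exists s k c, t = op s k /\ cohere s k c.
Proof.
  intros H. apply sepE in H; [|dfn]. destruct H as [H (c & Hc)]. apply prodE in H.
  destruct H as (s & k & _ & _ & ->). rewrite pi1_op, pi2_op in Hc. eauto.
Qed.
Lemma TT_intro s k c : cohere s k c -> op s k ∊ TT.
Proof.
  intros H. apply sepE; [dfn|]. rewrite prod_op, pi1_op, pi2_op. split; [|eauto].
  destruct H as (Hs & HU & Hz & Hk' & Hc & Hv). rewrite !powE. split; intros x Hx.
  - destruct (proj1 Hs x Hx) as (z & y & Hzd & ->). apply prod_op.
    split; [apply (U_sub (dom s)); auto|]. rewrite <- (ap_eq _ _ _ _ Hs Hx). apply Hz; auto.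
  - destruct (proj1 Hk' x Hx) as (i & y & Hi & ->). apply prod_op. split.
    + apply (proj1 (proj1 Hmu) c); auto.
    + rewrite <- (ap_eq _ _ _ _ Hk' Hx). auto.
Qed.
Lemma cohere_len s k c : cohere s k c -> c = dom k.
Proof.
  intros (_ & _ & _ & Hk' & _). apply ext. intros x. rewrite domE. split.
  - intros Hx. exists (ap k x). apply (fn_ap _ c); auto.
  - intros [y Hy]. eapply fn_dom; eauto.
Qed.
Lemma dom_lam Y (F : M -> M) : Fun1 F -> dom (lam Y F) = Y.
Proof.
  intros HF. apply ext. intros x. rewrite domE. split.
  - intros [y Hy]. apply lam_op in Hy; tauto.
  - intros Hx. exists (F x). apply lam_op; auto.
Qed.
Lemma ae_emp : ae (fun z => emp ∊ z).
Proof. apply ae_fine, HA, reg_emp; auto. Qed.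
Lemma ae_dom Y : Y ∊ U -> ae (fun z => z ∊ Y).
Proof. intros H. exists Y. auto. Qed.

Lemma leT_refl t : leT t t.
Proof. unfold leT, subs. auto. Qed.
Lemma leT_trans t s r : leT t s -> leT s r -> leT t r.
Proof. unfold leT, subs. intros (H1 & H2 & H3) (H4 & H5 & H6). split; [|split]; eauto. Qed.

(** Fewer than mu measure-one domains meet in a measure-one set, on which unions of conditions are
    taken pointwise; regularity of mu keeps the length of the enumeration below mu. *)
Lemma TT_closed d f : d ∊ mu -> dseq TT leT d f -> exists t, t ∊ TT /\
  (forall i, i ∊ d -> leT t (ap f i)) /\ pi2 t = union (im (fun i => pi2 (ap f i)) d).
Proof.
  intros Hd (Hf & Hv & Hdec). assert (Hdo : Ord d) by (eapply ord_mem; [apply Hmu|auto]).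
  set (sf := fun i => pi1 (ap f i)). set (kf := fun i => pi2 (ap f i)).
  assert (Dsf : Fun1 sf) by (unfold sf; dfn). assert (Dkf : Fun1 kf) by (unfold kf; dfn).
  assert (Hc : forall i, i ∊ d -> cohere (sf i) (kf i) (dom (kf i))).
  { intros i Hi. destruct (TT_in _ (Hv i Hi)) as (s & k & c & E & H). unfold sf, kf.
    rewrite E, pi1_op, pi2_op. rewrite <- (cohere_len _ _ _ H). auto. }
  assert (Hdec' : forall i j, i ∊ j -> j ∊ d -> subs (dom (sf j)) (dom (sf i)) /\
     (forall z, z ∊ dom (sf j) -> subs (ap (sf i) z) (ap (sf j) z)) /\ subs (kf i) (kf j)).
  { intros i j Hij Hj. apply (Hdec i j); auto. }
  set (Y := sep K (fun z => emp ∊ z /\ forall i, i ∊ d -> z ∊ dom (sf i))).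
  assert (HY : forall z, z ∊ Y <-> z ∊ K /\ emp ∊ z /\ forall i, i ∊ d -> z ∊ dom (sf i)).
  { intros z. unfold Y. rewrite sepE by dfn. reflexivity. }
  assert (HYU : Y ∊ U).
  { apply ae_set; [dfn|]. apply ae_and; [apply ae_emp|].
    apply (ae_small (fun i z => z ∊ dom (sf i))); [dfn|apply small_mk, small_mem; auto|].
    intros i Hi. apply ae_dom. apply (Hc i Hi). }
  set (S := fun z => union (im (fun i => ap (sf i) z) d)).
  assert (DS : Fun1 S) by (unfold S; dfn).
  assert (HS : forall z x, x ∊ S z <-> exists i, i ∊ d /\ x ∊ ap (sf i) z).
  { intros z x. unfold S. rewrite unionE. split.
    - intros (y & Hy & Hx). apply imE in Hy; [|dfn]. destruct Hy as (i & Hi & ->). eauto.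
    - intros (i & Hi & Hx). exists (ap (sf i) z). split; auto. apply imE; [dfn|eauto]. }
  set (k := union (im kf d)).
  assert (Hkk : forall x, x ∊ k <-> exists i, i ∊ d /\ x ∊ kf i).
  { intros x. unfold k. rewrite unionE. split.
    - intros (y & Hy & Hx). apply imE in Hy; auto. destruct Hy as (i & Hi & ->). eauto.
    - intros (i & Hi & Hx). exists (kf i). split; auto. apply imE; eauto. }
  assert (HcU : forall x, x ∊ union (im (fun i => dom (kf i)) d) <-> exists i, i ∊ d /\ x ∊ dom (kf i)).
  { intros x. rewrite unionE. split.
    - intros (y & Hy & Hx). apply imE in Hy; [|dfn]. destruct Hy as (i & Hi & ->). eauto.
    - intros (i & Hi & Hx). exists (dom (kf i)). split; auto. apply imE; [dfn|eauto]. }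
  set (c := union (im (fun i => dom (kf i)) d)) in *.
  assert (Hkfun : forall i j x y y', i ∊ d -> j ∊ d -> op x y ∊ kf i -> op x y' ∊ kf j -> y = y').
  { intros i j x y y' Hi Hj H1 H2.
    destruct (ord_tri i j) as [H|[H|H]]; try (eapply ord_mem; eauto; fail); subst.
    - apply (proj2 (proj2 (Hdec' i j H Hj))) in H1. destruct (Hc j Hj) as (_ & _ & _ & Hfn & _).
      rewrite <- (ap_eq _ _ _ _ Hfn H1). apply (ap_eq _ _ _ _ Hfn H2).
    - destruct (Hc j Hj) as (_ & _ & _ & Hfn & _).
      rewrite <- (ap_eq _ _ _ _ Hfn H1). apply (ap_eq _ _ _ _ Hfn H2).
    - apply (proj2 (proj2 (Hdec' j i H Hi))) in H2. destruct (Hc i Hi) as (_ & _ & _ & Hfn & _).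
      rewrite <- (ap_eq _ _ _ _ Hfn H1). apply (ap_eq _ _ _ _ Hfn H2). }
  assert (Hkfn : isfn k c).
  { split.
    - intros z Hz. apply Hkk in Hz. destruct Hz as (i & Hi & Hz). destruct (Hc i Hi) as (_ & _ & _ & Hfn & _).
      destruct (proj1 Hfn z Hz) as (x & y & Hx & ->). exists x, y. split; auto. apply HcU. eauto.
    - intros x Hx. apply HcU in Hx. destruct Hx as (i & Hi & Hx). apply domE in Hx. destruct Hx as [y Hy].
      exists y. split; [apply Hkk; eauto|]. intros y' Hy'. apply Hkk in Hy'. destruct Hy' as (j & Hj & Hy').
      eauto. }
  assert (Hkap : forall i x, i ∊ d -> x ∊ dom (kf i) -> ap k x = ap (kf i) x).
  { intros i x Hi Hx. apply (ap_eq _ c); auto. apply Hkk. exists i. split; auto.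
    apply (fn_ap _ (dom (kf i))); auto. apply (Hc i Hi). }
  assert (Hcmu : c ∊ mu).
  { destruct (reg_bound mu (fun i => dom (kf i)) d) as (b & Hb & Hbi); auto; [dfn|..].
    { intros i Hi. apply (Hc i Hi). }
    assert (Hbo : Ord b) by (eapply ord_mem; [apply Hmu|auto]).
    destruct (ord_sub c b) as [E|E]; auto.
    - apply ord_union. intros x Hx. apply imE in Hx; [|dfn]. destruct Hx as (i & Hi & ->).
      eapply ord_mem; [apply Hmu|]. apply (Hc i Hi).
    - intros x Hx. apply HcU in Hx. destruct Hx as (i & Hi & Hx). apply (proj1 Hbo (dom (kf i))); auto.
    - rewrite E; auto.
    - apply (proj1 (proj1 Hmu) b); auto. }
  assert (HT : cohere (lam Y S) k c).
  { split; [rewrite dom_lam by auto; apply lam_fn; auto|]. rewrite dom_lam by auto.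
    split; auto. split; [|split; [auto|split; [auto|]]].
    - intros z Hz. rewrite ap_lam by auto. pose proof Hz as Hz'. apply HY in Hz'. destruct Hz' as (HzK & Hez & Hzi).
      split; auto. split; [|split; [|split]].
      + apply chain_union; auto; [dfn|..].
        * intros i Hi. apply (Hc i Hi); auto.
        * intros i j Hi Hj Hij. apply (Hdec' i j Hij Hj); auto.
      + intros x Hx. apply HS in Hx. destruct Hx as (i & Hi & Hx).
        destruct (Hc i Hi) as (_ & _ & Hzz & _). apply (Hzz z (Hzi i Hi)); auto.
      + intros x Hx. apply HcU in Hx. destruct Hx as (i & Hi & Hx).
        destruct (Hc i Hi) as (_ & _ & Hzz & _).
        destruct (Hzz z (Hzi i Hi)) as (_ & _ & _ & Hent & _). destruct (Hent x Hx) as (b & Hb & E).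
        exists b. rewrite (Hkap i x) by auto. split; auto. apply HS; eauto.
      + intros x b Hb. apply HS in Hb. destruct Hb as (i & Hi & Hb). apply HcU. exists i. split; auto.
        destruct (Hc i Hi) as (_ & _ & Hzz & _). apply (Hzz z (Hzi i Hi)) in Hb; auto.
    - intros x Hx. apply HcU in Hx. destruct Hx as (i & Hi & Hx). rewrite (Hkap i x) by auto.
      apply (Hc i Hi); auto. }
  exists (op (lam Y S) k). split; [eapply TT_intro; eauto|]. rewrite pi2_op. split; [|reflexivity].
  intros i Hi. unfold leT. rewrite pi1_op, pi2_op, dom_lam by auto. fold (sf i) (kf i). split; [|split].
  - intros z Hz. apply HY in Hz. apply Hz; auto.
  - intros z Hz x Hx. rewrite ap_lam by auto. apply HS; eauto.
  - intros x Hx. apply Hkk; eauto.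
Qed.

Lemma TT_compat t p : t ∊ TT -> p ∊ P -> ae (fun z => z ∊ dom (pi1 t) /\ cup p (ap (pi1 t) z) ∊ P).
Proof.
  intros Ht Hp. destruct (TT_in _ Ht) as (s & k & c & -> & Hs & HsU & Hz & _). rewrite pi1_op.
  generalize (ae_and _ _ (ae_dm p Hp) (ae_dom _ HsU)). apply ae_mono. intros z _ [Hd Hzd]. split; auto.
  destruct (Hz z Hzd) as (_ & HsP & Hfar & _). apply cond_cup; auto.
  intros d b b' Hb Hb'. exfalso. apply (Hfar _ Hb'). pose proof (Hd _ Hb) as H. unfold dm in *.
  rewrite pi1_op in *. auto.
Qed.

Lemma TT_ext t a : t ∊ TT -> a ∊ A0 -> exists t', t' ∊ TT /\ leT t' t /\
  pi2 t' = cup (pi2 t) (sing (op (dom (pi2 t)) a)).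
Proof.
  intros Ht Ha. destruct (TT_in _ Ht) as (s & k & c & -> & Hcoh). rewrite pi2_op.
  rewrite <- (cohere_len _ _ _ Hcoh). pose proof Hcoh as (Hs & HsU & Hz & Hkf & Hc & Hkv).
  (* h z is the code of a at coordinate [al z]. A code exists once z contains a, which is why the
     domain shrinks to Y. *)
  destruct (AC_rel (fun z b => z ∊ dom s -> a ∊ z -> b ∊ al z /\ ap (ez z) b = a) K) as (h & Hh & HhR); [dfn|..].
  { intros z HzK. destruct (classic (z ∊ dom s /\ a ∊ z)) as [[H1 H2]|Hn]; [|exists emp; tauto].
    destruct (azP z HzK) as (_ & _ & _ & _ & H); [apply (Hz z H1)|]. destruct (H a H2) as (b & Hb & E). eauto. }
  set (Y := sep (dom s) (fun z => a ∊ z)).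
  assert (HY : forall z, z ∊ Y <-> z ∊ dom s /\ a ∊ z) by (intros z; unfold Y; rewrite sepE by dfn; reflexivity).
  assert (HYK : forall z, z ∊ Y -> z ∊ K) by (intros z Hzy; apply HY in Hzy; apply (U_sub (dom s)); tauto).
  assert (HYU : Y ∊ U).
  { destruct (ae_and _ _ (ae_dom _ HsU) (ae_fine a Ha)) as (W & HW & HWz). apply (U_up W); auto.
    intros z Hzw. apply HY; auto. }
  set (S := fun z => cup (ap s z) (sing (entry z c (ap h z)))).
  assert (DS : Fun1 S) by (unfold S; dfn).
  assert (HS : forall z x, x ∊ S z <-> x ∊ ap s z \/ x = entry z c (ap h z)).
  { intros z x. unfold S. rewrite cupE, singE. reflexivity. }
  set (k' := cup k (sing (op c a))).
  assert (Hk' : forall x, x ∊ k' <-> x ∊ k \/ x = op c a).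
  { intros x. unfold k'. rewrite cupE, singE. reflexivity. }
  assert (Hk'fn : isfn k' (succ c)).
  { split.
    - intros x Hx. apply Hk' in Hx. destruct Hx as [Hx| ->].
      + destruct (proj1 Hkf x Hx) as (i & y & Hi & ->). exists i, y. rewrite succE. auto.
      + exists c, a. rewrite succE. auto.
    - intros x Hx. apply succE in Hx. destruct Hx as [Hx| ->].
      + exists (ap k x). split; [apply Hk'; left; apply (fn_ap _ c); auto|].
        intros y Hy. apply Hk' in Hy. destruct Hy as [Hy|E].
        * symmetry. eapply ap_eq; eauto.
        * apply op_inj in E. destruct E; subst. exfalso. eapply mem_irrefl; eauto.
      + exists a. split; [apply Hk'; auto|]. intros y Hy. apply Hk' in Hy. destruct Hy as [Hy|E].
        * exfalso. apply (mem_irrefl c). eapply fn_dom; eauto.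
        * apply op_inj in E. tauto. }
  assert (Hkap : forall x, x ∊ c -> ap k' x = ap k x).
  { intros x Hx. apply (ap_eq _ (succ c)); auto. apply Hk'. left. apply (fn_ap _ c); auto. }
  assert (Hkc' : ap k' c = a) by (apply (ap_eq _ (succ c)); auto; apply Hk'; auto).
  assert (HT : cohere (lam Y S) k' (succ c)).
  { split; [rewrite dom_lam by auto; apply lam_fn; auto|]. rewrite dom_lam by auto.
    split; auto. split; [|split; [auto|split; [apply reg_succ; auto|]]].
    - intros z Hzy. rewrite ap_lam by auto. pose proof Hzy as Hzd. apply HY in Hzd. destruct Hzd as [Hzd Haz'].
      destruct (Hz z Hzd) as (Hez & HsP & Hfar & Hent & Hlen).
      destruct (azP z (HYK z Hzy) Hez) as (Halk & Halz & _ & _ & _).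
      destruct (HhR z (HYK z Hzy) Hzd Haz') as [Hha Hhe].
      split; auto. split; [|split; [|split]].
      + apply cond_cup; auto.
        * apply HP. split; [|split].
          -- intros x Hx. apply singE in Hx. exists (al z), c, (ap h z). auto.
          -- intros d b b' Hb Hb'. apply singE in Hb, Hb'. rewrite <- Hb in Hb'. apply op_inj in Hb'.
             destruct Hb'; auto.
          -- apply small_sing; auto.
        (* No conflict arises: the filled positions of coordinate [al z] are exactly those below c,
           so position c is free. *)
        * intros d b b' Hb Hb'. apply singE in Hb'. apply op_inj in Hb'. destruct Hb' as [Ed _].
          exfalso. apply (mem_irrefl c). apply (Hlen c b). unfold entry. rewrite <- Ed. exact Hb.
      + intros x Hx. apply HS in Hx. destruct Hx as [Hx| ->]; auto. rewrite entry_dm. auto.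
      + intros x Hx. apply succE in Hx. destruct Hx as [Hx| ->].
        * destruct (Hent x Hx) as (b & Hb & E). exists b. rewrite HS, Hkap by auto. auto.
        * exists (ap h z). rewrite HS, Hkc'. auto.
      + intros x b Hb. apply HS in Hb. apply succE. destruct Hb as [Hb|E]; eauto.
        apply op_inj in E. destruct E as [E _]. apply op_inj in E. tauto.
    - intros x Hx. apply succE in Hx. destruct Hx as [Hx| ->]; [rewrite Hkap|rewrite Hkc']; auto. }
  exists (op (lam Y S) k'). split; [eapply TT_intro; eauto|]. rewrite pi2_op. split; [|reflexivity].
  unfold leT. rewrite !pi1_op, !pi2_op, dom_lam by auto. split; [|split].
  - intros z Hzy. apply HY in Hzy. tauto.
  - intros z Hzy x Hx. rewrite ap_lam by auto. apply HS; auto.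
  - intros x Hx. apply Hk'; auto.
Qed.

(** In [cohere] the filled positions of the enumerating coordinate form an ordinal below mu. An
    arbitrary condition may leave gaps there; below a bound g they receive the default value b0. *)
Lemma fill r a b0 : r ∊ P -> a ∊ kappa -> b0 ∊ a -> exists q g, q ∊ P /\ subs r q /\ g ∊ mu /\
  forall x, (exists b, op (op a x) b ∊ q) <-> x ∊ g.
Proof.
  intros Hr Ha Hb0. pose proof Hr as Hr'. apply HP in Hr'. destruct Hr' as (Hr1 & Hr2 & Hr3).
  destruct (small_bounded mu (sep mu (fun x => exists b, op (op a x) b ∊ r))) as (g & Hg & Hgs); auto.
  { apply (small_onto _ _ r); auto.
    apply (onto_rel (fun z x => exists b, z = op (op a x) b)); [dfn|..].
    - intros z x y _ (b & ->) (b' & E). apply op_inj in E. destruct E as [E _]. apply op_inj in E. tauto.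
    - intros x Hx. apply sepE in Hx; [|dfn]. destruct Hx as [_ (b & Hb)]. eauto. }
  { intros x Hx. apply sepE in Hx; [tauto|dfn]. }
  assert (Hgs' : forall x b, op (op a x) b ∊ r -> x ∊ g).
  { intros x b Hb. apply Hgs. apply sepE; [dfn|]. split; [|eauto].
    destruct (Hr1 _ Hb) as (a' & x' & b' & _ & Hx & _ & E). apply op_inj in E. destruct E as [E _].
    apply op_inj in E. destruct E; subst; auto. }
  set (X := sep g (fun x => ~ exists b, op (op a x) b ∊ r)).
  assert (HX : forall x, x ∊ X <-> x ∊ g /\ ~ exists b, op (op a x) b ∊ r) by (intros; unfold X; rewrite sepE by dfn; reflexivity).
  set (q1 := im (fun x => op (op a x) b0) X).
  assert (Hq1 : forall z, z ∊ q1 <-> exists x, x ∊ X /\ z = op (op a x) b0) by (intros; unfold q1; rewrite imE by dfn; reflexivity).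
  assert (Hgmu : forall x, x ∊ g -> x ∊ mu) by (intros x Hx; apply (proj1 (proj1 Hmu) g); auto).
  exists (cup r q1), g. split; [|split; [|split; [auto|]]].
  - apply cond_cup; auto.
    + apply HP. split; [|split].
      * intros z Hz. apply Hq1 in Hz. destruct Hz as (x & Hx & ->). apply HX in Hx. exists a, x, b0.
        split; auto. split; [apply Hgmu; tauto|auto].
      * intros d b b' Hb Hb'. apply Hq1 in Hb, Hb'. destruct Hb as (x & _ & E), Hb' as (x' & _ & E').
        apply op_inj in E, E'. destruct E, E'; congruence.
      * apply small_im; [dfn|]. apply (small_sub mu _ g); [intros x Hx; apply HX in Hx; tauto|].
        apply small_mem; auto.
    + intros d b b' Hb Hb'. apply Hq1 in Hb'. destruct Hb' as (x & Hx & E). apply op_inj in E.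
      destruct E; subst. apply HX in Hx. exfalso. apply Hx. eauto.
  - intros x Hx. apply cupE; auto.
  - intros x. split.
    + intros (b & Hb). apply cupE in Hb. destruct Hb as [Hb|Hb]; eauto. apply Hq1 in Hb.
      destruct Hb as (y & Hy & E). apply op_inj in E. destruct E as [E _]. apply op_inj in E.
      destruct E; subst. apply HX in Hy. tauto.
    + intros Hx. destruct (classic (exists b, op (op a x) b ∊ r)) as [(b & Hb)|Hn].
      * exists b. apply cupE; auto.
      * exists b0. apply cupE. right. apply Hq1. exists x. rewrite HX. auto.
Qed.

(** Choose q z below p1 and t(z) so that a value is decided. Completeness fixes the value i and the
    length g, [decomposition] separates from q z a constant p with coordinates in z, and normality
    fixes the element enumerated at each position below g. The new condition consists of the
    remaining parts; together with p they restore q z. *)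
Lemma TT_decide t p1 w0 (dec : M -> M -> M -> Prop) : t ∊ TT -> p1 ∊ P -> w0 ∊ mu -> Def3 dec ->
  (forall r r' z i, op r' r ∊ L -> dec r z i -> dec r' z i) ->
  (forall z r, z ∊ K -> op r p1 ∊ L -> exists r' i, op r' r ∊ L /\ i ∊ w0 /\ dec r' z i) ->
  exists p t' i, op p p1 ∊ L /\ t' ∊ TT /\ leT t' t /\ i ∊ w0 /\
    forall z r, z ∊ dom (pi1 t') -> op r p ∊ L -> op r (ap (pi1 t') z) ∊ L -> dec r z i.
Proof.
  intros Ht Hp1 Hw0 Hdec Hmono Hex. pose proof (TT_compat t p1 Ht Hp1) as Hcomp.
  destruct (TT_in _ Ht) as (s & k & c & -> & Hcoh). rewrite pi1_op in Hcomp.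
  pose proof Hcoh as (Hs & HsU & Hz & Hkf & Hc & Hkv).
  set (good0 := fun z => (forall x, x ∊ p1 -> dm x ∊ z) /\ z ∊ dom s /\ cup p1 (ap s z) ∊ P).
  assert (Dg0 : Def1 good0) by (unfold good0; dfn).
  assert (Hg0 : ae good0) by (apply ae_and; auto; apply ae_dm; auto).
  set (R := fun z q i g => q ∊ P /\ subs p1 q /\ subs (ap s z) q /\ i ∊ w0 /\ dec q z i /\ g ∊ mu /\
     forall x, (exists b, entry z x b ∊ q) <-> x ∊ g).
  assert (DR : Def4 R) by (unfold R; dfn).
  destruct (AC_rel (fun z y => good0 z -> R z (pi1 y) (pi1 (pi2 y)) (pi2 (pi2 y))) K)
    as (f & Hf & HfR); [dfn|..].
  { intros z HzK. destruct (classic (good0 z)) as [Hgz|Hn]; [|exists emp; tauto].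
    destruct Hgz as (Hdm & Hzd & Hcup). destruct (le_cup _ _ Hcup) as [Hl1 Hl2].
    destruct (Hex z _ HzK Hl1) as (r & i & Hr & Hi & Hd).
    destruct (Hz z Hzd) as (Hez & _). destruct (azP z HzK Hez) as (Halk & _ & _ & _ & Hson).
    (* The default value for [fill]: since emp is in z, it has a code below [al z]. *)
    destruct (Hson emp Hez) as (b0 & Hb0 & _). pose proof Hr as Hr'. apply HL in Hr'.
    destruct (fill r (al z) b0) as (q & g & Hq & Hrq & Hg & Hqg); auto; [tauto|].
    exists (op q (op i g)). intros _. rewrite !pi1_op, !pi2_op, !pi1_op.
    assert (Hsub : subs (cup p1 (ap s z)) q) by (intros x Hx; apply Hrq, Hr'; auto).
    split; auto. split; [intros x Hx; apply Hsub, cupE; auto|].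
    split; [intros x Hx; apply Hsub, cupE; auto|]. split; auto. split; [|split; auto].
    apply (Hmono r); auto. apply HL. tauto. }
  set (q := fun z => pi1 (ap f z)) in *.
  assert (Dq : Fun1 q) by (unfold q; dfn).
  assert (H1 : ae (fun z => good0 z /\ exists i g, i ∊ w0 /\ g ∊ mu /\ R z (q z) i g)).
  { revert Hg0. apply ae_mono. intros z HzK Hgz. split; auto. pose proof (HfR z HzK Hgz) as HR.
    exists (pi1 (pi2 (ap f z))), (pi2 (pi2 (ap f z))). split; [apply HR|]. split; [apply HR|auto]. }
  assert (Hsmw : small kappa w0) by (apply small_mk, small_mem; auto).
  assert (Hsmmu : small kappa mu) by (apply small_mem; auto).
  destruct (ae_const (fun z i => good0 z /\ exists g, g ∊ mu /\ R z (q z) i g) w0) as (i & Hi & H2); auto.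
  { dfn. }
  { revert H1. apply ae_mono. intros z _ (Hgz & i & g & Hi & Hg & HR). exists i. split; auto. split; auto.
    exists g; auto. }
  destruct (ae_const (fun z g => good0 z /\ R z (q z) i g) mu) as (g & Hg & H3); auto.
  { dfn. }
  { revert H2. apply ae_mono. intros z _ (Hgz & g & Hg & HR). exists g. auto. }
  clear H1 H2.
  destruct (decomposition q Dq) as (p & Hp).
  { revert H3. apply ae_mono. intros z _ [_ HR]. apply HR. }
  set (val := fun z x a => exists b, entry z x b ∊ q z /\ ap (ez z) b = a).
  assert (Dval : Def3 val) by (unfold val; dfn).
  destruct (AC_rel (fun x a => a ∊ A0 /\ ae (fun z => val z x a)) g) as (k' & Hk' & Hk'R); [dfn|..].
  { intros x Hx. destruct (ae_norm (fun z a => val z x a)) as (a & Ha & Haa); [dfn|..].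
    - revert H3. apply ae_mono. intros z HzK [(_ & Hzd & _) HR].
      destruct (Hz z Hzd) as (Hez & _). destruct (azP z HzK Hez) as (_ & _ & _ & Hev & _).
      destruct HR as (HqP & _ & _ & _ & _ & _ & Hent). destruct (proj2 (Hent x) Hx) as (b & Hb).
      exists (ap (ez z) b). split; [|exists b; auto]. apply Hev. apply HP in HqP.
      destruct (proj1 HqP _ Hb) as (a' & x' & b' & _ & _ & Hb' & E). apply op_inj in E.
      destruct E as [E ->]. apply op_inj in E. destruct E as [-> _]. auto.
    - exists a. split; auto. revert Haa. apply ae_mono. tauto. }
  assert (H4 : ae (fun z => forall x, x ∊ g -> val z x (ap k' x))).
  { apply (ae_small (fun x z => val z x (ap k' x))); [dfn|apply small_mk, small_mem; auto|].
    intros x Hx. apply Hk'R; auto. }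
  set (allok := fun z => (good0 z /\ R z (q z) i g) /\ (forall x, x ∊ p <-> x ∊ q z /\ dm x ∊ z) /\
     forall x, x ∊ g -> val z x (ap k' x)).
  assert (Dok : Def1 allok) by (unfold allok; dfn).
  set (Y := sep K allok).
  assert (HYU : Y ∊ U) by (apply ae_set; auto; apply ae_and; auto; apply ae_and; auto).
  assert (HY : forall z, z ∊ Y <-> z ∊ K /\ allok z) by (intros; unfold Y; apply sepE; auto).
  set (S := fun z => sep (q z) (fun x => ~ dm x ∊ z)).
  assert (DS : Fun1 S) by (unfold S; dfn).
  assert (HS : forall z x, x ∊ S z <-> x ∊ q z /\ ~ dm x ∊ z) by (intros; unfold S; rewrite sepE by dfn; reflexivity).
  assert (HT : cohere (lam Y S) k' g).
  { split; [rewrite dom_lam by auto; apply lam_fn; auto|]. rewrite dom_lam by auto.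
    split; auto. split; [|split; [auto|split; [auto|intros x Hx; apply Hk'R; auto]]].
    intros z Hzy. rewrite ap_lam by auto. apply HY in Hzy.
    destruct Hzy as (HzK & [(_ & Hzd & _) (HqP & _ & _ & _ & _ & _ & Hent)] & _ & Hval).
    destruct (Hz z Hzd) as (Hez & _). destruct (azP z HzK Hez) as (_ & Halz & _ & _ & _).
    split; auto. split; [|split; [|split]].
    - eapply cond_sub; [exact HqP|]. intros x Hx. apply HS in Hx. tauto.
    - intros x Hx. apply HS in Hx. tauto.
    - intros x Hx. destruct (Hval x Hx) as (b & Hb & E). exists b. split; auto. apply HS.
      rewrite entry_dm. auto.
    - intros x b Hb. apply HS in Hb. apply Hent. exists b. tauto. }
  destruct (U_ne Y HYU) as [z0 Hz0]. apply HY in Hz0.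
  destruct Hz0 as (HzK0 & [(Hdm0 & Hzd0 & _) HR0] & Hp0 & Hval0).
  assert (HpP : p ∊ P).
  { apply (cond_sub p (q z0)); [apply HR0|]. intros x Hx. apply Hp0 in Hx. tauto. }
  exists p, (op (lam Y S) k'), i. split; [|split; [|split; [|split; [auto|]]]].
  - apply HL. split; auto. split; auto. intros x Hx. apply Hp0. split; auto. apply (proj1 (proj2 HR0)); auto.
  - eapply TT_intro; eauto.
  - unfold leT. rewrite !pi1_op, !pi2_op, dom_lam by auto. split; [|split].
    + intros z Hzy. apply HY in Hzy. apply Hzy.
    + intros z Hzy x Hx. rewrite ap_lam by auto. apply HS. apply HY in Hzy.
      destruct Hzy as (_ & [(_ & Hzd & _) HR] & _). split; [apply (proj1 (proj2 (proj2 HR))); auto|].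
      destruct (Hz z Hzd) as (_ & _ & Hfar & _). auto.
    (* That k' extends k can be checked at a single good index z0, because both are read off from
       the entries of q z0. *)
    + intros y Hy. destruct (proj1 Hkf y Hy) as (x & v & Hx & ->).
      destruct (Hz z0 Hzd0) as (_ & _ & _ & Hent & _). destruct (Hent x Hx) as (b & Hb & E).
      destruct HR0 as (HqP & _ & Hsq & _ & _ & _ & Hentq). apply Hsq in Hb.
      assert (Hxg : x ∊ g) by (apply Hentq; eauto).
      destruct (Hval0 x Hxg) as (b' & Hb' & E').
      assert (Ebb : b = b') by (apply HP in HqP; eapply (proj1 (proj2 HqP)); eauto). subst b'.
      rewrite <- (ap_eq _ _ _ _ Hkf Hy), <- E, E'. apply (fn_ap _ g); auto.
  - intros z r Hzd Hrp Hrs. rewrite pi1_op in Hzd, Hrs. rewrite dom_lam in Hzd by auto.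
    rewrite ap_lam in Hrs by auto. apply HY in Hzd.
    destruct Hzd as (_ & [_ (HqP & _ & _ & _ & Hd & _)] & Hpz & _).
    apply (Hmono (q z)); auto. apply HL in Hrp, Hrs. apply HL. split; [tauto|]. split; auto.
    intros x Hx. destruct (classic (dm x ∊ z)) as [Hin|Hin].
    + apply Hrp. apply Hpz. auto.
    + apply Hrs. apply HS. auto.
Qed.

(** * The approximating poset in the collapse extension *)

Section Star.
Context {N : struct} {ZN : ZFC N} {Fo : fm -> M -> (nat -> M) -> Prop} {chk : M -> M}
  (F : fnotion P L Fo chk) {G : M -> Prop} {val : M -> N} (X : gext P L Fo chk G val).
Local Notation ι := (@ii M N chk val).
Context (A a0 g vf : N) (B : M) (HBA : subs B A0) (Ha0 : a0 ∊ A)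
  (HB : forall y, y ∊ A -> exists b, b ∊ B /\ y = val b)
  (Hg : forall y, y ∊ g <-> exists p, G p /\ y = ι p)
  (Hvf : forall z, z ∊ vf <-> exists b, b ∊ B /\ z = op (ι b) (val b)).

(** The ground model can only enumerate names. [pr] passes from a name to its value, and to the
    default a0 if the value is not in A. *)
Definition pr (b a : N) : Prop :=
  (op b a ∊ vf /\ a ∊ A) \/ (~ (exists a', op b a' ∊ vf /\ a' ∊ A) /\ a = a0).
Lemma Def_pr : Def2 pr.
Proof. unfold pr. dfn. Qed.
Hint Resolve Def_pr : dfn.
Lemma pr_fun b a a' : pr b a -> pr b a' -> a = a'.
Proof.
  intros [[H1 H2]|[H1 H2]] [[H3 H4]|[H3 H4]]; subst; auto; try (exfalso; eauto; fail).
  apply Hvf in H1, H3. destruct H1 as (b1 & _ & E1), H3 as (b2 & _ & E2).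
  apply op_inj in E1, E2. destruct E1 as [E1 ->], E2 as [E2 ->]. rewrite E1 in E2.
  apply (ii_inj X) in E2. subst; auto.
Qed.
Lemma pr_total b : exists a, pr b a.
Proof.
  unfold pr. destruct (classic (exists a', op b a' ∊ vf /\ a' ∊ A)) as [(a & H)|Hn]; eauto.
Qed.
Lemma pr_A b a : pr b a -> a ∊ A.
Proof. intros [[_ H]|[_ ->]]; auto. Qed.
Lemma pr_surj a : a ∊ A -> exists b, b ∊ B /\ pr (ι b) a.
Proof.
  intros Ha. destruct (HB a Ha) as (b & Hb & ->). exists b. split; auto. left. split; auto.
  apply Hvf. eauto.
Qed.

Definition LT : M := sep (prod TT TT) (fun z => leT (pi1 z) (pi2 z)).
Lemma LTE t' t : op t' t ∊ LT <-> t' ∊ TT /\ t ∊ TT /\ leT t' t.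
Proof.
  pose proof Def_leT. unfold LT. rewrite sepE by dfn. rewrite prod_op, pi1_op, pi2_op. tauto.
Qed.
Definition wle (t' t : N) : Prop := op t' t ∊ ι LT.
Definition wkk (t x a : N) : Prop := exists b, op x b ∊ pi2 t /\ pr b a.
Definition wix (t z : N) : Prop := z ∊ dom (pi1 t) /\ ap (pi1 t) z ∊ g.
(** The generic function at coordinate [al z], followed by [ez z], which returns a name, and by
    [pr], which returns an element of A. *)
Definition wKK (z x a : N) : Prop := z ∊ ι K /\ x ∊ ι mu /\ exists p b, p ∊ g /\
  op (op (ap (ι (lam K al)) z) x) b ∊ p /\ pr (ap (ap (ι (lam K ez)) z) b) a.
Lemma wleE (t' t : N) : wle t' t <-> exists s' s, t' = ι s' /\ t = ι s /\ s' ∊ TT /\ s ∊ TT /\ leT s' s.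
Proof.
  unfold wle. split.
  - intros H. apply (ii_opI X) in H. destruct H as (s' & s & -> & -> & H). apply LTE in H. eauto 8.
  - intros (s' & s & -> & -> & H). apply (ii_opE X), LTE. auto.
Qed.
Lemma pi_TT t : t ∊ TT -> pi1 (ι t) = ι (pi1 t) /\ pi2 (ι t) = ι (pi2 t).
Proof.
  intros H. destruct (TT_in t H) as (s & k & c & -> & _).
  rewrite (ii_pi1 X), (ii_pi2 X), pi1_op, pi2_op. auto.
Qed.
Lemma wkkE t (x a : N) : t ∊ TT ->
  (wkk (ι t) x a <-> exists i b, x = ι i /\ op i b ∊ pi2 t /\ pr (ι b) a).
Proof.
  intros Ht. unfold wkk. rewrite (proj2 (pi_TT t Ht)). split.
  - intros (b & Hb & H). apply (ii_opI X) in Hb. destruct Hb as (i & b' & -> & -> & Hb). eauto 6.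
  - intros (i & b & -> & Hb & H). exists (ι b). rewrite (ii_opE X). auto.
Qed.
Lemma wixE t (z : N) : t ∊ TT ->
  (wix (ι t) z <-> exists y, z = ι y /\ y ∊ dom (pi1 t) /\ G (ap (pi1 t) y)).
Proof.
  intros Ht. unfold wix. rewrite (proj1 (pi_TT t Ht)), (ii_dom X).
  destruct (TT_in t Ht) as (s & k & c & -> & Hs & _). rewrite pi1_op. split.
  - intros [Hz H]. apply (ii_elim X) in Hz. destruct Hz as (y & Hy & ->). exists y.
    rewrite (ii_ap X s (dom s)) in H by auto. apply Hg in H. destruct H as (p & Hp & E).
    apply (ii_inj X) in E. subst. auto.
  - intros (y & -> & Hy & H). rewrite (ii_mem X), (ii_ap X s (dom s)) by auto. split; auto.
    apply Hg. eauto.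
Qed.
Lemma al_val z : z ∊ K -> ap (ι (lam K al)) (ι z) = ι (al z).
Proof. intros Hz. rewrite (ii_ap X _ K); auto; [rewrite ap_lam; auto; dfn|apply lam_fn; dfn]. Qed.
Lemma ez_val z : z ∊ K -> ap (ι (lam K ez)) (ι z) = ι (ez z).
Proof. intros Hz. rewrite (ii_ap X _ K); auto; [rewrite ap_lam; auto; dfn|apply lam_fn; dfn]. Qed.

Lemma len_dom t : t ∊ TT -> dom (pi2 t) ∊ mu /\
  forall x : N, (exists a, wkk (ι t) x a) <-> x ∊ ι (dom (pi2 t)).
Proof.
  intros Ht. split.
  - destruct (TT_in t Ht) as (s & k & c & -> & Hc). rewrite pi2_op.
    rewrite <- (cohere_len _ _ _ Hc). apply Hc.
  - intros x. split.
    + intros (a & H). apply wkkE in H; auto. destruct H as (i & b & -> & Hb & _).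
      apply (ii_mem X), domE. eauto.
    + intros H. apply (ii_elim X) in H. destruct H as (i & Hi & ->). apply domE in Hi.
      destruct Hi as (b & Hb). destruct (pr_total (ι b)) as (a & Ha). exists a. apply wkkE; eauto.
Qed.

Lemma wkk_KK t (z x a : N) : t ∊ TT -> wix (ι t) z -> wkk (ι t) x a -> wKK z x a.
Proof.
  intros Ht Hz Hx. apply wixE in Hz; auto. destruct Hz as (y & -> & Hy & HGy).
  apply wkkE in Hx; auto. destruct Hx as (i & b & -> & Hb & Hpr).
  destruct (TT_in t Ht) as (s & k & c & -> & Hs & HsU & Hz & Hkf & Hc & _).
  rewrite pi1_op in *. rewrite pi2_op in *.
  pose proof (fn_dom _ _ _ _ Hkf Hb) as Hi. destruct (Hz y Hy) as (Hey & HyP & _ & Hent & _).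
  assert (HyK : y ∊ K) by (apply (U_sub (dom s)); auto).
  destruct (Hent i Hi) as (e & He & Ee). rewrite (ap_eq _ _ _ _ Hkf Hb) in Ee.
  destruct (azP y HyK Hey) as (_ & _ & Hezf & _ & _).
  assert (Heal : e ∊ al y).
  { apply HP in HyP. destruct (proj1 HyP _ He) as (a' & x' & b' & _ & _ & Hb' & E). apply op_inj in E.
    destruct E as [E ->]. apply op_inj in E. destruct E as [-> _]. auto. }
  split; [apply (ii_mem X); auto|]. split; [apply (ii_mem X), (proj1 (proj1 Hmu) c); auto|].
  exists (ι (ap s y)), (ι e). split; [apply Hg; eauto|]. rewrite al_val, ez_val by auto. split.
  - rewrite <- !(ii_op X). apply (ii_mem X). exact He.
  - rewrite (ii_ap X _ (al y)) by auto. rewrite Ee. auto.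
Qed.

Lemma wKK_fun (z x a b : N) : wKK z x a -> wKK z x b -> a = b.
Proof.
  intros (Hz & _ & p & c & Hp & Hc & Ha) (_ & _ & p' & c' & Hp' & Hc' & Hb).
  apply Hg in Hp, Hp'. destruct Hp as (q & Hq & ->), Hp' as (q' & Hq' & ->).
  apply (ii_opI X) in Hc, Hc'. destruct Hc as (d & e & Ed & -> & Hc), Hc' as (d' & e' & Ed' & -> & Hc').
  rewrite Ed in Ed'. apply (ii_inj X) in Ed'. subst d'.
  rewrite (generic_fun X q q' d e e') in Ha by auto. eapply pr_fun; eauto.
Qed.

Lemma wext t (a : N) : t ∊ TT -> a ∊ A -> exists t', t' ∊ TT /\ leT t' t /\
  forall x b, wkk (ι t') x b <-> wkk (ι t) x b \/ (x = ι (dom (pi2 t)) /\ b = a).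
Proof.
  intros Ht Ha. destruct (pr_surj a Ha) as (c & Hc & Hpr).
  destruct (TT_ext t c Ht (HBA c Hc)) as (t' & Ht' & Hl & E). exists t'. split; auto. split; auto.
  intros x b. rewrite !wkkE by auto. rewrite E. split.
  - intros (i & e & -> & He & Hp). apply cupE in He. destruct He as [He|He]; [left; eauto|].
    apply singE in He. apply op_inj in He. destruct He; subst. right. split; auto. eapply pr_fun; eauto.
  - intros [(i & e & -> & He & Hp)|[-> ->]].
    + exists i, e. rewrite cupE. auto.
    + exists (dom (pi2 t)), c. rewrite cupE, singE. auto.
Qed.

(** A sequence from the extension is brought back to the ground model by [distributivity], where
    [TT_closed] applies. *)
Lemma wclosed (d f : N) : d ∊ ι mu -> dseq (ι TT) wle d f -> exists t, t ∊ TT /\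
  (forall i, i ∊ d -> wle (ι t) (ap f i)) /\ forall x a, wkk (ι t) x a <-> exists i, i ∊ d /\ wkk (ap f i) x a.
Proof.
  intros Hd (Hf & Hv & Hdec). apply (ii_elim X) in Hd. destruct Hd as (e & He & ->).
  destruct (distributivity F X mu e TT f) as (h & Hh & Hhv & E); auto; [apply Hmu|apply levy_closed|].
  fold (ι h) in E. subst f.
  assert (Hap : forall i, i ∊ e -> ap (ι h) (ι i) = ι (ap h i)) by (intros; apply (ii_ap X h e); auto).
  destruct (TT_closed e h He) as (t & Ht & Htl & Etk).
  { split; auto. split; auto. intros i j Hij Hj.
    assert (Hi : i ∊ e) by (apply (proj1 (ord_mem _ _ (proj1 Hmu) He) j); auto).
    specialize (Hdec (ι i) (ι j)). rewrite !Hap in Hdec by auto.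
    destruct (proj1 (wleE _ _) (Hdec (proj2 (ii_mem X _ _) Hij) (proj2 (ii_mem X _ _) Hj)))
      as (s' & s & E1 & E2 & _ & _ & H). apply (ii_inj X) in E1, E2. subst; auto. }
  exists t. split; auto. split.
  - intros i Hi. apply (ii_elim X) in Hi. destruct Hi as (j & Hj & ->). rewrite Hap by auto.
    apply wleE. exists t, (ap h j). repeat (split; auto).
  - intros x a. rewrite wkkE by auto. rewrite Etk. split.
    + intros (i & b & -> & Hb & Hp). apply unionE in Hb. destruct Hb as (y & Hy & Hb).
      apply imE in Hy; [|dfn]. destruct Hy as (j & Hj & ->). exists (ι j). rewrite (ii_mem X), Hap by auto.
      split; auto. apply wkkE; eauto.
    + intros (i & Hi & H). apply (ii_elim X) in Hi. destruct Hi as (j & Hj & ->).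
      rewrite Hap in H by auto. apply wkkE in H; auto. destruct H as (i & b & -> & Hb & Hp).
      exists i, b. split; auto. split; auto. apply unionE. exists (pi2 (ap h j)). split; auto.
      apply imE; [dfn|eauto].
Qed.

(** By genericity and [TT_compat]: almost always p has its coordinates in z, while t(z) has none
    there, so the two are compatible. *)
Lemma wne t : t ∊ TT -> exists z, wix (ι t) z.
Proof.
  intros Ht. destruct (g_meet _ _ _ _ _ _ X (fun p => exists z, z ∊ dom (pi1 t) /\ op p (ap (pi1 t) z) ∊ L))
    as (p & Hp & z & Hz & H); [dfn|..].
  - intros p Hp. destruct (ae_ex _ (TT_compat t p Ht Hp)) as (z & _ & Hz & Hc).
    destruct (le_cup _ _ Hc) as [H1 H2]. eauto.
  - exists (ι z). apply wixE; auto. exists z. split; auto. split; auto.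
    apply (g_up _ _ _ _ _ _ X p); auto.
Qed.

Lemma wdecide t w (f : N) : t ∊ TT -> w ∊ mu -> isfn f (ι K) -> (forall z, z ∊ ι K -> ap f z ∊ ι w) ->
  exists t' i, t' ∊ TT /\ leT t' t /\ i ∊ w /\ forall z, wix (ι t') z -> ap f z = ι i.
Proof.
  intros Ht Hw Hf Hfv. destruct (v_surj _ _ _ _ _ _ X f) as [gn Egn].
  destruct (U_fun 0 1 2) as [ffun Hffun]. destruct (U_pin 0 1 2) as [fpin Hfpin].
  assert (H0 : exists p, G p /\ Fo ffun p (scons gn (scons (chk K) (fun _ => chk w)))).
  { apply (truth_u X _ _ _ Hffun). apply sat_fun. cbn [scons]. rewrite <- Egn. auto. }
  destruct H0 as (p0 & Hp0 & Hf0).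
  destruct (decide_value F gn K w ffun fpin Hffun Hfpin p0 Hf0) as [Hval _].
  set (dec := fun r z i => Fo fpin r (scons (chk z) (scons (chk i) (fun _ => gn)))) in *.
  assert (Ddec : Def3 dec) by (unfold dec; dfn).
  assert (Hmono : forall r r' z i, op r' r ∊ L -> dec r z i -> dec r' z i).
  { intros r r' z i Hr. apply (n_mono _ _ _ _ F); auto. }
  pose proof Def_leT as DleT.
  destruct (gen_below F X p0 (fun p => exists t' i, t' ∊ TT /\ leT t' t /\ i ∊ w /\
     forall z r, z ∊ dom (pi1 t') -> op r p ∊ L -> op r (ap (pi1 t') z) ∊ L -> dec r z i))
    as (p & Hp & (t' & i & Ht' & Hl & Hi & Hd) & _); auto; [dfn|..].
  - intros q Hq. destruct (TT_decide t q w dec) as (p & t' & i & Hpq & Ht' & Hl & Hi & Hd); auto.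
    + apply (n_dom _ _ _ _ F) in Hq. tauto.
    + intros z r Hz Hr. destruct (Hval r z Hz) as (r' & y & Hr' & Hy & Hdy); [|eauto].
      eapply (n_trans _ _ _ _ F); eauto.
    + exists p. split; eauto 8.
  - exists t', i. split; auto. split; auto. split; auto. intros z Hz. apply wixE in Hz; auto.
    destruct Hz as (y & -> & Hy & HGy).
    destruct (g_dir _ _ _ _ _ _ X p (ap (pi1 t') y) Hp HGy) as (r & Hr & Hrp & Hry).
    apply (ap_eq _ (ι K)); auto. apply sat_pin. rewrite Egn.
    apply (truth_u X _ _ (scons (chk y) (scons (chk i) (fun _ => gn))) Hfpin). exists r. split; auto.
    apply Hd; auto.
Qed.

Theorem levy_star : star (ι mu) A (ι TT) (ι K) wle wkk wix wKK.
Proof.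
  pose proof Def_pr as Dpr.
  assert (HT : forall t : N, t ∊ ι TT -> exists s, s ∊ TT /\ t = ι s) by (intros; apply (ii_elim X); auto).
  constructor.
  - unfold wle. dfn.
  - unfold wkk. dfn.
  - unfold wix. dfn.
  - unfold wKK. dfn.
  - intros t Ht. destruct (HT t Ht) as (s & Hs & ->). apply wleE. exists s, s.
    do 4 (split; auto). apply leT_refl.
  - intros t s r H1 H2. apply wleE in H1, H2. destruct H1 as (t' & s' & -> & -> & Ht & Hs & H1).
    destruct H2 as (s'' & r' & E & -> & _ & Hr & H2). apply (ii_inj X) in E. subst.
    apply wleE. exists t', r'. do 4 (split; auto). eapply leT_trans; eauto.
  - intros t Ht. destruct (HT t Ht) as (s & Hs & ->). destruct (len_dom s Hs) as [H1 H2].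
    exists (ι (dom (pi2 s))). split; auto. apply (ii_mem X); auto.
  - intros t x a b Ht H1 H2. destruct (HT t Ht) as (s & Hs & ->). apply wkkE in H1, H2; auto.
    destruct H1 as (i & c & -> & Hc & Ha), H2 as (j & c' & E & Hc' & Hb). apply (ii_inj X) in E. subst j.
    destruct (TT_in s Hs) as (s0 & k & c0 & -> & _ & _ & _ & Hk' & _). rewrite pi2_op in *.
    rewrite <- (ap_eq _ _ _ _ Hk' Hc), (ap_eq _ _ _ _ Hk' Hc') in Ha. eapply pr_fun; eauto.
  - intros t x a Ht (b & _ & H). eapply pr_A; eauto.
  - intros t t' x a H. apply wleE in H. destruct H as (s' & s & -> & -> & Hs' & Hs & _ & _ & Hk').
    rewrite !wkkE by auto. intros (i & b & -> & Hb & Hp). eauto 6.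
  - intros t t' z H. apply wleE in H. destruct H as (s' & s & -> & -> & Hs' & Hs & Hd & Hss & _).
    rewrite !wixE by auto. intros (y & -> & Hy & HGy). exists y. split; auto. split; auto.
    apply (g_up _ _ _ _ _ _ X (ap (pi1 s') y)); auto. apply HL. split; [apply (g_in _ _ _ _ _ _ X); auto|].
    split; auto. eapply cond_sub; [|apply (Hss y Hy)]. apply (g_in _ _ _ _ _ _ X); auto.
  - intros t z Ht Hz. destruct (HT t Ht) as (s & Hs & ->). apply wixE in Hz; auto.
    destruct Hz as (y & -> & Hy & _). apply (ii_mem X).
    destruct (TT_in s Hs) as (s0 & k & c0 & -> & _ & HU & _). rewrite pi1_op in Hy.
    apply (U_sub (dom s0)); auto.
  - intros t z x a Ht. destruct (HT t Ht) as (s & Hs & ->). apply wkk_KK; auto.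
  - apply wKK_fun.
  - intros z x a (_ & Hx & p & b & _ & _ & H). split; auto. eapply pr_A; eauto.
  - intros t a c Ht Ha Hc. destruct (HT t Ht) as (s & Hs & ->).
    destruct (wext s a Hs Ha) as (t' & Ht' & Hl & H). exists (ι t'). split; [apply (ii_mem X); auto|].
    split; [apply wleE; eauto 8|].
    assert (E : c = ι (dom (pi2 s))).
    { apply ext. intros x. rewrite <- Hc. apply len_dom; auto. }
    subst c. auto.
  - intros d f Hd Hf. destruct (wclosed d f Hd Hf) as (t & Ht & H). exists (ι t). rewrite (ii_mem X). auto.
  - intros t Ht. destruct (HT t Ht) as (s & Hs & ->). apply wne; auto.
  - intros t w f Ht Hw Hf Hfv. destruct (HT t Ht) as (s & Hs & ->).
    apply (ii_elim X) in Hw. destruct Hw as (w0 & Hw & ->).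
    destruct (wdecide s w0 f) as (t' & i & Ht' & Hl & Hi & H); auto. exists (ι t'), (ι i).
    rewrite !(ii_mem X). split; auto. split; [apply wleE; eauto 8|auto].
Qed.
End Star.
End Conditions.
End Levy.
End Measure.

Arguments st_dle {W mu A T Zs leT kk ix KK}. Arguments st_dkk {W mu A T Zs leT kk ix KK}.
Arguments st_dix {W mu A T Zs leT kk ix KK}. Arguments st_dKK {W mu A T Zs leT kk ix KK}.
Arguments st_refl {W mu A T Zs leT kk ix KK}. Arguments st_trans {W mu A T Zs leT kk ix KK}.
Arguments st_len {W mu A T Zs leT kk ix KK}. Arguments st_kfun {W mu A T Zs leT kk ix KK}.
Arguments st_kA {W mu A T Zs leT kk ix KK}. Arguments st_kmono {W mu A T Zs leT kk ix KK}.
Arguments st_imono {W mu A T Zs leT kk ix KK}. Arguments st_iZ {W mu A T Zs leT kk ix KK}.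
Arguments st_iK {W mu A T Zs leT kk ix KK}. Arguments st_Kfun {W mu A T Zs leT kk ix KK}.
Arguments st_Kmu {W mu A T Zs leT kk ix KK}. Arguments st_ext {W mu A T Zs leT kk ix KK}.
Arguments st_closed {W mu A T Zs leT kk ix KK}. Arguments st_ne {W mu A T Zs leT kk ix KK}.
Arguments st_dec {W mu A T Zs leT kk ix KK}.

(** * Guessing a strict upper bound *)

(* <<u, i>, <k, <v, l>>> in r codes that the i-th element of S_u lies below the l-th
   element of S_v in the k-th relation of the system. *)
Definition TrF {X : Type} (u i k v l r : X) : form X :=
  ∃ x y z, is_opair x u i ∧ is_opair z v l ∧ is_opair y k z ∧ pin x y r.
Definition TrP {M : struct} (u i k v l r : M) : Prop := op (op u i) (op k (op v l)) ∊ r.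
Lemma sat_Tr {M : struct} {Z : ZFC M} (u i k v l r : M) : sat mem (TrF u i k v l r) <-> TrP u i k v l r.
Proof.
  unfold TrP. split.
  - intros (x & y & z & H1 & H2 & H3 & H4). apply sat_opair in H1, H2, H3. apply sat_pin in H4. subst; auto.
  - intros H. exists (op u i), (op k (op v l)), (op v l). cbn [sat]. rewrite !sat_opair, sat_pin. auto.
Qed.
Lemma U_Tr a b c d e f : uniform (fun X s => TrF (s a) (s b) (s c) (s d) (s e) (s f)).
Proof. unfold TrF. utac. Qed.
#[export] Hint Resolve U_Tr : unif.

#[export] Hint Resolve Def_lqr : dfn.

Section Good.
Context {M : struct} {Z : ZFC M} (L : M).
Implicit Types f x y p q b : M.
(* [f] is a partial enumeration of pairs (condition, name). *)
Definition vl f x q : Prop := exists b, op x (op q b) ∊ f.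
Lemma Def_vl : Def3 vl.
Proof. unfold vl. dfn. Qed.
Hint Resolve Def_vl : dfn.
(* A position is good if its condition lies below the conditions of all earlier good
   positions; the good conditions of an arbitrary enumeration thus form a chain. *)
Definition gstep f x h : M := sep one (fun _ => exists q, vl f x q /\
  forall y p, y ∊ x -> emp ∊ ap h y -> vl f y p -> lqr L q p).
(** The recursion is written out, although it amounts to [emp ∊ ordrec (gstep f) x], because
    goodness has to be definable in f as well as in x. *)
Definition gd f x : Prop := exists h, approx (fun x => x) (gstep f) x h /\
  (forall h', approx (fun x => x) (gstep f) x h' -> h' = h) /\ emp ∊ gstep f x h.
Lemma Fun_gstep f : Fun2 (gstep f).
Proof. unfold gstep. dfn. Qed.
Lemma Fun3_gstep : Fun3 gstep.
Proof. unfold gstep. dfn. Qed.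
Lemma Def_gd : Def2 gd.
Proof. pose proof Fun3_gstep. unfold gd, approx. dfn. Qed.
Lemma gd_rec f x : gd f x <-> emp ∊ ordrec (gstep f) x.
Proof.
  unfold gd, ordrec, recF. rewrite setofE; [reflexivity|]. apply recF_isset; [dfn|apply Fun_gstep].
Qed.
Lemma gdE f x : Ord x -> (gd f x <-> exists q, vl f x q /\
  forall y p, y ∊ x -> gd f y -> vl f y p -> lqr L q p).
Proof.
  intros Hx. rewrite gd_rec, ordrec_eq by (auto; apply Fun_gstep). unfold gstep at 1. rewrite sepE by dfn.
  assert (HF : Fun1 (ordrec (gstep f))) by (apply Fun_ordrec, Fun_gstep).
  split.
  - intros (_ & q & Hq & H). exists q. split; auto. intros y p Hy Hg. apply H; auto.
    rewrite ap_lam by auto. apply gd_rec; auto.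
  - intros (q & Hq & H). split; [apply singE; auto|]. exists q. split; auto.
    intros y p Hy Hg. apply H; auto. rewrite ap_lam in Hg by auto. apply gd_rec; auto.
Qed.
Lemma gd_local f f' x : Ord x -> (forall y a, y ∊ x \/ y = x -> (op y a ∊ f <-> op y a ∊ f')) ->
  (gd f x <-> gd f' x).
Proof.
  pose proof Def_gd as Dg. revert x.
  apply (ord_ind (fun x => (forall y a, y ∊ x \/ y = x -> (op y a ∊ f <-> op y a ∊ f')) ->
    (gd f x <-> gd f' x))); [dfn|].
  intros x Hx IH H. rewrite !gdE by auto. unfold vl.
  assert (HI : forall y, y ∊ x -> (gd f y <-> gd f' y)).
  { intros y Hy. apply IH; auto. intros y' a [Hy'| ->]; apply H; left; auto. apply (proj1 Hx y); auto. }
  split; intros (q & (b & Hb) & Hq); exists q; (split; [exists b; apply H; auto|]);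
    intros y p Hy Hg (b' & Hb'); (apply (Hq y); [auto|apply HI; auto|exists b'; apply H; auto]).
Qed.
Lemma gd_le f x y p q : Ord x -> Ord y -> (forall x a b, op x a ∊ f -> op x b ∊ f -> a = b) ->
  gd f x -> gd f y -> vl f x p -> vl f y q -> y ∊ x -> lqr L p q.
Proof.
  intros Hx Hy Hf Hgx Hgy (b & Hb) Hq Hyx. apply gdE in Hgx; auto. destruct Hgx as (p' & (b' & Hb') & H).
  assert (E : op p b = op p' b') by eauto. apply op_inj in E. destruct E as [-> _]. eauto.
Qed.
End Good.
#[export] Hint Resolve Def_vl Def_gd : dfn.

Section Guess.
Context {M : struct} {Z : ZFC M} (mu kappa Q L : M) {Fo : fm -> M -> (nat -> M) -> Prop} {chk : M -> M}
  (F : fnotion Q L Fo chk) (Hmu : reg mu) (Hk : Ord kappa) (Hmk : mu ∊ kappa)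
  (Qcl : closed Q (lqr L) kappa)
  (Qdir : forall D, subs D Q -> (exists p, p ∊ D) -> onto D mu ->
     (forall p q, p ∊ D -> q ∊ D -> lqr L p q \/ lqr L q p) -> exists r, r ∊ Q /\ forall p, p ∊ D -> lqr L r p)
  (q0 w ln trn B : M) (Hq0 : q0 ∊ Q) (Hw : w ∊ mu)
  (Hdir : forall (N : struct) (G : M -> Prop) (val : M -> N), gext Q L Fo chk G val -> G q0 ->
     forall f, isfn f (val (chk mu)) -> (forall i, i ∊ val (chk mu) -> ap f i ∊ val ln) ->
     exists v, v ∊ val ln /\ forall j, j ∊ val (chk mu) -> exists i k l, i ∊ val (chk w) /\
       k ∊ val (chk w) /\ l ∊ val (chk w) /\ TrP (ap f j) i k v l (val trn)).
Definition below : M := sep Q (fun q => lqr L q q0).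
Context (T Zs : M) (leT : M -> M -> Prop) (kk : M -> M -> M -> Prop)
  (ix : M -> M -> Prop) (KK : M -> M -> M -> Prop)
  (St : star mu (prod below B) T Zs leT kk ix KK).

Lemma belowE q : q ∊ below <-> q ∊ Q /\ lqr L q q0.
Proof. unfold below. rewrite sepE by dfn. reflexivity. Qed.
Lemma lqr_trans (p q r : M) : lqr L p q -> lqr L q r -> lqr L p r.
Proof. apply (n_trans _ _ _ _ F). Qed.
Lemma lqr_dom (p q : M) : lqr L p q -> p ∊ Q /\ q ∊ Q.
Proof. apply (n_dom _ _ _ _ F). Qed.

Definition kf (t : M) : M := sep (prod mu (prod below B)) (fun y => kk t (pi1 y) (pi2 y)).
Definition Kf (z : M) : M := sep (prod mu (prod below B)) (fun y => KK z (pi1 y) (pi2 y)).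
Lemma Fun_kf : Fun1 kf.
Proof. pose proof (st_dkk St). unfold kf. dfn. Qed.
Lemma Fun_Kf : Fun1 Kf.
Proof. pose proof (st_dKK St). unfold Kf. dfn. Qed.
Hint Resolve Fun_kf Fun_Kf : dfn.
Lemma kfE t x a : t ∊ T -> (op x a ∊ kf t <-> kk t x a).
Proof.
  intros Ht. pose proof (st_dkk St). unfold kf. rewrite sepE by dfn. rewrite prod_op, pi1_op, pi2_op.
  split; [tauto|]. intros H1. split; auto. split; [|apply (st_kA St t x a); auto].
  destruct (st_len St t Ht) as (c & Hc & E). apply (proj1 (proj1 Hmu) c); auto. apply E; eauto.
Qed.
Lemma KfE z x a : op x a ∊ Kf z <-> KK z x a.
Proof.
  pose proof (st_dKK St). unfold Kf. rewrite sepE by dfn. rewrite prod_op, pi1_op, pi2_op.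
  split; [tauto|]. intros H1. split; auto. apply (st_Kmu St z); auto.
Qed.
Lemma kf_fun t x a b : t ∊ T -> op x a ∊ kf t -> op x b ∊ kf t -> a = b.
Proof. intros Ht. rewrite !kfE by auto. apply (st_kfun St); auto. Qed.
Lemma Kf_fun z x a b : op x a ∊ Kf z -> op x b ∊ Kf z -> a = b.
Proof. rewrite !KfE. apply (st_Kfun St). Qed.
Definition enu (f : M) : Prop := (forall x a b, op x a ∊ f -> op x b ∊ f -> a = b) /\
  subs f (prod mu (prod below B)).
Lemma kf_enu t : t ∊ T -> enu (kf t).
Proof.
  intros Ht. split; [intros; eapply kf_fun; eauto|]. intros y Hy.
  pose proof (st_dkk St). unfold kf in Hy. apply sepE in Hy; [tauto|dfn].
Qed.
Lemma Kf_enu z : enu (Kf z).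
Proof.
  split; [intros; eapply Kf_fun; eauto|]. intros y Hy.
  pose proof (st_dKK St). unfold Kf in Hy. apply sepE in Hy; [tauto|dfn].
Qed.
Lemma enu_vl f x q : enu f -> vl f x q -> x ∊ mu /\ Ord x /\ q ∊ Q /\ lqr L q q0.
Proof.
  intros [_ Hf] (b & Hb). apply Hf in Hb. apply prod_op in Hb. destruct Hb as [Hx Hb].
  apply prod_op in Hb. destruct Hb as [Hb _]. apply belowE in Hb. split; auto.
  split; auto. eapply ord_mem; [apply Hmu|auto].
Qed.
Lemma kf_gd t f x a : t ∊ T -> enu f -> subs (kf t) f -> op x a ∊ kf t -> (gd L f x <-> gd L (kf t) x).
Proof.
  intros Ht Hf Hs Hx. apply kfE in Hx; auto. destruct (st_len St t Ht) as (c & Hc & E).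
  assert (Hxc : x ∊ c) by (apply E; eauto).
  assert (Hco : Ord c) by (eapply ord_mem; [apply Hmu|auto]).
  apply gd_local; [eapply ord_mem; eauto|]. intros y b Hy.
  assert (Hyc : y ∊ c) by (destruct Hy as [Hy| ->]; auto; apply (proj1 Hco x); auto).
  apply E in Hyc. destruct Hyc as (b' & Hb'). apply kfE in Hb'; auto. split.
  - intros Hb. assert (E' : b = b') by (eapply (proj1 Hf); eauto). subst; auto.
  - apply Hs.
Qed.
Lemma kf_mono t t' : t ∊ T -> t' ∊ T -> leT t' t -> subs (kf t) (kf t').
Proof.
  intros Ht Ht' H y Hy. pose proof (proj2 (kf_enu t Ht) y Hy) as Hp. apply prodE in Hp.
  destruct Hp as (x & a & _ & _ & ->). apply kfE in Hy; auto. apply kfE; auto. eapply (st_kmono St); eauto.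
Qed.
Lemma kf_Kf t z : t ∊ T -> ix t z -> subs (kf t) (Kf z).
Proof.
  intros Ht H y Hy. pose proof (proj2 (kf_enu t Ht) y Hy) as Hp. apply prodE in Hp.
  destruct Hp as (x & a & _ & _ & ->). apply kfE in Hy; auto. apply KfE; auto. eapply (st_iK St); eauto.
Qed.

(** The good conditions form a chain indexed by positions below mu, so [Qdir] bounds them; q0 serves
    when there are none. *)
Lemma good_lower f : enu f -> exists r, lqr L r q0 /\ forall x p, gd L f x -> vl f x p -> lqr L r p.
Proof.
  intros Hf. set (D := sep Q (fun p => exists x, x ∊ mu /\ gd L f x /\ vl f x p)).
  assert (HD : forall p, p ∊ D <-> exists x, gd L f x /\ vl f x p).
  { intros p. unfold D. rewrite sepE by dfn. split.
    - intros (_ & x & _ & H). eauto.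
    - intros (x & H1 & H2). destruct (enu_vl _ _ _ Hf H2) as (H3 & _ & H4 & _). eauto. }
  destruct (classic (exists p, p ∊ D)) as [Hne|Hn].
  2: { exists q0. split; [apply (n_refl _ _ _ _ F); auto|]. intros x p H1 H2. exfalso. apply Hn.
       exists p. apply HD. eauto. }
  destruct (Qdir D) as (r & Hr & H); auto.
  - intros p Hp. unfold D in Hp. apply sepE in Hp; [tauto|dfn].
  - apply (onto_rel (fun x p => vl f x p)); [dfn|..].
    + intros x p p' _ (b & Hb) (b' & Hb'). pose proof (proj1 Hf _ _ _ Hb Hb') as E.
      apply op_inj in E. tauto.
    + intros p Hp. apply HD in Hp. destruct Hp as (x & _ & Hx). exists x. split; auto.
      apply (enu_vl _ _ _ Hf Hx).
  - intros p q Hp Hq. apply HD in Hp, Hq. destruct Hp as (x & Hgx & Hx), Hq as (y & Hgy & Hy).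
    destruct (enu_vl _ _ _ Hf Hx) as (_ & Ox & Hp & _), (enu_vl _ _ _ Hf Hy) as (_ & Oy & _).
    destruct (ord_tri x y) as [H|[H|H]]; auto.
    + right. eapply (gd_le L f y x); eauto. apply Hf.
    + subst y. destruct Hx as (b & Hb), Hy as (b' & Hb'). pose proof (proj1 Hf _ _ _ Hb Hb') as E.
      apply op_inj in E. destruct E; subst. left. apply (n_refl _ _ _ _ F); auto.
    + left. eapply (gd_le L f x y); eauto. apply Hf.
  - exists r. split.
    + destruct Hne as (p & Hp). apply (lqr_trans _ p); [apply H; auto|]. apply HD in Hp.
      destruct Hp as (x & _ & Hx). apply (enu_vl _ _ _ Hf Hx).
    + intros x p H1 H2. apply H, HD. eauto.
Qed.

Context (fnl ftr : fm)
  (Hfnl : forall (X : Type) (e : nat -> X), (¬ e 0 ∈ e 1) = dinst fnl e)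
  (Hftr : forall (X : Type) (e : nat -> X), TrF (e 0) (e 1) (e 2) (e 3) (e 4) (e 5) = dinst ftr e).
Definition env6 (b i k v l : M) : nat -> M :=
  scons b (scons (chk i) (scons (chk k) (scons v (scons (chk l) (fun _ => trn))))).
Definition nin (q b : M) : Prop := Fo fnl q (scons b (fun _ => ln)).
Definition trq (q b i k v l : M) : Prop := Fo ftr q (env6 b i k v l).
(** B contains names for all elements of Lambda but possibly others; the first alternative disposes
    of names whose value is not in Lambda. *)
Definition ok (q v b : M) : Prop := nin q b \/ exists i k l, i ∊ w /\ k ∊ w /\ l ∊ w /\ trq q b i k v l.
Lemma Def_ok : Def3 ok.
Proof. unfold ok, nin, trq, env6. dfn. Qed.
Hint Resolve Def_ok : dfn.
Lemma ok_mono q q' v b : lqr L q' q -> ok q v b -> ok q' v b.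
Proof.
  unfold ok, nin, trq. intros H [H1|(i & k & l & Hi & Hk' & Hl & H1)].
  - left. eapply (n_mono _ _ _ _ F); eauto.
  - right. exists i, k, l. do 3 (split; auto). eapply (n_mono _ _ _ _ F); eauto.
Qed.
(* q is below the good conditions of the enumeration at z, v names a strict upper bound of
   the elements of Lambda that it lists, and q decides how they lie below v. *)
Definition chosen (z q v : M) : Prop := lqr L q q0 /\
  (forall x p, gd L (Kf z) x -> vl (Kf z) x p -> lqr L q p) /\
  forall x p b, op x (op p b) ∊ Kf z -> ok q v b.

(** Take a generic filter containing a lower bound q1 of the good conditions. In its extension
    [Hdir] provides v, and each position is decided by a condition of the filter. By
    [distributivity] the mu many deciding conditions form a ground-model sequence, so the filter
    contains a lower bound of them. *)
Lemma choose z : exists q v, chosen z q v.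
Proof.
  destruct (good_lower (Kf z) (Kf_enu z)) as (q1 & Hq1 & Hq1g).
  destruct (n_gen _ _ _ _ F q1) as (N & G & val & X & HG1); [apply (lqr_dom _ _ Hq1)|].
  pose proof (g_zfc _ _ _ _ _ _ X) as ZN. change (ZFC N) in ZN.
  assert (HG0 : G q0) by (eapply (g_up _ _ _ _ _ _ X); eauto).
  destruct (v_fun _ _ _ _ _ _ X B) as (vf & Hvf). destruct (v_gen _ _ _ _ _ _ X) as (g & Hg).
  assert (Hv : exists vn, forall x p b, op x (op p b) ∊ Kf z -> ~ val b ∊ val ln \/
    exists i k l, i ∊ w /\ k ∊ w /\ l ∊ w /\ TrP (val b) (val (chk i)) (val (chk k)) (val vn) (val (chk l)) (val trn)).
  { destruct (classic (exists x p b, op x (op p b) ∊ Kf z /\ val b ∊ val ln)) as [(x0 & p0 & b0 & _ & Hb0)|Hn].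
    2: { exists emp. intros x p b Hb. left. intros H. apply Hn. eauto. }
    (* f lists the elements of Lambda named at z; at positions that name none it takes the default
       [val b0], since [Hdir] wants a total function on mu. *)
    destruct (AC_rel (fun x u : N => u ∊ val ln /\ forall p b u', op x (op p b) ∊ ii (chk := chk) (val := val) (Kf z) ->
      op b u' ∊ vf -> u' ∊ val ln -> u = u') (val (chk mu))) as (f & Hf & HfR); [dfn|..].
    { intros x Hx. destruct (classic (exists p b u', op x (op p b) ∊ ii (chk := chk) (val := val) (Kf z) /\
        op b u' ∊ vf /\ u' ∊ val ln)) as [(p & b & u & Hb & Hu & Hul)|Hn].
      - exists u. split; auto. intros p' b' u' Hb' Hu' _.
        apply (ii_opI X) in Hb, Hb'. destruct Hb as (y & a & -> & Ea & Hb), Hb' as (y' & a' & Ey & Ea' & Hb').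
        apply (ii_inj X) in Ey. subst y'. rewrite (Kf_fun _ _ _ _ Hb Hb') in Ea. rewrite <- Ea' in Ea.
        apply op_inj in Ea. destruct Ea as [_ ->]. apply Hvf in Hu, Hu'.
        destruct Hu as (b1 & _ & E1), Hu' as (b2 & _ & E2). apply op_inj in E1, E2.
        destruct E1 as [E1 ->], E2 as [E2 ->]. rewrite E1 in E2. apply (v_inj _ _ _ _ _ _ X) in E2. subst; auto.
      - exists (val b0). split; auto. intros p b u' H1 H2 H3. exfalso. apply Hn. eauto 8. }
    destruct (Hdir N G val X HG0 f Hf) as (v & Hv & Hvb); [intros; apply HfR; auto|].
    destruct (v_surj _ _ _ _ _ _ X v) as (vn & ->). exists vn. intros x p b Hb.
    destruct (classic (val b ∊ val ln)) as [Hbl|]; auto. right.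
    pose proof (proj2 (Kf_enu z) _ Hb) as Hx. apply prod_op in Hx. destruct Hx as [Hx Hpb].
    apply prod_op in Hpb. destruct Hpb as [_ HbB].
    assert (Hix : val (chk x) ∊ val (chk mu)) by (apply (ii_mem X); auto).
    destruct (Hvb _ Hix) as (i & k & l & Hi & Hk' & Hl & Ht).
    assert (E : ap f (val (chk x)) = val b).
    { apply (proj2 (HfR _ Hix) (ii (chk := chk) (val := val) p) (ii (chk := chk) (val := val) b)); auto.
      - rewrite <- (ii_op X). apply (ii_opE X); auto.
      - apply Hvf. exists b. auto. }
    rewrite E in Ht. apply (ii_elim X) in Hi, Hk', Hl.
    destruct Hi as (i' & Hi & ->), Hk' as (k' & Hk' & ->), Hl as (l' & Hl & ->). exists i', k', l'. auto. }
  destruct Hv as (vn & Hvn).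
  set (RS := sep (prod mu Q) (fun y => forall p b, op (pi1 y) (op p b) ∊ Kf z -> ok (pi2 y) vn b)).
  assert (HRS : forall x r, op x r ∊ RS <-> x ∊ mu /\ r ∊ Q /\ forall p b, op x (op p b) ∊ Kf z -> ok r vn b).
  { intros x r. unfold RS. rewrite sepE by dfn. rewrite prod_op, pi1_op, pi2_op. tauto. }
  assert (HU : forall x, x ∊ mu -> exists r, G r /\ forall p b, op x (op p b) ∊ Kf z -> ok r vn b).
  { intros x Hx. destruct (classic (exists p b, op x (op p b) ∊ Kf z)) as [(p & b & Hb)|Hn].
    2: { exists q1. split; auto. intros p b Hb. exfalso; eauto. }
    assert (Hr : exists r, G r /\ ok r vn b).
    { destruct (Hvn _ _ _ Hb) as [H|(i & k & l & Hi & Hk' & Hl & H)].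
      - apply (truth_u X _ _ (scons b (fun _ => ln)) Hfnl) in H. destruct H as (r & Hr & H).
        exists r. split; auto. left; auto.
      - apply sat_Tr in H. apply (truth_u X _ _ (env6 b i k vn l) Hftr) in H.
        destruct H as (r & Hr & H). exists r. split; auto. right. exists i, k, l. auto. }
    destruct Hr as (r & Hr & Hrb). exists r. split; auto. intros p' b' Hb'.
    pose proof (Kf_fun _ _ _ _ Hb Hb') as E. apply op_inj in E. destruct E; subst; auto. }
  destruct (AC_rel (fun x r : N => r ∊ g /\ op x r ∊ ii (chk := chk) (val := val) RS) (val (chk mu)))
    as (f & Hf & HfR); [dfn|..].
  { intros x Hx. apply (ii_elim X) in Hx. destruct Hx as (y & Hy & ->). destruct (HU y Hy) as (r & Hr & H).
    exists (ii (chk := chk) (val := val) r). split; [apply Hg; exists r; auto|]. apply (ii_opE X), HRS. split; auto. split; auto.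
    apply (g_in _ _ _ _ _ _ X); auto. }
  destruct (distributivity F X kappa mu Q f) as (h & Hh & Hhv & E); auto.
  { intros i Hi. destruct (HfR i Hi) as [Hgi _]. apply Hg in Hgi. destruct Hgi as (p & Hp & E).
    rewrite E. apply (ii_mem X), (g_in _ _ _ _ _ _ X); auto. }
  assert (Hh' : forall i, i ∊ mu -> G (ap h i) /\ op i (ap h i) ∊ RS).
  { intros i Hi. destruct (HfR (ii (chk := chk) (val := val) i)) as [H1 H2]; [apply (ii_mem X); auto|]. subst f.
    change (val (chk h)) with (ii (chk := chk) (val := val) h) in *.
    rewrite (ii_ap X h mu) in H1, H2 by auto. split; [|apply (ii_opE X); auto].
    apply Hg in H1. destruct H1 as (p & Hp & E). apply (ii_inj X) in E. rewrite E; auto. }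
  destruct (closed_lower F X kappa mu h) as (h0 & Hh0 & Hh0l); auto.
  { intros i Hi. apply Hh'; auto. }
  destruct (g_dir _ _ _ _ _ _ X h0 q1 Hh0 HG1) as (q & Hq & Hqh & Hqq). exists q, vn.
  split; [apply (lqr_trans _ q1); auto|]. split.
  - intros x p H1 H2. apply (lqr_trans _ q1); auto. eapply Hq1g; eauto.
  - intros x p b Hb. assert (Hx : x ∊ mu).
    { apply (enu_vl (Kf z) x p (Kf_enu z)). exists b; auto. }
    destruct (Hh' x Hx) as [_ H]. apply HRS in H. destruct H as (_ & _ & H).
    apply (ok_mono (ap h x)); eauto. eapply lqr_trans; [exact Hqh|]. apply Hh0l; auto.
Qed.

Lemma choose_all : exists qv, isfn qv Zs /\ forall z, z ∊ Zs -> chosen z (pi1 (ap qv z)) (pi2 (ap qv z)).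
Proof.
  destruct (AC_rel (fun z y => chosen z (pi1 y) (pi2 y)) Zs) as (f & Hf & H).
  - unfold chosen. dfn.
  - intros z _. destruct (choose z) as (q & v & H). exists (op q v). rewrite pi1_op, pi2_op. auto.
  - exists f. auto.
Qed.

Section Extension.
Context (qv : M) (Hqv : forall z, z ∊ Zs -> chosen z (pi1 (ap qv z)) (pi2 (ap qv z))).
Definition dec (z b i k l : M) : Prop := trq (pi1 (ap qv z)) b i k (pi2 (ap qv z)) l.
Lemma Def_dec : Def5 dec.
Proof. unfold dec, trq, env6. dfn. Qed.
Hint Resolve Def_dec : dfn.

(** The pair (h, b) is appended at the first free position c. As h lies below all earlier good
    conditions, c is good, and therefore q_z lies below h for every index z that is left. *)
Lemma ext_good s h b : s ∊ T -> b ∊ B -> lqr L h q0 ->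
  (forall x p, gd L (kf s) x -> vl (kf s) x p -> lqr L h p) ->
  exists t c, t ∊ T /\ leT t s /\ gd L (kf t) c /\ op c (op h b) ∊ kf t /\
    forall z, ix t z -> lqr L (pi1 (ap qv z)) h /\ ok (pi1 (ap qv z)) (pi2 (ap qv z)) b.
Proof.
  intros Hs Hb Hh Hhg. destruct (st_len St s Hs) as (c & Hc & Ec).
  destruct (st_ext St s (op h b) c) as (t & Ht & Hts & Et); auto.
  { apply prod_op. split; auto. apply belowE. split; auto. apply (lqr_dom _ _ Hh). }
  assert (Hct : op c (op h b) ∊ kf t) by (apply kfE; auto; apply Et; auto).
  assert (Hco : Ord c) by (eapply ord_mem; [apply Hmu|auto]).
  assert (Hgc : gd L (kf t) c).
  { apply gdE; auto. exists h. split; [exists b; auto|]. intros y p Hy Hg (b' & Hb').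
    assert (Hys : op y (op p b') ∊ kf s).
    { apply kfE in Hb'; auto. apply kfE; auto. apply Et in Hb'. destruct Hb' as [Hb'|[-> _]]; auto.
      exfalso. apply (mem_irrefl c); auto. }
    apply (Hhg y); [|exists b'; auto]. apply (kf_gd s (kf t) y _) in Hys; auto.
    - apply Hys; auto.
    - apply kf_enu; auto.
    - apply kf_mono; auto. }
  exists t, c. do 4 (split; auto). intros z Hz.
  assert (HzZ : z ∊ Zs) by (eapply (st_iZ St); eauto).
  pose proof (kf_Kf t z Ht Hz) as HK. destruct (Hqv z HzZ) as (_ & H1 & H2). split.
  - apply (H1 c); [|exists b; auto]. apply (kf_gd t (Kf z) c _ Ht (Kf_enu z) HK Hct); auto.
  - eapply H2. apply HK. eauto.
Qed.

Context {N : struct} {ZN : ZFC N} {G : M -> Prop} {val : M -> N} (X : gext Q L Fo chk G val)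
  (HG0 : G q0) (HB : forall u, u ∊ val ln -> exists b, b ∊ B /\ u = val b)
  (g vf : N) (Hg : forall y, y ∊ g <-> exists p, G p /\ y = val (chk p))
  (Hvf : forall z, z ∊ vf <-> exists b, b ∊ B /\ z = op (val (chk b)) (val b)).
Local Notation ι := (@ii M N chk val).
(** The relations used so far are definable only over the ground model. [GV], [LH], [IX] and [DD]
    are their graphs as sets, so that the extension can refer to them. *)
Definition GV : M := sep (prod T Q) (fun y => exists x, gd L (kf (pi1 y)) x /\ vl (kf (pi1 y)) x (pi2 y)).
Definition LH : M := sep (prod T T) (fun y => leT (pi1 y) (pi2 y)).
Definition IX : M := sep (prod T Zs) (fun y => ix (pi1 y) (pi2 y)).
Definition DD : M := sep (prod Zs (prod B (prod w (prod w w))))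
  (fun y => exists z b i k l, y = op z (op b (op i (op k l))) /\ dec z b i k l).
(** The analogue of a quotient forcing: t survives if all its good conditions belong to the generic
    filter of Q. *)
Definition TH : N := sep (ι T) (fun t => forall p, op t p ∊ ι GV -> p ∊ g).
Definition leH (t' t : N) : Prop := op t' t ∊ ι LH.
(** For all indices z of t, q_z forces the i-th element of level u below the l-th element of level
    v_z in the k-th relation. The level v_z may vary with z, but k and l may not, so they code the
    branch. *)
Definition FF (t k l u i : N) : Prop := exists b, op b u ∊ vf /\
  forall z, op t z ∊ ι IX -> op z (op b (op i (op k l))) ∊ ι DD.
Lemma GVE t p : op t p ∊ GV <-> t ∊ T /\ exists x, gd L (kf t) x /\ vl (kf t) x p.
Proof.
  unfold GV. rewrite sepE by dfn. rewrite prod_op, pi1_op, pi2_op. split; [tauto|].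
  intros (Ht & x & H1 & H2). split; [split; auto|eauto]. apply (enu_vl (kf t) x p); auto. apply kf_enu; auto.
Qed.
Lemma LHE t' t : op t' t ∊ LH <-> t' ∊ T /\ t ∊ T /\ leT t' t.
Proof.
  pose proof (st_dle St). unfold LH. rewrite sepE by dfn. rewrite prod_op, pi1_op, pi2_op. tauto.
Qed.
Lemma IXE t z : op t z ∊ IX <-> t ∊ T /\ ix t z.
Proof.
  pose proof (st_dix St). unfold IX. rewrite sepE by dfn. rewrite prod_op, pi1_op, pi2_op.
  split; [tauto|]. intros [H1 H2]. split; [split|]; auto. eapply (st_iZ St); eauto.
Qed.
Lemma DDE z b i k l : op z (op b (op i (op k l))) ∊ DD <->
  z ∊ Zs /\ b ∊ B /\ i ∊ w /\ k ∊ w /\ l ∊ w /\ dec z b i k l.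
Proof.
  unfold DD. rewrite sepE by dfn. rewrite !prod_op. split.
  - intros (H1 & z' & b' & i' & k' & l' & E & H). apply op_inj in E. destruct E as [-> E].
    apply op_inj in E. destruct E as [-> E]. apply op_inj in E. destruct E as [-> E].
    apply op_inj in E. destruct E as [-> ->]. tauto.
  - intros H. split; [tauto|]. exists z, b, i, k, l. tauto.
Qed.
Lemma DDI (z b i k l : N) : op z (op b (op i (op k l))) ∊ ι DD -> exists z' b' i' k' l',
  z = ι z' /\ b = ι b' /\ i = ι i' /\ k = ι k' /\ l = ι l' /\ op z' (op b' (op i' (op k' l'))) ∊ DD.
Proof.
  intros H. apply (ii_elim X) in H. destruct H as (y & Hy & E).
  pose proof Hy as Hy'. unfold DD in Hy'. apply sepE in Hy'; [|dfn].
  destruct Hy' as (_ & z' & b' & i' & k' & l' & -> & _). rewrite !(ii_op X) in E.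
  apply op_inj in E. destruct E as [-> E].
  apply op_inj in E. destruct E as [-> E]. apply op_inj in E. destruct E as [-> E].
  apply op_inj in E. destruct E as [-> ->]. exists z', b', i', k', l'. do 5 (split; auto).
Qed.
Lemma Def_TH : Def1 (fun t : N => forall p, op t p ∊ ι GV -> p ∊ g).
Proof. dfn. Qed.
Lemma THE (t : N) : t ∊ TH <-> exists s, t = ι s /\ s ∊ T /\
  forall x p, gd L (kf s) x -> vl (kf s) x p -> G p.
Proof.
  unfold TH. rewrite sepE by apply Def_TH. split.
  - intros [H1 H2]. apply (ii_elim X) in H1. destruct H1 as (s & Hs & ->). exists s. split; auto. split; auto.
    intros x p H3 H4. assert (H5 : ι p ∊ g) by (apply H2, (ii_opE X), GVE; eauto).
    apply Hg in H5. destruct H5 as (p' & Hp & E). apply (ii_inj X) in E. subst; auto.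
  - intros (s & -> & Hs & H). split; [apply (ii_mem X); auto|]. intros p Hp. apply (ii_opI X) in Hp.
    destruct Hp as (s' & p' & E & -> & Hp). apply GVE in Hp. destruct Hp as (_ & x & H1 & H2).
    apply (ii_inj X) in E. subst. apply Hg. exists p'. split; eauto.
Qed.
Lemma leHE (t' t : N) : leH t' t <-> exists s' s, t' = ι s' /\ t = ι s /\ s' ∊ T /\ s ∊ T /\ leT s' s.
Proof.
  unfold leH. split.
  - intros H. apply (ii_opI X) in H. destruct H as (s' & s & -> & -> & H). apply LHE in H. eauto 8.
  - intros (s' & s & -> & -> & H). apply (ii_opE X), LHE. auto.
Qed.
Lemma TH_ne : exists t, t ∊ TH.
Proof.
  destruct (st_closed St emp emp) as (t & Ht & _ & E).
  - apply reg_emp; auto.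
  - split; [|split].
    + split; intros x Hx; destruct (empE x Hx).
    + intros i Hi. destruct (empE i Hi).
    + intros i j _ Hj. destruct (empE j Hj).
  - exists (ι t). apply THE. exists t. split; auto. split; auto. intros x p _ (b & Hb).
    apply kfE in Hb; auto. apply E in Hb. destruct Hb as (i & Hi & _). exfalso. apply (empE i); auto.
Qed.
Lemma TH_refl (t : N) : t ∊ TH -> leH t t.
Proof.
  intros H. apply THE in H. destruct H as (s & -> & Hs & _). apply leHE. exists s, s.
  do 4 (split; auto). apply (st_refl St); auto.
Qed.
Lemma TH_trans (t s r : N) : leH t s -> leH s r -> leH t r.
Proof.
  intros H1 H2. apply leHE in H1, H2. destruct H1 as (t' & s' & -> & -> & Ht & Hs & H1).
  destruct H2 as (s2 & r' & E & -> & _ & Hr & H2). apply (ii_inj X) in E. subst.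
  apply leHE. exists t', r'. do 4 (split; auto). eapply (st_trans St); eauto.
Qed.
(** Q adds no sequences shorter than kappa, so the sequence lies in the ground model and has a lower
    bound there. Each position of the bound comes from some term and is good in that term, so its
    condition is in the filter. *)
Lemma TH_closed : closed TH leH (ι mu).
Proof.
  intros d f Hd (Hf & Hv & Hdec). apply (ii_elim X) in Hd. destruct Hd as (e & He & ->).
  assert (Hek : e ∊ kappa) by (apply (proj1 Hk mu); auto).
  destruct (distributivity F X kappa e T f) as (h & Hh & Hhv & E); auto.
  { intros i Hi. apply Hv in Hi. apply THE in Hi. destruct Hi as (s & -> & Hs & _). apply (ii_mem X); auto. }
  fold (ι h) in E. subst f.
  assert (Hap : forall i, i ∊ e -> ap (ι h) (ι i) = ι (ap h i)) by (intros; apply (ii_ap X h e); auto).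
  destruct (st_closed St e h He) as (t & Ht & Htl & Etk).
  { split; auto. split; auto. intros i j Hij Hj.
    assert (Hi : i ∊ e) by (apply (proj1 (ord_mem _ _ (proj1 Hmu) He) j); auto).
    specialize (Hdec (ι i) (ι j)). rewrite !Hap in Hdec by auto.
    destruct (proj1 (leHE _ _) (Hdec (proj2 (ii_mem X _ _) Hij) (proj2 (ii_mem X _ _) Hj)))
      as (s' & s & E1 & E2 & _ & _ & H). apply (ii_inj X) in E1, E2. subst; auto. }
  exists (ι t). split.
  - apply THE. exists t. split; auto. split; auto. intros x p Hgx Hvx.
    destruct Hvx as (b & Hb). apply kfE in Hb; auto. apply Etk in Hb. destruct Hb as (i & Hi & Hb).
    assert (HiT : ap h i ∊ T) by auto. apply kfE in Hb; auto.
    assert (H : ι (ap h i) ∊ TH) by (rewrite <- Hap by auto; apply Hv, (ii_mem X); auto).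
    apply THE in H. destruct H as (s & E & _ & H). apply (ii_inj X) in E. subst s.
    apply (H x p); [|exists b; auto]. apply (kf_gd (ap h i) (kf t) x (op p b)); auto.
    + apply kf_enu; auto.
    + apply kf_mono; auto.
  - intros i Hi. apply (ii_elim X) in Hi. destruct Hi as (j & Hj & ->). rewrite Hap by auto.
    apply leHE. exists t, (ap h j). repeat (split; auto).
Qed.
Lemma FF_mono (t t' k l u i : N) : leH t' t -> FF t k l u i -> FF t' k l u i.
Proof.
  intros H (b & Hb & HF). apply leHE in H. destruct H as (s' & s & -> & -> & Hs' & Hs & H).
  exists b. split; auto. intros z Hz. apply HF. apply (ii_opI X) in Hz.
  destruct Hz as (s2 & z' & E & -> & Hz). apply (ii_inj X) in E. subst. apply (ii_opE X), IXE.
  apply IXE in Hz. split; auto. eapply (st_imono St); eauto. tauto.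
Qed.
Lemma TH_lower s p : s ∊ T -> (forall x p, gd L (kf s) x -> vl (kf s) x p -> G p) -> G p ->
  exists h, G h /\ lqr L h p /\ lqr L h q0 /\ forall x p', gd L (kf s) x -> vl (kf s) x p' -> lqr L h p'.
Proof.
  intros Hs HGs Hp.
  destruct (AC_rel (fun x y => (gd L (kf s) x /\ vl (kf s) x y) \/
    (~ (exists y, gd L (kf s) x /\ vl (kf s) x y) /\ y = q0)) mu) as (f & Hf & HfR); [dfn|..].
  { intros x _. destruct (classic (exists y, gd L (kf s) x /\ vl (kf s) x y)) as [(y & H)|Hn]; eauto. }
  destruct (closed_lower F X kappa mu f) as (h0 & Hh0 & Hh0l); auto.
  { intros i Hi. destruct (HfR i Hi) as [[H1 H2]|[_ ->]]; eauto. }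
  destruct (g_dir _ _ _ _ _ _ X p q0 Hp HG0) as (h1 & Hh1 & Hh1p & Hh1q).
  destruct (g_dir _ _ _ _ _ _ X h0 h1 Hh0 Hh1) as (h & Hh & Hha & Hhb).
  exists h. split; auto. split; [eapply lqr_trans; eauto|]. split; [eapply lqr_trans; eauto|].
  intros x p' H1 H2. destruct (enu_vl (kf s) x p' (kf_enu s Hs) H2) as (Hx & _).
  destruct (HfR x Hx) as [[H3 H4]|[H3 _]]; [|exfalso; apply H3; eauto].
  destruct H2 as (b & Hb), H4 as (b' & Hb'). pose proof (kf_fun s _ _ _ Hs Hb Hb') as E.
  apply op_inj in E. destruct E as [-> _]. eapply lqr_trans; [exact Hha|]. apply Hh0l; auto.
Qed.
Lemma FF_elim s (k l u i : N) : s ∊ T -> FF (ι s) k l u i -> exists b i' k' l', b ∊ B /\ u = val b /\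
  i = ι i' /\ k = ι k' /\ l = ι l' /\ forall z, ix s z -> dec z b i' k' l'.
Proof.
  intros Hs (b & Hb & H). apply Hvf in Hb. destruct Hb as (b' & Hb' & E). apply op_inj in E.
  destruct E as [-> ->]. destruct (st_ne St s Hs) as (z & Hz).
  assert (Hz' : op (ι s) (ι z) ∊ ι IX) by (apply (ii_opE X), IXE; auto).
  destruct (DDI _ _ _ _ _ (H _ Hz')) as (z' & b2 & i' & k' & l' & _ & E & -> & -> & -> & _).
  exists b', i', k', l'. do 5 (split; auto). intros y Hy.
  assert (Hy' : op (ι s) (ι y) ∊ ι IX) by (apply (ii_opE X), IXE; auto).
  specialize (H _ Hy'). fold (ι b') in H. rewrite <- !(ii_op X) in H. apply (ii_mem X), DDE in H. tauto.
Qed.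
(** Suppose that some p in G forces the two elements to have no common upper bound of this kind. A
    condition h of G below p can be appended as a good position, so q_z lies below p for the indices
    z that remain; but q_z forces both elements below the same element of level v_z. *)
Lemma FF_cmp (t k l u u' i i' : N) : t ∊ TH -> FF t k l u i -> FF t k l u' i' ->
  exists v l', TrP u i k v l' (val trn) /\ TrP u' i' k v l' (val trn).
Proof.
  intros Ht H1 H2. apply THE in Ht. destruct Ht as (s & -> & Hs & HGs).
  apply FF_elim in H1, H2; auto. destruct H1 as (b & j & k' & l' & Hb & -> & -> & -> & -> & H1).
  destruct H2 as (b' & j' & k2 & l2 & Hb' & -> & -> & Ek & El & H2).
  apply (ii_inj X) in Ek, El. subst k2 l2. apply NNPP. intros Hn.
  assert (HU : uniform (fun X e => ¬ ∃ v l, TrF (e 0) (e 1) (e 4) v l (e 5) ∧ TrF (e 2) (e 3) (e 4) v l (e 5)))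
    by utac.
  destruct HU as (fc & Hfc).
  set (ev := scons b (scons (chk j) (scons b' (scons (chk j') (scons (chk k') (fun _ => trn)))))).
  assert (Hp : exists p, G p /\ Fo fc p ev).
  { apply (truth_u X _ _ ev Hfc). intros (v & y & H3 & H4). apply sat_Tr in H3, H4. apply Hn.
    exists v, y. auto. }
  destruct Hp as (p & Hp & Hpc). destruct (TH_lower s p Hs HGs Hp) as (h & Hh & Hhp & Hhq & Hhg).
  destruct (ext_good s h b Hs Hb Hhq Hhg) as (t & c & Ht & Hts & _ & _ & Hz).
  destruct (st_ne St t Ht) as (z & Hzt). destruct (Hz z Hzt) as [Hzh _].
  assert (Hzs : ix s z) by (eapply (st_imono St); eauto).
  destruct (n_gen _ _ _ _ F (pi1 (ap qv z))) as (N' & G' & val' & X' & HG'); [apply (lqr_dom _ _ Hzh)|].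
  pose proof (g_zfc _ _ _ _ _ _ X') as ZN'. change (ZFC N') in ZN'.
  assert (HG'p : G' p).
  { apply (g_up _ _ _ _ _ _ X' (pi1 (ap qv z))); auto. apply (lqr_trans _ h); auto. }
  assert (Hc : sat mem (¬ ∃ v l, TrF (val' b) (val' (chk j)) (val' (chk k')) v l (val' trn) ∧
     TrF (val' b') (val' (chk j')) (val' (chk k')) v l (val' trn))).
  { apply (truth_u X' _ _ ev Hfc). eauto. }
  apply Hc. exists (val' (pi2 (ap qv z))), (val' (chk l')). split.
  - apply (truth_u X' _ _ (env6 b j k' (pi2 (ap qv z)) l') Hftr). exists (pi1 (ap qv z)). split; auto.
    apply (H1 z Hzs).
  - apply (truth_u X' _ _ (env6 b' j' k' (pi2 (ap qv z)) l') Hftr). exists (pi1 (ap qv z)). split; auto.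
    apply (H2 z Hzs).
Qed.

(** A density argument below h: any q is appended together with the name b. Each q_z forces b into
    Lambda and hence decides some triple (i, k, l), which [st_dec] makes constant. A lower bound r
    of all good conditions lies below q, and if r is in G then the resulting condition is in TH. *)
Lemma FF_full (t u : N) : t ∊ TH -> u ∊ val ln -> exists t' k l i, t' ∊ TH /\ leH t' t /\
  k ∊ ι w /\ l ∊ ι w /\ i ∊ ι w /\ FF t' k l u i.
Proof.
  intros Ht Hu. apply THE in Ht. destruct Ht as (s & -> & Hs & HGs).
  destruct (HB u Hu) as (b & Hb & ->). destruct (U_mem 0 1) as (fi & Hfi).
  assert (Hp : exists p, G p /\ Fo fi p (scons b (fun _ => ln))).
  { apply (truth_u X _ _ _ Hfi). exact Hu. }
  destruct Hp as (p & Hp & Hpi). destruct (TH_lower s p Hs HGs Hp) as (h & Hh & Hhp & Hhq & Hhg).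
  pose proof (st_dle St) as D1. pose proof (st_dix St) as D2.
  destruct (gen_below F X h (fun r => exists t i k l, t ∊ T /\ leT t s /\ i ∊ w /\ k ∊ w /\ l ∊ w /\
    (forall z, ix t z -> dec z b i k l) /\ forall x p, gd L (kf t) x -> vl (kf t) x p -> lqr L r p))
    as (r & Hr & (t & i & k & l & Ht & Hts & Hi & Hk' & Hl & Hz & Hrg) & _); auto; [dfn|..].
  2: { exists (ι t), (ι k), (ι l), (ι i). rewrite !(ii_mem X). split; [|split; [|do 3 (split; auto)]].
       - apply THE. exists t. split; auto. split; auto. intros x p' H1 H2.
         apply (g_up _ _ _ _ _ _ X r); auto. eapply Hrg; eauto.
       - apply leHE. exists t, s. repeat (split; auto).
       - exists (ι b). split; [apply Hvf; eauto|]. intros z Hz'. apply (ii_opI X) in Hz'.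
         destruct Hz' as (t2 & z' & E & -> & Hz'). apply (ii_inj X) in E. subst t2. apply IXE in Hz'.
         rewrite <- !(ii_op X). apply (ii_mem X), DDE. split; [eapply (st_iZ St); eauto; tauto|].
         do 4 (split; auto). apply Hz; tauto. }
  intros q Hq.
  destruct (ext_good s q b Hs Hb) as (t1 & c & Ht1 & Hts1 & Hgc & Hct & Hz1).
  { apply (lqr_trans _ h); auto. }
  { intros x p' H1 H2. apply (lqr_trans _ h); auto. eapply Hhg; eauto. }
  assert (Hz2 : forall z, ix t1 z -> exists i k l, i ∊ w /\ k ∊ w /\ l ∊ w /\ dec z b i k l).
  { intros z Hz. destruct (Hz1 z Hz) as [Hzq [Hno|Hyes]]; auto. exfalso.
    destruct (n_gen _ _ _ _ F (pi1 (ap qv z))) as (N' & G' & val' & X' & HG'); [apply (lqr_dom _ _ Hzq)|].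
    assert (HG'p : G' p).
    { apply (g_up _ _ _ _ _ _ X' (pi1 (ap qv z))); auto. apply (lqr_trans _ q); auto.
      apply (lqr_trans _ h); auto. }
    assert (H1 : sat mem (val' b ∈ val' ln)) by (apply (truth_u X' _ _ (scons b (fun _ => ln)) Hfi); eauto).
    assert (H2 : sat mem (¬ val' b ∈ val' ln)) by (apply (truth_u X' _ _ (scons b (fun _ => ln)) Hfnl); eauto).
    apply H2, H1. }
  destruct (st_ne St t1 Ht1) as (z0 & Hz0). destruct (Hz2 z0 Hz0) as (i0 & _ & _ & Hi0 & _).
  destruct (AC_rel (fun z y => exists i k l, y = op i (op k l) /\ i ∊ w /\ k ∊ w /\ l ∊ w /\
    ((exists i k l, i ∊ w /\ k ∊ w /\ l ∊ w /\ dec z b i k l) -> dec z b i k l)) Zs) as (f & Hf & HfR); [dfn|..].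
  { intros z _. destruct (classic (exists i k l, i ∊ w /\ k ∊ w /\ l ∊ w /\ dec z b i k l))
      as [(i & k & l & Hi & Hk' & Hl & H)|Hn].
    - exists (op i (op k l)), i, k, l. auto.
    - exists (op i0 (op i0 i0)), i0, i0, i0. do 4 (split; auto). tauto. }
  set (fa := lam Zs (fun z => pi1 (ap f z))). set (fb := lam Zs (fun z => pi1 (pi2 (ap f z)))).
  set (fd := lam Zs (fun z => pi2 (pi2 (ap f z)))).
  destruct (st_dec St t1 w fa) as (t2 & i & Ht2 & H21 & Hi & Hai); auto.
  { apply lam_fn; dfn. }
  { intros z Hz. unfold fa. rewrite ap_lam by (auto; dfn). destruct (HfR z Hz) as (i & k & l & -> & Hi & _).
    rewrite pi1_op; auto. }
  destruct (st_dec St t2 w fb) as (t3 & k & Ht3 & H32 & Hk' & Hbk); auto.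
  { apply lam_fn; dfn. }
  { intros z Hz. unfold fb. rewrite ap_lam by (auto; dfn). destruct (HfR z Hz) as (i' & k & l & -> & _ & Hk' & _).
    rewrite pi2_op, pi1_op; auto. }
  destruct (st_dec St t3 w fd) as (t4 & l & Ht4 & H43 & Hl & Hdl); auto.
  { apply lam_fn; dfn. }
  { intros z Hz. unfold fd. rewrite ap_lam by (auto; dfn). destruct (HfR z Hz) as (i' & k' & l & -> & _ & _ & Hl & _).
    rewrite !pi2_op; auto. }
  assert (H42 : leT t4 t2) by (eapply (st_trans St); eauto).
  assert (H41 : leT t4 t1) by (eapply (st_trans St); eauto).
  destruct (good_lower (kf t4) (kf_enu t4 Ht4)) as (r & _ & Hrg).
  exists r. split.
  - apply (Hrg c).
    + apply (kf_gd t1 (kf t4) c (op q b)); auto; [apply kf_enu; auto|apply kf_mono; auto].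
    + exists b. apply (kf_mono t1); auto.
  - exists t4, i, k, l. split; auto. split; [eapply (st_trans St); eauto|]. do 3 (split; auto). split; auto.
    intros z Hz. assert (HzZ : z ∊ Zs) by (apply (st_iZ St t4); auto).
    assert (E1 : ap fa z = i) by (apply Hai; eapply (st_imono St); eauto).
    assert (E2 : ap fb z = k) by (apply Hbk; eapply (st_imono St); eauto).
    assert (E3 : ap fd z = l) by (apply Hdl; auto).
    unfold fa in E1. unfold fb in E2. unfold fd in E3. rewrite ap_lam in E1, E2, E3 by (auto; dfn).
    destruct (HfR z HzZ) as (i' & k' & l' & E & _ & _ & _ & Hd). rewrite E in *.
    rewrite !pi2_op, !pi1_op in *. subst. apply Hd, Hz2. eapply (st_imono St); eauto.
Qed.
Lemma Def_leH : Def2 leH.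
Proof. unfold leH. dfn. Qed.
Lemma Def_FF : Def5 FF.
Proof. unfold FF. dfn. Qed.
End Extension.
End Guess.

Theorem guessing {M N : struct} {Z : ZFC M} {ZN : ZFC N} (mu kappa Q L : M)
  {Fo : fm -> M -> (nat -> M) -> Prop} {chk : M -> M} (F : fnotion Q L Fo chk)
  {G : M -> Prop} {val : M -> N} (X : gext Q L Fo chk G val) (q0 w ln trn B : M) :
  reg mu -> Ord kappa -> mu ∊ kappa -> closed Q (lqr L) kappa ->
  (forall D, subs D Q -> (exists p, p ∊ D) -> onto D mu ->
     (forall p q, p ∊ D -> q ∊ D -> lqr L p q \/ lqr L q p) -> exists r, r ∊ Q /\ forall p, p ∊ D -> lqr L r p) ->
  G q0 -> w ∊ mu ->
  (forall (N : struct) (G : M -> Prop) (val : M -> N), gext Q L Fo chk G val -> G q0 ->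
     forall f, isfn f (val (chk mu)) -> (forall i, i ∊ val (chk mu) -> ap f i ∊ val ln) ->
     exists v, v ∊ val ln /\ forall j, j ∊ val (chk mu) -> exists i k l, i ∊ val (chk w) /\
       k ∊ val (chk w) /\ l ∊ val (chk w) /\ TrP (ap f j) i k v l (val trn)) ->
  (forall u, u ∊ val ln -> exists b, b ∊ B /\ u = val b) ->
  (exists T Zs leT kk ix KK, star mu (prod (below Q L q0) B) T Zs leT kk ix KK) ->
  exists (T : N) (leT : N -> N -> Prop) (FF : N -> N -> N -> N -> N -> Prop), Def2 leT /\ Def5 FF /\
    (exists t, t ∊ T) /\ (forall t, t ∊ T -> leT t t) /\
    (forall t s r, leT t s -> leT s r -> leT t r) /\ closed T leT (val (chk mu)) /\
    (forall t t' k l u i, leT t' t -> FF t k l u i -> FF t' k l u i) /\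
    (forall t k l u u' i i', t ∊ T -> FF t k l u i -> FF t k l u' i' ->
       exists v l', TrP u i k v l' (val trn) /\ TrP u' i' k v l' (val trn)) /\
    forall t u, t ∊ T -> u ∊ val ln -> exists t' k l i, t' ∊ T /\ leT t' t /\ k ∊ val (chk w) /\
      l ∊ val (chk w) /\ i ∊ val (chk w) /\ FF t' k l u i.
Proof.
  intros Hmu Hk Hmk Qcl Qdir HG0 Hw Hdir HB (T & Zs & leT & kk & ix & KK & St).
  assert (Hq0 : q0 ∊ Q) by (apply (g_in _ _ _ _ _ _ X); auto).
  assert (U1 : uniform (fun X e => ¬ e 0 ∈ e 1)) by utac. destruct U1 as (fnl & Hfnl).
  destruct (U_Tr 0 1 2 3 4 5) as (ftr & Hftr).
  destruct (v_gen _ _ _ _ _ _ X) as (g & Hg). destruct (v_fun _ _ _ _ _ _ X B) as (vf & Hvf).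
  destruct (choose_all mu kappa Q L F Hmu Hk Hmk Qcl Qdir q0 w ln trn B Hq0 Hdir T Zs leT kk ix KK St
    fnl ftr Hfnl Hftr) as (qv & _ & Hqv).
  exists (TH mu Q L (chk := chk) q0 B T kk (val := val) g), (leH (chk := chk) T leT (val := val)),
    (FF (Fo := Fo) (chk := chk) w trn B T Zs ix ftr qv (val := val) vf).
  split; [apply Def_leH; auto|]. split; [apply Def_FF; auto|].
  split; [apply (TH_ne mu Q L Hmu q0 B T Zs leT kk ix KK St X g Hg)|].
  split; [apply (TH_refl mu Q L Hmu q0 B T Zs leT kk ix KK St X g Hg)|].
  split; [apply (TH_trans mu Q L q0 B T Zs leT kk ix KK St X)|].
  split; [apply (TH_closed mu kappa Q L F Hmu Hk Hmk Qcl q0 B T Zs leT kk ix KK St X g Hg)|].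
  split; [apply (FF_mono mu Q L q0 w trn B T Zs leT kk ix KK St ftr qv X vf)|].
  split; [apply (FF_cmp mu kappa Q L F Hmu Hk Hmk Qcl q0 w ln trn B T Zs leT kk ix KK St fnl ftr Hftr
    qv Hqv X HG0 g vf Hg Hvf)|].
  apply (FF_full mu kappa Q L F Hmu Hk Hmk Qcl Qdir q0 w ln trn B Hq0 Hw T Zs leT kk ix KK St fnl ftr Hfnl
    qv Hqv X HG0 HB g vf Hg Hvf).
Qed.

(** * Systems in a generic extension *)

Section Cardinality.
Context {M : struct} {Z : ZFC M}.
Implicit Types a b c d f g u v w x y B D : M.

(** [is_cardinality] demands a bijection. C is the closure of the points of a outside the range of g
    under g after f; the bijection is f on C and the inverse of g elsewhere. *)
Lemma cantor_bernstein a b : cle a b -> cle b a -> sat mem (equipotent a b).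
Proof.
  intros (f & Hf & Hfv & Hfi) (g & Hg & Hgv & Hgi).
  set (C := sep a (fun x => forall y, (forall x, x ∊ a -> ~ (exists i, i ∊ b /\ x = ap g i) -> x ∊ y) ->
    (forall x, x ∊ a -> x ∊ y -> ap g (ap f x) ∊ y) -> x ∊ y)).
  assert (HC : forall x, x ∊ C <-> x ∊ a /\ forall y, (forall x, x ∊ a -> ~ (exists i, i ∊ b /\ x = ap g i) ->
    x ∊ y) -> (forall x, x ∊ a -> x ∊ y -> ap g (ap f x) ∊ y) -> x ∊ y).
  { intros x. unfold C. rewrite sepE by dfn. reflexivity. }
  assert (C1 : forall x, x ∊ a -> ~ x ∊ C -> exists i, i ∊ b /\ x = ap g i).
  { intros x Hx Hn. apply NNPP. intros H. apply Hn, HC. split; auto. }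
  assert (C2 : forall x, x ∊ a -> (ap g (ap f x) ∊ C <-> x ∊ C)).
  { intros x Hx. split.
    - intros H. apply NNPP. intros Hn. apply HC in H. destruct H as [_ H].
      assert (Hy : ap g (ap f x) ∊ sep C (fun y => y <> ap g (ap f x))).
      { apply H.
        - intros x' Hx' Hno. apply sepE; [dfn|]. split.
          + apply NNPP. intros Hn'. apply Hno, C1; auto.
          + intros ->. apply Hno. eauto.
        - intros x' Hx' Hxy. apply sepE in Hxy; [|dfn]. destruct Hxy as [Hxy Hne].
          apply sepE; [dfn|]. split.
          + apply HC. split; auto. intros y H1 H2. apply H2; auto. apply HC in Hxy. apply Hxy; auto.
          + intros E. apply Hgi in E; auto. apply Hfi in E; auto. subst; auto. }
      apply sepE in Hy; [|dfn]. tauto.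
    - intros H. apply HC. split; auto. intros y H1 H2. apply H2; auto. apply HC in H. apply H; auto. }
  assert (HR : Def2 (fun x i => i ∊ b /\ ((x ∊ C /\ i = ap f x) \/ (~ x ∊ C /\ x = ap g i)))) by dfn.
  destruct (AC_rel _ a HR) as (h & Hh & HhR).
  { intros x Hx. destruct (classic (x ∊ C)) as [H|H]; [exists (ap f x); auto|].
    destruct (C1 x Hx H) as (i & Hi & E). exists i. auto. }
  exists h. split; [|split].
  - apply sat_fun. split; auto. intros x Hx. apply HhR; auto.
  - intros x x' y Hx Hx'. apply sat_pin in Hx, Hx'.
    pose proof (fn_dom _ _ _ _ Hh Hx) as Ha. pose proof (fn_dom _ _ _ _ Hh Hx') as Ha'.
    pose proof (HhR x Ha) as Hr. pose proof (HhR x' Ha') as Hr'.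
    rewrite (ap_eq _ _ _ _ Hh Hx) in Hr. rewrite (ap_eq _ _ _ _ Hh Hx') in Hr'.
    destruct Hr as [Hy [[H1 H2]|[H1 H2]]], Hr' as [_ [[H3 H4]|[H3 H4]]].
    + apply Hfi; auto. congruence.
    + exfalso. apply H3. rewrite H4, H2. apply C2; auto.
    + exfalso. apply H1. rewrite H2, H4. apply C2; auto.
    + congruence.
  - intros y Hy. destruct (classic (ap g y ∊ C)) as [H|H].
    + assert (Hy' : exists x, x ∊ C /\ y = ap f x).
      { apply NNPP. intros Hn. apply HC in H. destruct H as [_ H].
        assert (Hc : ap g y ∊ sep C (fun x => x <> ap g y)).
        { apply H.
          - intros x Hx Hno. apply sepE; [dfn|]. split.
            + apply NNPP. intros Hn'. apply Hno, C1; auto.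
            + intros ->. apply Hno. eauto.
          - intros x Hx Hxc. apply sepE in Hxc; [|dfn]. destruct Hxc as [Hxc _].
            apply sepE; [dfn|]. split; [apply C2; auto|].
            intros E. apply Hgi in E; auto. apply Hn. exists x. auto. }
        apply sepE in Hc; [|dfn]. tauto. }
      destruct Hy' as (x & Hx & ->). assert (Hxa : x ∊ a) by (apply HC in Hx; tauto).
      exists x. apply sat_pin. destruct (HhR x Hxa) as [_ [[_ E]|[H1 _]]]; [|tauto].
      rewrite <- E. apply (fn_ap _ a); auto.
    + exists (ap g y). apply sat_pin. assert (Hga : ap g y ∊ a) by auto.
      destruct (HhR _ Hga) as [H1 [[H2 _]|[_ E]]]; [tauto|]. apply Hgi in E; auto. rewrite E at 2.
      apply (fn_ap _ a); auto.
Qed.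
Lemma cardinality_exists B : exists c, sat mem (is_cardinality c B).
Proof.
  destruct (zermelo B) as (a & f & Ha & Hf & Hi & Hv & Hs).
  assert (DB : Def1 (fun a => onto B a)) by (pose proof Def_onto; dfn).
  destruct (lordP (fun a => onto B a) DB) as (Hc & Hco & Hmin).
  { exists a. split; auto. apply (onto_fun (ap f)); auto. dfn. }
  set (c := lord (fun a => onto B a)) in *. exists c. split.
  - apply sat_card. split; auto. intros x Hx H. apply (mem_irrefl x), (Hmin x); auto; [eapply ord_mem; eauto|].
    apply (onto_trans _ c); auto. apply onto_cle; auto.
  - apply cantor_bernstein; [apply cle_onto; auto|]. apply NNPP. intros Hn.
    apply small_of_no_cle in Hn; auto. destruct Hn as (d & Hd & H).
    apply (mem_irrefl d), (Hmin d); auto. eapply ord_mem; eauto.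
Qed.
Lemma cardinality_onto c B : sat mem (is_cardinality c B) -> onto B c.
Proof. intros [_ (f & H1 & H2 & _)]. apply onto_cle, sat_card_le. exists f. split; auto. Qed.

Section Collapsed.
Context (mu kappa : M) (Hmu : reg mu) (Hk : Ord kappa) (Hmk : mu ∊ kappa)
  (Hno : ~ onto kappa mu) (Hcol : forall x, x ∊ kappa -> onto x mu).
Lemma collapsed_card : sat mem (is_card kappa).
Proof.
  apply sat_card. split; auto. intros x Hx H. apply Hno. apply (onto_trans _ x); auto. apply onto_cle; auto.
Qed.
(** Here kappa is the successor of mu. If w were not below mu, then w', being collapsed to mu, would
    inject into w. *)
Lemma collapsed_width w w' S RR : isfn S (dom S) -> sat mem (is_width w S RR) -> sat mem (is_succ_card w w') ->
  w' ∊ kappa -> w ∊ mu /\ onto RR w /\ forall u, u ∊ dom S -> onto (ap S u) w.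
Proof.
  intros HS (s & c & Hs & Hc & Hw) (Hw1 & Hw2 & _) Hw'. apply sat_card in Hw1. destruct Hw1 as [Ow' Hw1].
  assert (Ow : Ord w) by (eapply ord_mem; eauto).
  assert (Hsub : subs s w /\ subs c w).
  { destruct Hw as [[H1 H2]|[H1 H2]]; cbn in H2; subst; split; auto; intros x Hx; auto; apply (H1 x Hx). }
  split; [|split].
  - apply NNPP. intros Hn. apply (Hw1 w Hw2). apply (cle_trans _ mu).
    + apply cle_onto; auto. apply Hmu.
    + apply cle_sub, ord_nmem; auto. apply Hmu.
  - apply (onto_sub _ RR c); [unfold subs; auto|apply Hsub|apply cardinality_onto; auto].
  - intros u Hu. destruct (cardinality_exists (ap S u)) as (d & Hd).
    apply (onto_sub _ (ap S u) d); [unfold subs; auto| |apply cardinality_onto; auto].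
    intros i Hi. apply (proj1 Hsub). apply Hs. exists u, (ap S u), d. split; [|split; auto].
    apply sat_pin, (fn_ap _ (dom S)); auto.
Qed.
(** Under either reading of [d_ge] there is a cardinal above mu for which Lam is directed: d itself,
    or kappa if Lam is directed for all cardinals. *)
Lemma collapsed_directed Lam le D : sat mem (d_ge kappa Lam le) -> subs D Lam -> onto D mu ->
  exists v, v ∊ Lam /\ forall u, u ∊ D -> op u v ∊ le.
Proof.
  intros H HD Ho.
  assert (H1 : exists d, sat mem (is_card d) /\ mu ∊ d /\ sat mem (card_directed d Lam le)).
  { destruct H as [(d & (H1 & H2 & _) & H3)|H].
    - exists d. split; auto. split; auto. apply H3; auto.
    - exists kappa. split; [apply collapsed_card|]. split; auto. apply H, collapsed_card. }
  destruct H1 as (d & H1 & H2 & H3). destruct (H3 D) as (v & Hv & Hvu).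
  - split; [intros x Hx; apply HD; auto|]. apply card_lt_small; auto. exists mu. auto.
  - exists v. split; auto. intros u Hu. apply sat_pin, Hvu; auto.
Qed.
Lemma collapsed_chains Q L D : sat mem (directed_closed kappa Q L) -> subs D Q -> small kappa D ->
  (forall p, p ∊ D -> lqr L p p) ->
  (forall p q, p ∊ D -> q ∊ D -> lqr L p q \/ lqr L q p) -> exists r, r ∊ Q /\ forall p, p ∊ D -> lqr L r p.
Proof.
  intros HQ HD Hs Hr Hc. destruct (HQ D) as (r & Hr' & H).
  - split; [intros x Hx; apply HD; auto|]. split; [apply card_lt_small; auto; apply collapsed_card|].
    intros p Hp q Hq. cbn [sat]. setoid_rewrite sat_pin. fold (lqr L).
    destruct (Hc p q Hp Hq); [exists p|exists q]; unfold lqr in *; auto.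
  - exists r. split; auto. intros p Hp. apply sat_pin, H; auto.
Qed.
Lemma collapsed_closed Q L : (forall p, p ∊ Q -> lqr L p p) ->
  sat mem (directed_closed kappa Q L) -> closed Q (lqr L) kappa.
Proof.
  intros Hrefl HQ d f Hd (Hf & Hv & Hdec).
  assert (HF : Fun1 (ap f)) by dfn.
  destruct (collapsed_chains Q L (im (ap f) d)) as (r & Hr & H); auto.
  - intros p Hp. apply imE in Hp; auto. destruct Hp as (i & Hi & ->). auto.
  - apply small_im; auto. exists d. split; auto. apply onto_cle, cle_sub. unfold subs; auto.
  - intros p Hp. apply imE in Hp; auto. destruct Hp as (i & Hi & ->). auto.
  - intros p q Hp Hq. apply imE in Hp, Hq; auto. destruct Hp as (i & Hi & ->), Hq as (j & Hj & ->).
    assert (Od : Ord d) by (eapply ord_mem; eauto).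
    destruct (ord_tri i j) as [H|[H|H]]; try (eapply ord_mem; eauto; fail); auto. subst; auto.
  - exists r. split; auto. intros i Hi. apply H, imE; eauto.
Qed.
End Collapsed.
End Cardinality.

(** Directedness of the coded system as one formula, to be forced by a single condition q0. Nothing
    else about the system is required in the other generic extensions that contain q0. *)
Definition boundedF {X : Type} (a t m b : X) : form X :=
  ∀ f, is_fun f m a ⇒ ∃[v ∈ a] ∀ j u, pin j u f ⇒ ∃[i ∈ b] ∃[k ∈ b] ∃[l ∈ b] TrF u i k v l t.
Lemma U_bounded a t m b : uniform (fun X e => boundedF (e a) (e t) (e m) (e b)).
Proof. unfold boundedF. utac. Qed.

(** * The principle in an extension by a directed closed forcing *)

Section Extension_SNSP.
Context {M N : struct} {Z : ZFC M} {ZN : ZFC N} (mu kappa Q L : M)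
  {Fo : fm -> M -> (nat -> M) -> Prop} {chk : M -> M} (F : fnotion Q L Fo chk)
  {G : M -> Prop} {val : M -> N} (X : gext Q L Fo chk G val)
  (Hmu : reg mu) (Hk : Ord kappa) (Hmk : mu ∊ kappa)
  (Hno : ~ onto kappa mu) (Hcol : forall x, x ∊ kappa -> onto x mu)
  (Hstar : forall A, (exists a, a ∊ A) -> exists T Zs leT kk ix KK, star mu A T Zs leT kk ix KK)
  (Qdc : sat mem (directed_closed kappa Q L)).
Local Notation ι := (@ii M N chk val).

Lemma Q_refl p : p ∊ Q -> lqr L p p.
Proof. apply (n_refl _ _ _ _ F). Qed.
Lemma Q_closed : closed Q (lqr L) kappa.
Proof. eapply collapsed_closed; eauto. apply Q_refl. Qed.
Lemma ext_reg : reg (ι mu).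
Proof. apply (reg_extension F X); auto. eapply closed_sub; eauto. apply Q_closed. Qed.
Lemma ext_no_onto : ~ onto (ι kappa) (ι mu).
Proof.
  intros Ho. destruct (onto_total (ι kappa) (ι mu) Ho) as (g & Hg & Hgv & Hgs).
  { exists (ι mu). apply (ii_mem X); auto. }
  destruct (distributivity F X kappa mu kappa g) as (h & Hh & Hhv & E); auto; [apply Q_closed|].
  fold (ι h) in E. subst g. apply Hno. apply (onto_fun (ap h)); [dfn|]. intros x Hx.
  destruct (Hgs (ι x)) as (i & Hi & Ei); [apply (ii_mem X); auto|].
  apply (ii_elim X) in Hi. destruct Hi as (j & Hj & ->). rewrite (ii_ap X h mu) in Ei by auto.
  apply (ii_inj X) in Ei. exists j. auto.
Qed.
Lemma ext_collapsed (x : N) : x ∊ ι kappa -> onto x (ι mu).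
Proof. intros H. apply (ii_elim X) in H. destruct H as (y & Hy & ->). apply (ii_onto X); auto. Qed.

Section System.
Context (Lam le S RR w : N) (Hpo : sat mem (partial_order Lam le)) (Hd : sat mem (d_ge (ι kappa) Lam le))
  (Hsys : sat mem (is_system Lam le S RR)) (Hw : w ∊ ι mu) (HRR : onto RR w)
  (HSw : forall u, u ∊ Lam -> onto (ap S u) w).
Implicit Types u v x y z k l R i : N.

Lemma le_anti u v : op u v ∊ le -> op v u ∊ le -> u = v.
Proof. intros H1 H2. destruct Hpo as (_ & _ & H & _). apply H; apply sat_pin; auto. Qed.
Lemma le_trans u v x : op u v ∊ le -> op v x ∊ le -> op u x ∊ le.
Proof. intros H1 H2. destruct Hpo as (_ & _ & _ & H). apply sat_pin. apply (H u v x); apply sat_pin; auto. Qed.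
Lemma S_fn : isfn S Lam.
Proof. apply sat_family. apply Hsys. Qed.
Lemma level u x : sat mem (at_level S u x) <-> u ∊ Lam /\ x ∊ ap S u.
Proof.
  pose proof S_fn as HS. split.
  - intros (B & HB & Hx). apply sat_pin in HB. rewrite (ap_eq _ _ _ _ HS HB). split; auto.
    eapply fn_dom; eauto.
  - intros [Hu Hx]. exists (ap S u). split; auto. apply sat_pin, (fn_ap _ Lam); auto.
Qed.
Lemma level_ne u : u ∊ Lam -> exists x, x ∊ ap S u.
Proof.
  intros Hu. destruct Hsys as (_ & H & _). destruct (H u Hu) as (x & Hx). apply level in Hx. exists x. tauto.
Qed.
Lemma Lam_dir (D : N) : subs D Lam -> onto D (ι mu) -> exists v, v ∊ Lam /\ forall u, u ∊ D -> op u v ∊ le.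
Proof.
  apply (collapsed_directed (ι mu) (ι kappa)); auto.
  - apply (ii_ord X); auto.
  - apply (ii_mem X); auto.
  - apply ext_no_onto.
  - apply ext_collapsed.
Qed.
Lemma RR_trans R x y z : R ∊ RR -> op x y ∊ R -> op y z ∊ R -> op x z ∊ R.
Proof.
  intros HR H1 H2. destruct Hsys as (_ & _ & _ & _ & _ & H & _). apply sat_pin.
  apply (H R HR x y z); apply sat_pin; auto.
Qed.
Lemma RR_lev R x y u v : R ∊ RR -> op x y ∊ R -> u ∊ Lam -> v ∊ Lam -> x ∊ ap S u -> y ∊ ap S v ->
  op u v ∊ le /\ u <> v.
Proof.
  intros HR H1 Hu Hv Hx Hy. destruct Hsys as (_ & _ & _ & _ & _ & _ & H & _).
  destruct (H R HR x y u v) as [H2 H3]; try (apply level; auto); [apply sat_pin; auto|].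
  apply sat_pin in H2. auto.
Qed.
Lemma RR_tree R x y z u v : R ∊ RR -> op x z ∊ R -> op y z ∊ R -> u ∊ Lam -> v ∊ Lam -> x ∊ ap S u ->
  y ∊ ap S v -> op u v ∊ le -> op x y ∊ R \/ x = y.
Proof.
  intros HR H1 H2 Hu Hv Hx Hy Huv. destruct Hsys as (_ & _ & _ & _ & _ & _ & _ & H & _).
  destruct (H R HR x y z u v) as [H3|H3]; try (apply level; auto); try (apply sat_pin; auto).
  - apply sat_pin in H3. auto.
  - auto.
Qed.
Lemma RR_full u v : op u v ∊ le -> u <> v -> exists x y R, x ∊ ap S u /\ y ∊ ap S v /\ R ∊ RR /\ op x y ∊ R.
Proof.
  intros H1 H2. destruct Hsys as (_ & _ & _ & _ & _ & _ & _ & _ & H).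
  destruct (H u v) as (x & y & Hx & Hy & R & HR & Hxy); [split; [apply sat_pin; auto|exact H2]|].
  apply level in Hx, Hy. apply sat_pin in Hxy. exists x, y, R. tauto.
Qed.

(** With a maximum there are no strict upper bounds to guess, but one element of the top level
    already meets every cofinality demand. *)
Lemma max_branch m : m ∊ Lam -> (forall u, u ∊ Lam -> op u m ∊ le) ->
  sat mem (has_cofinal_branch Lam le S RR).
Proof.
  intros Hm Hmax. destruct (level_ne m Hm) as (x & Hx). destruct Hsys as (_ & _ & _ & (R & HR) & _).
  assert (Hl : sat mem (at_level S m x)) by (apply level; auto).
  exists (sing x). split.
  - exists R. split; auto. split.
    + intros y Hy. apply singE in Hy. subst. exists m. auto.
    + intros y Hy y' Hy'. apply singE in Hy, Hy'. subst. exists x. split; [exists m; auto|].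
      split; right; reflexivity.
  - intros u Hu. exists m. split; auto. split; [apply sat_pin; auto|]. exists x. split; auto.
    apply singE; auto.
Qed.

Section No_max.
Context (Hnm : ~ exists m, m ∊ Lam /\ forall u, u ∊ Lam -> op u m ∊ le)
  (rho eS : N) (Hrho : forall i R R', op i R ∊ rho -> op i R' ∊ rho -> R = R')
  (Hrhos : forall R, R ∊ RR -> exists i, i ∊ w /\ op i R ∊ rho)
  (HeS : forall u i x y, u ∊ Lam -> op i x ∊ ap eS u -> op i y ∊ ap eS u -> x = y)
  (HeSs : forall u x, u ∊ Lam -> x ∊ ap S u -> exists i, i ∊ w /\ op i x ∊ ap eS u).
(** Elements and relations are replaced by indices below w. These are ground-model ordinals, so
    conditions can decide them, and there are fewer than mu of them. *)
Definition Tr : N := sep (prod (prod Lam w) (prod w (prod Lam w))) (fun y => exists u i k v l x x' R,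
  y = op (op u i) (op k (op v l)) /\ x ∊ ap S u /\ op i x ∊ ap eS u /\ x' ∊ ap S v /\ op l x' ∊ ap eS v /\
  R ∊ RR /\ op k R ∊ rho /\ op x x' ∊ R).
Lemma TrE u i k v l : TrP u i k v l Tr <-> u ∊ Lam /\ i ∊ w /\ k ∊ w /\ v ∊ Lam /\ l ∊ w /\ exists x x' R,
  x ∊ ap S u /\ op i x ∊ ap eS u /\ x' ∊ ap S v /\ op l x' ∊ ap eS v /\ R ∊ RR /\ op k R ∊ rho /\ op x x' ∊ R.
Proof.
  unfold TrP, Tr. rewrite sepE by dfn. rewrite !prod_op. split.
  - intros (H1 & u' & i' & k' & v' & l' & x & x' & R & E & H). apply op_inj in E. destruct E as [E E'].
    apply op_inj in E, E'. destruct E as [-> ->], E' as [-> E']. apply op_inj in E'. destruct E' as [-> ->].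
    do 5 (split; [tauto|]). exists x, x', R. exact H.
  - intros (H1 & H2 & H3 & H4 & H5 & x & x' & R & H). split; [tauto|].
    exists u, i, k, v, l, x, x', R. split; auto.
Qed.
Lemma strict_bound v : v ∊ Lam -> exists v', v' ∊ Lam /\ op v v' ∊ le /\ v <> v'.
Proof.
  intros Hv. apply NNPP. intros Hn. apply Hnm. exists v. split; auto. intros u Hu.
  destruct (Lam_dir (upair u v)) as (x & Hx & H).
  - intros y Hy. apply upairE in Hy. destruct Hy; subst; auto.
  - pose proof ext_reg as Hr. apply (onto_sub _ (upair u v) (succ one)); [unfold subs; auto|..].
    + intros y Hy. apply (proj1 (proj1 Hr) (succ one)); auto. apply reg_succ, reg_one; auto.
    + apply (onto_rel (fun i x => (i = emp /\ x = u) \/ (i = one /\ x = v))); [dfn|..].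
      * intros i y y' _ [[H1 H2]|[H1 H2]] [[H3 H4]|[H3 H4]]; subst; auto; exfalso;
          apply (empE (emp : N)); [rewrite H3 at 2|rewrite <- H3 at 2]; apply singE; auto.
      * intros y Hy. apply upairE in Hy. destruct Hy; subst.
        -- exists emp. split; auto. apply succE. left. apply singE; auto.
        -- exists one. split; auto. apply succE; auto.
  - destruct (classic (v = x)) as [<-|Hne]; [apply H, upairE; auto|]. exfalso. apply Hn. exists x.
    split; auto. split; auto. apply H, upairE; auto.
Qed.
Lemma Tr_dir (f : N) : isfn f (ι mu) -> (forall i, i ∊ ι mu -> ap f i ∊ Lam) ->
  exists v, v ∊ Lam /\ forall j, j ∊ ι mu -> exists i k l, i ∊ w /\ k ∊ w /\ l ∊ w /\ TrP (ap f j) i k v l Tr.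
Proof.
  intros Hf Hfv. assert (HF : Fun1 (ap f)) by dfn.
  destruct (Lam_dir (im (ap f) (ι mu))) as (v & Hv & Hvu).
  { intros y Hy. apply imE in Hy; auto. destruct Hy as (i & Hi & ->). auto. }
  { apply (onto_fun (ap f)); auto. intros y Hy. apply imE in Hy; auto. destruct Hy as (i & Hi & ->). eauto. }
  destruct (strict_bound v Hv) as (v' & Hv' & Hvv & Hne). exists v'. split; auto. intros j Hj.
  assert (Hju : op (ap f j) v ∊ le) by (apply Hvu, imE; eauto).
  destruct (RR_full (ap f j) v') as (x & y & R & Hx & Hy & HR & Hxy).
  { eapply le_trans; eauto. }
  { intros E. apply Hne. apply le_anti; auto. rewrite <- E; auto. }
  destruct (HeSs (ap f j) x) as (i & Hi & Hix); auto. destruct (HeSs v' y) as (l & Hl & Hly); auto.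
  destruct (Hrhos R HR) as (k & Hk' & HkR). exists i, k, l. do 3 (split; auto). apply TrE.
  do 5 (split; auto). exists x, y, R. repeat (split; auto).
Qed.

Lemma no_max_branch : sat mem (has_cofinal_branch Lam le S RR).
Proof.
  destruct (v_surj _ _ _ _ _ _ X Lam) as (ln & Eln). destruct (v_surj _ _ _ _ _ _ X Tr) as (trn & Etr).
  pose proof Hw as Hw0. apply (ii_elim X) in Hw0. destruct Hw0 as (w0 & Hw0 & Ew).
  destruct (v_name _ _ _ _ _ _ X ln) as (B & HB).
  destruct (U_bounded 0 1 2 3) as (fd & Hfd).
  set (ev := scons ln (scons trn (scons (chk mu) (fun _ => chk w0)))).
  assert (Hq : exists q, G q /\ Fo fd q ev).
  { apply (truth_u X _ _ ev Hfd). intros f Hf. apply sat_fun in Hf. destruct Hf as [Hf Hfv].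
    cbn [ev scons] in *. rewrite <- Eln in *.
    destruct (Tr_dir f Hf Hfv) as (v & Hv & Hvj). exists v. split; auto. intros j u Hju. apply sat_pin in Hju.
    rewrite <- (ap_eq _ _ _ _ Hf Hju). destruct (Hvj j) as (i & k & l & Hi & Hk' & Hl & Ht).
    { eapply fn_dom; eauto. }
    unfold ii in Ew. rewrite <- Ew. exists i. split; auto. exists k. split; auto. exists l. split; auto.
    apply sat_Tr. rewrite <- Etr. auto. }
  destruct Hq as (q0 & Hq0 & Hq0f).
  assert (Hq0Q : q0 ∊ Q) by (apply (g_in _ _ _ _ _ _ X); auto).
  assert (HLne : exists u, u ∊ Lam).
  { destruct (Lam_dir emp) as (v & Hv & _); eauto; [intros x Hx; destruct (empE x Hx)|].
    exists emp. split; intros; exfalso; eapply empE; eauto. }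
  destruct (guessing mu kappa Q L F X q0 w0 ln trn B) as
    (T & leT & FF & DleT & DFF & Tne & Trefl & Ttrans & Tcl & Fmono & Fcmp & Ffull); auto.
  { apply Q_closed. }
  { intros D HD _ Ho Hc. eapply collapsed_chains; eauto.
    - exists mu; auto.
    - intros p Hp. apply Q_refl; auto. }
  { intros N' G' val' X' HG' f Hf Hfv. pose proof (g_zfc _ _ _ _ _ _ X') as ZN'. change (ZFC N') in ZN'.
    pose proof (proj2 (truth_u X' _ _ ev Hfd) (ex_intro _ q0 (conj HG' Hq0f))) as H.
    destruct (H f) as (v & Hv & Hvj); [apply sat_fun; auto|]. exists v. split; auto. intros j Hj.
    destruct (Hvj j (ap f j)) as (i & Hi & k & Hk' & l & Hl & Ht).
    { apply sat_pin, (fn_ap _ (val' (chk mu))); auto. }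
    apply sat_Tr in Ht. exists i, k, l. auto. }
  (* The set to be enumerated consists of conditions below q0 paired with names from B. It is
     nonempty because Lam is, which follows from directedness for the empty set. *)
  { apply Hstar. destruct HLne as (u & Hu). rewrite Eln in Hu. destruct (HB u Hu) as (b & Hb & _).
    exists (op q0 b). apply prod_op. split; auto. apply belowE. split; auto. apply Q_refl; auto. }
  rewrite <- Etr in Fcmp. rewrite <- Eln in Ffull. fold (ι w0) in Ffull. rewrite <- Ew in Ffull.
  fold (ι mu) in Tcl.
  set (ltk := fun k x y => exists R, R ∊ RR /\ op k R ∊ rho /\ op x y ∊ R).
  set (FB := fun t k l x => exists u i, u ∊ Lam /\ x ∊ ap S u /\ op i x ∊ ap eS u /\ FF t k l u i).
  assert (HFB : forall t k l x y, t ∊ T -> FB t k l x -> FB t k l y -> exists R z, R ∊ RR /\ op k R ∊ rho /\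
    insys Lam (ap S) z /\ op x z ∊ R /\ op y z ∊ R).
  { intros t k l x y Ht (u & i & Hu & Hx & Hix & Hf) (u' & i' & Hu' & Hy & Hiy & Hf').
    destruct (Fcmp t k l u u' i i' Ht Hf Hf') as (v & l' & H1 & H2). apply TrE in H1, H2.
    destruct H1 as (_ & _ & _ & Hv & _ & x1 & z1 & R1 & Hx1 & Hix1 & Hz1 & Hlz1 & HR1 & HkR1 & Hxz1).
    destruct H2 as (_ & _ & _ & _ & _ & y1 & z2 & R2 & Hy1 & Hiy1 & Hz2 & Hlz2 & HR2 & HkR2 & Hyz2).
    rewrite (HeS u i x1 x Hu Hix1 Hix) in Hxz1. rewrite (HeS u' i' y1 y Hu' Hiy1 Hiy) in Hyz2.
    rewrite (HeS v l' z2 z1 Hv Hlz2 Hlz1) in Hyz2. rewrite (Hrho k R2 R1 HkR2 HkR1) in Hyz2.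
    exists R1, z1. do 2 (split; auto). split; auto. exists v. auto. }
  destruct (branch_exists (ι mu) Lam w T (fun u v => op u v ∊ le) leT (ap S) ltk FB) as
    (k & l & b & Hk' & Hl & Hb1 & Hb2 & Hb3 & t & x0 & Ht & Hx0); auto.
  - dfn.
  - dfn.
  - unfold FB. dfn.
  - apply ext_reg.
  - intros u v. apply le_anti.
  - intros u v x. apply le_trans.
  - intros f Hf Hfv. destruct (Lam_dir (im (ap f) (ι mu))) as (v & Hv & Hvu).
    + intros y Hy. apply imE in Hy; [|dfn]. destruct Hy as (i & Hi & ->). auto.
    + apply (onto_fun (ap f)); [dfn|]. intros y Hy. apply imE in Hy; [|dfn]. destruct Hy as (i & Hi & ->). eauto.
    + exists v. split; auto. intros i Hi. apply Hvu, imE; [dfn|eauto].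
  - intros k x y z (R & HR & HkR & Hxy) (R' & _ & HkR' & Hyz). rewrite (Hrho k R' R HkR' HkR) in Hyz.
    exists R. do 2 (split; auto). apply (RR_trans R x y z); auto.
  - intros k x y u v (R & HR & HkR & Hxy). apply RR_lev with (R := R); auto.
  - intros k x y z u v (R & HR & HkR & Hxz) (R' & _ & HkR' & Hyz) Hu Hv Hx Hy Huv.
    rewrite (Hrho k R' R HkR' HkR) in Hyz. destruct (RR_tree R x y z u v) as [H|H]; auto.
    + left. exists R. auto.
    + right. auto.
  - intros u Hu. exists w. auto.
  - intros t t' k l x _ Htt (u & i & H1 & H2 & H3 & H4). exists u, i. do 3 (split; auto). eapply Fmono; eauto.
  - intros t k l x y Ht _ _ H1 H2. destruct (HFB t k l x y Ht H1 H2) as (R & z & HR & HkR & Hz & Hxz & Hyz).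
    exists z. split; auto. split; left; exists R; auto.
  - intros t u Ht Hu. destruct (Ffull t u Ht Hu) as (t' & k & l & i & Ht' & Htt & Hk' & Hl & Hi & Hf).
    destruct (Fcmp t' k l u u i i Ht' Hf Hf) as (v & l' & H1 & _). apply TrE in H1.
    destruct H1 as (_ & _ & _ & _ & _ & x & _ & _ & Hx & Hix & _). exists t', k, l, x.
    do 5 (split; auto). exists u, i. auto.
  (* A condition that chooses some x0 for the codes (k, l) exhibits a relation R with code k; the
     abstract branch is a branch through this R. *)
  - destruct (HFB t k l x0 x0 Ht Hx0 Hx0) as (R & _ & HR & HkR & _).
    assert (Hins : forall x, insys Lam (ap S) x -> sat mem (in_system S x)).
    { intros x (u & Hu & Hx). exists u. apply level; auto. }
    assert (Hlek : forall x y, lek ltk k x y -> sat mem (le_rel R x y)).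
    { intros x y [(R' & _ & HkR' & H)|H]; [left|right; exact H]. apply sat_pin.
      rewrite <- (Hrho k R' R HkR' HkR). auto. }
    exists b. split.
    + exists R. split; auto. split; [intros x Hx; apply Hins, Hb1; auto|].
      intros x Hx y Hy. destruct (Hb2 x y Hx Hy) as (z & Hz & H1 & H2). exists z.
      split; [apply Hins; auto|]. split; apply Hlek; auto.
    + intros u Hu. destruct (Hb3 u Hu) as (v & x & Hv & Huv & Hx & Hxv). exists v. split; auto.
      split; [apply sat_pin; auto|]. exists x. split; auto. apply level; auto.
Qed.
End No_max.

Lemma system_branch : sat mem (has_cofinal_branch Lam le S RR).
Proof.
  destruct (classic (exists m, m ∊ Lam /\ forall u, u ∊ Lam -> op u m ∊ le)) as [(m & Hm & Hmax)|Hnm].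
  { apply (max_branch m); auto. }
  destruct HRR as (rho & Hrho & Hrhos).
  destruct (AC_rel (fun u f => (forall i x y, op i x ∊ f -> op i y ∊ f -> x = y) /\
     forall x, x ∊ ap S u -> exists i, i ∊ w /\ op i x ∊ f) Lam) as (eS & HeS & HeSR); [dfn|..].
  { intros u Hu. destruct (HSw u Hu) as (f & H1 & H2). exists f. auto. }
  apply (no_max_branch Hnm rho eS); auto.
  - intros u i x y Hu. apply HeSR; auto.
  - intros u x Hu. apply HeSR; auto.
Qed.
End System.

Theorem SNSP_extension : sat mem (SNSP (ι kappa)).
Proof.
  intros Lam le (Hpo & _ & Hd) S RR (Hsys & w & w' & Hwid & Hsc & Hw').
  assert (HS : isfn S Lam) by (apply sat_family, Hsys).
  assert (E : dom S = Lam).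
  { apply ext. intros x. rewrite domE. split; [intros (y & Hy); eapply fn_dom; eauto|].
    intros Hx. exists (ap S x). apply (fn_ap _ Lam); auto. }
  destruct (collapsed_width (ι mu) (ι kappa) ext_reg ext_collapsed w w' S RR) as (H1 & H2 & H3); auto.
  { rewrite E; auto. }
  rewrite E in H3. apply (system_branch Lam le S RR w); auto.
Qed.
End Extension_SNSP.

(** * The Levy extension *)

Section Translation.
Context {M : struct} {Z : ZFC M}.
Lemma sat_comp_in (U K : M) (f : M -> form M) (P : M -> Prop) : Def1 P -> (forall x, sat mem (f x) <-> P x) ->
  (sat mem (comp_in U K f) <-> sep K P ∊ U).
Proof.
  intros HP Hf. split.
  - intros (Y & HY & H). replace (sep K P) with Y; auto. apply ext. intros x. rewrite sepE by auto.
    rewrite <- Hf. exact (H x).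
  - intros H. exists (sep K P). split; auto. intros x.
    change (x ∊ sep K P <-> x ∊ K /\ sat mem (f x)). rewrite sepE by auto. rewrite Hf. reflexivity.
Qed.

Lemma supercompact_measure (kappa A0 : M) : sat mem (supercompact kappa) -> subs kappa A0 -> exists K U,
  (forall z, z ∊ K <-> subs z A0 /\ small kappa z) /\
  (forall Y, Y ∊ U -> subs Y K) /\
  K ∊ U /\
  (forall Y, Y ∊ U -> exists x, x ∊ Y) /\
  (forall Y Y', Y ∊ U -> subs Y Y' -> subs Y' K -> Y' ∊ U) /\
  (forall Y, subs Y K -> Y ∊ U \/ sep K (fun x => ~ x ∊ Y) ∊ U) /\
  (forall F, subs F U -> (exists Y, Y ∊ F) -> small kappa F ->
     sep K (fun x => forall Y, Y ∊ F -> x ∊ Y) ∊ U) /\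
  (forall a, a ∊ A0 -> sep K (fun x => a ∊ x) ∊ U) /\
  (forall f, isfn f K -> (forall x, x ∊ K -> ap f x ∊ A0) ->
     sep K (fun x => ap f x ∊ x) ∊ U -> exists a, a ∊ A0 /\ sep K (fun x => ap f x = a) ∊ U).
Proof.
  intros (Hc & _ & H) HA. destruct (H A0) as (K & U & HK & H1 & H2 & H3 & H4 & H5 & H6 & H7 & H8).
  { apply sat_card_le, cle_sub; auto. }
  exists K, U. split; [|do 8 (try split)].
  - intros z. rewrite <- (card_lt_small kappa z Hc). apply (HK z).
  - exact H1.
  - exact H2.
  - intros Y HY. apply NNPP. intros Hn. apply (H3 Y HY). intros x Hx. apply Hn. eauto.
  - intros Y Y' HY HYY HYK. apply (H4 Y HY Y'). split; auto.
  - intros Y HY. destruct (H5 Y HY) as [H'|H']; auto. right.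
    apply (sat_comp_in _ _ _ (fun x => ~ x ∊ Y)) in H'; auto; [dfn|reflexivity].
  - intros F HF (Y0 & HY0) Hs.
    assert (H' : sat mem (comp_in U K (fun x => ∀[Y ∈ F] x ∈ Y))).
    { apply (H6 F). split; [exact HF|]. split; [|apply card_lt_small; auto]. intros Hn. apply (Hn Y0 HY0). }
    apply (sat_comp_in _ _ _ (fun x => forall Y, Y ∊ F -> x ∊ Y)) in H'; auto; [dfn|reflexivity].
  - intros a Ha. specialize (H7 a Ha).
    apply (sat_comp_in _ _ _ (fun x => a ∊ x)) in H7; auto; [dfn|reflexivity].
  - intros f Hf Hfv Hr.
    assert (Hp : forall x a, x ∊ K -> (op x a ∊ f <-> ap f x = a)).
    { intros x a Hx. split; [apply (ap_eq _ K); auto|]. intros <-. apply (fn_ap _ K); auto. }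
    destruct (H8 f) as (a & Ha & H').
    + split; [apply sat_fun; auto|]. exists (sep K (fun x => ap f x ∊ x)). split; auto. intros x.
      change (x ∊ sep K (fun x => ap f x ∊ x) <-> x ∊ K /\ exists y, y ∊ x /\ sat mem (pin x y f)).
      rewrite sepE by dfn. split.
      * intros [Hx Hfx]. split; auto. exists (ap f x). split; auto. apply sat_pin, Hp; auto.
      * intros [Hx (y & Hy & Hxy)]. split; auto. apply sat_pin, Hp in Hxy; auto. subst; auto.
    + exists a. split; auto. destruct H' as (Y & HY & HYx).
      replace (sep K (fun x => ap f x = a)) with Y; auto. apply ext. intros x. rewrite sepE by dfn.
      change (x ∊ Y <-> x ∊ K /\ ap f x = a).
      assert (HYx' : x ∊ Y <-> x ∊ K /\ sat mem (pin x a f)) by exact (HYx x).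
      rewrite HYx'. rewrite sat_pin. split; intros [Hx Hy]; split; auto; apply Hp; auto.
Qed.

Lemma sat_levy (mu kappa P L : M) : sat mem (is_card mu) -> sat mem (is_levy_collapse mu kappa P L) ->
  (forall p, p ∊ P <-> cond kappa mu p) /\ (forall q p, op q p ∊ L <-> q ∊ P /\ p ∊ P /\ subs p q).
Proof.
  intros Hmu [H1 H2]. split.
  - intros p. assert (H : p ∊ P <-> sat mem (collapse_condition mu kappa p)) by exact (H1 p).
    rewrite H. unfold collapse_condition, cond. cbn [sat]. rewrite card_lt_small by auto. clear H.
    split; intros (A & B & C); (split; [|split]); auto.
    + intros z Hz. destruct (A z Hz) as (a & Ha & x & Hx & b & Hb & d & Hd & Ez).
      apply sat_opair in Hd, Ez. subst. exists a, x, b. auto.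
    + intros d b b' Hb Hb'. apply (B d b b'); apply sat_pin; auto.
    + intros z Hz. destruct (A z Hz) as (a & x & b & Ha & Hx & Hb & ->).
      exists a. split; auto. exists x. split; auto. exists b. split; auto. exists (op a x).
      rewrite !sat_opair. auto.
    + intros d b b' Hb Hb'. apply sat_pin in Hb, Hb'. apply (B d b b'); auto.
  - intros q p. split.
    + intros H. apply (proj1 (H2 _)) in H. destruct H as (q' & Hq & p' & Hp & E & Hs).
      apply sat_opair in E. apply op_inj in E. destruct E; subst. auto.
    + intros (Hq & Hp & Hs). apply (proj2 (H2 _)). exists q. split; auto. exists p. split; auto.
      split; [apply sat_opair; auto|exact Hs].
Qed.
Lemma card_no_onto (m d : M) : sat mem (is_card m) -> d ∊ m -> ~ onto m d.
Proof.
  intros H Hd Ho. apply sat_card in H. destruct H as [Hm H]. apply (H d Hd), cle_onto; auto.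
  eapply ord_mem; eauto.
Qed.

(** Below any q, a generic extension containing q yields a condition that forces the formula;
    density then gives the claim for p. *)
Lemma force_all (P L : M) (H : forall X : Type, (nat -> X) -> form X) (e : nat -> M) : poset P L -> uniform H ->
  (forall (N : struct) (G : M -> Prop) (val : M -> N), ZFC N ->
     gext P L (fun f p e => frc L p (dinst f e)) (chk P) G val -> sat mem (H N (fun n => val (e n)))) ->
  forall p, p ∊ P -> sat mem (forces L p (H M e)).
Proof.
  intros HP [f Hf] Hall p Hp. rewrite Hf. apply (frc_dens P L HP (dinst f e) p Hp). intros q Hq.
  pose proof (forcing_fnotion P L HP) as F.
  destruct (n_gen _ _ _ _ F q) as (N & G & val & X & HGq); [apply HP in Hq; tauto|].
  pose proof (g_zfc _ _ _ _ _ _ X) as ZN. specialize (Hall N G val ZN X).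
  apply (truth_u X H f e Hf) in Hall. destruct Hall as (u & Hu & Hfu).
  destruct (force_below F q u f e G val X HGq Hu Hfu) as (r & _ & Hrq & Hr). eauto.
Qed.
End Translation.

Section Collapsed_model.
Context {M : struct} {Z : ZFC M} (mu kappa : M) (Hmu : reg mu) (Hk : Ord kappa) (Hmk : mu ∊ kappa)
  (Hno : ~ onto kappa mu) (Hcol : forall x, x ∊ kappa -> onto x mu)
  (Hstar : forall A, (exists a, a ∊ A) -> exists T Zs leT kk ix KK, star mu A T Zs leT kk ix KK).
Lemma collapsed_SNSP : sat mem (SNSP kappa).
Proof.
  apply (SNSP_extension mu kappa _ _ trivial_fnotion trivial_gext); auto.
  intros D (HD & _). exists emp. split; [apply singE; auto|]. intros q Hq.
  apply sat_pin, trivial_le. split; auto. apply singE, HD, Hq.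
Qed.
Lemma collapsed_indestructible : sat mem (SNSP_indestructible kappa).
Proof.
  intros Q L (HQ & Hdc) c Hc p Hp. apply check_unique in Hc. subst c.
  pose proof (sat_poset Q L HQ) as HP.
  apply (force_all Q L (fun X e => SNSP (e 0)) (fun _ => chk Q kappa) HP); auto; [apply U_SNSP|].
  intros N G val ZN X. apply (SNSP_extension mu kappa Q L (forcing_fnotion Q L HP) X); auto.
Qed.
End Collapsed_model.

Theorem levy_SNSP {M : struct} {Z : ZFC M} (mu kappa P L c p : M) :
  sat mem (infinite_regular mu) -> sat mem (infinite_regular kappa) -> mu ∊ kappa ->
  sat mem (supercompact kappa) -> sat mem (is_levy_collapse mu kappa P L) -> sat mem (is_check P kappa c) ->
  p ∊ P -> sat mem (forces L p (SNSP c ∧ SNSP_indestructible c)).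
Proof.
  intros Hmu Hk Hmk Hsc HPL Hc Hp. apply check_unique in Hc. subst c.
  pose proof (proj1 Hmu) as Cmu. pose proof (proj1 Hk) as Ck.
  apply reg_regular in Hmu, Hk. destruct (sat_levy mu kappa P L Cmu HPL) as [HP HL].
  pose proof (levy_poset kappa mu P L Hmu HP HL) as Hpos. change (poset P L) in Hpos.
  pose proof (levy_closed kappa mu P L Hmu HP HL) as Hcl.
  assert (Hkc : forall d, d ∊ kappa -> ~ onto kappa d) by (intros; apply card_no_onto; auto).
  assert (Hmc : forall d, d ∊ mu -> ~ onto mu d) by (intros; apply card_no_onto; auto).
  apply (force_all P L (fun X e => SNSP (e 0) ∧ SNSP_indestructible (e 0)) (fun _ => chk P kappa) Hpos); auto.
  { apply U_and; [apply U_SNSP|apply U_SNSP_ind]. }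
  intros N G val ZN X. pose proof (forcing_fnotion P L Hpos) as F.
  change (val (chk P kappa)) with (ii (chk := chk P) (val := val) kappa).
  set (mu' := ii (chk := chk P) (val := val) mu). set (kappa' := ii (chk := chk P) (val := val) kappa).
  assert (H1 : reg mu') by (apply (reg_extension F X); auto).
  assert (H2 : Ord kappa') by (apply (ii_ord X), Hk).
  assert (H3 : mu' ∊ kappa') by (apply (ii_mem X); auto).
  assert (H4 : ~ onto kappa' mu').
  (* For the preservation of kappa a measure on P_kappa(kappa) suffices. *)
  { destruct (supercompact_measure kappa kappa Hsc) as (K & U & M1 & M2 & M3 & M4 & M5 & M6 & M7 & M8 & M9);
      [unfold subs; auto|].
    apply (levy_no_onto kappa kappa K U Hk (fun x Hx => Hx) M1 M2 M3 M4 M5 M6 M7 M8 M9 mu P L Hmu Hkc Hmk HP HL F X). }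
  assert (H5 : forall x, x ∊ kappa' -> onto x mu') by (apply (levy_collapses kappa mu P L Hmu Hmc HP HL X)).
  assert (H6 : forall A : N, (exists a, a ∊ A) -> exists T Zs leT kk ix KK, star mu' A T Zs leT kk ix KK).
  { intros A (a0 & Ha0). destruct (v_surj _ _ _ _ _ _ X A) as (an & EA).
    destruct (v_name _ _ _ _ _ _ X an) as (B & HB). rewrite <- EA in HB.
    destruct (v_gen _ _ _ _ _ _ X) as (g & Hg). destruct (v_fun _ _ _ _ _ _ X B) as (vf & Hvf).
    (* The measure lives on subsets of B ∪ kappa: B supplies names for the elements of A, and kappa
       is needed so that coordinates of conditions can belong to z. *)
    assert (HA0 : subs kappa (cup B kappa)) by (intros x Hx; apply cupE; auto).
    assert (HBA : subs B (cup B kappa)) by (intros x Hx; apply cupE; auto).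
    destruct (supercompact_measure kappa (cup B kappa) Hsc HA0) as
      (K & U & M1 & M2 & M3 & M4 & M5 & M6 & M7 & M8 & M9).
    destruct (collapse_index kappa (cup B kappa) K Hk M1) as (az & _ & Haz).
    do 6 eexists. apply (levy_star kappa (cup B kappa) K U Hk HA0 M1 M2 M3 M4 M5 M6 M7 M8 M9 mu P L
      Hmu Hmk HP HL az Haz F X A a0 g vf B HBA Ha0 HB Hg Hvf). }
  split; [apply (collapsed_SNSP mu')|apply (collapsed_indestructible mu')]; auto.
Qed.

Theorem theorem6p2 (V : Type) (E : V -> V -> Prop) (hV : models_ZFC E)
    (mu kappa : V)
    (hmu : sat E (infinite_regular mu ∧ uncountable mu))
    (hkappa : sat E (infinite_regular kappa ∧ uncountable kappa))
    (hlt : sat E (mu ∈ kappa))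
    (hsc : sat E (supercompact kappa))
    (P L : V) (hP : sat E (is_levy_collapse mu kappa P L))
    (c : V) (hc : sat E (is_check P kappa c)) :
  sat E (forced P L (SNSP c ∧ SNSP_indestructible c)).
Proof.
  (* A failure is a single uniform statement about mu, kappa, P, L, c and p, so it passes to a
     countable elementary submodel, where generic filters exist. *)
  intros p Hp. apply NNPP. intros Hn.
  assert (HU : uniform (fun X e => infinite_regular (e 0) ∧ infinite_regular (e 1) ∧ e 0 ∈ e 1 ∧
    supercompact (e 1) ∧ is_levy_collapse (e 0) (e 1) (e 2) (e 3) ∧ is_check (e 2) (e 1) (e 4) ∧ e 5 ∈ e 2 ∧
    ¬ forces (e 3) (e 5) (SNSP (e 4) ∧ SNSP_indestructible (e 4)))).
  { do 7 (apply U_and; [first [apply U_regular | apply U_mem | apply U_supercompact | apply U_levy | apply U_check]|]).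
    apply U_imp; [|apply U_bot]. apply U_forces, U_and; [apply U_SNSP|apply U_SNSP_ind]. }
  destruct HU as (f & Hf).
  set (base := scons mu (scons kappa (scons P (scons L (scons c (fun _ => p)))))).
  destruct (countable_elementary_submodel V E base) as (M & inc & b & Hb & Hel).
  assert (ZM : ZFC M) by (apply (ZFC_uniform V E M inc Hel hV)).
  assert (HE : sat E (dinst f (fun n => inc (b n)))).
  { replace (fun n => inc (b n)) with base by (extensionality n; auto). rewrite <- Hf.
    destruct hmu, hkappa. do 7 (split; [assumption|]). exact Hn. }
  apply Hel in HE. rewrite <- Hf in HE. destruct HE as (H1 & H2 & H3 & H4 & H5 & H6 & H7 & H8).
  apply H8. apply (levy_SNSP (b 0) (b 1) (b 2)); auto.
Qed.
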